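(* Let $\{X_t\}$ be a strictly stationary sequence of random elements of $L^2([0,1],\mathbb R)$ with mean $\mu$, satisfying (i) $\mathbb E\|X_0\|_2^k<\infty$ and $\sum_{t_1,\ldots,t_{k-1}=-\infty}^{\infty}\|\operatorname{cum}(X_{t_1},\ldots,X_{t_{k-1}},X_0)\|_2<\infty$ for all $k\ge2$; (ii) $\sum_{t\in\mathbb Z}|||\mathscr R_t|||_1<\infty$. Then, as $T\to\infty$, $$\sqrt T\Big(\frac1T\sum_{t=0}^{T-1}X_t(\tau)-\mu(\tau)\Big)\ \xrightarrow{d}\ \mathcal N\Big(0,\sum_{t\in\mathbb Z}\mathscr R_t\Big),$$ convergence in distribution being in $L^2([0,1],\mathbb R)$.
   Context: $\mu(\tau)=\mathbb EX_0(\tau)$. The autocovariance kernel is $r_t(\tau,\sigma)=\mathbb E[(X_{t}(\tau)-\mu(\tau))(X_0(\sigma)-\mu(\sigma))]$ and $\mathscr R_t$ is the operator $\mathscr R_th(\tau)=\int_0^1r_t(\tau,\sigma)h(\sigma)\,d\sigma$; $|||\cdot|||_1$ is the nuclear (Schatten 1-) norm. The $k$th order cumulant kernel is the element of $L^2([0,1]^k,\mathbb R)$ $$\operatorname{cum}(X_{t_1}(\tau_1),\ldots,X_{t_k}(\tau_k))=\sum_{\nu=(\nu_1,\ldots,\nu_p)}(-1)^{p-1}(p-1)!\prod_{l=1}^p\mathbb E\Big[\prod_{j\in\nu_l}X_{t_j}(\tau_j)\Big],$$ the sum extending over all unordered partitions of $\{1,\ldots,k\}$, and $\|\cdot\|_2$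 is its $L^2([0,1]^k)$ norm. $\mathcal N(0,\mathscr C)$ is the mean zero Gaussian law on $L^2([0,1],\mathbb R)$ with covariance operator $\mathscr C$. *)

(* Defs.v *)
From HB Require Import structures.
From mathcomp Require Import all_boot all_order all_algebra.
From mathcomp Require Import all_classical all_reals all_analysis.
Set Implicit Arguments.
Unset Strict Implicit.
Unset Printing Implicit Defensive.
Set Warnings "-redundant-canonical-projection".
Import Order.TTheory GRing.Theory Num.Theory.
Import numFieldNormedType.Exports.
Local Open Scope classical_set_scope.
Local Open Scope ring_scope.

Section L2_space.
Variable R : realType.

Definition leb01 : {measure set (measurableTypeR R) -> \bar R} :=
  mrestr lebesgue_measure
    (measurable_itv `[0%R, 1%R] : measurable (`[0%R, 1%R] : set (measurableTypeR R))).

(* L^2([0,1]) as L^2 of the line with Lebesgue measure restricted to [0,1].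
   The elements are square-integrable functions, not classes of functions:
   functions that agree a.e. on [0,1] are at distance 0, hence have the same
   neighbourhoods, so that open sets, Borel sets, Borel laws and continuous
   functionals correspond to those of the quotient. *)
Definition L2 := LfunType leb01 (lee1n 2 : (1 <= (2%:R : R)%:E)%E).

HB.instance Definition _ := GRing.Lmodule.on L2.
HB.instance Definition _ := SubType.on L2.
HB.instance Definition _ := isPointed.Build L2 0.

Definition L2norm (f : L2) : R := fine ('N[leb01]_2%:E [EFin \o (f : R -> R)])%E.

Definition L2inner (f g : L2) : R := \int[leb01]_x (f x * g x).

(* junk value 0 when f is not measurable and square-integrable on [0,1] *)
Definition toL2 (f : R -> R) : L2 := insubd (0 : L2) f.

Definition L2ball (f : L2) (e : R) (g : L2) : Prop := L2norm (f - g) < e.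

Lemma L2norm0 : L2norm 0 = 0.
Proof. by rewrite /L2norm Lnorm0// eqe pnatr_eq0. Qed.

Lemma L2ball_center (f : L2) (e : R) : 0 < e -> L2ball f e f.
Proof. by rewrite /L2ball subrr L2norm0. Qed.

Lemma L2ball_sym (f g : L2) (e : R) : L2ball f e g -> L2ball g e f.
Proof. by rewrite /L2ball -(opprB f g) /L2norm LnormrN. Qed.

Lemma L2ball_triangle (f g h : L2) (e1 e2 : R) :
  L2ball f e1 g -> L2ball g e2 h -> L2ball f (e1 + e2) h.
Proof.
rewrite /L2ball => fg gh.
rewrite (_ : f - h = (f - g) + (g - h)); last by rewrite addrA subrK.
exact: le_lt_trans (ler_LnormD _ _) (ltrD fg gh).
Qed.

HB.instance Definition _ := hasNbhs.Build L2 (nbhs_ (entourage_ L2ball)).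
HB.instance Definition _ := @Nbhs_isPseudoMetric.Build R L2
  (entourage_ L2ball) erefl L2ball
  L2ball_center L2ball_sym L2ball_triangle erefl.

Definition L2borel := g_sigma_algebraType (@open L2).

(* |||A|||_1 is the infimum of sum_n ||u_n|| ||v_n|| over all nuclear
   representations A = sum_n <., v_n> u_n, and +oo if there is none. *)
Definition nuclear_norm (A : L2 -> L2) : \bar R :=
  ereal_inf [set s | exists u v : nat -> L2,
    (forall h : L2,
      (fun N => \sum_(0 <= n < N) L2inner h (v n) *: u n) @ \oo --> A h) /\
    s = (\sum_(0 <= n <oo) (L2norm (u n) * L2norm (v n))%:E)%E].

(* C is the sum over all t in Z of the operators A t, in nuclear norm; the
   partial sums run over -N <= t <= N. *)
Definition nuclear_sum (A : int -> L2 -> L2) (C : L2 -> L2) : Prop :=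
  (fun N : nat => nuclear_norm
     (fun h => \sum_(0 <= i < N.*2.+1) A (i%:Z - N%:Z) h - C h)) @ \oo --> 0%E.

(* N(m, v) on the line; the library's normal_prob is not a point mass when its
   standard deviation is 0. *)
Definition normal_law (m v : R) (B : set (measurableTypeR R)) : \bar R :=
  if v == 0 then \d_m B else normal_prob m (Num.sqrt v) B.

Definition gaussian (nu : probability L2borel R) : Prop :=
  forall h : L2, exists m v : R, 0 <= v /\
    forall B : set (measurableTypeR R), measurable B ->
      nu [set f : L2 | B (L2inner f h)] = normal_law m v B.

Definition mean_zero_gaussian (C : L2 -> L2) (nu : probability L2borel R) :=
  [/\ gaussian nu,
      forall h : L2, (\int[nu]_f (L2inner f h)%:E = 0)%E
    & forall g h : L2,
        (\int[nu]_f (L2inner f g * L2inner f h)%:E = (L2inner (C g) h)%:E)%E].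

(* the integral over [0,1]^k, iterated *)
Fixpoint integral01 (k : nat) : (k.-tuple R -> \bar R) -> \bar R :=
  match k with
  | 0%N => fun f => f [tuple]
  | k'.+1 => fun f =>
      (\int[leb01]_x integral01 (fun y : k'.-tuple R => f [tuple of x :: y]))%E
  end.

Definition kernel_norm (k : nat) (c : k.-tuple R -> R) : \bar R :=
  (integral01 (fun tau => (c tau ^+ 2)%:E) `^ 2^-1)%E.

End L2_space.

Section functional_time_series.
Context {R : realType} {d : measure_display} {Omega : measurableType d}.
Variable P : probability Omega R.
Local Notation L2 := (L2 R).
Local Notation L2borel := (L2borel R).

(* Every Borel map Omega -> L^2([0,1]) has, up to a choice of representative
   for each outcome, a jointly measurable version, and conversely; joint
   measurability is what gives a meaning to E[X(tau_1) ... X(tau_k)]. *)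
Definition random_element (X : Omega -> L2) : Prop :=
  measurable_fun [set: Omega * measurableTypeR R] (fun p => X p.1 p.2).

Definition strictly_stationary (X : int -> Omega -> L2) : Prop :=
  forall (n : nat) (t : n.-tuple int) (s : int) (B : set (n.-tuple L2borel)),
    measurable B ->
    P [set w | B [tuple (X (tnth t i + s) w : L2borel) | i < n]] =
    P [set w | B [tuple (X (tnth t i) w : L2borel) | i < n]].

Variable X : int -> Omega -> L2.

Definition mean_fun (tau : R) : R := fine 'E_P[fun w => X 0 w tau].

Definition autocov_kernel (t : int) (tau sigma : R) : R :=
  fine 'E_P[fun w =>
    (X t w tau - mean_fun tau) * (X 0 w sigma - mean_fun sigma)].

Definition autocov_op (t : int) (h : L2) : L2 :=
  toL2 (fun tau => \int[leb01 R]_sigma (autocov_kernel t tau sigma * h sigma)).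

Definition cumulant_kernel (k : nat) (t : 'I_k -> int) (tau : k.-tuple R) : R :=
  \sum_(nu : {set {set 'I_k}} | finset.partition nu [set: 'I_k]%SET)
    (-1) ^+ (#|nu|.-1) * ((#|nu|.-1)`!)%:R *
    \prod_(B in nu) fine 'E_P[fun w => \prod_(j in B) X (t j) w (tnth tau j)].

(* (t_1, ..., t_{k-1}, 0): nth returns its default 0 at the last index *)
Definition times_with_last0 (k : nat) (t : k.-1.-tuple int) (j : 'I_k) : int :=
  nth 0 t j.

Definition normalized_sum (T : nat) (w : Omega) : L2 :=
  Num.sqrt T%:R *: (T%:R^-1 *: \sum_(0 <= t < T) X t%:Z w - toL2 mean_fun).

End functional_time_series.

Definition converges_in_law (R : realType) (d : measure_display)
    (Omega : measurableType d) (P : probability Omega R)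
    (S : nat -> Omega -> L2 R) (nu : probability (L2borel R) R) : Prop :=
  forall F : L2 R -> R, continuous F -> (exists M : R, forall f, `|F f| <= M) ->
    ('E_P[fun w => F (S T w)])%E @[T --> \oo] --> (\int[nu]_f (F f)%:E)%E.

(* Main.v *)
(* Write S_T for the normalized sum. For a fixed h the cumulants of <S_T, h> are
   averages of sums of joint cumulants of the <X_t, h>, which the cumulant
   kernels dominate; by (i) those of order at least 3 vanish in the limit and the
   second one tends to <C h, h>. The recursion between moments and cumulants then
   gives the convergence of all moments of <S_T, h> to the normal ones, hence of
   E cos(<S_T, h> + th). By (ii), E <S_T, e_n>^2 is bounded, uniformly in T, by
   the terms of a convergent series for an orthonormal basis e, so that S_T is
   uniformly close in mean square to its projection on finitely many e_n. For
   Lipschitz functionals, one coordinate at a time is discretized by a partition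
   of unity and smoothed by Gaussian convolution into a mixture of cosines;
   infimal convolutions extend the result to bounded continuous functionals.

   The limit law is built by hand: the binary digits of a uniform variable give
   independent uniform, hence by quantiles independent normal variables, and the
   coordinates on e are combinations of these whose coefficients come from the
   Gram-Schmidt process for the form <C f, g>. *)

Require Import Defs.
From HB Require Import structures.
From mathcomp Require Import all_boot all_order all_algebra.
From mathcomp Require Import all_classical all_reals all_analysis.
From mathcomp Require Import measurable_realfun.
From mathcomp Require Import ring lra zify.
Set Implicit Arguments.
Unset Strict Implicit.
Unset Printing Implicit Defensive.
Import Order.TTheory GRing.Theory Num.Theory.
Import numFieldNormedType.Exports.
Local Open Scope classical_set_scope.
Local Open Scope ring_scope.

(** * The space L^2([0,1]) *)

(** Without independence, the limit must come out of cumulants: multilinearity and stationarity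
    bound a cumulant of order k of a sum of T terms by T times a convergent series, while the
    normalization divides it by T^(k/2). Moments suffice because the Taylor remainders of even order
    of the cosine have expectations tending to (v/2)^N / N!, which vanishes as N grows. Cosines with
    an arbitrary phase replace complex exponentials: they determine laws, and a product of two of
    them is a combination of two others, as the joint treatment of several coordinates requires.
    Convergence of projections is not enough in infinite dimension. The missing compactness is
    quantitative: the sum over n of |<R_t e_n, e_n>| is at most the nuclear norm of R_t, so the
    numbers b_n = sum over t of |<R_t e_n, e_n>| are summable, and they bound the second moment of
    the n-th coordinate of every S_T and of the limit. No extraction of subsequences takes place, so
    the limit law must exist beforehand; the same trace bound makes the series defining it converge
    almost surely. *)

Section psd_forms.
Variables (R : realType) (V : lmodType R) (B : V -> V -> R).
Hypothesis Bsym : forall f g, B f g = B g f.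
Hypothesis BD : forall f g h, B (f + g) h = B f h + B g h.
Hypothesis BZ : forall a f g, B (a *: f) g = a * B f g.
Hypothesis Bpos : forall f, 0 <= B f f.

Lemma psdDr f g h : B f (g + h) = B f g + B f h.
Proof. by rewrite Bsym BD !(Bsym _ f). Qed.

Lemma psdZr a f g : B f (a *: g) = a * B f g.
Proof. by rewrite Bsym BZ Bsym. Qed.

Lemma psdN f g : B (- f) g = - B f g.
Proof. by rewrite -scaleN1r BZ mulN1r. Qed.

Lemma psdNr f g : B f (- g) = - B f g.
Proof. by rewrite Bsym psdN Bsym. Qed.

Lemma psd0 g : B 0 g = 0.
Proof. by rewrite -(scale0r 0) BZ mul0r. Qed.

Lemma psd0r g : B g 0 = 0.
Proof. by rewrite Bsym psd0. Qed.

Lemma psd_suml I (r : seq I) (F : I -> V) g :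
  B (\sum_(i <- r) F i) g = \sum_(i <- r) B (F i) g.
Proof.
elim: r => [|i r ih]; first by rewrite !big_nil psd0.
by rewrite !big_cons BD ih.
Qed.

Lemma psd_sumr I (r : seq I) (F : I -> V) g :
  B g (\sum_(i <- r) F i) = \sum_(i <- r) B g (F i).
Proof. by rewrite Bsym psd_suml; apply: eq_bigr => i _; rewrite Bsym. Qed.

(** The form is only semidefinite: it stands for [L2inner], where almost equal functions differ by
    null vectors, for <C f, g>, and for dot products of row vectors. Hence the case [B g g = 0],
    where the quadratic [q] is affine and stays nonnegative only if its slope vanishes. *)
Lemma psd_cauchy_schwarz f g : B f g ^+ 2 <= B f f * B g g.
Proof.
have q t : 0 <= B f f + 2 * t * B f g + t ^+ 2 * B g g.
  have := Bpos (f + t *: g); rewrite BD !psdDr !BZ !psdZr (Bsym g f); lra.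
have [g0|g0] := eqVneq (B g g) 0.
  rewrite g0 mulr0; have [->|fg0] := eqVneq (B f g) 0; first by rewrite expr0n.
  (* At this point the affine function takes the value -1. *)
  have := q (- (B f f + 1) / (2 * B f g)); rewrite g0 mulr0 addr0.
  rewrite [X in _ + X](_ : _ = - (B f f + 1)); last by field.
  by lra.
have gp : 0 < B g g by rewrite lt_def g0 Bpos.
(* The minimizer of [q]. *)
have := q (- B f g / B g g).
rewrite (_ : _ + _ = B f f - B f g ^+ 2 / B g g); last by field.
by rewrite subr_ge0 ler_pdivrMr.
Qed.

Lemma psd_null f g : B f f = 0 -> B f g = 0.
Proof.
move=> f0; have := psd_cauchy_schwarz f g; rewrite f0 mul0r => h.
by apply/eqP; rewrite -sqrf_eq0 eq_le h sqr_ge0.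
Qed.

End psd_forms.

Section L2_basics.
Variable R : realType.
Local Notation L2 := (L2 R).
Local Notation leb := (leb01 R).

Lemma leb01T : leb setT = 1%E.
Proof.
rewrite /leb01 /= /mrestr setTI /= lebesgue_measure_itv /= lte_fin ltr01.
by rewrite sube0.
Qed.

(** A second name for [leb01], on which the probability structure is declared; the Fubini lemmas are
    applied with it. *)
Definition leb1 : set (measurableTypeR R) -> \bar R := leb01 R.
HB.instance Definition _ := Measure.on leb1.
HB.instance Definition _ := Measure_isProbability.Build _ _ _ leb1 leb01T.

Lemma L2_measurable (f : L2) : measurable_fun setT (f : R -> R).
Proof. exact: (@measurable_funPT _ _ _ _ f). Qed.

Lemma L2_in (f : L2) : (f : R -> R) \in Lfun leb 2%:E.
Proof. exact: LfunP. Qed.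

Lemma L2inner_integrable (f g : L2) :
  leb.-integrable setT (EFin \o (fun x => f x * g x)).
Proof. exact/Lfun1_integrable/(Lfun2_mul_Lfun1 (L2_in f) (L2_in g)). Qed.

Lemma L2innerC (f g : L2) : L2inner f g = L2inner g f.
Proof. by rewrite /L2inner; apply: eq_Rintegral => x _; rewrite mulrC. Qed.

Lemma L2innerDl (f g h : L2) : L2inner (f + g) h = L2inner f h + L2inner g h.
Proof.
rewrite /L2inner -RintegralD//; try exact: L2inner_integrable.
by apply: eq_Rintegral => x _ /=; rewrite mulrDl.
Qed.

Lemma L2innerZl a (f h : L2) : L2inner (a *: f) h = a * L2inner f h.
Proof.
rewrite /L2inner -RintegralZl//; last exact: L2inner_integrable.
by apply: eq_Rintegral => x _ /=; rewrite mulrA.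
Qed.

Lemma L2inner_ge0 (f : L2) : 0 <= L2inner f f.
Proof. by apply: Rintegral_ge0 => x _; rewrite -expr2 sqr_ge0. Qed.

Lemma L2norm_ge0 (f : L2) : 0 <= L2norm f.
Proof. by rewrite fine_ge0// Lnorm_ge0. Qed.

Lemma L2normE (f : L2) : L2norm f ^+ 2 = L2inner f f.
Proof.
apply: EFin_inj; rewrite /L2inner fineK; last first.
  by apply: integrable_fin_num => //; exact: L2inner_integrable.
rewrite -powR_mulrn ?L2norm_ge0// -poweR_EFin finite_norm_fine.
rewrite powR_Lnorm ?pnatr_eq0//; apply: eq_integral => x _ /=.
by rewrite powR_mulrn// real_normK ?num_real.
Qed.

Lemma L2innerDr (f g h : L2) : L2inner f (g + h) = L2inner f g + L2inner f h.
Proof. exact: psdDr L2innerC L2innerDl _ _ _. Qed.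

Lemma L2innerZr a (f h : L2) : L2inner f (a *: h) = a * L2inner f h.
Proof. exact: psdZr L2innerC L2innerZl _ _ _. Qed.

Lemma L2innerNl (f h : L2) : L2inner (- f) h = - L2inner f h.
Proof. exact: psdN L2innerZl _ _. Qed.

Lemma L2innerNr (f h : L2) : L2inner f (- h) = - L2inner f h.
Proof. exact: psdNr L2innerC L2innerZl _ _. Qed.

Lemma L2innerBl (f g h : L2) : L2inner (f - g) h = L2inner f h - L2inner g h.
Proof. by rewrite L2innerDl L2innerNl. Qed.

Lemma L2innerBr (f g h : L2) : L2inner f (g - h) = L2inner f g - L2inner f h.
Proof. by rewrite L2innerDr L2innerNr. Qed.

Lemma L2inner0r (f : L2) : L2inner f 0 = 0.
Proof. exact: psd0r L2innerC L2innerZl _. Qed.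

Lemma L2inner_suml I (r : seq I) (F : I -> L2) g :
  L2inner (\sum_(i <- r) F i) g = \sum_(i <- r) L2inner (F i) g.
Proof. exact: psd_suml L2innerDl L2innerZl _ _ _ _. Qed.

Lemma L2inner_sumr I (r : seq I) (F : I -> L2) g :
  L2inner g (\sum_(i <- r) F i) = \sum_(i <- r) L2inner g (F i).
Proof. exact: psd_sumr L2innerC L2innerDl L2innerZl _ _ _ _. Qed.

Lemma L2_cauchy_schwarz (f g : L2) : `|L2inner f g| <= L2norm f * L2norm g.
Proof.
rewrite -ler_sqr ?nnegrE ?mulr_ge0 ?L2norm_ge0// exprMn !L2normE.
rewrite real_normK ?num_real//.
exact: psd_cauchy_schwarz L2innerC L2innerDl L2innerZl L2inner_ge0 _ _.
Qed.

Lemma L2norm_triangle (f g : L2) : L2norm (f + g) <= L2norm f + L2norm g.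
Proof. exact: ler_LnormD. Qed.

Lemma L2normZ a (f : L2) : L2norm (a *: f) = `|a| * L2norm f.
Proof.
apply/eqP; rewrite -(@eqrXn2 _ 2)// ?mulr_ge0 ?L2norm_ge0//.
rewrite exprMn !L2normE L2innerZl L2innerZr real_normK ?num_real//.
by rewrite mulrA expr2.
Qed.

Lemma L2normN (f : L2) : L2norm (- f) = L2norm f.
Proof. by rewrite -scaleN1r L2normZ normrN1 mul1r. Qed.

Lemma L2normB (f g : L2) : L2norm (f - g) = L2norm (g - f).
Proof. by rewrite -L2normN opprB. Qed.

Lemma L2norm_triangleB (f g h : L2) : L2norm (f - h) <= L2norm (f - g) + L2norm (g - h).
Proof. by rewrite (_ : f - h = (f - g) + (g - h)) ?L2norm_triangle// addrA subrK. Qed.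

Lemma L2norm_dist (f g : L2) : `|L2norm f - L2norm g| <= L2norm (f - g).
Proof.
have h1 := L2norm_triangle (f - g) g; rewrite subrK in h1.
have h2 := L2norm_triangle (g - f) f; rewrite subrK L2normB in h2.
by rewrite ler_norml; apply/andP; split; lra.
Qed.

Lemma L2norm_sum I (r : seq I) (F : I -> L2) :
  L2norm (\sum_(i <- r) F i) <= \sum_(i <- r) L2norm (F i).
Proof.
elim: r => [|i r ih]; first by rewrite !big_nil L2norm0.
by rewrite !big_cons (le_trans (L2norm_triangle _ _))// lerD2l.
Qed.

Lemma L2_cvgP (F : set_system L2) (FF : Filter F) (f : L2) :
  F --> f <-> (forall e, 0 < e -> \forall g \near F, L2norm (f - g) < e).
Proof.
split=> [/cvg_ballP h e e0|h]; first exact: h.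
by apply/cvg_ballP => e e0; exact: h.
Qed.

Lemma L2_cvg_norm (u : nat -> L2) (f : L2) :
  u @ \oo --> f <-> (L2norm (u n - f) @[n --> \oo] --> (0 : R)).
Proof.
split.
  move/L2_cvgP => h; apply/cvgrPdist_lt => e e0; have /= := h e e0.
  apply: (@filterS _ \oo) => n /=.
  by rewrite sub0r normrN ger0_norm ?L2norm_ge0// L2normB.
move=> /cvgrPdist_lt h; apply/L2_cvgP => e e0; have /= := h e e0.
apply: (@filterS _ \oo) => n /=.
by rewrite sub0r normrN ger0_norm ?L2norm_ge0// L2normB.
Qed.

Lemma L2_continuousP (F : L2 -> R) : continuous F <->
  (forall (f : L2) (e : R), 0 < e ->
   exists2 d : R, 0 < d & forall g : L2, L2norm (f - g) < d -> `|F f - F g| < e).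
Proof.
split=> [cF f e e0|h f].
  have /cvgrPdist_lt/(_ _ e0) := cF f; rewrite nearE => /nbhs_ballP[d d0 hd].
  by exists d => // g gd; exact: hd.
apply: (iffRL (@cvgrPdist_lt R R L2 (nbhs f) (nbhs_filter f) F (F f))) => e e0.
have [d d0 hd] := h f e e0.
by apply/nbhs_ballP; exists d.
Qed.

Lemma L2_lipschitz_continuous (F : L2 -> R) K :
  (forall f g, `|F f - F g| <= K * L2norm (f - g)) -> continuous F.
Proof.
move=> h; apply/L2_continuousP => f e e0.
have K0 : 0 < `|K| + 1 by rewrite ltr_wpDl.
exists (e / (`|K| + 1)) => [|g]; first by rewrite divr_gt0.
rewrite ltr_pdivlMr// => ge; apply: le_lt_trans (h f g) _; apply: le_lt_trans ge.
rewrite mulrC ler_wpM2l ?L2norm_ge0// (le_trans (ler_norm _))// lerDl//.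
Qed.

Lemma L2_continuous_cvg (F : L2 -> R) (u : nat -> L2) f : continuous F ->
  L2norm (u n - f) @[n --> \oo] --> (0 : R) -> F (u n) @[n --> \oo] --> F f.
Proof.
move=> cF /L2_cvg_norm uf.
exact: (@continuous_cvg nat L2 R \oo _ u F f (cF f) uf).
Qed.

Lemma L2inner_continuous (h : L2) : continuous (fun f : L2 => L2inner f h).
Proof.
apply: (@L2_lipschitz_continuous _ (L2norm h)) => f g.
by rewrite -L2innerBl mulrC L2_cauchy_schwarz.
Qed.

Lemma L2norm_continuous : continuous (@L2norm R).
Proof. by apply: (@L2_lipschitz_continuous _ 1) => f g; rewrite mul1r L2norm_dist. Qed.

Lemma toL2E (f : R -> R) : measurable_fun setT f ->
  (\int[leb]_x (f x ^+ 2)%:E < +oo)%E -> (toL2 f : R -> R) = f.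
Proof.
move=> mf f2; rewrite /toL2 insubdK//.
apply/andP; split; first by rewrite inE.
rewrite inE /= /finite_norm unlock /Lnorm; apply: poweR_lty.
apply: le_lt_trans f2; apply: ge0_le_integral => //=.
- by apply/measurable_EFinP; apply: (measurableT_comp (measurable_powR _)); exact: measurableT_comp.
- by apply/measurable_EFinP; exact: measurable_funX.
- by move=> x _; rewrite lee_fin powR_mulrn// real_normK ?num_real.
Qed.

Lemma L2norm_eqae (f g : L2) : {ae leb, forall x, f x = g x} -> L2norm (f - g) = 0.
Proof.
move=> fg; apply/eqP; rewrite -sqrf_eq0 L2normE; apply/eqP.
rewrite /L2inner /Rintegral [X in fine X](_ : _ = 0%E)//.
rewrite -(integral0 leb setT); apply: ae_eq_integral => //.
- by apply/measurable_EFinP; apply: measurable_funM; exact: L2_measurable.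
- by apply: filterS fg => x fgx _; rewrite (_ : (f - g) x = f x - g x)// fgx subrr mulr0.
Qed.

Lemma L2inner_ae (f : L2) (g h : L2) : L2norm (g - h) = 0 -> L2inner f g = L2inner f h.
Proof.
move=> gh; apply/eqP; rewrite -subr_eq0 -L2innerBr -normr_le0.
by rewrite (le_trans (L2_cauchy_schwarz _ _))// gh mulr0.
Qed.

End L2_basics.

Lemma le_of_sqr (R : realType) (x y : R) : 0 <= y -> x ^+ 2 <= y ^+ 2 -> x <= y.
Proof. by move=> y0 xy; rewrite leNgt; apply/negP => yx; nra. Qed.

Section toolbox.
Context {d : measure_display} {T : measurableType d} {R : realType}.

(** Passes an integral bound to a pointwise limit without an integrable majorant. Completeness,
    integrability under a normal law and the bounds on second moments rest on it. *)
Lemma fatou_bound (mu : {measure set T -> \bar R}) (f_ : nat -> T -> R) (f : T -> R) (c : \bar R) N :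
  (forall n, measurable_fun setT (f_ n)) -> (forall n x, 0 <= f_ n x) ->
  (forall x, f_ n x @[n --> \oo] --> f x) ->
  (forall n, (N <= n)%N -> (\int[mu]_x (f_ n x)%:E <= c)%E) ->
  (\int[mu]_x (f x)%:E <= c)%E.
Proof.
move=> mf f0 ff fc.
rewrite (eq_integral (fun x => limn_einf (fun n => (f_ n x)%:E))); last first.
  move=> x _; have fx : EFin \o f_^~ x @ \oo --> (f x)%:E.
    by apply/cvg_EFin; [exact: nearW|exact: ff].
  by rewrite is_cvg_limn_einfE; [apply/esym/cvg_lim|apply/cvg_ex; exists (f x)%:E].
apply: le_trans (fatou _ _ _ _) _ => //.
- by move=> n; exact/measurable_EFinP.
- by move=> n x _; rewrite lee_fin.
rewrite limn_einf_lim; apply: lime_le.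
  exact: is_cvg_einfs.
apply: nearW => n /=; apply: le_trans (fc (maxn n N) (leq_maxr _ _)).
by apply: ereal_inf_lbound; exists (maxn n N) => //=; rewrite leq_maxl.
Qed.

Lemma Rintegral_dct (mu : {measure set T -> \bar R}) (f_ : nat -> T -> R) (f g : T -> R) :
  (forall n, measurable_fun setT (f_ n)) ->
  (forall x, f_ n x @[n --> \oo] --> f x) ->
  mu.-integrable setT (EFin \o g) ->
  (forall n x, `|f_ n x| <= g x) ->
  (\int[mu]_x (f_ n x)) @[n --> \oo] --> (\int[mu]_x (f x)) /\
  mu.-integrable setT (EFin \o f).
Proof.
move=> mf ff ig fg.
have mff : measurable_fun setT f.
  exact: (measurable_fun_cvg mf) => x _.
have [||||ie _ h] := @dominated_convergence _ _ _ mu setT measurableT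
   (fun n => EFin \o f_ n) (EFin \o f) (EFin \o g) _ _ _ ig.
- by move=> n; exact/measurable_EFinP.
- exact/measurable_EFinP.
- by apply: aeW => x _; apply/cvg_EFin; [exact: nearW|exact: ff].
- by apply: aeW => x n _ /=; rewrite lee_fin.
split=> //; apply: fine_cvg.
by rewrite fineK//; exact: integrable_fin_num.
Qed.

Lemma integrable_bdd (mu : {finite_measure set T -> \bar R}) (f : T -> R) (M : R) :
  measurable_fun setT f -> (forall x, `|f x| <= M) -> mu.-integrable setT (EFin \o f).
Proof.
move=> mf fM; apply: measurable_bounded_integrable => //.
  by rewrite ltey_eq fin_num_measure.
by exists M; split=> [|N MN x _]; [rewrite num_real|exact: le_trans (fM x) (ltW MN)].
Qed.

Lemma integrable_le (mu : {measure set T -> \bar R}) (f g : T -> R) :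
  measurable_fun setT f -> mu.-integrable setT (EFin \o g) ->
  (forall x, `|f x| <= g x) -> mu.-integrable setT (EFin \o f).
Proof.
move=> mf ig fg; apply: le_integrable ig => //; first exact/measurable_EFinP.
by move=> x _ /=; rewrite lee_fin (le_trans (fg x))// ler_norm.
Qed.

Lemma Rintegral_bdd_dct (mu : {finite_measure set T -> \bar R}) (f_ : nat -> T -> R) (f : T -> R) (M : R) :
  (forall n, measurable_fun setT (f_ n)) ->
  (forall x, f_ n x @[n --> \oo] --> f x) ->
  (forall n x, `|f_ n x| <= M) ->
  (\int[mu]_x (f_ n x)) @[n --> \oo] --> (\int[mu]_x (f x)).
Proof.
move=> mf ff fM; apply: (Rintegral_dct mf ff _ fM).1.
by apply: (@integrable_bdd _ _ `|M|).
Qed.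

Lemma Rintegral_sum (mu : {measure set T -> \bar R}) I (r : seq I) (F : I -> T -> R) :
  (forall i, mu.-integrable setT (EFin \o F i)) ->
  \int[mu]_x (\sum_(i <- r) F i x) = \sum_(i <- r) \int[mu]_x F i x /\
  mu.-integrable setT (EFin \o (fun x => \sum_(i <- r) F i x)).
Proof.
move=> h; elim: r => [|i r [ih1 ih2]].
  rewrite big_nil (_ : (fun _ => _) = cst 0); last by apply/funext => x; rewrite big_nil.
  by rewrite /Rintegral integral0; split => //; exact: integrable0.
rewrite (_ : (fun x => _) = (fun x => F i x + \sum_(j <- r) F j x)); last first.
  by apply/funext => x; rewrite big_cons.
rewrite big_cons RintegralD// ih1; split=> //.
exact: (integrableD measurableT (h i) ih2).
Qed.

Lemma Rintegral_le_bdd (mu : probability T R) (f : T -> R) M :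
  measurable_fun setT f -> (forall x, `|f x| <= M) -> `|\int[mu]_x f x| <= M.
Proof.
move=> mf fM; have i := integrable_bdd mu mf fM.
apply: (le_trans (le_normr_Rintegral _ i)) => //.
rewrite (_ : M = \int[mu]_x (cst M x)); last first.
  transitivity (M * fine (mu setT)); last by rewrite Rintegral_cst.
  by rewrite (@probability_setT _ _ _ mu) mulr1.
apply: le_Rintegral => //.
  by apply: (@integrable_bdd _ _ M) => [|x]; [exact: measurableT_comp|rewrite normr_id].
by apply: (@integrable_bdd _ _ `|M|) => // x.
Qed.

End toolbox.

(** * Completeness of the space *)

Section L2_complete.
Variable R : realType.
Local Notation L2 := (L2 R).
Local Notation leb := (leb01 R).

Lemma L2norm_int (f : L2) : ((L2norm f ^+ 2)%:E = \int[leb]_x (f x ^+ 2)%:E)%E.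
Proof.
rewrite L2normE /L2inner fineK//.
by apply: integrable_fin_num => //; exact: L2inner_integrable.
Qed.

(** Young's inequality |f| <= f^2 / (2c) + c / 2, integrated against total mass 1, with c close to
    the norm of f. Stated for extended integrals, it also gives the integrability of f. *)
Lemma L2_abs_int (f : L2) : (\int[leb]_x `|f x|%:E <= (L2norm f)%:E)%E.
Proof.
(* The term e keeps c positive when the norm is 0. *)
apply/lee_addgt0Pr => e e0; set c := L2norm f + e.
have c0 : 0 < c by rewrite ltr_wpDl// L2norm_ge0.
apply: (@le_trans _ _ (\int[leb]_x ((c^-1 / 2) * f x ^+ 2 + c / 2)%:E)%E).
  apply: ge0_le_integral => //.
  - by apply/measurable_EFinP; apply: measurableT_comp.
  - apply/measurable_EFinP; apply: measurable_funD => //.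
    by apply: measurable_funM => //; apply: measurable_funX.
  - move=> x _; rewrite lee_fin.
    have : 0 <= (`|f x| - c) ^+ 2 / (2 * c) by rewrite divr_ge0 ?sqr_ge0// mulr_ge0// ltW.
    rewrite (_ : (`|f x| - c) ^+ 2 / _ = c^-1 / 2 * f x ^+ 2 + c / 2 - `|f x|).
      by rewrite subr_ge0.
    by rewrite sqrrB real_normK ?num_real//; field; rewrite gt_eqF.
under eq_integral do rewrite EFinD EFinM.
rewrite ge0_integralD//; last 3 first.
- by move=> x _; rewrite mule_ge0// lee_fin ?sqr_ge0// divr_ge0// invr_ge0 ltW.
- by apply/measurable_EFinP; apply: measurable_funM => //; apply: measurable_funX.
- by move=> x _; rewrite lee_fin divr_ge0// ltW.
rewrite ge0_integralZl_EFin//; last 3 first.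
- by move=> x _; rewrite lee_fin sqr_ge0.
- by apply/measurable_EFinP; apply: measurable_funX.
- by rewrite divr_ge0// invr_ge0 ltW.
rewrite -L2norm_int integral_cst// (_ : leb _ = 1%E); last exact: leb01T.
rewrite mule1 -!EFinM -!EFinD lee_fin.
have : c^-1 / 2 * L2norm f ^+ 2 <= c^-1 / 2 * c ^+ 2.
  rewrite ler_pM2l ?divr_gt0 ?invr_gt0// ler_sqr ?nnegrE ?L2norm_ge0 ?ltW//.
  by rewrite /c ltrDl.
rewrite (_ : c^-1 / 2 * c ^+ 2 = c / 2); last by field; rewrite gt_eqF.
by rewrite -/c; lra.
Qed.

(** The series g of the absolute increments has integral at most 2, so it is finite off a null set.
    A is the set where it is finite; there the telescoping series converges absolutely, and
    multiplying by the indicator of A makes the convergence hold everywhere. *)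
Lemma L2_cauchy_summable (v : nat -> L2) :
  (forall k, L2norm (v k.+1 - v k) <= 2^-1 ^+ k) ->
  exists (A : set R) (F : R -> R), [/\ measurable A, leb (~` A) = 0%E &
   forall x, (\1_A x * v k x) @[k --> \oo] --> F x].
Proof.
move=> vk.
pose g x : \bar R := (\sum_(0 <= k <oo) `|(v k.+1 - v k) x|%:E)%E.
have mabs k : measurable_fun setT (fun x => `|(v k.+1 - v k) x|%:E : \bar R).
  by apply/measurable_EFinP; apply: measurableT_comp.
have mg : measurable_fun setT g.
  by apply: ge0_emeasurable_sum => // k x _ _.
have ig : (\int[leb]_x g x < +oo)%E.
  rewrite integral_nneseries//.
  apply: (@le_lt_trans _ _ (\sum_(0 <= k <oo) (2^-1 ^+ k)%:E)%E).
    apply: lee_nneseries => k _ //.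
      by move=> _; apply: integral_ge0.
    by apply: le_trans (L2_abs_int _) _; rewrite lee_fin.
  have := @cvg_geometric_eseries_half R 2 0; move/cvg_lim => h.
  rewrite (_ : (fun _ => _) = (fun n => \sum_(0 <= k < n) (2 / (2 ^ (k + 1))%:R)%:E)%E); last first.
    apply/funext => n; apply: eq_bigr => k _; congr EFin.
    by rewrite exprVn natrX addn1 exprS; field; rewrite expf_neq0.
  rewrite h//; exact: ltry.
pose A := [set x | (g x < +oo)%E].
have mA : measurable A.
  have := emeasurable_fun_infty_o measurableT mg (+oo%E); rewrite setTI; exact.
have A0 : leb (~` A) = 0%E.
  have iig : leb.-integrable setT g.
    apply/integrableP; split=> //; apply: le_lt_trans ig.
    by apply: ge0_le_integral => //; [exact: measurableT_comp|move=> x _; rewrite gee0_abs// nneseries_ge0].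
  have [N [mN N0 sN]] := integrable_ae measurableT iig.
  apply: (subset_measure0 _ mN _ N0); first exact: measurableC.
  apply: subset_trans sN => x /=; rewrite /A/= => nA h; apply: nA.
  by have := h I; rewrite ge0_fin_numE// nneseries_ge0.
exists A, (fun x => limn (fun k => \1_A x * v k x)); split => // x.
apply/cvg_ex; have [xA|xA] := boolP (x \in A); last first.
  exists 0; rewrite (_ : (fun _ => _) = cst 0); first exact: cvg_cst.
  by apply/funext => k; rewrite indicE (negbTE xA) mul0r.
suff : cvgn (fun k => v k x).
  by rewrite (_ : (fun k => \1_A x * v k x) = (fun k => v k x))// => [/cvg_ex//|];
     apply/funext => k; rewrite indicE xA mul1r.
have c1 : cvgn [normed series (fun k => (v k.+1 - v k) x)].
  apply: nondecreasing_is_cvgn.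
    move=> a b ab; rewrite /series /=.
    by apply: (@nondecreasing_series R (fun k => `|(v k.+1 - v k) x|) xpredT 0%N) => // k _ _.
  exists (fine (g x)) => _ [n _ <-]; rewrite -lee_fin fineK.
    rewrite /series /= -sumEFin; apply: nneseries_lim_ge => k _ _.
    by rewrite lee_fin.
  by move: xA; rewrite inE /A /= => xA; rewrite ge0_fin_numE// nneseries_ge0.
have := normed_cvg c1 => c2.
rewrite (_ : (fun k => v k x) = (fun k => series (fun k => (v k.+1 - v k) x) k + v 0%N x)).
  apply/cvg_ex; eexists; apply: cvgD; [exact: c2|exact: cvg_cst].
apply/funext => k; rewrite /series /= -[LHS](subrK (v 0%N x)); congr (_ + _).
by rewrite (telescope_sumr (fun k => v k x)).
Qed.

Lemma L2_complete (u : nat -> L2) :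
  (forall e : R, 0 < e -> exists N, forall m n, (N <= m)%N -> (N <= n)%N -> L2norm (u m - u n) < e) ->
  exists f, L2norm (u n - f) @[n --> \oo] --> (0 : R).
Proof.
move=> cu.
have /choice[phi hphi] : forall k, exists N, forall m n, (N <= m)%N -> (N <= n)%N -> L2norm (u m - u n) < 2^-1 ^+ k.
  by move=> k; apply: cu; rewrite exprn_gt0.
(* A nondecreasing subsequence above both [phi] and the identity, so that each increment falls under
   the k-th threshold. *)
pose psi k := (k + \sum_(i < k.+1) phi i)%N.
have psi_phi k : (phi k <= psi k)%N by rewrite /psi big_ord_recr /= addnA leq_addl.
have psi_ge k : (k <= psi k)%N by rewrite leq_addr.
have psi_mono k l : (k <= l)%N -> (psi k <= psi l)%N.
  move=> kl; rewrite -(subnK kl); elim: (l - k)%N => [|i ih]; first by rewrite add0n.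
  by apply: leq_trans ih _; rewrite /psi addSn [X in (_ <= _ + X)%N]big_ord_recr /=; lia.
have [A [F [mA A0 vF]]] : exists (A : set R) (F : R -> R), [/\ measurable A, leb (~` A) = 0%E &
   forall x, (\1_A x * u (psi k) x) @[k --> \oo] --> F x].
  apply: (@L2_cauchy_summable (fun k => u (psi k))) => k; apply/ltW/hphi => //.
  exact: leq_trans (psi_phi k) (psi_mono _ _ _).
have mF : measurable_fun setT F.
  apply: (@measurable_fun_cvg _ _ _ _ (fun k x => \1_A x * u (psi k) x)) => [k|x _//].
  by apply: measurable_funM; [exact: measurable_indic|exact: L2_measurable].
(* Fatou along the subsequence, whose terms are eventually within e of [u n]. *)
have key e N n : 0 < e -> (forall m n, (N <= m)%N -> (N <= n)%N -> L2norm (u m - u n) < e) ->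
   (N <= n)%N -> (\int[leb]_x ((\1_A x * u n x - F x) ^+ 2)%:E <= (e ^+ 2)%:E)%E.
  move=> e0 hN Nn.
  apply: (@fatou_bound _ _ _ leb (fun k x => (\1_A x * u n x - \1_A x * u (psi k) x) ^+ 2) _ _ N).
  - by move=> k; apply: measurable_funX; apply: measurable_funB; apply: measurable_funM.
  - by move=> k x; rewrite sqr_ge0.
  - move=> x; under eq_fun do rewrite expr2; rewrite expr2.
    by apply: cvgM; apply: cvgB (vF x); exact: cvg_cst.
  - move=> k Kk; apply: (@le_trans _ _ ((L2norm (u n - u (psi k)) ^+ 2)%:E)).
      rewrite L2norm_int; apply: ge0_le_integral => //.
      + by move=> x _; rewrite lee_fin sqr_ge0.
      + apply/measurable_EFinP.
        by apply: measurable_funX; apply: measurable_funB; apply: measurable_funM.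
      + by apply/measurable_EFinP; apply: measurable_funX.
      + move=> x _; rewrite lee_fin -mulrBr exprMn indicE.
        by case: (_ \in _); rewrite ?mulr0n ?mulr1n ?expr1n ?expr0n /= ?mul0r ?mul1r// sqr_ge0.
    rewrite lee_fin ler_sqr ?nnegrE ?L2norm_ge0 ?ltW//; apply: hN => //.
    exact: leq_trans Kk (psi_ge _).
have aeA : {ae leb, forall x : measurableTypeR R, A x}.
  by exists (~` A); split=> //; exact: measurableC.
have key2 e N n : 0 < e -> (forall m n, (N <= m)%N -> (N <= n)%N -> L2norm (u m - u n) < e) ->
   (N <= n)%N -> (\int[leb]_x ((u n x - F x) ^+ 2)%:E <= (e ^+ 2)%:E)%E.
  move=> e0 hN Nn; apply: le_trans (key _ _ _ e0 hN Nn).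
  rewrite le_eqVlt; apply/orP; left; apply/eqP; apply: ae_eq_integral => //.
  - by apply/measurable_EFinP; apply: measurable_funX; apply: measurable_funB.
  - apply/measurable_EFinP; apply: measurable_funX; apply: measurable_funB => //.
    exact: measurable_funM.
  - apply: (@filterS _ _ (ae_filter_ringOfSetsType leb)) aeA => x Ax _.
    by rewrite indicE mem_set// mul1r.
have [N0 hN0] := cu 1 ltr01.
have mG : measurable_fun setT (fun x => u N0 x - F x) by exact: measurable_funB.
have hG : (\int[leb]_x ((u N0 x - F x) ^+ 2)%:E < +oo)%E.
  by apply: le_lt_trans (key2 _ _ _ ltr01 hN0 (leqnn _)) _; exact: ltry.
(* F is not yet known to be square-integrable, but its difference with [u N0] is; the limit is
   recovered from that difference, so that [toL2] is not junk. *)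
pose f := u N0 - toL2 (fun x => u N0 x - F x).
have fF x : f x = F x.
  rewrite (_ : f x = u N0 x - toL2 (fun x => u N0 x - F x) x)//.
  by rewrite (toL2E mG hG) opprB addrC subrK.
exists f; apply/cvgrPdist_le => e e0; have [N hN] := cu e e0.
exists N => // n /= Nn; rewrite sub0r normrN ger0_norm ?L2norm_ge0//.
suff : ((L2norm (u n - f) ^+ 2)%:E <= (e ^+ 2)%:E)%E.
  by rewrite lee_fin; apply: le_of_sqr; exact: ltW.
rewrite L2norm_int; apply: le_trans (key2 _ _ _ e0 hN Nn); rewrite le_eqVlt; apply/orP; left.
by apply/eqP; apply: eq_integral => x _; rewrite -fF.
Qed.

End L2_complete.

(** * Gram-Schmidt process for a semidefinite form *)

Section gram_schmidt.
Variables (R : realType) (V : lmodType R) (B : V -> V -> R).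
Hypothesis Bsym : forall f g, B f g = B g f.
Hypothesis BD : forall f g h, B (f + g) h = B f h + B g h.
Hypothesis BZ : forall a f g, B (a *: f) g = a * B f g.
Hypothesis Bpos : forall f, 0 <= B f f.

(* Vectors whose residual is null are replaced by 0, so that every vector of
   the system is either 0 or of norm 1. *)
Definition orthosystem (e : nat -> V) :=
  (forall i j, i != j -> B (e i) (e j) = 0) /\
  (forall i, B (e i) (e i) = 1 \/ e i = 0).

Let residual (g e : nat -> V) n := g n - \sum_(k < n) B (g n) (e k) *: e k.

Let normalize r := if B r r == 0 then 0 else (Num.sqrt (B r r))^-1 *: r.

(** Each vector depends on all earlier ones, so the recursion runs on the lists [gsl n] of the first
    n vectors. *)
Let gs_seq (g : nat -> V) : exists e, forall n, e n = normalize (residual g e n).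
Proof.
pose step v (s : seq V) := normalize (v - \sum_(x <- s) B v x *: x).
pose gsl := fix gsl n := if n is m.+1 then rcons (gsl m) (step (g m) (gsl m)) else [::].
have gslE n : gsl n = [seq step (g i) (gsl i) | i <- iota 0 n].
  by elim: n => [//|n ih]; rewrite -addn1 iotaD map_cat -ih cats1 add0n addn1.
exists (fun n => step (g n) (gsl n)) => n; congr normalize; rewrite /residual {1}gslE.
congr (_ - _).
rewrite big_map -(big_mkord xpredT (fun k => B (g n) (step (g k) (gsl k)) *: step (g k) (gsl k))).
by rewrite /index_iota subn0.
Qed.

(** A residual is orthogonal to the vectors already built, and removing its own normalized direction
    leaves a vector on which the form vanishes. When the form is degenerate, [g n] itself need not
    be a combination of the [e k]. *)
Lemma gram_schmidt (g : nat -> V) : exists2 e, orthosystem e &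
  forall n, B (g n - \sum_(k < n.+1) B (g n) (e k) *: e k)
              (g n - \sum_(k < n.+1) B (g n) (e k) *: e k) = 0.
Proof.
have [e eE] := gs_seq g.
have e1 i : B (e i) (e i) = 1 \/ e i = 0.
  rewrite eE /normalize; move: (residual g e i) => r; case: eqP => [_|/eqP r0]; first by right.
  left; have rp : 0 < B r r by rewrite lt_def r0 Bpos.
  by rewrite BZ (@psdZr R V B Bsym BZ) mulrA -expr2 exprVn sqr_sqrtr ?ltW// mulVf.
have resB n v i : (forall i j, (i < n)%N -> (j < n)%N -> i != j -> B (e i) (e j) = 0) ->
    (i < n)%N -> B (v - \sum_(k < n) B v (e k) *: e k) (e i) = 0.
  move=> h ni.
  rewrite BD -scaleN1r BZ (@psd_suml R V B BD BZ) (bigD1 (Ordinal ni))//= big1; last first.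
    by move=> j ji; rewrite BZ h ?mulr0.
  rewrite BZ addr0; have [->|e0] := e1 i; first by rewrite mulr1 mulN1r subrr.
  by rewrite e0 !(@psd0r R V B Bsym BZ) !mulr0 addr0.
have ej n i : (forall i j, (i < n)%N -> (j < n)%N -> i != j -> B (e i) (e j) = 0) ->
   (i < n)%N -> B (e n) (e i) = 0.
  move=> h ni; have r0 : B (residual g e n) (e i) = 0 by exact: resB.
  rewrite (eE n) /normalize; case: eqP => _; first exact: (@psd0 R V B BZ).
  by rewrite BZ r0 mulr0.
have ee n : forall i j, (i < n)%N -> (j < n)%N -> i != j -> B (e i) (e j) = 0.
  elim: n => [//|n ih i j]; rewrite !ltnS (leq_eqVlt i) (leq_eqVlt j).
  move=> /predU1P[->|i_n] /predU1P[->|j_n].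
  - by rewrite eqxx.
  - by move=> _; exact: ej.
  - by move=> _; rewrite Bsym; exact: ej.
  - exact: ih.
exists e; first by split=> // i j; apply: (ee (maxn i j).+1); rewrite ltnS ?leq_maxl ?leq_maxr.
move=> n; rewrite big_ord_recr/= opprD addrA -/(residual g e n).
have Bge : B (residual g e n) (e n) = B (g n) (e n).
  rewrite BD -scaleN1r BZ (@psd_suml R V B BD BZ) big1 ?mulr0 ?addr0// => j _.
  by rewrite BZ (ee n.+1) ?mulr0// ?ltn_eqF// ltnS// ltnW.
rewrite -Bge (eE n) /normalize; move: (residual g e n) => r.
have [r0|r0] := eqVneq (B r r) 0; first by rewrite scaler0 subr0.
have rp : 0 < B r r by rewrite lt_def r0 Bpos.
rewrite (@psdZr R V B Bsym BZ) scalerA mulrAC -expr2 exprVn sqr_sqrtr ?(ltW rp)// mulVf//.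
by rewrite scale1r subrr (@psd0 R V B BZ).
Qed.

End gram_schmidt.

Section orthosystems.
Variable R : realType.
Local Notation L2 := (L2 R).
Local Notation leb := (leb01 R).
Variable e : nat -> L2.
Hypothesis oe : orthosystem (@L2inner R) e.

Definition proj N (f : L2) : L2 := \sum_(k < N) L2inner f (e k) *: e k.

Lemma inner_ortho_sum (c : nat -> R) N j :
  L2inner (\sum_(k < N) c k *: e k) (e j) = if (j < N)%N then c j * L2inner (e j) (e j) else 0.
Proof.
rewrite L2inner_suml; case: ifPn => jN.
  rewrite (bigD1 (Ordinal jN))//= L2innerZl big1 ?addr0// => i ij.
  by rewrite L2innerZl oe.1 ?mulr0.
rewrite big1// => i _; rewrite L2innerZl oe.1 ?mulr0//.
by apply: contraNneq jN => <-.
Qed.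

Lemma inner_proj N f j : (j < N)%N -> L2inner (proj N f) (e j) = L2inner f (e j).
Proof.
move=> jN; rewrite (inner_ortho_sum (fun k => L2inner f (e k))) jN.
by have [->|->] := oe.2 j; rewrite ?mulr1// !L2inner0r mulr0.
Qed.

Lemma norm_ortho_sum (c : nat -> R) m n : (m <= n)%N ->
  L2norm (\sum_(k < n) c k *: e k - \sum_(k < m) c k *: e k) ^+ 2 =
    \sum_(m <= k < n) c k ^+ 2 * L2inner (e k) (e k).
Proof.
move=> mn; pose b k := if (m <= k)%N then c k else 0.
have -> : \sum_(k < n) c k *: e k - \sum_(k < m) c k *: e k = \sum_(k < n) b k *: e k.
  rewrite -(big_mkord xpredT (fun k => c k *: e k)) (@big_cat_nat _ _ _ m)//=.
  rewrite (big_mkord xpredT (fun k => c k *: e k)) addrAC subrr add0r.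
  rewrite -(big_mkord xpredT (fun k => b k *: e k)) (@big_cat_nat _ _ _ m 0 n)//=.
  rewrite [X in _ = X + _]big_nat_cond [X in _ = X + _]big1 ?add0r.
    by apply: eq_big_nat => i /andP[mi _]; rewrite /b mi.
  by move=> i /andP[/andP[_ im] _]; rewrite /b leqNgt im scale0r.
rewrite L2normE L2inner_sumr.
under eq_bigr => i _ do rewrite L2innerZr inner_ortho_sum ltn_ord.
rewrite -(big_mkord xpredT (fun k => b k * (b k * L2inner (e k) (e k)))).
rewrite (@big_cat_nat _ _ _ m)//= big_nat_cond big1 ?add0r.
  by apply: eq_big_nat => i /andP[mi _]; rewrite /b mi mulrA expr2.
by move=> i /andP[/andP[_ im] _]; rewrite /b leqNgt im mul0r.
Qed.

Lemma ortho_unit_le i (x : R) : 0 <= x -> x * L2inner (e i) (e i) <= x.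
Proof. by move=> x0; have [->|->] := oe.2 i; rewrite ?mulr1// L2inner0r mulr0. Qed.

Lemma ortho_coef i f : L2inner f (e i) ^+ 2 * L2inner (e i) (e i) = L2inner f (e i) ^+ 2.
Proof. by have [->|->] := oe.2 i; rewrite ?mulr1// !L2inner0r mulr0 expr0n. Qed.

Lemma norm_proj N f : L2norm (proj N f) ^+ 2 = \sum_(k < N) L2inner f (e k) ^+ 2.
Proof.
have := norm_ortho_sum (fun k => L2inner f (e k)) (leq0n N).
rewrite big_ord0 subr0 big_mkord => ->.
by apply: eq_bigr => i _; rewrite ortho_coef.
Qed.

Lemma norm_subproj N f :
  L2norm (f - proj N f) ^+ 2 = L2norm f ^+ 2 - \sum_(k < N) L2inner f (e k) ^+ 2.
Proof.
have h : L2inner f (proj N f) = \sum_(k < N) L2inner f (e k) ^+ 2.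
  by rewrite L2inner_sumr; apply: eq_bigr => i _; rewrite L2innerZr expr2.
rewrite L2normE L2innerBl !L2innerBr -L2normE (L2innerC (proj N f) f) h.
by rewrite -L2normE norm_proj; ring.
Qed.

Lemma bessel N f : \sum_(k < N) L2inner f (e k) ^+ 2 <= L2norm f ^+ 2.
Proof. by rewrite -subr_ge0 -norm_subproj sqr_ge0. Qed.

Lemma norm_proj_le N f : L2norm (proj N f) <= L2norm f.
Proof. by apply: le_of_sqr; rewrite ?L2norm_ge0// norm_proj bessel. Qed.

(** By Pythagoras, the squared distance of two partial sums is at most a block of the series of
    squared coefficients; vectors [e k] equal to 0 only make it smaller. *)
Lemma ortho_series_cvg (c : nat -> R) (M : R) :
  (forall N, \sum_(k < N) c k ^+ 2 <= M) ->
  exists f, L2norm (\sum_(k < n) c k *: e k - f) @[n --> \oo] --> (0 : R).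
Proof.
move=> cM; apply: L2_complete => eps eps0.
pose s n := \sum_(k < n) c k ^+ 2.
have sm m n : (m <= n)%N -> s n - s m = \sum_(m <= k < n) c k ^+ 2.
  move=> mn; rewrite /s -(big_mkord xpredT (fun k => c k ^+ 2)) (@big_cat_nat _ _ _ m)//=.
  by rewrite (big_mkord xpredT (fun k => c k ^+ 2)) addrAC subrr add0r.
have sh : {homo s : m n / (m <= n)%N >-> m <= n}.
  by move=> m n mn; rewrite -subr_ge0 sm// sumr_ge0// => i _; rewrite sqr_ge0.
have cs : cvgn s by apply: nondecreasing_is_cvgn => //; exists M => _ [n _ <-]; exact: cM.
have key m n : (m <= n)%N -> L2norm (\sum_(k < n) c k *: e k - \sum_(k < m) c k *: e k) ^+ 2 <= limn s - s m.
  move=> mn; rewrite norm_ortho_sum//; apply: (@le_trans _ _ (s n - s m)).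
    by rewrite sm//; apply: ler_sum => i _; rewrite ortho_unit_le ?sqr_ge0.
  by rewrite lerD2r; exact: nondecreasing_cvgn_le.
have /cvgrPdist_lt/(_ (eps ^+ 2))[|N _ hN] := cs; first by rewrite exprn_gt0.
exists N; suff h m n : (N <= m)%N -> (m <= n)%N -> L2norm (\sum_(k < n) c k *: e k - \sum_(k < m) c k *: e k) < eps.
  move=> m n Nm Nn; have [mn|/ltnW nm] := leqP m n; last exact: h.
  by rewrite L2normB; exact: h.
move=> Nm mn; rewrite ltNge; apply/negP => ge.
have := key _ _ mn; have /= := hN _ Nm; rewrite ger0_norm.
  move=> h1 h2; have := le_lt_trans h2 h1; rewrite ltNge.
  by rewrite ler_pXn2r ?nnegrE ?L2norm_ge0 ?(ltW eps0)// ge.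
by rewrite subr_ge0; exact: nondecreasing_cvgn_le.
Qed.

End orthosystems.

(** * A countable total orthosystem *)

Section total_system.
Variable R : realType.
Local Notation L2 := (L2 R).
Local Notation leb := (leb01 R).

Definition L2indic (A : set (measurableTypeR R)) : L2 := toL2 (\1_A : R -> R).

Lemma L2indicE A : measurable A -> (L2indic A : R -> R) = \1_A.
Proof.
move=> mA; apply: toL2E; first exact: measurable_indic.
apply: (@le_lt_trans _ _ (\int[leb]_x (cst 1%E x))%E); last first.
  by rewrite integral_cst// (_ : leb _ = 1%E) ?mule1 ?ltry//; exact: leb01T.
apply: ge0_le_integral => //.
- by apply/measurable_EFinP; apply: measurable_funX; exact: measurable_indic.
- by move=> x _; rewrite lee_fin indicE; case: (_ \in _); rewrite ?expr1n ?expr0n.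
Qed.

Lemma L2_integrable (f : L2) : leb.-integrable setT (EFin \o (f : R -> R)).
Proof.
apply/integrableP; split; first exact/measurable_EFinP.
by apply: le_lt_trans (L2_abs_int f) _; exact: ltry.
Qed.

Lemma inner_indic (f : L2) A : measurable A ->
  (L2inner f (L2indic A))%:E = (\int[leb]_(x in A) (f x)%:E)%E.
Proof.
move=> mA; rewrite /L2inner fineK; last first.
  by apply: integrable_fin_num => //; exact: L2inner_integrable.
rewrite [RHS]integral_mkcond; apply: eq_integral => x _.
rewrite L2indicE// patchE indicE; case: ifPn => _; first by rewrite mulr1.
by rewrite mulr0.
Qed.

Lemma mem_ray (a y : R) : (y \in `[a, +oo[%classic) = (a <= y).
Proof. by apply/idP/idP; rewrite inE /= in_itv /= andbT. Qed.

Lemma inner_indic_cvg0 (h : L2) (A_ : nat -> set (measurableTypeR R)) A :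
  (forall k, measurable (A_ k)) -> measurable A ->
  (forall y, \forall k \near \oo, (y \in A_ k) = (y \in A)) ->
  (forall k, L2inner h (L2indic (A_ k)) = 0) -> L2inner h (L2indic A) = 0.
Proof.
move=> mA_ mA A_A h0.
have [c0 _] : \int[leb]_x (h x * L2indic (A_ k) x) @[k --> \oo] --> \int[leb]_x (h x * L2indic A x) /\
    leb.-integrable setT (EFin \o (fun x => h x * L2indic A x)).
  apply: (@Rintegral_dct _ _ _ leb _ _ (fun x => `|h x|)).
  - by move=> k; exact: measurable_funM.
  - move=> y; apply: cvgM; first exact: cvg_cst.
    apply: cvg_near_cst; apply: filterS (A_A y) => k.
    by rewrite !L2indicE// !indicE => ->.
  - exact: (integrable_abse (L2_integrable h)).
  - move=> k y; rewrite normrM ler_piMr// L2indicE// indicE.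
    by case: (_ \in _); rewrite ?normr1 ?normr0.
apply: (@cvg_unique _ (@norm_hausdorff _ R) _ _ _ _ c0).
rewrite (_ : (fun _ => _) = cst 0); first exact: cvg_cst.
by apply/funext => k; exact: h0.
Qed.

(** Real endpoints are reached by rational ones tending to them from the left, the whole line by the
    rays from -k, and all Borel sets by Dynkin's lemma, since rays are stable under intersection. A
    function whose integrals over Borel sets all vanish is null almost everywhere. *)
Lemma orthogonal_rays_null (h : L2) :
  (forall q : rat, L2inner h (L2indic `[ratr q, +oo[) = 0) -> L2norm h = 0.
Proof.
move=> hq.
have hr x : L2inner h (L2indic `[x, +oo[) = 0.
  have /choice[q hqx] : forall k : nat, exists q : rat, ratr q \in `]x - k.+1%:R^-1, x[.
    by move=> k; apply: rat_in_itvoo; rewrite ltrBlDr ltrDl.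
  apply: (@inner_indic_cvg0 _ (fun k => `[ratr (q k), +oo[%classic)) => // y.
  have [xy|yx] := leP x y.
    apply: nearW => k; have := hqx k; rewrite in_itv/= => /andP[_ /ltW qx].
    by rewrite !mem_ray xy (le_trans qx xy).
  near=> k; have := hqx k; rewrite in_itv/= => /andP[xq qx].
  rewrite !mem_ray; apply/idP/idP; last by rewrite leNgt yx.
  rewrite leNgt => /negP[]; apply: le_lt_trans xq.
  rewrite lerBrDr -lerBrDl; near: k.
  have : 0 < x - y by rewrite subr_gt0.
  by move=> xy0; apply: filterS (near_infty_natSinv_lt (PosNum xy0)) => k /ltW.
have hT : L2inner h (L2indic setT) = 0.
  apply: (@inner_indic_cvg0 _ (fun k => `[(- k%:R)%R, +oo[%classic)) => // y.
  near=> k; rewrite mem_ray in_setT lerNl.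
  by near: k; exact: nbhs_infty_ger.
have hA (A : set (measurableTypeR R)) : measurable A -> L2inner h (L2indic A) = 0.
  have mR : @measurable _ (measurableTypeR R) = <<s (RGenCInfty.G (R:=R)) >>.
    exact: RGenCInfty.measurableE.
  move=> mA; move: (mA); rewrite mR => sA.
  apply: (@dynkin_induction _ _ _ (fun S => L2inner h (L2indic S) = 0) mR _ _ _ _ _ A sA) => //.
  - move=> _ _ [x ->] [y ->]; exists (Num.max x y).
    apply/seteqP; split => z /=; rewrite !in_itv/= !andbT ge_max.
      by move=> [-> ->].
    by move=> /andP[].
  - by move=> _ [x ->]; exact: hr.
  - move=> S mS hS.
    rewrite (_ : L2indic (~` S) = L2indic setT - L2indic S).
      by rewrite L2innerBr hT hS subrr.
    apply/LfuneqP => x.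
    rewrite (_ : (L2indic setT - L2indic S) x = L2indic setT x - L2indic S x)//.
    rewrite !L2indicE//; last exact: measurableC.
    rewrite !indicE in_setC in_setT.
    by case: (x \in S); rewrite /= ?mulr1n ?mulr0n ?subrr ?subr0.
  - move=> F mF tF hF; apply: EFin_inj.
    rewrite inner_indic; last exact: bigcupT_measurable.
    rewrite integral_bigcup//.
      by rewrite eseries0// => i _ _; rewrite -inner_indic// hF.
    by apply: integrableS (L2_integrable h) => //; exact: bigcupT_measurable.
rewrite -(subr0 h); apply: L2norm_eqae.
have : ae_eq leb setT (EFin \o h) (cst 0%E).
  apply: (integral_ae_eq measurableT (L2_integrable h)) => // E _ mE.
  by rewrite integral0 -inner_indic// hA.
by apply: (@filterS _ _ (ae_filter_ringOfSetsType leb)) => x /(_ I) [->].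
Unshelve. all: by end_near. Qed.

Lemma exists_total_orthosystem : exists2 e : nat -> L2, orthosystem (@L2inner R) e &
  forall f, L2norm (f - proj e n f) @[n --> \oo] --> (0 : R).
Proof.
(* The rays with rational endpoints, enumerated by their codes; other codes give 0. *)
pose g n : L2 := if unpickle n is Some q then L2indic `[ratr (q : rat), +oo[ else 0.
have [e oe ge] := gram_schmidt (@L2innerC R) (@L2innerDl R) (@L2innerZl R) (@L2inner_ge0 R) g.
exists e => // f.
(* f' is the sum of the orthogonal expansion of f. The difference is orthogonal to every [e k],
   hence to every ray, hence null. *)
have [|f' hf'] := @ortho_series_cvg _ e oe (fun k => L2inner f (e k)) (L2norm f ^+ 2).
  by move=> N; exact: bessel.
have ie k : L2inner (f - f') (e k) = 0.
  apply/eqP; rewrite L2innerBl subr_eq0; apply/eqP.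
  apply: (@cvg_unique _ (@norm_hausdorff _ R) (L2inner (proj e n f) (e k) @[n --> \oo])).
    apply: cvg_near_cst; near=> n; rewrite inner_proj//.
    by near: n; exact: nbhs_infty_gt.
  exact: (L2_continuous_cvg (@L2inner_continuous R (e k)) hf').
have ig n : L2inner (f - f') (g n) = 0.
  have := ge n; rewrite -L2normE => /eqP; rewrite sqrf_eq0 => /eqP r0.
  rewrite (L2inner_ae _ r0) L2inner_sumr big1// => k _.
  by rewrite L2innerZr ie mulr0.
have ff : L2norm (f - f') = 0.
  apply: orthogonal_rays_null => q; have := ig (pickle q).
  by rewrite /g pickleK.
apply: (@squeeze_cvgr _ _ _ _ (cst 0) (fun n => L2norm (proj e n f - f'))) => //.
  apply: nearW => n; rewrite L2norm_ge0/=.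
  by rewrite (le_trans (L2norm_triangleB f f' _))// ff add0r L2normB.
exact: cvg_cst.
Unshelve. all: by end_near. Qed.

End total_system.

(** * Random elements and stationarity *)

Section real_fubini.
Context {d1 d2 : measure_display} {T1 : measurableType d1} {T2 : measurableType d2} {R : realType}.
Variables (m1 : {sigma_finite_measure set T1 -> \bar R})
  (m2 : {sigma_finite_measure set T2 -> \bar R}).

(** The integral is the difference of those of the positive and negative parts, each measurable by
    Tonelli; this covers also the points where the section is not integrable. *)
Lemma measurable_integral_F (f : T1 * T2 -> \bar R) : measurable_fun setT f ->
  measurable_fun setT (fun x => \int[m2]_y f (x, y))%E.
Proof.
move=> mf; under eq_fun do rewrite integralE.
apply: emeasurable_funB.
  apply: (eq_measurable_fun _ _ (@measurable_fun_fubini_tonelli_F _ _ _ _ _ m2 (f^\+)%E (measurable_funepos mf) (funepos_ge0 _))).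
  by move=> x _; apply: eq_integral => y _; rewrite unlock.
apply: (eq_measurable_fun _ _ (@measurable_fun_fubini_tonelli_F _ _ _ _ _ m2 (f^\-)%E (measurable_funeneg mf) (funeneg_ge0 _))).
by move=> x _; apply: eq_integral => y _; rewrite unlock.
Qed.

Lemma measurable_integral_G (f : T1 * T2 -> \bar R) : measurable_fun setT f ->
  measurable_fun setT (fun y => \int[m1]_x f (x, y))%E.
Proof.
move=> mf; under eq_fun do rewrite integralE.
apply: emeasurable_funB.
  apply: (eq_measurable_fun _ _ (@measurable_fun_fubini_tonelli_G _ _ _ _ _ m1 (f^\+)%E (measurable_funepos mf) (funepos_ge0 _))).
  by move=> x _; apply: eq_integral => y _; rewrite unlock.
apply: (eq_measurable_fun _ _ (@measurable_fun_fubini_tonelli_G _ _ _ _ _ m1 (f^\-)%E (measurable_funeneg mf) (funeneg_ge0 _))).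
by move=> x _; apply: eq_integral => y _; rewrite unlock.
Qed.

Lemma measurable_Rintegral_F (f : T1 * T2 -> R) : measurable_fun setT f ->
  measurable_fun setT (fun x => \int[m2]_y f (x, y)).
Proof.
move=> mf; apply: measurableT_comp => //.
by apply: (@measurable_integral_F (EFin \o f)); exact/measurable_EFinP.
Qed.

Lemma measurable_Rintegral_G (f : T1 * T2 -> R) : measurable_fun setT f ->
  measurable_fun setT (fun y => \int[m1]_x f (x, y)).
Proof.
move=> mf; apply: measurableT_comp => //.
by apply: (@measurable_integral_G (EFin \o f)); exact/measurable_EFinP.
Qed.

End real_fubini.

Section real_fubini2.
Context {d1 d2 : measure_display} {T1 : measurableType d1} {T2 : measurableType d2} {R : realType}.
Variables (m1 : {sigma_finite_measure set T1 -> \bar R})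
  (m2 : {sigma_finite_measure set T2 -> \bar R}).

(** An integrable function is finite almost everywhere, so that [fine] alters it on a null set only.
    This reconciles the real integral, which is 0 where the extended one is infinite, with Fubini's
    theorem. *)
Lemma integrable_fine_comp d (T : measurableType d) (mu : {measure set T -> \bar R}) (g : T -> \bar R) :
  mu.-integrable setT g ->
  mu.-integrable setT (EFin \o (fun x => fine (g x))) /\
  (\int[mu]_x (fine (g x))%:E = \int[mu]_x g x)%E.
Proof.
move=> ig; have mg := measurable_int _ ig.
have mfg : measurable_fun setT (fun x => (fine (g x))%:E).
  by apply/measurable_EFinP; exact: measurableT_comp.
split.
  apply: le_integrable ig => // x _ /=; by case: (g x) => [r||]; rewrite ?lexx//= ?normr0 ?leey.
apply: ae_eq_integral => //.
apply: (@filterS _ _ (ae_filter_ringOfSetsType mu)) (integrable_ae measurableT ig) => x h _.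
by rewrite fineK// h.
Qed.

Lemma Rfubini (F : T1 * T2 -> R) : measurable_fun setT F ->
  (\int[m1]_x \int[m2]_y `|F (x, y)|%:E < +oo)%E ->
  [/\ \int[m1]_x (\int[m2]_y F (x, y)) = \int[m2]_y (\int[m1]_x F (x, y)),
      m1.-integrable setT (EFin \o (fun x => \int[m2]_y F (x, y))),
      m2.-integrable setT (EFin \o (fun y => \int[m1]_x F (x, y))) &
      {ae m2, forall y, m1.-integrable setT (EFin \o (fun x => F (x, y)))}].
Proof.
move=> mF fF.
have iF : (m1 \x m2)%E.-integrable setT (EFin \o F).
  by apply/integrable12ltyP => //; exact/measurable_EFinP.
have [iF1 eF1] := integrable_fine_comp (integrable_fubini_F iF).
have [iG1 eG1] : m2.-integrable setT (EFin \o (fun y => fine (\int[m1]_x (F (x, y))%:E)%E)) /\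
  (\int[m2]_y (fine (\int[m1]_x (F (x, y))%:E))%:E = \int[m2]_y \int[m1]_x (F (x, y))%:E)%E.
  apply: integrable_fine_comp; apply/integrableP; split.
    by apply: (@measurable_integral_G _ _ _ _ _ m1 (EFin \o F)); exact/measurable_EFinP.
  apply: le_lt_trans ((integrable21ltyP m1 m2 _).1 iF); last exact/measurable_EFinP.
  apply: ge0_le_integral => //.
  - apply: measurableT_comp => //.
    by apply: (@measurable_integral_G _ _ _ _ _ m1 (EFin \o F)); exact/measurable_EFinP.
  - apply: (@measurable_integral_G _ _ _ _ _ m1 (fun p => `|(F p)%:E|)%E).
    by apply: measurableT_comp => //; exact/measurable_EFinP.
  - move=> y _; apply: le_abse_integral => //.
    by apply/measurable_EFinP; exact: (measurableT_comp mF).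
split => //; last exact: (ae_integrable2 iF).
rewrite /Rintegral; congr fine.
transitivity (\int[m1]_x (\int[m2]_y (F (x, y))%:E))%E; first exact: eF1.
by rewrite (Fubini iF) -eG1.
Qed.

End real_fubini2.

Section L2_abs.
Variable R : realType.
Local Notation L2 := (L2 R).
Local Notation leb := (leb01 R).

Lemma L2_abs_inner (f g : L2) :
  (\int[leb]_x `|f x * g x|%:E <= (L2norm f * L2norm g)%:E)%E.
Proof.
have h := @hoelder _ _ _ leb f g 2 2 (L2_measurable f) (L2_measurable g) _ _ _.
rewrite EFinM !finite_norm_fine; apply: le_trans (h _ _ _) => //.
  by rewrite Lnorm1.
by rewrite [RHS]splitr !div1r.
Qed.

(** Cauchy-Schwarz against a vector of the unit ball, with an extended right-hand side that is +oo
    when g is not square-integrable. Iterated, it yields the bound of cumulants by their kernels. *)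
Lemma sqr_Rintegral_le (h : L2) (g : R -> R) : L2norm h <= 1 ->
  measurable_fun setT g ->
  (((\int[leb]_x (h x * g x)) ^+ 2)%:E <= \int[leb]_x (g x ^+ 2)%:E)%E.
Proof.
move=> h1 mg; have [gy|gy] := ltP (\int[leb]_x (g x ^+ 2)%:E)%E +oo%E; last first.
  by move: gy; rewrite leye_eq => /eqP ->; rewrite leey.
have gE := toL2E mg gy.
have -> : (\int[leb]_x (g x ^+ 2)%:E)%E = (L2norm (toL2 g) ^+ 2)%:E.
  by rewrite L2norm_int gE.
have -> : \int[leb]_x (h x * g x) = L2inner h (toL2 g) by rewrite /L2inner gE.
have := L2_cauchy_schwarz h (toL2 g).
have n1 := L2norm_ge0 h; have n2 := L2norm_ge0 (toL2 g).
move=> cs; rewrite lee_fin -[leLHS]real_normK ?num_real// ler_sqr ?nnegrE//.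
by apply: le_trans cs _; rewrite ler_piMl.
Qed.

End L2_abs.

Section random_elements.
Context {R : realType} {d : measure_display} {Omega : measurableType d}.
Variable P : probability Omega R.
Local Notation L2 := (L2 R).
Local Notation leb := (leb01 R).

Section one.
Variable X : Omega -> L2.
Hypothesis mX : random_element X.

Lemma random_element_at (x : R) : measurable_fun setT (fun w => X w x).
Proof. exact: (measurableT_comp mX (pair2_measurable (x : measurableTypeR R))). Qed.

Lemma random_inner_measurable (h : L2) : measurable_fun setT (fun w => L2inner (X w) h).
Proof.
apply: (@measurable_Rintegral_F _ _ _ _ _ (@leb1 R) (fun p => X p.1 p.2 * h p.2)).
apply: measurable_funM => //.
by apply: measurableT_comp => //; exact: measurable_snd.
Qed.

Lemma L2norm_sqrt (f : L2) : L2norm f = Num.sqrt (L2inner f f).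
Proof. by rewrite -L2normE sqrtr_sqr ger0_norm ?L2norm_ge0. Qed.

Lemma random_norm_measurable : measurable_fun setT (fun w => L2norm (X w)).
Proof.
under eq_fun do rewrite L2norm_sqrt -powR12_sqrt ?L2inner_ge0//.
apply: (measurableT_comp (measurable_powR _)).
apply: (@measurable_Rintegral_F _ _ _ _ _ (@leb1 R) (fun p => X p.1 p.2 * X p.1 p.2)).
exact: measurable_funM.
Qed.

Variables (W : Omega -> R) (h : L2).
Hypothesis mW : measurable_fun setT W.
Hypothesis XW : (\int[P]_w (L2norm (X w) * `|W w|)%:E < +oo)%E.

Lemma random_product_integrable_ae :
  {ae leb, forall x, P.-integrable setT (EFin \o (fun w => X w x * W w))}.
Proof.
pose F (p : Omega * measurableTypeR R) := X p.1 p.2 * W p.1.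
have mF : measurable_fun setT F.
  by apply: measurable_funM => //; apply: measurableT_comp => //; exact: measurable_fst.
have iF : (\int[P]_w \int[@leb1 R]_x `|F (w, x)|%:E < +oo)%E.
  apply: le_lt_trans XW.
  apply: ge0_le_integral => //.
  - by move=> w _; apply: integral_ge0.
  - apply: (@measurable_integral_F _ _ _ _ _ (@leb1 R) (fun p => `|F p|%:E)).
    by apply/measurable_EFinP; exact: measurableT_comp.
  - apply/measurable_EFinP; apply: measurable_funM; first exact: random_norm_measurable.
    exact: measurableT_comp.
  - move=> w _.
    rewrite (eq_integral (fun x => `|W w|%:E * `|X w x|%:E)%E); last first.
      by move=> x _; rewrite /F/= -EFinM !normrM; congr EFin; ring.
    rewrite ge0_integralZl//; last by apply/measurable_EFinP; exact: measurableT_comp.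
    by rewrite mulrC EFinM; apply: lee_pmul => //; [exact: integral_ge0|exact: L2_abs_int].
by have [] := @Rfubini _ _ _ _ _ P (@leb1 R) F mF iF.
Qed.

(** Fubini for h(x) X(w)(x) W(w), whose absolute integral is at most the norm of h times the
    expectation of the norm of X times |W|. It turns E[<X, h> W] into the integral of h against the
    kernel E[X(x) W]; the passages between operators or cumulants and their kernels go through
    it. *)
Lemma random_fubini :
  [/\ measurable_fun setT (fun x : measurableTypeR R => \int[P]_w (X w x * W w)),
      leb.-integrable setT (EFin \o (fun x => h x * \int[P]_w (X w x * W w))) &
      \int[leb]_x (h x * \int[P]_w (X w x * W w)) = \int[P]_w (L2inner (X w) h * W w)].
Proof.
pose F (p : Omega * measurableTypeR R) := h p.2 * (X p.1 p.2 * W p.1).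
have mXW : measurable_fun setT (fun p : Omega * measurableTypeR R => X p.1 p.2 * W p.1).
  by apply: measurable_funM => //; apply: measurableT_comp => //; exact: measurable_fst.
have mF : measurable_fun setT F.
  apply: measurable_funM => //.
  by apply: (measurableT_comp (L2_measurable h)); exact: measurable_snd.
have iF : (\int[P]_w \int[@leb1 R]_x `|F (w, x)|%:E < +oo)%E.
  apply: (@le_lt_trans _ _ (\int[P]_w ((L2norm h)%:E * (L2norm (X w) * `|W w|)%:E))%E).
    apply: ge0_le_integral => //.
    - by move=> w _; apply: integral_ge0.
    - apply: (@measurable_integral_F _ _ _ _ _ (@leb1 R) (fun p => `|F p|%:E)).
      by apply/measurable_EFinP; exact: measurableT_comp.
    - apply: emeasurable_funM => //; apply/measurable_EFinP; apply: measurable_funM.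
        exact: random_norm_measurable.
      exact: measurableT_comp.
    - move=> w _.
      rewrite (eq_integral (fun x => `|W w|%:E * `|h x * X w x|%:E)%E); last first.
        by move=> x _; rewrite /F/= -EFinM !normrM; congr EFin; ring.
      rewrite ge0_integralZl//.
      - rewrite -EFinM mulrA mulrC EFinM; apply: lee_pmul => //.
          exact: integral_ge0.
        exact: L2_abs_inner.
      - by apply/measurable_EFinP; apply: measurableT_comp => //; apply: measurable_funM.
  rewrite ge0_integralZl//.
  - by rewrite lte_mul_pinfty// lee_fin L2norm_ge0.
  - apply/measurable_EFinP; apply: measurable_funM; first exact: random_norm_measurable.
    exact: measurableT_comp.
  - by move=> w _; rewrite lee_fin mulr_ge0 ?L2norm_ge0.
  - by rewrite lee_fin L2norm_ge0.
have [e1 i1 i2 _] := @Rfubini _ _ _ _ _ P (@leb1 R) F mF iF.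
have mI : measurable_fun setT (fun x : measurableTypeR R => \int[P]_w (X w x * W w)).
  by apply: (@measurable_Rintegral_G _ _ _ _ _ P (fun p => X p.1 p.2 * W p.1)).
have mI2 : measurable_fun setT (fun x : measurableTypeR R => \int[P]_w F (w, x)).
  exact: (@measurable_Rintegral_G _ _ _ _ _ P F).
(* Only almost everywhere: [h x] leaves the expectation where the product of [X w x] and [W w] is
   integrable in w. *)
have hE : {ae leb, forall x, h x * \int[P]_w (X w x * W w) = \int[P]_w F (w, x)}.
  apply: (@filterS _ _ (ae_filter_ringOfSetsType leb)) random_product_integrable_ae => x ix.
  by rewrite -RintegralZl.
have mhI : measurable_fun setT (fun x : measurableTypeR R => h x * \int[P]_w (X w x * W w)).
  by apply: measurable_funM => //; exact: L2_measurable.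
split => //.
- apply/integrableP; split; first exact/measurable_EFinP.
  rewrite (ae_eq_integral (fun x => `|(\int[P]_w F (w, x))%:E|)%E)//.
  - by case/integrableP : i2.
  - by apply: measurableT_comp => //; exact/measurable_EFinP.
  - by apply: measurableT_comp => //; exact/measurable_EFinP.
  - apply: (@filterS _ _ (ae_filter_ringOfSetsType leb)) hE => x hx _ /=.
    by rewrite hx.
- transitivity (\int[leb]_x \int[P]_w F (w, x)).
    congr fine; apply: ae_eq_integral => //; try exact/measurable_EFinP.
    by apply: (@filterS _ _ (ae_filter_ringOfSetsType leb)) hE => x hx _ /=; rewrite hx.
  rewrite -[LHS]e1; apply: eq_Rintegral => w _; rewrite /L2inner mulrC -RintegralZl//.
    by apply: eq_Rintegral => x _; rewrite /F/=; ring.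
  exact: L2inner_integrable.
Qed.

End one.
End random_elements.

(** * Integrals under equal laws *)

Section equal_laws.
Context {R : realType} {d1 d2 : measure_display} {T1 : measurableType d1} {T2 : measurableType d2}.
Variables (P1 : probability T1 R) (P2 : probability T2 R).
Variables (Y1 : T1 -> R) (Y2 : T2 -> R).
Hypotheses (mY1 : measurable_fun setT Y1) (mY2 : measurable_fun setT Y2).
Hypothesis YY : forall B : set (measurableTypeR R), measurable B -> P1 (Y1 @^-1` B) = P2 (Y2 @^-1` B).

Lemma equal_law_ge0_integral (f : R -> \bar R) : measurable_fun setT f -> (forall x, 0 <= f x)%E ->
  (\int[P1]_w f (Y1 w) = \int[P2]_w f (Y2 w))%E.
Proof.
move=> mf f0.
pose Z1 : {RV P1 >-> R} := mfun_Sub (mem_set mY1).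
pose Z2 : {RV P2 >-> R} := mfun_Sub (mem_set mY2).
rewrite -(@ge0_integral_distribution _ _ _ _ _ P1 Z1)//.
rewrite -(@ge0_integral_distribution _ _ _ _ _ P2 Z2)//.
by apply: eq_measure_integral => A mA _; exact: YY.
Qed.

Lemma equal_law_integral (f : R -> R) : measurable_fun setT f ->
  \int[P1]_w f (Y1 w) = \int[P2]_w f (Y2 w).
Proof.
move=> mf; rewrite /Rintegral integralE [in RHS]integralE; congr (fine (_ - _)).
  under eq_integral do rewrite funeposE.
  under [RHS]eq_integral do rewrite funeposE.
  apply: (@equal_law_ge0_integral (fun x => maxe (f x)%:E 0%E)).
    by apply: measurable_maxe => //; exact/measurable_EFinP.
  by move=> x; rewrite le_max lexx orbT.
under eq_integral do rewrite funenegE.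
under [RHS]eq_integral do rewrite funenegE.
apply: (@equal_law_ge0_integral (fun x => maxe (- (f x)%:E)%E 0%E)).
  apply: measurable_maxe => //; apply: measurableT_comp => //; exact/measurable_EFinP.
by move=> x; rewrite le_max lexx orbT.
Qed.

End equal_laws.

(** The product is at most the k-th power of its largest factor. The term 1 is for the empty
    product. *)
Lemma prod_le_sum_expn (R : realType) k (a : 'I_k -> R) : (forall i, 0 <= a i) ->
  \prod_(i < k) a i <= 1 + \sum_(i < k) a i ^+ k.
Proof.
case: k a => [a _|k a a0]; first by rewrite !big_ord0 addr0.
have [m _ hm] := @arg_maxP _ _ _ (@ord0 k) xpredT a isT.
apply: (@le_trans _ _ (a m ^+ k.+1)).
  rewrite -[X in _ <= _ ^+ X](card_ord k.+1) -prodr_const.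
  by apply: ler_prod => i _; apply/andP; split; [exact: a0|exact: hm].
rewrite (bigD1 m)//= addrCA lerDl addr_ge0// sumr_ge0// => i _.
by rewrite exprn_ge0.
Qed.

(** The exponent is raised to k + 2 because moments of the norm are assumed from order 2 on. *)
Lemma expn_1D_le (R : realType) (x : R) k : 0 <= x -> (1 + x) ^+ k <= 2 ^+ k.+2 * (1 + x ^+ k.+2).
Proof.
move=> x0; apply: (@le_trans _ _ ((1 + x) ^+ k.+2)).
  by apply: ler_weXn2l; [rewrite lerDl|rewrite -addn2 leq_addr].
have [x1|/ltW x1] := leP x 1.
  apply: (@le_trans _ _ (2 ^+ k.+2)).
    by rewrite lerXn2r ?nnegrE ?addr_ge0// -[2]/(1 + 1) lerD2l.
  by rewrite ler_peMr ?exprn_ge0// lerDl exprn_ge0.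
apply: (@le_trans _ _ ((2 * x) ^+ k.+2)).
  by rewrite lerXn2r ?nnegrE ?addr_ge0 ?mulr_ge0// mulrDl mul1r lerD2r.
by rewrite exprMn ler_pM2l ?exprn_gt0// lerDr.
Qed.

Lemma L2borel_measurable (R : realType) (F : L2 R -> R) : continuous F ->
  measurable_fun setT (F : L2borel R -> R).
Proof.
move=> cF; apply: (@measurability _ _ (L2borel R) (measurableTypeR R) setT F _ (RGenOInfty.measurableE R)) => _ [_ [x ->] <-].
rewrite setTI; apply: sub_sigma_algebra.
apply: (@open_comp _ _ F) => //; exact: interval_open.
Qed.

Section stationary.
Context {R : realType} {d : measure_display} {Omega : measurableType d}.
Variable P : probability Omega R.
Local Notation L2 := (L2 R).
Local Notation leb := (leb01 R).
Variable X : int -> Omega -> L2.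
Hypothesis mX : forall t, random_element (X t).
Hypothesis sX : strictly_stationary P X.

Section law.
Variables (k : nat) (t : 'I_k -> int) (s : int) (F : 'I_k -> L2 -> R) (B : {set 'I_k}).
Hypothesis cF : forall j, continuous (F j).
Hypothesis mF : forall u j, measurable_fun setT (fun w => F j (X u w)).

Let mprod (u : 'I_k -> int) : measurable_fun setT (fun w => \prod_(j in B) F j (X (u j) w)).
Proof. by under eq_fun do rewrite -big_enum; apply: measurable_prod => j _; exact: mF. Qed.

(** The product is a measurable function G of the tuple of the [X (t j)], to whose law stationarity
    applies. *)
Let law (A : set (measurableTypeR R)) : measurable A ->
  P ((fun w => \prod_(j in B) F j (X (t j + s) w)) @^-1` A) =
  P ((fun w => \prod_(j in B) F j (X (t j) w)) @^-1` A).
Proof.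
move=> mA; pose G (v : k.-tuple (L2borel R)) := \prod_(j in B) F j (tnth v j).
have mG : measurable_fun setT G.
  rewrite /G; under eq_fun do rewrite -big_enum; apply: measurable_prod => j _.
  have h1 := L2borel_measurable (@cF j).
  have h2 := measurable_tnth (T := L2borel R) j.
  have h3 := measurableT_comp h1 h2.
  exact: h3.
have mGA : measurable (G @^-1` A) by rewrite -[X in measurable X]setTI; exact: mG.
have E (u : 'I_k -> int) w : \prod_(j in B) F j (X (u j) w) =
    G [tuple (X (u i) w : L2borel R) | i < k].
  by apply: eq_bigr => j _; rewrite tnth_mktuple.
have e (v : 'I_k -> int) : P ((fun w => \prod_(j in B) F j (X (v j) w)) @^-1` A) =
    P [set w | (G @^-1` A) [tuple (X (v i) w : L2borel R) | i < k]].
  by congr (P _); apply/seteqP; split => w /=; rewrite E.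
rewrite !e; have := @sX k (mktuple t) s _ mGA.
have e2 (v : 'I_k -> int) w : [tuple (X (v i) w : L2borel R) | i < k] =
    [tuple (X (tnth (mktuple v) i) w : L2borel R) | i < k].
  by apply: eq_from_tnth => i; rewrite !tnth_mktuple.
have e3 w : [tuple (X (t i + s) w : L2borel R) | i < k] =
    [tuple (X (tnth (mktuple t) i + s) w : L2borel R) | i < k].
  by apply: eq_from_tnth => i; rewrite !tnth_mktuple.
move=> h; transitivity (P [set w | (G @^-1` A) [tuple X (tnth (mktuple t) i + s) w  | i < k]]).
  by congr (P _); apply/seteqP; split => w /=; rewrite e3.
by rewrite h; congr (P _); apply/seteqP; split => w /=; rewrite -e2.
Qed.

Lemma stationary_integral (f : R -> R) : measurable_fun setT f ->
  \int[P]_w f (\prod_(j in B) F j (X (t j + s) w)) = \int[P]_w f (\prod_(j in B) F j (X (t j) w)).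
Proof. by move=> mf; apply: (equal_law_integral (mprod _) (mprod _) law mf). Qed.

Lemma stationary_ge0_integral (f : R -> \bar R) : measurable_fun setT f -> (forall x, 0 <= f x)%E ->
  (\int[P]_w f (\prod_(j in B) F j (X (t j + s)%R w))%R = \int[P]_w f (\prod_(j in B) F j (X (t j) w))%R)%E.
Proof. by move=> mf f0; apply: (equal_law_ge0_integral (mprod _) (mprod _) law mf f0). Qed.

End law.

Lemma stationary_inner_prod k (t : 'I_k -> int) (s : int) (h : L2) (B : {set 'I_k}) :
  \int[P]_w (\prod_(j in B) L2inner (X (t j + s) w) h) = \int[P]_w (\prod_(j in B) L2inner (X (t j) w) h).
Proof.
apply: (@stationary_integral k t s (fun _ f => L2inner f h) B _ _ idfun) => //.
- by move=> j; exact: L2inner_continuous.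
- by move=> u j; exact: random_inner_measurable.
- exact: measurable_id.
Qed.

Hypothesis X_moments : forall k : nat, (2 <= k)%N ->
      (\int[P]_w ((L2norm (X 0 w)) ^+ k)%:E < +oo)%E.

Lemma norm_pow_measurable t k : measurable_fun setT (fun w => (1 + L2norm (X t w)) ^+ k).
Proof.
apply: measurable_funX; apply: measurable_funD => //.
exact: random_norm_measurable.
Qed.

Lemma moment_bound t k : P.-integrable setT (EFin \o (fun w => (1 + L2norm (X t w)) ^+ k)).
Proof.
have i0 : P.-integrable setT (EFin \o (fun w => L2norm (X 0 w) ^+ k.+2)).
  apply/integrableP; split.
    by apply/measurable_EFinP; apply: measurable_funX; exact: random_norm_measurable.
  rewrite (eq_integral (fun w => (L2norm (X 0 w) ^+ k.+2)%:E)); first exact: X_moments.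
  by move=> w _ /=; rewrite ger0_norm// exprn_ge0// L2norm_ge0.
have it : P.-integrable setT (EFin \o (fun w => L2norm (X t w) ^+ k.+2)).
  apply/integrableP; split.
    by apply/measurable_EFinP; apply: measurable_funX; exact: random_norm_measurable.
  case/integrableP : i0 => _.
  have mf : measurable_fun setT (fun x : R => (`|x| ^+ k.+2)%:E).
    by apply/measurable_EFinP; apply: measurable_funX; exact: normr_measurable.
  have := @stationary_ge0_integral 1 (fun _ => 0) t (fun _ => @L2norm R) [set: 'I_1]%SET
    (fun _ => @L2norm_continuous R) (fun u _ => random_norm_measurable (mX u)) _ mf.
  have E u w : \prod_(j in [set: 'I_1]%SET) L2norm (X u w) = L2norm (X u w).
    by rewrite prodr_const cardsT card_ord expr1.
  under eq_integral do rewrite E; under [in RHS]eq_integral do rewrite E.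
  rewrite add0r => h; rewrite [X in (X < _)%E -> _](_ : _ = \int[P]_w (`|L2norm (X 0 w)| ^+ k.+2)%:E)%E.
    rewrite -h; last by move=> x; rewrite lee_fin exprn_ge0.
    move=> hh; apply: le_lt_trans hh; rewrite le_eqVlt; apply/orP; left; apply/eqP.
    by apply: eq_integral => w _ /=; rewrite normrX.
  by apply: eq_integral => w _ /=; rewrite normrX.
apply: (@integrable_le _ _ _ _ _ (fun w => 2 ^+ k.+2 * (1 + L2norm (X t w) ^+ k.+2))).
- exact: norm_pow_measurable.
- rewrite (_ : _ \o _ = (fun w => (2 ^+ k.+2)%:E * (1 + (L2norm (X t w) ^+ k.+2)%:E))%E).
    apply: integrableZl => //; apply: integrableD => //.
    exact: finite_measure_integrable_cst.
  by apply/funext => w /=; rewrite EFinM EFinD.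
- by move=> w; rewrite ger0_norm ?exprn_ge0 ?addr_ge0 ?L2norm_ge0// expn_1D_le ?L2norm_ge0.
Qed.

Lemma mixed_moment_bound k (t : 'I_k -> int) :
  P.-integrable setT (EFin \o (fun w => \prod_(j < k) (1 + L2norm (X (t j) w)))).
Proof.
apply: (@integrable_le _ _ _ _ _ (fun w => 1 + \sum_(j < k) (1 + L2norm (X (t j) w)) ^+ k)).
- apply: measurable_prod => j _; apply: measurable_funD => //; exact: random_norm_measurable.
- apply: (@integrableD _ _ _ P setT _ (cst 1%E) (EFin \o (fun w => \sum_(j < k) (1 + L2norm (X (t j) w)) ^+ k))) => //.
    exact: finite_measure_integrable_cst.
  apply: (Rintegral_sum (mu := P) _ _).2 => j; exact: moment_bound.
- move=> w; rewrite ger0_norm; last by apply: prodr_ge0 => j _; rewrite addr_ge0 ?L2norm_ge0.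
  by apply: prod_le_sum_expn => j; rewrite addr_ge0 ?L2norm_ge0.
Qed.

End stationary.

(** * Moments and cumulants *)

Section partition_sums.
Variables (T : finType) (R : comNzRingType).
Implicit Types (U V A B : {set T}) (nu : {set {set T}}).

(** Double counting: choosing a partition of U and then a block B amounts to choosing B and then a
    partition of its complement in U. *)
Lemma sum_partition_block (Q : pred {set T}) (F : {set {set T}} -> {set T} -> R) U :
  \sum_(nu | finset.partition nu U) \sum_(B in nu | Q B) F (nu :\ B)%SET B =
  \sum_(B : {set T} | (B \subset U) && (B != finset.set0) && Q B)
     \sum_(nu | finset.partition nu (U :\: B)) F nu B.
Proof.
under eq_bigr => nu _ do rewrite big_mkcondl.
rewrite exchange_big/= [LHS](bigID (fun B => (B \subset U) && (B != finset.set0)))/=.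
rewrite [X in _ + X]big1 ?addr0; last first.
  move=> B /andP[_ hB]; apply: big1 => nu pnu; case: ifP => // Bnu.
  move: hB; rewrite (partition_neq0 pnu Bnu) andbT => /negP[].
  have /and3P[/eqP <- _ _] := pnu.
  exact: finset.bigcup_sup.
apply: eq_big => [B|B /andP[_ /andP[BU B0]]]; first by rewrite andbC.
rewrite -big_mkcondr/=.
rewrite (reindex_onto (fun nu => B |: nu)%SET (fun nu => nu :\ B)%SET)/=; last first.
  by move=> nu /andP[_ Bnu]; rewrite finset.setD1K.
have notin nu : finset.partition nu (U :\: B) -> B \notin nu.
  move=> pnu; apply/negP => Bnu; have /and3P[/eqP cov _ _] := pnu.
  have : B \subset U :\: B by rewrite -cov; exact: finset.bigcup_sup.
  rewrite finset.subsetD => /andP[_]; rewrite -finset.setI_eq0 finset.setIid.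
  by rewrite (negbTE B0).
apply: eq_big => [nu|nu /andP[_ /eqP ->]//].
apply/idP/idP => [/andP[/andP[p1 _] /eqP nuE]|p1].
  have := partitionD1 p1 (finset.setU11 _ _); rewrite nuE//.
rewrite finset.setU11 andbT; apply/andP; split; last first.
  by rewrite finset.setU1K ?notin.
have := partitionU1 p1 B0; rewrite finset.setDE.
rewrite -finset.setDE -[in X in _ -> X](finset.setID U B) (finset.setIidPr BU) => -> //.
by rewrite -finset.setI_eq0 finset.setIDA finset.setIC finset.setDIl finset.setDv finset.setI0.
Qed.

Variable f : {set T} -> R.
Hypothesis f0 : f finset.set0 = 1.

(** The weight sees only the number of blocks. The weight (-1)^(n-1) (n-1)! gives cumulants; the
    weight (-1)^n n! gives the inverse of f for convolution over subsets. *)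
Definition wsum (c : nat -> R) U :=
  \sum_(nu | finset.partition nu U) c #|nu| * \prod_(B in nu) f B.

(** The factor n counts the choices of a distinguished block. *)
Lemma wsum_blocks (c : nat -> R) U :
  wsum (fun n => n%:R * c n.-1) U =
  \sum_(B : {set T} | (B \subset U) && (B != finset.set0)) f B * wsum c (U :\: B).
Proof.
transitivity (\sum_(nu | finset.partition nu U) \sum_(B in nu | xpredT B)
   (f B * (c #|(nu :\ B)%SET| * \prod_(A in (nu :\ B)%SET) f A))).
  apply: eq_bigr => nu _.
  rewrite [RHS](eq_bigr (fun=> c #|nu|.-1 * \prod_(B in nu) f B)); last first.
    by move=> B /andP[Bnu _]; rewrite mulrCA -big_setD1// (cardsD1 B nu) Bnu.
  rewrite [RHS](eq_bigl (mem nu)) => [|B]; last by rewrite andbT.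
  by rewrite sumr_const -[RHS]mulr_natl mulrA.
rewrite (sum_partition_block xpredT (fun nu B => f B * (c #|nu| * \prod_(A in nu) f A))).
by apply: eq_big => [B|B _]; rewrite ?andbT// /wsum big_distrr.
Qed.

(** Here the distinguished block is the one containing x, which is unique, so no factor appears. *)
Lemma wsum_block_at (c : nat -> R) U x : x \in U ->
  wsum (fun n => c n.-1) U =
  \sum_(B : {set T} | (B \subset U) && (x \in B)) f B * wsum c (U :\: B).
Proof.
move=> xU.
transitivity (\sum_(nu | finset.partition nu U) \sum_(B in nu | x \in B)
   (f B * (c #|(nu :\ B)%SET| * \prod_(A in (nu :\ B)%SET) f A))).
  apply: eq_bigr => nu pnu; have /and3P[/eqP cov tri _] := pnu.
  have xc : x \in finset.cover nu by rewrite cov.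
  rewrite [RHS](big_pred1 (finset.pblock nu x)) => [|B].
    rewrite mulrCA -big_setD1 ?pblock_mem//.
    by rewrite (cardsD1 (finset.pblock nu x) nu) pblock_mem.
  apply/andP/eqP => [[Bnu xB]|->]; first by rewrite (def_pblock tri Bnu xB).
  by rewrite pblock_mem// mem_pblock.
rewrite (sum_partition_block (fun B => x \in B) (fun nu B => f B * (c #|nu| * \prod_(A in nu) f A))).
apply: eq_big => [B|B _]; last by rewrite /wsum big_distrr.
rewrite -andbA; congr (_ && _); rewrite andbC; apply: andb_idr => xB.
by apply/finset.set0Pn; exists x.
Qed.

Lemma wsum0 c : wsum c finset.set0 = c 0%N.
Proof.
rewrite /wsum (big_pred1 finset.set0) => [|nu]; last by rewrite partition_set0.
by rewrite finset.big_set0 mulr1 cards0.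
Qed.

Definition cumulant_weight (n : nat) : R := (-1) ^+ n.-1 * (n.-1)`!%:R.

Let a (n : nat) : R := (-1) ^+ n * n`!%:R.

(** A partition into n blocks counts n! times, once for each ordering, so [wsum a] is the geometric
    series of the unit minus f for convolution. Concretely, the nonempty B contribute the weight n
    a(n-1), which cancels a(n). *)
Lemma wsum_inverse U : U != finset.set0 ->
  \sum_(B : {set T} | B \subset U) f B * wsum a (U :\: B) = 0.
Proof.
move=> U0; rewrite (bigD1 finset.set0) ?finset.sub0set//= f0 mul1r finset.setD0.
rewrite -wsum_blocks /wsum -big_split/= big1// => nu pnu.
have : (0 < #|nu|)%N.
  rewrite card_gt0; apply: contraNneq U0 => nu0.
  by move: pnu; rewrite nu0 => /and3P[/eqP <- _ _]; rewrite /finset.cover finset.big_set0.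
case: #|nu| => // n _ /=; rewrite -mulrDl /a factS exprS natrM.
by rewrite [X in X * _](_ : _ = 0) ?mul0r//; ring.
Qed.

(** The cumulant of B is split according to its block A containing x. With A fixed, the sum over B
    between A and U is the convolution of f with its inverse on the complement of A, which is 0
    unless A = U. *)
Lemma moment_cumulant_set U x : x \in U ->
  f U = \sum_(B : {set T} | (B \subset U) && (x \in B)) wsum cumulant_weight B * f (U :\: B).
Proof.
move=> xU.
transitivity (\sum_(B : {set T} | (B \subset U) && (x \in B))
   \sum_(A : {set T} | (A \subset B) && (x \in A)) f A * wsum a (B :\: A) * f (U :\: B)); last first.
  apply: eq_bigr => B /andP[_ xB]; rewrite -big_distrl/=; congr (_ * _).
  exact/esym/(wsum_block_at a xB).
rewrite (exchange_big_dep (fun A => (A \subset U) && (x \in A)))/=; last first.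
  by move=> B A /andP[BU xB] /andP[AB xA]; rewrite (fintype.subset_trans AB BU).
transitivity (\sum_(A : {set T} | (A \subset U) && (x \in A)) f A * (U :\: A == finset.set0)%:R).
  rewrite (bigD1 U) ?subxx//= finset.setDv eqxx mulr1 big1 ?addr0// => A /andP[/andP[AU _] nAU].
  case: eqP => [/eqP|_]; last by rewrite mulr0.
  by rewrite finset.setD_eq0 => UA; rewrite finset.eqEsubset AU UA in nAU.
apply: eq_bigr => A /andP[AU xA].
rewrite (eq_bigr (fun B => f A * (wsum a (B :\: A) * f (U :\: B)))); last by move=> B _; rewrite mulrA.
rewrite -big_distrr/=; congr (_ * _).
(* The variable becomes the complement C of B, a subset of U minus A. *)
rewrite (reindex_onto (fun C => U :\: C) (fun B => U :\: B))/=; last first.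
  by move=> B /andP[/andP[BU _] _]; rewrite finset.setDDr finset.setDv finset.set0U; apply/finset.setIidPr.
rewrite [RHS](eq_bigl (fun C : {set T} => C \subset U :\: A)); last first.
  move=> C; rewrite finset.subsetDl xA !andbT /=.
  apply/idP/idP.
    move=> /andP[/andP[/finset.setDP[xU' xC] sA] /eqP CE].
    rewrite finset.subsetD -{1}CE finset.subsetDl/=.
    by move: sA; rewrite finset.subsetD AU/= disjoint_sym.
  rewrite finset.subsetD => /andP[CU dCA]; rewrite finset.subsetD AU disjoint_sym dCA/=.
  rewrite !inE xU andbT finset.setDDr finset.setDv finset.set0U.
  rewrite (finset.setIidPr CU) eqxx !andbT; apply/negP => xC.
  by have := disjointFr dCA xC; rewrite xA.
rewrite [RHS](eq_bigr (fun C => f C * wsum a ((U :\: A) :\: C))); last first.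
  move=> C CU; rewrite mulrC; congr (f _ * wsum a _).
    rewrite finset.setDDr finset.setDv finset.set0U; apply/finset.setIidPr.
    exact: fintype.subset_trans CU (finset.subsetDl _ _).
  by rewrite !finset.setDDl finset.setUC.
have [->|UA0] := eqVneq (U :\: A) finset.set0; last by rewrite wsum_inverse.
rewrite (big_pred1 finset.set0) => [|C]; last by rewrite finset.subset0.
by rewrite f0 finset.setD0 wsum0 /a expr0 fact0 !mul1r.
Qed.

End partition_sums.

(** * Cumulants of a single variable *)

Section numeric_cumulants.
Variable (R : comNzRingType).

Lemma sum_subset_card (T : finType) (V : {set T}) (F : nat -> R) :
  \sum_(A : {set T} | A \subset V) F #|A| = \sum_(k < #|V|.+1) F k *+ 'C(#|V|, k).
Proof.
rewrite (partition_big (fun A : {set T} => inord #|A| : 'I_#|V|.+1) xpredT)//=.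
apply: eq_bigr => k _.
rewrite (eq_bigr (fun _ => F k)); last first.
  move=> A /andP[AV /eqP <-]; rewrite inordK// ltnS; exact: subset_leq_card.
rewrite sumr_const -cards_draws; congr (_ *+ _).
rewrite cardsE; apply: eq_card => A; rewrite /in_mem /=.
case AV: (A \subset V) => //=; rewrite -val_eqE /= inordK// ltnS.
exact: subset_leq_card.
Qed.

Lemma sum_subset_card_at (T : finType) (V : {set T}) x (F : nat -> R) : x \in V ->
  \sum_(A : {set T} | (A \subset V) && (x \in A)) F #|A| =
  \sum_(k < #|V|) F k.+1 *+ 'C(#|V|.-1, k).
Proof.
move=> xV; rewrite (cardsD1 x V) xV add1n /= -(sum_subset_card (V :\ x)%SET (fun k => F k.+1)).
rewrite (reindex_onto (fun A => x |: A)%SET (fun A => A :\ x)%SET)/=; last first.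
  by move=> A /andP[_ xA]; rewrite finset.setD1K.
have h (A : {set T}) : (x |: A \subset V) && (x \in x |: A)%SET && ((x |: A) :\ x == A)%SET = (A \subset V :\ x)%SET.
  rewrite finset.setU11 andbT finset.subUset finset.sub1set xV /= finset.subsetD1.
  congr (_ && _); apply/idP/idP => [/eqP <-|xA]; first by rewrite !inE eqxx.
  by rewrite finset.setU1K.
apply: eq_big => [A|A]; rewrite h// => /finset.subsetD1P[_ xA].
by rewrite cardsU1 xA.
Qed.

Variable m : nat -> R.
Hypothesis m0 : m 0%N = 1.

(** Induction on the cardinality, detaching the block of a chosen point. The two sets live in
    different types because a cumulant of order k is defined over ['I_k] but arises as a partition
    sum over a subset of a larger set. *)
Lemma wsum_card (T T' : finType) (c : nat -> R) (U : {set T}) (V : {set T'}) :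
  #|U| = #|V| -> wsum (fun B => m #|B|) c U = wsum (fun B => m #|B|) c V.
Proof.
move: {2}(#|U|) (leqnn #|U|) => n; elim: n T T' c U V => [|n ih] T T' c U V.
  rewrite leqn0 => /eqP U0 UV; have V0 := U0; rewrite UV in V0.
  by rewrite (cards0_eq U0) (cards0_eq V0) !wsum0.
have [->|U0] := eqVneq U finset.set0.
  by move=> _ /esym/eqP; rewrite cards0 cards_eq0 => /eqP ->; rewrite !wsum0.
move=> Un UV; have /finset.set0Pn[x xU] := U0.
have /finset.set0Pn[y yV] : V != finset.set0 by rewrite -card_gt0 -UV card_gt0.
(* A partition of a nonempty set has at least one block, so the weight can be written as a function
   of n - 1, as [wsum_block_at] requires. *)
have cE (T1 : finType) (W : {set T1}) : W != finset.set0 ->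
    wsum (fun B => m #|B|) c W = wsum (fun B => m #|B|) (fun n => (fun n => c n.+1) n.-1) W.
  move=> W0; apply: eq_bigr => nu pnu; congr (c _ * _); rewrite prednK//.
  rewrite card_gt0; apply: contraNneq W0 => nu0.
  by move: pnu; rewrite nu0 => /and3P[/eqP <- _ _]; rewrite /finset.cover finset.big_set0.
rewrite !cE//; last by apply/finset.set0Pn; exists y.
have -> := wsum_block_at (fun B => m #|B|) (fun n => c n.+1) xU.
have -> := wsum_block_at (fun B => m #|B|) (fun n => c n.+1) yV.
(* The value on a set of k points, realized inside ['I_n]: after removal of a nonempty block at most
   n points remain. *)
pose W k := wsum (fun B : {set 'I_n} => m #|B|) (fun n => c n.+1) [set i : 'I_n | (i < k)%N]%SET.
have WE (T1 : finType) (B W0 : {set T1}) z : (B \subset W0) && (z \in B) -> #|W0| = #|U| ->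
    #|(W0 :\: B)%SET| = #|[set i : 'I_n | (i < #|W0| - #|B|)%N]%SET|.
  move=> /andP[BW zB] W0U; rewrite cardsD (finset.setIidPr BW).
  have B0 : (0 < #|B|)%N by rewrite card_gt0; apply/finset.set0Pn; exists z.
  have kn : (#|W0| - #|B| <= n)%N by lia.
  rewrite -[RHS]sum1_card (eq_bigl (fun i : 'I_n => (i < #|W0| - #|B|)%N)); last by move=> i; rewrite inE.
  by rewrite -(big_ord_widen n (fun _ => 1%N) kn) sum1_card card_ord.
rewrite (eq_bigr (fun B : {set T} => (fun k => m k * W (#|U| - k)%N) #|B|)); last first.
  move=> B hB; congr (_ * _); apply: ih; last exact: (WE _ _ _ x).
  have /andP[BU xB] := hB; have := subset_leq_card BU.
  have : (0 < #|B|)%N by rewrite card_gt0; apply/finset.set0Pn; exists x.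
  by rewrite cardsD (finset.setIidPr BU); lia.
rewrite [RHS](eq_bigr (fun B : {set T'} => (fun k => m k * W (#|U| - k)%N) #|B|)); last first.
  move=> B hB; congr (_ * _); apply: ih; last by rewrite UV; exact: (WE _ _ _ y).
  have /andP[BU xB] := hB; have := subset_leq_card BU.
  have : (0 < #|B|)%N by rewrite card_gt0; apply/finset.set0Pn; exists y.
  by rewrite cardsD (finset.setIidPr BU); lia.
by rewrite !(sum_subset_card_at (fun k => m k * W (#|U| - k)%N))// UV.
Qed.

Definition cumulant_of_moments k :=
  wsum (fun B : {set 'I_k} => m #|B|) (@cumulant_weight R) [set: 'I_k]%SET.

(** Blocks containing a given point are grouped by size: C(n, k) of them have k + 1 elements. *)
Lemma moment_recursion n :
  m n.+1 = \sum_(k < n.+1) (cumulant_of_moments k.+1 * m (n - k)%N) *+ 'C(n, k).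
Proof.
have := @moment_cumulant_set 'I_n.+1 R (fun B => m #|B|) _ [set: _]%SET ord0 (finset.in_setT _).
rewrite cards0 m0 cardsT card_ord => -> //.
rewrite (eq_bigr (fun B : {set 'I_n.+1} => (fun k => cumulant_of_moments k * m (n.+1 - k)%N) #|B|)).
  rewrite (sum_subset_card_at (fun k => cumulant_of_moments k * m (n.+1 - k)%N)) ?finset.in_setT//.
  by rewrite cardsT card_ord.
move=> B _; congr (_ * m _); last by rewrite finset.setTD cardsCs finset.setCK card_ord.
by apply: wsum_card; rewrite cardsT card_ord.
Qed.

End numeric_cumulants.

Import HBNNSimple.

Section nonmeasurable_integral.
Context {d : measure_display} {T : measurableType d} {R : realType}.
Variable mu : {measure set T -> \bar R}.
Local Open Scope ereal_scope.

(* The nonnegative integral is a supremum over simple functions, so it is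
   monotone even without measurability; iterated integrals of kernels whose
   joint measurability is not at hand can be compared this way. *)
Lemma le_ge0_integral (f g : T -> \bar R) : (forall x, 0 <= f x) ->
  (forall x, f x <= g x) -> \int[mu]_x f x <= \int[mu]_x g x.
Proof.
move=> f0 fg; have g0 x : 0 <= g x by apply: le_trans (f0 x) (fg x).
rewrite !ge0_integralE//; apply: le_ereal_sup => _ [h hf <-].
exists h => //= x; apply: le_trans (hf x) _.
by rewrite !patch_setT.
Qed.

(** The exceptional null set is removed from the simple functions below f, which are measurable, and
    not from f or g. *)
Lemma le_ge0_integral_ae (f g : T -> \bar R) : (forall x, 0 <= f x) ->
  (forall x, 0 <= g x) ->
  {ae mu, forall x, f x <= g x} -> \int[mu]_x f x <= \int[mu]_x g x.
Proof.
move=> f0 g0 [N [mN N0 sN]].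
rewrite ge0_integralE//; apply: ge_ereal_sup => _ [h hf <-].
have hN : {ae mu, forall x, (h x)%:E = (h x * \1_(~` N) x)%:E}.
  exists N; split=> // x /= hx; apply: contrapT => Nx; apply: hx.
  by rewrite indicE mem_set// mulr1.
rewrite (_ : sintegral mu h = \int[mu]_x (h x)%:E); last by rewrite integral_nnsfun// patch_setT.
rewrite (ae_eq_integral (fun x => (h x * \1_(~` N) x)%:E))//.
- apply: le_ge0_integral => x; first by rewrite lee_fin mulr_ge0.
  have [xN|xN] := boolP (x \in N).
    by rewrite indicE in_setC xN mulr0.
  rewrite indicE in_setC xN mulr1; apply: le_trans (hf x) _; rewrite patch_setT.
  apply: contrapT => h1; move: xN; rewrite notin_setE; apply; exact: sN.
- exact/measurable_EFinP.
- apply/measurable_EFinP; apply: measurable_funM => //.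
  by apply: measurable_indic; exact: measurableC.
- by apply: (@filterS _ _ (ae_filter_ringOfSetsType mu)) hN => x hx _.
Qed.

End nonmeasurable_integral.

(** * Cumulants of inner products bounded by the norm of the kernel *)

Section kernel_bound.
Context {R : realType} {d : measure_display} {Omega : measurableType d}.
Variable P : probability Omega R.
Local Notation L2 := (L2 R).
Local Notation leb := (leb01 R).

Lemma integral01_ge0 k (f : k.-tuple R -> \bar R) : (forall y, 0 <= f y)%E ->
  (0 <= integral01 f)%E.
Proof.
elim: k f => [|k ih] f f0 /=; first exact: f0.
by apply: integral_ge0 => x _; apply: ih.
Qed.

Definition joint_cumulant k (Z : 'I_k -> Omega -> R) :=
  wsum (fun B : {set 'I_k} => \int[P]_w \prod_(j in B) Z j w) (@cumulant_weight R) [set: 'I_k]%SET.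

Lemma cumulant_kernelE (X : int -> Omega -> L2) k (t : 'I_k -> int) (tau : k.-tuple R) :
  cumulant_kernel P X t tau = joint_cumulant (fun j w => X (t j) w (tnth tau j)).
Proof.
by apply: eq_bigr => nu _; congr (_ * _); apply: eq_bigr => B _; rewrite unlock.
Qed.

Variable X : int -> Omega -> L2.
Hypothesis mX : forall t, random_element (X t).
Variables (k : nat) (t : 'I_k -> int) (h : L2).
Hypothesis h1 : L2norm h <= 1.

(** Hybrid variables: the first coordinates are evaluated at the points of s, the remaining ones are
    still tested against h. They interpolate between the cumulant of the inner products, for s
    empty, and the cumulant kernel, for s of length k. *)
Let Z (s : seq R) (j : 'I_k) (w : Omega) : R :=
  if (j < size s)%N then X (t j) w (nth 0 s j) else L2inner (X (t j) w) h.

Let D (s : seq R) (j : 'I_k) (w : Omega) : R :=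
  if (j < size s)%N then `|X (t j) w (nth 0 s j)| else L2norm (X (t j) w).

(** Finiteness of a mixed moment that dominates every product in the hybrid cumulant. It is
    inherited by almost every extension of s by one point. *)
Let good s := (\int[P]_w (\prod_(j < k) (1 + D s j w))%:E < +oo)%E.

Let D_ge0 s j w : 0 <= D s j w.
Proof. by rewrite /D; case: ifP => // _; rewrite L2norm_ge0. Qed.

Let ZD s j w : `|Z s j w| <= D s j w.
Proof.
rewrite /Z /D; case: ifP => // _.
by apply: le_trans (L2_cauchy_schwarz _ _) _; rewrite ler_piMr ?L2norm_ge0.
Qed.

Let mZ s j : measurable_fun setT (Z s j).
Proof.
rewrite /Z; case: (j < size s)%N; first exact: random_element_at.
exact: random_inner_measurable.
Qed.

Let mD s j : measurable_fun setT (D s j).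
Proof.
rewrite /D; case: (j < size s)%N; last exact: random_norm_measurable.
by apply: measurableT_comp => //; exact: random_element_at.
Qed.

Let mprodZ s (B : {set 'I_k}) : measurable_fun setT (fun w => \prod_(j in B) Z s j w).
Proof. by under eq_fun do rewrite -big_enum; apply: measurable_prod => j _; exact: mZ. Qed.

Let prodZ_le s (B : {set 'I_k}) w : \prod_(j in B) `|Z s j w| <= \prod_(j in B) (1 + D s j w).
Proof.
apply: ler_prod => j _; rewrite normr_ge0/= (le_trans (ZD _ _ _))//.
by rewrite lerDr.
Qed.

Section step.
Variables (s : seq R) (i : 'I_k).
Hypothesis si : size s = i :> nat.
Hypothesis gs : good s.

Let Zrcons x j w : Z (rcons s x) j w = if j == i then X (t i) w x else Z s j w.
Proof.
rewrite /Z size_rcons si nth_rcons si ltnS leq_eqVlt -val_eqE /=.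
by have [ji|ij|/val_inj->] := ltngtP j i; rewrite ?ltnn ?eqxx.
Qed.

Let Drcons x j w : D (rcons s x) j w = if j == i then `|X (t i) w x| else D s j w.
Proof.
rewrite /D size_rcons si nth_rcons si ltnS leq_eqVlt -val_eqE /=.
by have [ji|ij|/val_inj->] := ltngtP j i; rewrite ?ltnn ?eqxx.
Qed.

Let Di w : D s i w = L2norm (X (t i) w).
Proof. by rewrite /D si ltnn. Qed.

Let rest (w : Omega) := \prod_(j < k | j != i) (1 + D s j w).

Let rest_ge0 w : 0 <= rest w.
Proof. by apply: prodr_ge0 => j _; rewrite addr_ge0. Qed.

Let mrest : measurable_fun setT rest.
Proof.
rewrite /rest; under eq_fun do rewrite -big_filter.
by apply: measurable_prod => j _; apply: measurable_funD => //; exact: mD.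
Qed.

Let rest_int : (\int[P]_w (rest w * (1 + L2norm (X (t i) w)))%:E < +oo)%E.
Proof.
move: gs; rewrite /good; congr (_ < _)%E; apply: eq_integral => w _.
by rewrite (bigD1 i)//= Di mulrC.
Qed.

Lemma good_rcons_ae : {ae leb, forall x, good (rcons s x)}.
Proof.
have XW : (\int[P]_w (L2norm (X (t i) w) * `|rest w|)%:E < +oo)%E.
  apply: le_lt_trans rest_int; apply: le_ge0_integral => w.
    by rewrite lee_fin mulr_ge0 ?L2norm_ge0.
  by rewrite lee_fin ger0_norm// mulrC ler_wpM2l// lerDr.
have ir : P.-integrable setT (EFin \o rest).
  apply/integrableP; split; first exact/measurable_EFinP.
  apply: le_lt_trans rest_int; apply: le_ge0_integral => w //=.
  by rewrite lee_fin ger0_norm// ler_peMr// lerDl L2norm_ge0.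
apply: (@filterS _ _ (ae_filter_ringOfSetsType leb)) (random_product_integrable_ae (mX (t i)) mrest XW) => x ix.
have : P.-integrable setT ((EFin \o rest) \+ (fun w => `|(X (t i) w x * rest w)%:E|))%E.
  by apply: integrableD => //; exact: integrable_abse.
case/integrableP => _; apply: le_lt_trans; apply: le_ge0_integral => w.
  by rewrite lee_fin prodr_ge0// => j _; rewrite addr_ge0.
rewrite (bigD1 i)//= Drcons eqxx lee_fin (eq_bigr (fun j => 1 + D s j w)); last first.
  by move=> j /negbTE ji; rewrite Drcons ji.
rewrite -/(rest w) mulrDl mul1r normrM (ger0_norm (rest_ge0 w)).
exact: ler_norm.
Qed.

Let others (B : {set 'I_k}) w := \prod_(j in B | j != i) Z s j w.

Let mothers B : measurable_fun setT (others B).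
Proof.
rewrite /others; under eq_fun do rewrite -big_filter.
by apply: measurable_prod => j _; exact: mZ.
Qed.

Let others_le B w : `|others B w| <= rest w.
Proof.
rewrite /others normr_prod big_mkcondl; apply: ler_prod => j _; case: ifP => _.
  by rewrite normr_ge0/= (le_trans (ZD _ _ _))// lerDr.
by rewrite ler01 /= lerDl.
Qed.

Let XWB B : (\int[P]_w (L2norm (X (t i) w) * `|others B w|)%:E < +oo)%E.
Proof.
apply: le_lt_trans rest_int; apply: le_ge0_integral => w.
  by rewrite lee_fin mulr_ge0 ?L2norm_ge0.
rewrite lee_fin [leLHS]mulrC; apply: ler_pM => //; first exact: L2norm_ge0.
by rewrite lerDr.
Qed.

Let I0 (B : {set 'I_k}) := \int[P]_w \prod_(j in B) Z s j w.

(** A term of the cumulant is linear in the i-th variable, which occurs only in the block B0 of i; K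
    collects the other blocks, which do not change when the i-th coordinate is evaluated. *)
Let blocks (nu : {set {set 'I_k}}) : finset.partition nu [set: 'I_k]%SET ->
  exists (B0 : {set 'I_k}) (K : R),
    \prod_(B in nu) \int[P]_w \prod_(j in B) Z s j w = K * \int[P]_w (L2inner (X (t i) w) h * others B0 w) /\
    forall x, \prod_(B in nu) \int[P]_w \prod_(j in B) Z (rcons s x) j w = K * \int[P]_w (X (t i) w x * others B0 w).
Proof.
move=> pnu; have /and3P[/eqP cov tri _] := pnu.
have ic : i \in finset.cover nu by rewrite cov finset.in_setT.
pose B0 := finset.pblock nu i; have B0nu : B0 \in nu by exact: pblock_mem.
have iB0 : i \in B0 by rewrite mem_pblock.
exists B0, (\prod_(B in nu | B != B0) I0 B); split.
  rewrite (bigD1 B0)//= mulrC; congr (_ * _); apply: eq_Rintegral => w _.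
  by rewrite (bigD1 i)//=; congr (_ * _); rewrite /Z si ltnn.
move=> x; rewrite (bigD1 B0)//= mulrC; congr (_ * _).
  apply: eq_bigr => B /andP[Bnu BB0]; apply: eq_Rintegral => w _.
  apply: eq_bigr => j jB; rewrite Zrcons; case: eqP => // ji; subst j.
  by move/eqP: BB0; case; rewrite /B0 (def_pblock tri Bnu jB).
apply: eq_Rintegral => w _; rewrite (bigD1 i)//= Zrcons eqxx; congr (_ * _).
by apply: eq_bigr => j /andP[_ /negbTE ji]; rewrite Zrcons ji.
Qed.

Lemma cumulant_integrate_one :
  measurable_fun setT (fun x : measurableTypeR R => joint_cumulant (Z (rcons s x))) /\
  joint_cumulant (Z s) = \int[leb]_x (h x * joint_cumulant (Z (rcons s x))).
Proof.
pose T0 (nu : {set {set 'I_k}}) := cumulant_weight R #|nu| * \prod_(B in nu) \int[P]_w \prod_(j in B) Z s j w.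
pose T1 (nu : {set {set 'I_k}}) x := cumulant_weight R #|nu| * \prod_(B in nu) \int[P]_w \prod_(j in B) Z (rcons s x) j w.
have key (nu : {set {set 'I_k}}) : finset.partition nu [set: 'I_k]%SET ->
   [/\ measurable_fun setT (fun x : measurableTypeR R => T1 nu x),
    leb.-integrable setT (EFin \o (fun x => h x * T1 nu x)) &
    T0 nu = \int[leb]_x (h x * T1 nu x)].
  move=> /blocks[B0 [K [e0 e1]]].
  have [m1 i1 E1] := random_fubini (mX (t i)) h (@mothers B0) (@XWB B0).
  have T1E : T1 nu = fun x => (cumulant_weight R #|nu| * K) * \int[P]_w (X (t i) w x * others B0 w).
    by apply/funext => x; rewrite /T1 e1 mulrA.
  have hT1 : (fun x => h x * T1 nu x) = (fun x => (cumulant_weight R #|nu| * K) * (h x * \int[P]_w (X (t i) w x * others B0 w))).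
    by apply/funext => x; rewrite T1E mulrCA.
  rewrite hT1 T1E; split.
  - exact: measurable_funM.
  - rewrite (_ : _ \o _ = fun x => (cumulant_weight R #|nu| * K)%:E * (h x * \int[P]_w (X (t i) w x * others B0 w))%:E)%E.
      exact: integrableZl.
    by apply/funext => x; rewrite /= EFinM.
  - by rewrite RintegralZl// E1 /T0 e0 mulrA.
pose p (nu : {set {set 'I_k}}) := finset.partition nu [set: 'I_k]%SET.
have cE x : joint_cumulant (Z (rcons s x)) = \sum_(nu : {set {set 'I_k}}) if p nu then T1 nu x else 0.
  by rewrite /joint_cumulant /wsum big_mkcond.
split.
  under eq_fun do rewrite cE; apply: measurable_sum => nu.
  by case: (boolP (p nu)) => [/key[]//|_]; exact: measurable_cst.
have E x : h x * joint_cumulant (Z (rcons s x)) =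
   \sum_(nu : {set {set 'I_k}}) if p nu then h x * T1 nu x else 0.
  by rewrite cE mulr_sumr; apply: eq_bigr => nu _; case: ifP => // _; rewrite mulr0.
under eq_Rintegral do rewrite E.
rewrite (@Rintegral_sum _ _ _ leb _ (index_enum {set {set 'I_k}})
   (fun nu x => if p nu then h x * T1 nu x else 0) _).1.
  rewrite {1}/joint_cumulant /wsum big_mkcond; apply: eq_bigr => nu _; rewrite -/(p nu).
  by case: (boolP (p nu)) => [/key[]//|_]; rewrite Rintegral_cst// mul0r.
move=> nu; case: (boolP (p nu)) => [/key[]//|_].
exact: integrable0.
Qed.

End step.
Let cumulant_step s (i : 'I_k) : size s = i :> nat -> good s ->
  (((joint_cumulant (Z s)) ^+ 2)%:E <= \int[leb]_x ((joint_cumulant (Z (rcons s x))) ^+ 2)%:E)%E.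
Proof.
move=> si gs; have [m1 ->] := cumulant_integrate_one si gs.
exact: sqr_Rintegral_le.
Qed.

Let cumulant_iter m s : (size s + m = k)%N -> good s ->
  (((joint_cumulant (Z s)) ^+ 2)%:E <=
    integral01 (fun y : m.-tuple R => ((joint_cumulant (Z (s ++ y))) ^+ 2)%:E))%E.
Proof.
elim: m s => [|m ih] s sk gs; first by rewrite /= cats0.
have sk' : (size s < k)%N by rewrite -sk addnS ltnS leq_addr.
apply: le_trans (@cumulant_step s (Ordinal sk') erefl gs) _.
rewrite [leRHS]/=; apply: le_ge0_integral_ae.
- by move=> x; rewrite lee_fin sqr_ge0.
- by move=> x; apply: integral01_ge0 => y; rewrite lee_fin sqr_ge0.
- apply: (@filterS _ _ (ae_filter_ringOfSetsType leb)) (good_rcons_ae (i := Ordinal sk') erefl gs) => x gx.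
  apply: le_trans (ih (rcons s x) _ gx) _; first by rewrite size_rcons addSnnS.
  rewrite le_eqVlt; apply/orP; left; apply/eqP; congr integral01.
  by apply/funext => y; rewrite cat_rcons.
Qed.

(** The cumulant is the kernel integrated against h in each variable, so Cauchy-Schwarz bounds it by
    the norm of the kernel. The variables are treated one at a time, in accordance with the iterated
    integral; almost every point then remains good for the next step. *)
Lemma inner_cumulant_bound :
  P.-integrable setT (EFin \o (fun w => \prod_(j < k) (1 + L2norm (X (t j) w)))) ->
  (`|joint_cumulant (fun j w => L2inner (X (t j) w) h)|%:E <=
    kernel_norm (cumulant_kernel P X t))%E.
Proof.
case/integrableP => _ iD.
have g0 : good [::].
  apply: le_lt_trans iD; apply: le_ge0_integral => w.
    by rewrite lee_fin prodr_ge0// => j _; rewrite addr_ge0.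
  by rewrite /D /= lee_fin ler_norm.
have := cumulant_iter (s := [::]) (add0n k) g0.
rewrite {1}(_ : Z [::] = fun j w => L2inner (X (t j) w) h)//.
set c := joint_cumulant _ => hc.
have hc' : ((c ^+ 2)%:E <= integral01 (fun tau : k.-tuple R => (cumulant_kernel P X t tau ^+ 2)%:E))%E.
  apply: le_trans hc _; rewrite le_eqVlt; apply/orP; left; apply/eqP; congr integral01.
  apply/funext => y; congr (_ ^+ 2)%:E; rewrite cumulant_kernelE /=; congr joint_cumulant.
  by apply/funext => j; apply/funext => w; rewrite /Z /= size_tuple ltn_ord (tnth_nth 0).
rewrite /kernel_norm.
have -> : (`|c|%:E = (c ^+ 2)%:E `^ 2^-1)%E.
  by rewrite poweR_EFin powR12_sqrt ?sqr_ge0// sqrtr_sqr.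
apply: gt0_ler_poweR => //.
- by rewrite in_itv/= leey andbT lee_fin sqr_ge0.
- by rewrite in_itv/= leey andbT integral01_ge0// => y; rewrite lee_fin sqr_ge0.
Qed.

End kernel_bound.

(** * Convergence of moments *)

Section taylor_cosine.
Variable R : realType.

Lemma derive_divided_power n (x : R) :
  is_derive x 1 (fun y : R => y ^+ n.+1 / n.+1`!%:R) (x ^+ n / n`!%:R).
Proof.
have did : is_derive x 1 (@id R) 1 by exact: is_derive_id.
have h := is_deriveZ (n.+1`!%:R^-1) (is_deriveX n.+1 did).
rewrite (_ : (fun y : R => _) = n.+1`!%:R^-1 \*: (@id R ^+ n.+1)); last first.
  by apply/funext => y; rewrite mulrC exprfctE.
apply: is_derive_eq.
rewrite /= -[LHS]/(_ * (_ * 1)) mulr1 factS natrM invfM mulrCA mulrA mulrA mulfV ?mul1r; last first.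
  by rewrite pnatr_eq0.
by rewrite mulrC.
Qed.

(** The sum and the difference of x^(n+1) / (n+1)! and f vanish at 0 and have nonnegative
    derivatives on the positive half-line. *)
Lemma derivative_power_bound n (f f' : R -> R) :
  (forall x : R, is_derive x 1 f (f' x)) -> f 0 = 0 ->
  (forall x : R, 0 <= x -> `|f' x| <= x ^+ n / n`!%:R) ->
  forall x : R, 0 <= x -> `|f x| <= x ^+ n.+1 / n.+1`!%:R.
Proof.
move=> df f0 hf'.
have key (g g' : R -> R) : (forall x : R, is_derive x 1 g (g' x)) -> g 0 = 0 ->
    (forall x : R, 0 <= x -> - g' x <= x ^+ n / n`!%:R) ->
    forall x : R, 0 <= x -> - g x <= x ^+ n.+1 / n.+1`!%:R.
  move=> dg g0 hg x x0.
  pose k := (fun y : R => y ^+ n.+1 / n.+1`!%:R) + g.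
  have dk (y : R) : is_derive y 1 k (y ^+ n / n`!%:R + g' y).
    by have h1 := derive_divided_power n y; have h2 := dg y; exact: is_deriveD.
  have k0 : k 0 = 0 by rewrite /k fctE g0 addr0 expr0n mul0r.
  suff : k 0 <= k x.
    by rewrite k0 /k fctE -lerBlDr sub0r.
  apply: (@ger0_derive1_ndecr _ k 0 x) => //.
  - move=> y; rewrite in_itv/= => /andP[y0 _]; rewrite derive1E; have := dk y => dky.
    by rewrite derive_val -lerBlDr sub0r hg// ltW.
  - apply: continuous_subspaceT => y; apply: differentiable_continuous.
    by apply/derivable1_diffP; have := dk y => dky.
move=> x x0; rewrite ler_norml; apply/andP; split.
  by rewrite lerNl; apply: (key f f') => // y y0; apply: le_trans (hf' y y0); rewrite -normrN ler_norm.
rewrite -[f x]opprK; apply: (key (- f) (- f')) => //.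
- by rewrite fctE f0 oppr0.
- by move=> y y0; rewrite fctE opprK; apply: le_trans (hf' y y0); rewrite ler_norm.
Qed.

Definition cos_coef (th : R) j := cos (th + (pi / 2) *+ j).

Definition cos_taylor th n (x : R) := \sum_(j < n) cos_coef th j * (x ^+ j / j`!%:R).

Lemma cos_coefS th j : cos_coef th j.+1 = cos_coef (th + pi / 2) j.
Proof. by rewrite /cos_coef mulrS addrA. Qed.

Lemma cos_taylor_derive th n (x : R) :
  is_derive x 1 (fun x => cos (x + th) - cos_taylor th n.+1 x) (cos (x + (th + pi / 2)) - cos_taylor (th + pi / 2) n x).
Proof.
have dT m : is_derive x 1 (cos_taylor th m.+1) (cos_taylor (th + pi / 2) m x).
  elim: m => [|m ih].
    rewrite (_ : cos_taylor th 1 = cst (cos_coef th 0)).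
      by rewrite /cos_taylor big_ord0; exact: is_derive_cst.
    by apply/funext => y; rewrite /cos_taylor big_ord1 expr0 fact0 divr1 mulr1.
  rewrite (_ : cos_taylor th m.+2 = cos_taylor th m.+1 + cos_coef th m.+1 \*: (fun y => y ^+ m.+1 / m.+1`!%:R)); last first.
    by apply/funext => y; rewrite /cos_taylor big_ord_recr.
  rewrite [X in is_derive _ _ _ X](_ : _ = cos_taylor (th + pi / 2) m x + cos_coef th m.+1 *: (x ^+ m / m`!%:R)); last first.
    by rewrite /cos_taylor big_ord_recr/= cos_coefS.
  by apply: is_deriveD; apply: is_deriveZ; exact: derive_divided_power.
have dc : is_derive x 1 (cos \o (fun y => y + th)) (cos (x + (th + pi / 2))).
  have d1 : is_derive x 1 (@id R + cst th) (1 + 0).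
    by apply: is_deriveD.
  have d2 := is_derive1_comp (is_derive_cos ((@id R + cst th) x)) d1.
  apply: is_derive_eq; rewrite addr0 mulr1 /=.
  by rewrite addrA cosDpihalf.
rewrite (_ : (fun x => _) = (cos \o (fun y => y + th)) - cos_taylor th n.+1) //.
exact: is_deriveB.
Qed.

Lemma cos_coefN th j : cos_coef (- th) j = (-1) ^+ j * cos_coef th j.
Proof.
elim: j th => [|j ih] th; first by rewrite /cos_coef !mulr0n !addr0 cosN expr0 mul1r.
rewrite !cos_coefS (_ : - th + pi / 2 = - (th - pi / 2)); last by ring.
rewrite ih exprS mulN1r mulNr -mulrN; congr (_ * _).
rewrite /cos_coef (_ : th + pi / 2 + _ = th - pi / 2 + (pi / 2) *+ j + pi); last by field.
by rewrite cosDpi opprK.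
Qed.

(** Differentiating the remainder of order n + 1 at th gives that of order n at th + pi / 2, so the
    bound is integrated up from |cos| <= 1 for all phases at once. Negative x are reflected together
    with the phase. *)
Lemma cos_taylor_bound n th x : `|cos (x + th) - cos_taylor th n x| <= `|x| ^+ n / n`!%:R.
Proof.
have pos m t (y : R) : 0 <= y -> `|cos (y + t) - cos_taylor t m y| <= y ^+ m / m`!%:R.
  elim: m t y => [|m ih] t y y0.
    rewrite /cos_taylor big_ord0 subr0 expr0 fact0 divr1 ler_norml.
    by rewrite cos_geN1 cos_le1.
  apply: (@derivative_power_bound m _ _ (cos_taylor_derive t m)) => //.
    rewrite /cos_taylor add0r big_ord_recl big1 ?addr0.
      by rewrite /cos_coef mulr0n addr0 expr0 fact0 divr1 mulr1 subrr.
    by move=> i _; rewrite expr0n /= mul0r mulr0.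
  by move=> z z0; exact: ih.
have [x0|x0] := leP 0 x; first by rewrite (ger0_norm x0); exact: pos.
have := pos n (- th) (- x); rewrite (ltr0_norm x0) oppr_ge0 => /(_ (ltW x0)).
rewrite -opprD cosN; congr (`|_ - _| <= _); apply: eq_bigr => j _.
have ss : (-1) ^+ j * (-1) ^+ j = 1 :> R by rewrite -exprMn mulrNN mulr1 expr1n.
rewrite cos_coefN [(- x) ^+ j]exprNn; move: ((-1) ^+ j) ss => s ss.
transitivity ((s * s) * (cos_coef th j * (x ^+ j / j`!%:R))); last by rewrite ss mul1r.
by rewrite -!mulrA; congr (_ * _); rewrite mulrCA.
Qed.

End taylor_cosine.

(** * The method of moments *)

Section moment_method.
Variable R : realType.

(** The moments of N(0, v), in the form produced both by the recursion between moments and cumulants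
    and by integration by parts against the density. *)
Fixpoint gauss_moment (v : R) (n : nat) : R :=
  match n with
  | 0%N => 1
  | 1%N => 0
  | n'.+2 => n'.+1%:R * v * gauss_moment v n'
  end.

Lemma gauss_moment_even v i : gauss_moment v i.*2 / i.*2`!%:R = (v / 2) ^+ i / i`!%:R.
Proof.
elim: i => [|i ih]; first by rewrite /= fact0 expr0.
rewrite doubleS [gauss_moment _ _]/= !factS !natrM exprS.
have f1 : i.*2`!%:R != 0 :> R by rewrite pnatr_eq0 -lt0n fact_gt0.
have f2 : i`!%:R != 0 :> R by rewrite pnatr_eq0 -lt0n fact_gt0.
have f3 : i.+1%:R != 0 :> R by rewrite pnatr_eq0.
have f4 : i.*2.+1%:R != 0 :> R by rewrite pnatr_eq0.
have f5 : i.*2.+2%:R = 2 * i.+1%:R :> R by rewrite -natrM mul2n doubleS.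
rewrite f5; move: f1 f2 f3 f4 ih.
move: (i.*2`!%:R) (i`!%:R) (i.+1%:R) (i.*2.+1%:R) => a1 a2 a3 a4 f1 f2 f3 f4 ih.
transitivity (v / 2 / a3 * (gauss_moment v i.*2 / a1)); last first.
  by rewrite ih; field; rewrite f2 f3.
by field; rewrite f1 f3 f4.
Qed.

Lemma gauss_moment_odd v i : gauss_moment v i.*2.+1 = 0.
Proof. by elim: i => // i ih; rewrite doubleS /= in ih *; rewrite ih mulr0. Qed.

Lemma cos_coef_even (th : R) i : cos_coef th i.*2 = (-1) ^+ i * cos th.
Proof.
elim: i th => [|i ih] th; first by rewrite /cos_coef mulr0n addr0 mul1r.
rewrite doubleS !cos_coefS ih (_ : _ + _ / _ = th + pi); last by field.
by rewrite cosDpi exprS mulN1r mulrN mulNr.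
Qed.

(** Odd moments vanish, and the even terms are those of the exponential series at - v / 2. *)
Lemma gauss_cos_series (v th : R) N :
  \sum_(j < N.*2) cos_coef th j * (gauss_moment v j / j`!%:R) =
  cos th * series (exp_coeff (- v / 2)) N.
Proof.
elim: N => [|N ih]; first by rewrite big_ord0 seriesEnat /= big_geq// mulr0.
pose f j := cos_coef th j * (gauss_moment v j / j`!%:R).
have -> : \sum_(j < N.+1.*2) f j = \sum_(j < N.*2) f j + f N.*2 + f N.*2.+1.
  by rewrite doubleS !big_ord_recr.
rewrite ih {2}/f gauss_moment_odd mul0r mulr0 addr0.
rewrite seriesSr mulrDr; congr (_ + _).
rewrite /f cos_coef_even gauss_moment_even /exp_coeff /= mulNr [(- (v / 2)) ^+ N]exprNn.
by rewrite [(-1) ^+ N * cos th]mulrC -!mulrA.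
Qed.

Lemma cvg_sum_seq I (s : seq I) (u : I -> nat -> R) (l : I -> R) :
  (forall i, u i n @[n --> \oo] --> l i) ->
  \sum_(i <- s) u i n @[n --> \oo] --> \sum_(i <- s) l i.
Proof.
move=> ul; elim: s => [|i s ih].
  by under eq_fun do rewrite big_nil; rewrite big_nil; exact: cvg_cst.
by under eq_fun do rewrite big_cons; rewrite big_cons; exact: cvgD.
Qed.

Lemma cvg_double_limit (a : nat -> R) (b r : nat -> nat -> R) (B rho : nat -> R) (L : R) :
  (forall N n, `|a n - b N n| <= r N n) ->
  (forall N, b N n @[n --> \oo] --> B N) -> (forall N, r N n @[n --> \oo] --> rho N) ->
  B @ \oo --> L -> rho @ \oo --> (0 : R) -> a @ \oo --> L.
Proof.
move=> abr bB rr BL r0; apply/cvgrPdist_lt => e e0.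
have e4 : 0 < e / 4 by rewrite divr_gt0.
have [N [h1 h2]] : exists N, `|L - B N| < e / 4 /\ `|rho N| < e / 4.
  have /cvgrPdist_lt/(_ _ e4)[N1 _ h1] := BL; have /cvgrPdist_lt/(_ _ e4)[N2 _ h2] := r0.
  exists (maxn N1 N2); split; first by apply: h1; rewrite /= leq_maxl.
  by have := h2 (maxn N1 N2) (leq_maxr _ _); rewrite sub0r normrN.
near=> n.
have h3 : `|B N - b N n| < e / 4 by near: n; move/cvgrPdist_lt : (bB N) => /(_ _ e4).
have h4 : `|rho N - r N n| < e / 4 by near: n; move/cvgrPdist_lt : (rr N) => /(_ _ e4).
have h5 := abr N n.
rewrite !ltr_norml in h1 h2 h3 h4 *; rewrite ler_norml in h5.
move: h1 h2 h3 h4 h5 => /andP[? ?] /andP[? ?] /andP[? ?] /andP[? ?] /andP[? ?].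
by apply/andP; split; lra.
Unshelve. all: by end_near. Qed.

Context {d : measure_display} {Omega : measurableType d}.
Variable P : probability Omega R.

(** Taylor polynomials of even order 2N are integrated termwise. The remainder is at most the moment
    of order 2N over (2N)!, where evenness removes the absolute value; its limit in n is (v / 2)^N /
    N!, which tends to 0 in N. *)
Lemma moments_cvg_cos (V : nat -> Omega -> R) (v th : R) :
  (forall n, measurable_fun setT (V n)) ->
  (forall n k, P.-integrable setT (EFin \o (fun w => V n w ^+ k))) ->
  (forall k, \int[P]_w (V n w ^+ k) @[n --> \oo] --> gauss_moment v k) ->
  \int[P]_w cos (V n w + th) @[n --> \oo] --> cos th * expR (- v / 2).
Proof.
move=> mV iV cV.
pose b N n := \sum_(j < N.*2) cos_coef th j * ((\int[P]_w (V n w ^+ j)) / j`!%:R).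
pose r N n := (\int[P]_w (V n w ^+ N.*2)) / N.*2`!%:R.
apply: (@cvg_double_limit _ b r (fun N => cos th * series (exp_coeff (- v / 2)) N)
  (fun N => (v / 2) ^+ N / N`!%:R)).
- move=> N n.
  have mc : measurable_fun setT (fun w => cos (V n w + th)).
    apply: (measurableT_comp (continuous_measurable_fun (@continuous_cos R))).
    exact: measurable_funD.
  have ic : P.-integrable setT (EFin \o (fun w => cos (V n w + th))).
    by apply: (@integrable_bdd _ _ _ _ _ 1) => // w; rewrite ler_norml cos_geN1 cos_le1.
  have iT j : P.-integrable setT (EFin \o (fun w => cos_coef th j * (V n w ^+ j / j`!%:R))).
    rewrite (_ : _ \o _ = fun w => ((cos_coef th j / j`!%:R)%:E * (V n w ^+ j)%:E)%E).
      exact: (integrableZl measurableT _ (iV n j)).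
    by apply/funext => w /=; rewrite -EFinM; congr EFin; ring.
  have [sT siT] := @Rintegral_sum _ _ _ P _ (index_enum 'I_N.*2)
    (fun j w => cos_coef th j * (V n w ^+ j / j`!%:R)) (fun j => iT j).
  have bE : b N n = \int[P]_w cos_taylor th N.*2 (V n w).
    rewrite [RHS]sT; apply: eq_bigr => j _.
    rewrite [RHS](_ : _ = \int[P]_w ((cos_coef th j / j`!%:R) * V n w ^+ j)); last first.
      by congr Rintegral; apply/funext => w; rewrite mulrA mulrAC.
    by rewrite RintegralZl// mulrA mulrAC.
  have iB : P.-integrable setT (EFin \o (fun w => cos (V n w + th) - cos_taylor th N.*2 (V n w))).
    exact: (@integrableB _ _ _ P setT measurableT _ _ ic siT).
  rewrite bE -RintegralB//; apply: le_trans (le_normr_Rintegral _ _) _ => //.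
  rewrite /r -RintegralZr//.
  apply: le_Rintegral => //.
  + exact: (integrable_abse iB).
  + rewrite (_ : _ \o _ = fun w => ((N.*2`!%:R^-1)%:E * (V n w ^+ N.*2)%:E)%E).
      exact: (integrableZl measurableT _ (iV n N.*2)).
    by apply/funext => w /=; rewrite -EFinM mulrC.
  + move=> w _; apply: le_trans (cos_taylor_bound _ _ _) _.
    by rewrite -normrX ger0_norm// -muln2 exprM sqr_ge0.
- move=> N; rewrite -gauss_cos_series; apply: cvg_sum_seq => j.
  by apply: cvgM; [exact: cvg_cst|apply: cvgM; [exact: cV|exact: cvg_cst]].
- by move=> N; rewrite -gauss_moment_even; apply: cvgM; [exact: cV|exact: cvg_cst].
- apply: cvgM; first exact: cvg_cst.
  exact: (@is_cvg_series_exp_coeff R (- v / 2)).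
- have := @cvg_exp_coeff R (v / 2); exact.
Qed.

End moment_method.

Lemma cvg0_le (R : realType) (u v : nat -> R) : (forall n, `|u n| <= v n) ->
  v @ \oo --> (0 : R) -> u @ \oo --> (0 : R).
Proof.
move=> uv /cvgrPdist_lt v0; apply/cvgrPdist_lt => e e0; near=> n.
have : `|0 - v n| < e by near: n; exact: v0.
by rewrite !sub0r !normrN => /(le_lt_trans (ler_norm _)); apply: le_lt_trans.
Unshelve. all: by end_near. Qed.

(** * Effect of centring on moments and cumulants *)

Section centred_moments.
Variables (R : comNzRingType) (m kap : nat -> R).
Hypothesis m_rec : forall n, m n.+1 = \sum_(k < n.+1) (kap k.+1 * m (n - k)%N) *+ 'C(n, k).

(** The expectation of p(Y) for a variable Y with moments m; on polynomials, centring is a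
    substitution. *)
Definition moment_functional (p : {poly R}) := \sum_(i < size p) p`_i * m i.

Lemma moment_functional_widen (p : {poly R}) n : (size p <= n)%N ->
  moment_functional p = \sum_(i < n) p`_i * m i.
Proof.
move=> pn; rewrite /moment_functional (big_ord_widen _ (fun i => p`_i * m i) pn) big_mkcond/=.
apply: eq_bigr => i _; case: ltnP => // ip.
by rewrite nth_default// mul0r.
Qed.

Lemma moment_functionalB p q c :
  moment_functional (p - c *: q) = moment_functional p - c * moment_functional q.
Proof.
pose n := maxn (size (p - c *: q)) (maxn (size p) (size q)).
rewrite !(@moment_functional_widen _ n) ?leq_max ?leqnn ?orbT// mulr_sumr -sumrB.
by apply: eq_bigr => i _; rewrite coefB coefZ mulrBl mulrA.
Qed.

(** The moment recursion extended by linearity: E[Y p(Y)] is the sum over k of kap (k + 1)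
    E[p^(k)(Y)] / k!. *)
Lemma moment_functionalMX (p : {poly R}) n : (size p <= n)%N -> moment_functional (p * 'X) =
  \sum_(k < n) kap k.+1 * moment_functional p^`N(k).
Proof.
move=> pn.
have sX : (size (p * 'X)%R <= n.+1)%N.
  by apply: leq_trans (size_polyMleq _ _) _; rewrite size_polyX addn2.
rewrite (moment_functional_widen sX) big_ord_recl coefMX mul0r add0r.
under eq_bigr => i _ do rewrite coefMX /= m_rec big_distrr/=.
have h (k : nat) : kap k.+1 * moment_functional p^`N(k) = \sum_(i < n) kap k.+1 * ((p`_(k + i) *+ 'C(k + i, k)) * m i).
  rewrite -big_distrr/= (@moment_functional_widen _ n).
    by congr (_ * _); apply: eq_bigr => i _; rewrite coef_nderivn.
  apply/leq_sizeP => j nj; rewrite coef_nderivn nth_default ?mul0rn//.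
  by rewrite (leq_trans pn)// (leq_trans nj)// leq_addl.
under [RHS]eq_bigr => k _ do rewrite h.
pose G i k := p`_i * (kap k.+1 * m (i - k)%N *+ 'C(i, k)).
transitivity (\sum_(k < n) \sum_(i < n | (k <= i)%N) G i k).
  rewrite [RHS](exchange_big_dep xpredT)//=; apply: eq_bigr => i _.
  rewrite (big_ord_widen n (fun k => p`_i * (kap k.+1 * m (i - k)%N *+ 'C(i, k))))//.
apply: eq_bigr => k _.
transitivity (\sum_(k <= i < n) G i k).
  by rewrite (big_nat_widenl k 0%N)//= big_mkord.
rewrite -{1}[nat_of_ord k]add0n big_addn -(big_mkord xpredT (fun i => kap k.+1 * (p`_(k + i) *+ 'C(k + i, k) * m i))).
rewrite [RHS](big_cat_nat (n := (n - k)%N)) ?leq_subr//= [X in _ = _ + X]big1_seq ?addr0.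
  apply: eq_bigr => i _; rewrite /G addnK addnC mulrnAr mulrnAl mulrnAr; congr (_ *+ _).
  by rewrite mulrCA.
move=> i; rewrite mem_index_iota => /andP[_ /andP[nki _]]; rewrite nth_default ?mul0rn ?mul0r ?mulr0//.
by rewrite (leq_trans pn)// -leq_subLR.
Qed.

Lemma nderivn_expXsubC c n k : (('X - c%:P) ^+ n)^`N(k) = ('X - c%:P) ^+ (n - k) *+ 'C(n, k) :> {poly R}.
Proof.
elim: n k => [|n ih] [|k]; rewrite ?nderivn0 ?subn0 ?bin0 ?mulr1n//.
  by rewrite expr0 nderivnC bin0n mulr0n.
rewrite exprSr mulrBr mulrC -[_ * c%:P]mulrC mul_polyC nderivnB nderivnZ mulrC.
have := nderivnMXaddC k (('X - c%:P) ^+ n) 0; rewrite addr0 => ->; rewrite !ih.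
rewrite subSS binS mulrnDr -addrA addrC; congr (_ + _).
rewrite mulrnAl -scalerMnr -mulrnBl -mul_polyC [c%:P * _]mulrC -mulrBr.
have [kn|nk] := ltnP k n; last by rewrite bin_small// !mulr0n.
by rewrite -exprSr subnSK.
Qed.

Definition centred_moment c n := moment_functional (('X - c%:P) ^+ n).

(** For p = (X - c)^n the identity for E[Y p(Y)] keeps its shape, and subtracting c E[p(Y)] changes
    only the term k = 0: translation affects the first cumulant alone. *)
Lemma centred_moment_recursion c n :
  centred_moment c n.+1 =
  \sum_(k < n.+1) ((kap k.+1 - c *+ (k == 0%N :> nat)) * centred_moment c (n - k)%N) *+ 'C(n, k).
Proof.
rewrite /centred_moment exprSr mulrBr -[_ * c%:P]mulrC mul_polyC moment_functionalB.
rewrite (@moment_functionalMX _ n.+1) ?size_exp_XsubC// !big_ord_recl.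
rewrite nderivn0 eqxx subn0 bin0 !mulr1n mulrBl addrAC; congr (_ + _).
apply: eq_bigr => k _; rewrite nderivn_expXsubC mulr0n subr0 -mulrnAr; congr (_ * _).
set q := _ ^+ _; rewrite !(@moment_functional_widen _ (size q)) ?size_polyMn//.
  by rewrite -sumrMnl; apply: eq_bigr => i _; rewrite coefMn mulrnAl.
by apply/leq_sizeP => j nj; rewrite coefMn nth_default ?mul0rn.
Qed.

End centred_moments.

(** * Averages over tuples of times, as over independent uniform indices *)

Section averages.
Variables (k : nat) (S : finType) (R : numFieldType).
Hypothesis S0 : (0 < #|S|)%N.
Implicit Types (t : {ffun 'I_k -> S}) (g h : {ffun 'I_k -> S} -> R) (B : {set 'I_k}).

Let N : R := (#|S| ^ k)%:R.

Let N0 : N != 0.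
Proof. by rewrite pnatr_eq0 -lt0n expn_gt0 S0. Qed.

Definition average g := N^-1 * \sum_t g t.

Definition depends_on B g := forall t t', (forall j, j \in B -> t j = t' j) -> g t = g t'.

(* The involution exchanging the coordinates outside B of a pair (t, t') turns
   g t * h t' into g t * h t. *)
Lemma average_mul B g h : depends_on B g -> depends_on (~: B) h ->
  average (fun t => g t * h t) = average g * average h.
Proof.
move=> gB hB.
pose swap (p : {ffun 'I_k -> S} * {ffun 'I_k -> S}) : {ffun 'I_k -> S} * {ffun 'I_k -> S} :=
  ([ffun j => if j \in B then p.1 j else p.2 j], [ffun j => if j \in B then p.2 j else p.1 j]).
have swapK : involutive swap.
  by move=> [a b]; congr (_, _); apply/ffunP => j; rewrite !ffunE; case: (j \in B).
have card : \sum_(b : {ffun 'I_k -> S}) 1 = N :> R.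
  by rewrite sumr_const card_ffun card_ord.
have : (\sum_t g t) * (\sum_t h t) = N * \sum_t (g t * h t).
  rewrite big_distrl/=; under eq_bigr do rewrite big_distrr/=.
  rewrite pair_bigA/= (reindex_inj (inv_inj swapK))/=.
  rewrite (eq_bigr (fun p => g p.1 * h p.1 * 1)); last first.
    move=> [a b] _ /=; rewrite mulr1; congr (_ * _); [apply: gB|apply: hB] => j jB; rewrite !ffunE ?jB//.
    by move: jB; rewrite finset.in_setC => /negbTE ->.
  rewrite -(pair_bigA _ (fun a b => g a * h a * 1))/= big_distrr/=; apply: eq_bigr => a _.
  by rewrite -big_distrr/= card mulrC.
rewrite /average => E; rewrite mulrACA E -mulrA; congr (_ * _).
by rewrite mulrA mulVf// mul1r.
Qed.

Lemma average1 : average (fun=> 1) = 1.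
Proof. by rewrite /average sumr_const card_ffun card_ord mulVf. Qed.

Lemma average_prod (s : seq {set 'I_k}) (g : {set 'I_k} -> {ffun 'I_k -> S} -> R) :
  uniq s -> (forall A B : {set 'I_k}, A \in s -> B \in s -> A != B -> (A :&: B)%SET = finset.set0) ->
  (forall B, depends_on B (g B)) ->
  average (fun t => \prod_(B <- s) g B t) = \prod_(B <- s) average (g B).
Proof.
move=> us ds gB; elim: s us ds => [_ _|B s ih /= /andP[Bs us] ds].
  by rewrite big_nil -[RHS]average1; congr average; apply/funext => t; rewrite big_nil.
rewrite big_cons -ih//; last by move=> A C As Cs; apply: ds; rewrite inE ?As ?Cs orbT.
rewrite -(@average_mul B)//.
  by congr average; apply/funext => t; rewrite big_cons.
move=> t t' tt'; rewrite !big_seq; apply: eq_bigr => A As; apply: gB => j jA.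
have AB : (A :&: B)%SET = finset.set0.
  by apply: ds; rewrite ?inE ?eqxx ?As ?orbT//; apply: contraNneq Bs => <-.
apply: tt'; rewrite finset.in_setC; apply/negP => jB.
by have := finset.in_set0 j; rewrite -AB finset.in_setI jA jB.
Qed.

Lemma average_coordinates B (y : S -> R) :
  average (fun t => \prod_(j in B) y (t j)) = (#|S|%:R^-1 * \sum_s y s) ^+ #|B|.
Proof.
pose G (j : 'I_k) s := #|S|%:R^-1 * (if j \in B then y s else 1).
have S0' : #|S|%:R != 0 :> R by rewrite pnatr_eq0 -lt0n.
transitivity (\prod_j \sum_s G j s).
  rewrite bigA_distr_bigA/= /average big_distrr/=; apply: eq_bigr => t _.
  rewrite /G big_split/= prodr_const card_ord exprVn -natrX.
  by congr (_ * _); rewrite [LHS]big_mkcond.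
rewrite -prodr_const [RHS]big_mkcond/=; apply: eq_bigr => j _; rewrite -big_distrr/=.
by case: ifP => //; rewrite sumr_const mulVf.
Qed.

End averages.

(** * Cumulants of the sums of a stationary sequence *)

Section cumulants_of_sums.
Context {R : realType} {d : measure_display} {Omega : measurableType d}.
Variable P : probability Omega R.
Variable Y : int -> Omega -> R.
Hypothesis iY : forall k (t : 'I_k -> int) (B : {set 'I_k}),
  P.-integrable setT (EFin \o (fun w => \prod_(j in B) Y (t j) w)).

Definition sum_until T w : R := \sum_(s < T) Y s%:Z w.

Lemma sum_until_pow T k w : sum_until T w ^+ k = \sum_(t : {ffun 'I_k -> 'I_T}) \prod_j Y (t j)%:Z w.
Proof.
rewrite -[X in _ ^+ X](card_ord k) -prodr_const; exact: bigA_distr_bigA.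
Qed.

Lemma sum_until_moment T k :
  \int[P]_w (sum_until T w ^+ k) =
    \sum_(t : {ffun 'I_k -> 'I_T}) \int[P]_w \prod_j Y (t j)%:Z w /\
  P.-integrable setT (EFin \o (fun w => sum_until T w ^+ k)).
Proof.
have iT (t : {ffun 'I_k -> 'I_T}) : P.-integrable setT (EFin \o (fun w => \prod_j Y (t j)%:Z w)).
  have := iY (fun j => (t j)%:Z) [set: 'I_k]%SET.
  rewrite (_ : (fun w => \prod_(j in _) _) = (fun w => \prod_j Y (t j)%:Z w))//.
  by apply/funext => w; apply: eq_bigl => j; rewrite finset.in_setT.
rewrite (_ : (fun w => _) = fun w => \sum_(t : {ffun 'I_k -> 'I_T}) \prod_j Y (t j)%:Z w); last first.
  by apply/funext => w; exact: sum_until_pow.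
exact: Rintegral_sum.
Qed.

(** Multilinearity of cumulants. For a tuple of independent uniform times, the moment over a block B
    averages to T^(-|B|) E[S^|B|], and averages over disjoint blocks multiply; over a partition the
    powers of T combine to T^(-k). *)
Lemma sum_until_cumulant T k : (0 < T)%N ->
  cumulant_of_moments (fun n => \int[P]_w (sum_until T w ^+ n)) k =
  \sum_(t : {ffun 'I_k -> 'I_T}) joint_cumulant P (fun j => Y (t j)%:Z).
Proof.
move=> T0; have cT : (0 < #|'I_T|)%N by rewrite card_ord.
have T0' : T%:R != 0 :> R by rewrite pnatr_eq0 -lt0n.
pose E (B : {set 'I_k}) (t : {ffun 'I_k -> 'I_T}) := \int[P]_w \prod_(j in B) Y (t j)%:Z w.
have aE B : average (E B) = T%:R^-1 ^+ #|B| * \int[P]_w (sum_until T w ^+ #|B|).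
  have [_ iS] := sum_until_moment T #|B|.
  have [eA iA] := @Rintegral_sum _ _ _ P _ (index_enum {ffun 'I_k -> 'I_T})
    (fun t w => \prod_(j in B) Y (t j)%:Z w) (fun t => iY _ B).
  rewrite -(RintegralZl _ measurableT iS) /average -eA -(RintegralZl _ measurableT iA).
  apply: eq_Rintegral => w _.
  have := average_coordinates cT B (fun s : 'I_T => Y s%:Z w).
  by rewrite /average card_ord exprMn.
rewrite /joint_cumulant /cumulant_of_moments /wsum exchange_big/=; apply: eq_bigr => nu pnu.
rewrite -big_distrr/=; congr (_ * _).
have /and3P[_ /finset.trivIsetP tri _] := pnu.
have : average (fun t => \prod_(B <- enum nu) E B t) = \prod_(B <- enum nu) average (E B).
  apply: average_prod => //; first exact: enum_uniq.
    move=> A B; rewrite !mem_enum => An Bn AB; apply/eqP.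
    by rewrite finset.setI_eq0; exact: tri.
  move=> B t t' tt'; apply: eq_Rintegral => w _; apply: eq_bigr => j jB.
  by rewrite tt'.
rewrite big_enum/= (eq_bigr _ (fun B _ => aE B)) big_split/= prodrXr -(card_partition pnu) cardsT card_ord.
rewrite /average card_ord exprVn natrX => /(mulfI (invr_neq0 (expf_neq0 k T0'))) <-.
by apply: eq_bigr => t _; rewrite big_enum.
Qed.


Hypothesis sY : forall k (t : 'I_k -> int) (s : int) (B : {set 'I_k}),
  \int[P]_w (\prod_(j in B) Y (t j + s) w) = \int[P]_w (\prod_(j in B) Y (t j) w).

Lemma joint_cumulant_shift k (t : 'I_k -> int) s :
  joint_cumulant P (fun j => Y (t j + s)) = joint_cumulant P (fun j => Y (t j)).
Proof.
by apply: eq_bigr => nu _; congr (_ * _); apply: eq_bigr => B _; exact: sY.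
Qed.

Let joint k (t : k.-1.-tuple int) := joint_cumulant P (fun j : 'I_k => Y (times_with_last0 t j)).

(** Tuples are sorted by their last time s. Stationarity moves s to 0, and the other times minus s
    form distinct tuples of integers, so each of the T values of s contributes at most the whole
    series. *)
Lemma sum_cumulants_le k T : (1 < k)%N ->
  (\sum_(t : {ffun 'I_k -> 'I_T}) `|joint_cumulant P (fun j => Y (t j)%:Z)|%:E <=
   T%:R%:E * \esum_(t in [set: k.-1.-tuple int]) `|joint t|%:E)%E.
Proof.
case: k => [//|k] _; rewrite /joint /=.
rewrite (partition_big (fun t : {ffun 'I_k.+1 -> 'I_T} => t ord_max) xpredT)//=.
rewrite (_ : T%:R%:E = \sum_(s < T) 1%E)%E; last by rewrite sumEFin sumr_const card_ord.
rewrite ge0_sume_distrl//; apply: lee_sum => s _; rewrite mul1e.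
pose D : pred {ffun 'I_k.+1 -> 'I_T} := fun t => t ord_max == s.
pose u (t : {ffun 'I_k.+1 -> 'I_T}) : k.-tuple int := [tuple (t (lift ord_max i))%:Z - s%:Z | i < k].
have uE (t : {ffun 'I_k.+1 -> 'I_T}) j : t ord_max = s -> (t j)%:Z = times_with_last0 (k := k.+1) (u t) j + s%:Z.
  move=> ts; rewrite /times_with_last0; case: (unliftP ord_max j) => [i ->|->].
    by rewrite lift_max -tnth_nth tnth_mktuple subrK.
  by rewrite nth_default ?size_tuple// add0r ts.
have uinj : {in D &, injective u}.
  move=> t t' /eqP ts /eqP ts' uu; apply/ffunP => j; apply: val_inj.
  have : (t j)%:Z = (t' j)%:Z by rewrite (uE t j ts) (uE t' j ts') uu.
  by move=> [].
rewrite (eq_bigr (fun t => `|joint_cumulant P (fun j => Y (times_with_last0 (k := k.+1) (u t) j))|%:E)); last first.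
  move=> t /eqP ts; congr (`|_|%:E); rewrite -[RHS](joint_cumulant_shift _ s%:Z).
  by congr joint_cumulant; apply/funext => j; rewrite (uE t).
pose r := map u (enum D).
have ur : uniq r by rewrite map_inj_in_uniq ?enum_uniq// => x y; rewrite !mem_enum; exact: uinj.
apply: esum_ge; exists [set` r] => //.
  by split => //; exact: finite_seq.
rewrite -(fsbig_seq _ _ ur)/= big_map big_enum/=.
exact: lexx.
Qed.


Let mu := \int[P]_w Y 0 w.

Definition autocovariance u := \int[P]_w (Y u w * Y 0 w) - mu ^+ 2.

Let i1 t : P.-integrable setT (EFin \o Y t).
Proof.
have := iY (fun _ : 'I_1 => t) [set: 'I_1]%SET; rewrite (_ : (fun w => \prod_(j in _) _) = Y t)//.
by apply/funext => w; rewrite prodr_const cardsT card_ord.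
Qed.

Lemma prod_I2 (a b : R) (B : {set 'I_2}) : B = [set: 'I_2]%SET ->
  \prod_(j in B) (if j == ord0 then a else b) = a * b.
Proof.
move=> ->; rewrite (eq_bigl xpredT) => [|j]; last by rewrite finset.in_setT.
by rewrite !big_ord_recl big_ord0 mulr1.
Qed.

Let i2 t s : P.-integrable setT (EFin \o (fun w => Y t w * Y s w)).
Proof.
have := iY (fun j : 'I_2 => if j == ord0 then t else s) [set: 'I_2]%SET.
rewrite (_ : (fun w => \prod_(j in _) _) = (fun w => Y t w * Y s w))//.
apply/funext => w; rewrite -[RHS](@prod_I2 _ _ _ erefl).
by apply: eq_bigr => j _; case: ifP.
Qed.

Let s1 t : \int[P]_w Y t w = mu.
Proof.
have := sY (fun _ : 'I_1 => 0) t [set: 'I_1]%SET.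
have E u : \int[P]_w \prod_(j in [set: 'I_1]%SET) Y u w = \int[P]_w Y u w.
  by apply: eq_Rintegral => w _; rewrite prodr_const cardsT card_ord.
by rewrite !E add0r.
Qed.

Let s2 t s : \int[P]_w (Y t w * Y s w) = \int[P]_w (Y (t - s) w * Y 0 w).
Proof.
have := sY (fun j : 'I_2 => if j == ord0 then t - s else 0) s [set: 'I_2]%SET.
rewrite [X in X = _ -> _](_ : _ = \int[P]_w (Y t w * Y s w)); last first.
  apply: eq_Rintegral => w _; rewrite -[RHS](@prod_I2 _ _ _ erefl).
  by apply: eq_bigr => j _; case: ifP => _; rewrite ?subrK ?add0r.
rewrite [X in _ = X -> _](_ : _ = \int[P]_w (Y (t - s) w * Y 0 w))//.
apply: eq_Rintegral => w _; rewrite -[RHS](@prod_I2 _ _ _ erefl).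
by apply: eq_bigr => j _; case: ifP.
Qed.

Lemma autocovarianceN u : autocovariance (- u) = autocovariance u.
Proof.
rewrite /autocovariance; congr (_ - _).
by rewrite -[- u]sub0r -s2; apply: eq_Rintegral => w _; rewrite mulrC.
Qed.

Definition symmetric_sum (rho : int -> R) N := \sum_(0 <= i < N.*2.+1) rho (i%:Z - N%:Z).

Lemma symmetric_sumS rho N :
  symmetric_sum rho N.+1 = symmetric_sum rho N + rho N.+1%:Z + rho (- N.+1%:Z).
Proof.
rewrite /symmetric_sum doubleS big_nat_recl// big_nat_recr//=.
rewrite sub0r [LHS]addrC; congr (_ + _); congr (_ + _).
  by apply: eq_bigr => i _; congr rho; lia.
by congr rho; lia.
Qed.

(** Passing from T to T + 1 times adds one row and one column of covariances, whose sum is that of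
    the autocovariances over |u| <= T. Divided by T, the variance is therefore a Cesaro mean of
    symmetric partial sums. *)
Lemma sum_until_variance T :
  \int[P]_w (sum_until T w ^+ 2) - (\int[P]_w sum_until T w) ^+ 2 =
  \sum_(0 <= t < T) symmetric_sum autocovariance t.
Proof.
have -> : \int[P]_w sum_until T w = T%:R * mu.
  have [-> _] := @Rintegral_sum _ _ _ P _ (index_enum 'I_T) (fun t : 'I_T => Y t%:Z) (fun t => i1 t%:Z).
  by under eq_bigr do rewrite s1; rewrite sumr_const card_ord mulr_natl.
have -> : \int[P]_w (sum_until T w ^+ 2) = \sum_(t < T) \sum_(s < T) \int[P]_w (Y t%:Z w * Y s%:Z w).
  transitivity (\int[P]_w \sum_(t < T) \sum_(s < T) (Y t%:Z w * Y s%:Z w)).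
    by apply: eq_Rintegral => w _; rewrite expr2 /sum_until big_distrlr.
  have h (t : 'I_T) := @Rintegral_sum _ _ _ P _ (index_enum 'I_T) (fun s w => Y t%:Z w * Y s%:Z w) (fun s => i2 t s).
  have [-> _] := @Rintegral_sum _ _ _ P _ (index_enum 'I_T) (fun t w => \sum_(s < T) (Y t%:Z w * Y s%:Z w)) (fun t => (h t).2).
  by apply: eq_bigr => t _; exact: (h t).1.
transitivity (\sum_(t < T) \sum_(s < T) autocovariance (t%:Z - s%:Z)).
  under [RHS]eq_bigr do under eq_bigr do rewrite /autocovariance -s2.
  under [RHS]eq_bigr do rewrite sumrB.
  rewrite sumrB; congr (_ - _).
  by rewrite !sumr_const !card_ord -mulrnA -[RHS]mulr_natl natrM exprMn [in LHS]expr2.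
elim: T => [|T ih]; first by rewrite big_ord0 big_geq.
rewrite big_nat_recr//= -ih big_ord_recr/=; under eq_bigr do rewrite big_ord_recr/=.
rewrite big_split/= -addrA; congr (_ + _).
elim: T {ih} => [|T ih].
  by rewrite big_ord0 add0r big_ord1 /symmetric_sum big_nat1.
rewrite symmetric_sumS -ih big_ord_recl [X in _ + X = _]big_ord_recl.
rewrite subr0 sub0r autocovarianceN.
have E (t : 'I_T) : (lift ord0 t)%:Z - T.+1%:Z = t%:Z - T%:Z by rewrite lift0 -!natz !mulrSr; lia.
have E' (t : 'I_T.+1) : T.+1%:Z - (lift ord0 t)%:Z = T%:Z - t%:Z by rewrite lift0; lia.
rewrite (eq_bigr _ (fun t _ => congr1 autocovariance (E t))).
rewrite [X in _ + (_ + X) = _](eq_bigr _ (fun t _ => congr1 autocovariance (E' t))).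
ring.
Qed.

Variable L : R.
Hypothesis cL : symmetric_sum autocovariance @ \oo --> L.
Hypothesis cY : forall k, (2 <= k)%N -> (\esum_(t in [set: k.-1.-tuple int]) `|joint t|%:E < +oo)%E.

Definition standardized_sum T w := (Num.sqrt T%:R)^-1 * (sum_until T w - T%:R * mu).

Let m T n := \int[P]_w (sum_until T w ^+ n).

Let m0 T : m T 0 = 1.
Proof.
rewrite /m (eq_Rintegral _ (g := cst 1)) => [|w _]; last by rewrite expr0.
by rewrite Rintegral_cst//= probability_setT mulr1.
Qed.

Let kap T := cumulant_of_moments (m T).

Let m_rec T := @moment_recursion R (m T) (m0 T).

Let m1 T : m T 1 = T%:R * mu.
Proof.
rewrite /m (eq_Rintegral _ (g := sum_until T)) => [|w _]; last by rewrite expr1.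
have [-> _] := @Rintegral_sum _ _ _ P _ (index_enum 'I_T) (fun t : 'I_T => Y t%:Z) (fun t => i1 t%:Z).
by under eq_bigr do rewrite s1; rewrite sumr_const card_ord mulr_natl.
Qed.

Let kap1 T : kap T 1 = T%:R * mu.
Proof. by rewrite -m1 (m_rec T 0) big_ord1 subn0 m0 mulr1 bin0 mulr1n. Qed.

Let kap2 T : kap T 2 = \sum_(0 <= t < T) symmetric_sum autocovariance t.
Proof.
rewrite -sum_until_variance -/(m T 2) (m_rec T 1) !big_ord_recl big_ord0 addr0 /= subn0 bin0 binn !mulr1n.
rewrite -/(kap T 1) kap1 m1 m0 mulr1.
rewrite (_ : \int[P]_w sum_until T w = T%:R * mu); first by rewrite expr2 addrAC subrr add0r.
by rewrite -m1 /m; under [RHS]eq_Rintegral do rewrite expr1.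
Qed.

Lemma standardized_sum_integrable T n :
  \int[P]_w (standardized_sum T w ^+ n) =
    (Num.sqrt T%:R)^-1 ^+ n * centred_moment (m T) (T%:R * mu) n /\
  P.-integrable setT (EFin \o (fun w => standardized_sum T w ^+ n)).
Proof.
pose p : {poly R} := ('X - (T%:R * mu)%:P) ^+ n; pose s := (Num.sqrt T%:R)^-1 : R.
have E w : standardized_sum T w ^+ n = \sum_(i < size p) s ^+ n * (p`_i * sum_until T w ^+ i).
  by rewrite exprMn -(hornerXsubC (T%:R * mu) (sum_until T w)) -horner_exp -/p horner_coef big_distrr.
have i i0 : P.-integrable setT (EFin \o (fun w => s ^+ n * (p`_i0 * sum_until T w ^+ i0))).
  have := integrableZl measurableT (s ^+ n * p`_i0) (sum_until_moment T i0).2.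
  by congr (P.-integrable _ _); apply/funext => w /=; rewrite -EFinM mulrA.
have [e ie] := @Rintegral_sum _ _ _ P _ (index_enum 'I_(size p))
  (fun i w => s ^+ n * (p`_i * sum_until T w ^+ i)) (fun i0 => i i0).
rewrite (_ : (fun w => _) = (fun w => \sum_(i < size p) s ^+ n * (p`_i * sum_until T w ^+ i))); last first.
  by apply/funext => w; exact: E.
split=> //; rewrite e big_distrr/=; apply: eq_bigr => j _.
under eq_Rintegral do rewrite mulrA.
by rewrite RintegralZl//; [rewrite mulrA|exact: (sum_until_moment T j).2].
Qed.


(** The cumulant of order k + 1 of [standardized_sum T]. *)
Let coef T k := (Num.sqrt T%:R)^-1 ^+ k.+1 * (kap T k.+1 - (T%:R * mu) *+ (k == 0)%N).

Let coef_cvg k : coef T k @[T --> \oo] --> L *+ (k == 1)%N.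
Proof.
have s0 : (Num.sqrt n.+1%:R)^-1 @[n --> \oo] --> (0 : R).
  under eq_fun => n do rewrite -sqrtrV//.
  rewrite -[X in nbhs X]sqrtr0; apply: continuous_cvg; last exact: cvg_harmonic.
  exact: sqrt_continuous.
rewrite -cvg_shiftS /=.
(* Order 1 vanishes by centring; order 2 is a Cesaro mean; for order k + 3, T^(-(k+3)/2) times the
   bound T S is at most S / sqrt T. *)
case: k => [|[|k]] /=.
- rewrite (_ : (fun n => _) = cst (0 : R)); first exact: cvg_cst.
  by apply/funext => n; rewrite /coef kap1 mulr1n subrr mulr0.
- rewrite mulr1n (_ : (fun n => _) = arithmetic_mean (symmetric_sum autocovariance)); first exact: cesaro.
  apply/funext => n; rewrite /coef mulr0n subr0 kap2 exprVn sqr_sqrtr//.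
- rewrite mulr0n; pose S := fine (\esum_(t in [set: k.+2.-tuple int]) `|joint (k := k.+3) t|%:E)%E.
  have fS : (\esum_(t in [set: k.+2.-tuple int]) `|joint (k := k.+3) t|%:E = S%:E)%E.
    by rewrite fineK// ge0_fin_numE; [exact: (@cY k.+3)|exact: esum_ge0].
  apply: (@cvg0_le _ _ (fun n => S * (Num.sqrt n.+1%:R)^-1)).
  + move=> n; rewrite /coef mulr0n subr0 normrM.
    have kS : `|kap n.+1 k.+3| <= n.+1%:R * S.
      rewrite -lee_fin EFinM -fS /kap sum_until_cumulant//.
      apply: le_trans (@sum_cumulants_le k.+3 n.+1 isT).
      by rewrite sumEFin lee_fin ler_norm_sum.
    set s := (Num.sqrt _)^-1; have s0' : 0 <= s by rewrite invr_ge0 sqrtr_ge0.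
    have s1' : s <= 1 by rewrite invf_le1 ?sqrtr_gt0// -[leLHS]sqrtr1 ler_wsqrtr// ler1n.
    have sT : s ^+ 2 * n.+1%:R = 1.
      by rewrite exprVn sqr_sqrtr// mulVf.
    rewrite ger0_norm ?exprn_ge0//; apply: (le_trans (ler_wpM2l (exprn_ge0 _ s0') kS)).
    rewrite -addn2 exprD -mulrA [s ^+ 2 * _]mulrA sT mul1r mulrC ler_wpM2l//.
      by rewrite fine_ge0// esum_ge0.
    by rewrite exprS ler_piMr// exprn_ile1.

  + by rewrite -(mulr0 S); apply: cvgM => //; exact: cvg_cst.
Qed.

Let g0 T : \int[P]_w (standardized_sum T w ^+ 0) = 1.
Proof.
by rewrite (standardized_sum_integrable T 0).1 /centred_moment !expr0 mul1r /moment_functional size_poly1 big_ord1 coef1 eqxx mul1r m0.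
Qed.

Let gS T k : \int[P]_w (standardized_sum T w ^+ k.+1) =
  \sum_(i < k.+1) coef T i * \int[P]_w (standardized_sum T w ^+ (k - i)) * 'C(k, i)%:R.
Proof.
rewrite (standardized_sum_integrable T _).1 (centred_moment_recursion (m_rec T)) big_distrr/=.
apply: eq_bigr => i _; rewrite (standardized_sum_integrable T _).1 -[(_ - _) * _ *+ _]mulr_natr /coef.
set s := (Num.sqrt _)^-1; set cm := centred_moment _ _ _.
have -> : s ^+ k.+1 = s ^+ i.+1 * s ^+ (k - i)%N by rewrite -exprD addSn subnKC// -ltnS.
by rewrite -/(kap T i.+1); ring.
Qed.

Lemma standardized_sum_second_moment T : \int[P]_w (standardized_sum T w ^+ 2) =
  (Num.sqrt T%:R)^-1 ^+ 2 * \sum_(0 <= t < T) symmetric_sum autocovariance t.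
Proof.
rewrite gS !big_ord_recl big_ord0 addr0 {1}/coef kap1 mulr1n subrr mulr0 !mul0r add0r.
by rewrite /= subnn g0 binn !mulr1 /coef mulr0n subr0 kap2.
Qed.

(** The recursion [gS] passes to the limit by strong induction. Only its term with the second
    cumulant survives, which is the recursion of [gauss_moment]. *)
Theorem standardized_sum_moment_cvg n :
  \int[P]_w (standardized_sum T w ^+ n) @[T --> \oo] --> gauss_moment L n.
Proof.
suff : forall k, (k <= n)%N -> \int[P]_w (standardized_sum T w ^+ k) @[T --> \oo] --> gauss_moment L k by exact.
elim: n => [|n ih] k.
  by rewrite leqn0 => /eqP ->; under eq_fun do rewrite g0; exact: cvg_cst.
rewrite leq_eqVlt => /orP[/eqP ->|]; last by rewrite ltnS; exact: ih.
under eq_fun do rewrite gS.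
rewrite (_ : gauss_moment L n.+1 = \sum_(i < n.+1) L *+ (i == 1 :> nat)%N * gauss_moment L (n - i)%N * 'C(n, i)%:R); last first.
  case: n {ih} => [|n]; first by rewrite big_ord1 mulr0n !mul0r.
  rewrite !big_ord_recl big1/= ?addr0 => [|i _]; last by rewrite mulr0n !mul0r.
  by rewrite mulr0n !mul0r add0r mulr1n subSS subn0 bin1; ring.
apply: cvg_sum_seq => i; apply: cvgM; last exact: cvg_cst.
by apply: cvgM; [exact: coef_cvg|apply: ih; rewrite leq_subr].
Qed.

End cumulants_of_sums.

(** * Autocovariance operators and nuclear series *)

Lemma Rintegral_cauchy_schwarz (d : measure_display) (T : measurableType d) (R : realType)
    (mu : {measure set T -> \bar R}) (f g : T -> R) :
  measurable_fun setT f -> measurable_fun setT g ->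
  mu.-integrable setT (EFin \o (fun x => f x ^+ 2)) ->
  mu.-integrable setT (EFin \o (fun x => g x ^+ 2)) ->
  (\int[mu]_x (f x * g x)) ^+ 2 <= (\int[mu]_x (f x ^+ 2)) * (\int[mu]_x (g x ^+ 2)) /\
  mu.-integrable setT (EFin \o (fun x => f x * g x)).
Proof.
move=> mf mg if2 ig2.
have ifg : mu.-integrable setT (EFin \o (fun x => f x * g x)).
  apply: (@integrable_le _ _ _ _ _ (fun x => f x ^+ 2 + g x ^+ 2)).
  - exact: measurable_funM.
  - exact: (@integrableD _ _ _ mu setT measurableT _ _ if2 ig2).
  - by move=> x; rewrite ler_norml; apply/andP; split; nra.
split=> //; set A := \int[mu]_x (f x ^+ 2); set B := \int[mu]_x (g x ^+ 2); set G := \int[mu]_x (f x * g x).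
have B0 : 0 <= B by apply: Rintegral_ge0 => x _; exact: sqr_ge0.
have A0 : 0 <= A by apply: Rintegral_ge0 => x _; exact: sqr_ge0.
have q s : 0 <= A + (2 * s) * G + s ^+ 2 * B.
  have i1 : mu.-integrable setT (EFin \o (fun x => (2 * s) * (f x * g x))) by exact: (integrableZl measurableT (2 * s) ifg).
  have i2 : mu.-integrable setT (EFin \o (fun x => s ^+ 2 * g x ^+ 2)) by exact: (integrableZl measurableT (s ^+ 2) ig2).
  have i3 : mu.-integrable setT (EFin \o (fun x => f x ^+ 2 + (2 * s) * (f x * g x))).
    exact: (@integrableD _ _ _ mu setT measurableT _ _ if2 i1).
  rewrite /G /B -RintegralZl// -RintegralZl// /A -RintegralD// -RintegralD//.
  apply: Rintegral_ge0 => x _; rewrite (_ : _ + _ = (f x + s * g x) ^+ 2) ?sqr_ge0//.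
  by ring.
have [b0|b0] := eqVneq B 0.
  have [->|G0] := eqVneq G 0; first by rewrite expr0n mulr_ge0.
  have := q (- (A + 1) / (2 * G)); rewrite b0 mulr0 addr0.
  by rewrite (_ : 2 * _ * G = - (A + 1)); [lra|field].
have := q (- G / B); rewrite (_ : _ + _ = (A * B - G ^+ 2) / B); last by field.
by rewrite pmulr_lge0 ?invr_gt0 ?lt_neqAle 1?eq_sym ?b0// subr_ge0.
Qed.

(** * Operators with a covariance kernel *)

Section cross_covariance.
Context {R : realType} {d : measure_display} {Omega : measurableType d}.
Variable P : probability Omega R.
Local Notation L2 := (L2 R).
Local Notation leb := (leb01 R).
Variables Z Z' : Omega -> L2.
Hypotheses (mZ : random_element Z) (mZ' : random_element Z').
Hypotheses (iZ : P.-integrable setT (EFin \o (fun w => L2norm (Z w) ^+ 2)))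
  (iZ' : P.-integrable setT (EFin \o (fun w => L2norm (Z' w) ^+ 2))).

Definition cross_kernel (h : L2) tau := \int[leb]_sigma ((\int[P]_w (Z w tau * Z' w sigma)) * h sigma).

(** For almost every tau, testing the kernel E[Z(tau) Z'(sigma)] against h gives E[Z(tau) <Z', h>],
    which is then tested against g. The Cauchy-Schwarz bound by E[<Z', h>^2] E[Z(tau)^2] makes this
    function square-integrable, so that [toL2] is not junk. *)
Lemma cross_kernel_inner (g h : L2) :
  (toL2 (cross_kernel h) : R -> R) = cross_kernel h /\
  L2inner (toL2 (cross_kernel h)) g = \int[P]_w (L2inner (Z w) g * L2inner (Z' w) h).
Proof.
pose W w := L2inner (Z' w) h.
have mW : measurable_fun setT W by exact: random_inner_measurable.
have iW : P.-integrable setT (EFin \o (fun w => W w ^+ 2)).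
  apply: (@integrable_le _ _ _ _ _ (fun w => L2norm h ^+ 2 * L2norm (Z' w) ^+ 2)).
  - exact: measurable_funX.
  - exact: (integrableZl measurableT _ iZ').
  - move=> w; rewrite ger0_norm ?sqr_ge0// mulrC -exprMn -[W w ^+ 2]real_normK ?num_real//.
    by rewrite lerXn2r ?nnegrE ?mulr_ge0 ?L2norm_ge0// L2_cauchy_schwarz.
have abs_int (V : Omega -> R) : measurable_fun setT V -> P.-integrable setT (EFin \o (fun w => V w ^+ 2)) ->
    (\int[P]_w (L2norm (Z w) * `|V w|)%:E < +oo)%E.
  move=> mV iV.
  have mN := random_norm_measurable mZ.
  have mV' : measurable_fun setT (fun w => `|V w|) by exact: measurableT_comp.
  have iV' : P.-integrable setT (EFin \o (fun w => `|V w| ^+ 2)).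
    by under eq_fun do rewrite real_normK ?num_real//.
  have [_ /integrableP[_]] := Rintegral_cauchy_schwarz mN mV' iZ iV'.
  rewrite (eq_integral (fun w => (L2norm (Z w) * `|V w|)%:E))// => w _ /=.
  by rewrite ger0_norm// mulr_ge0 ?L2norm_ge0.
pose k tau := \int[P]_w (Z w tau * W w).
have [mk ik ek] := @random_fubini _ _ _ P Z mZ W g mW (abs_int _ mW iW).
have mN' := random_norm_measurable mZ'.
have Kk : {ae leb, forall tau, cross_kernel h tau = k tau}.
  have aN : (\int[P]_w (L2norm (Z w) * `|L2norm (Z' w)|)%:E < +oo)%E by exact: abs_int.
  have := @random_product_integrable_ae _ _ _ P Z mZ _ mN' aN.
  apply: (@filterS _ _ (ae_filter_ringOfSetsType leb)) => tau /integrableP[_ itau].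
  have mZt : measurable_fun setT (fun w => Z w tau) by exact: random_element_at.
  have [|_ _ e] := @random_fubini _ _ _ P Z' mZ' (fun w => Z w tau) h mZt.
    apply: le_lt_trans itau; apply: le_ge0_integral => w.
      by rewrite lee_fin mulr_ge0 ?L2norm_ge0.
    by rewrite lee_fin normrM mulrC (ger0_norm (L2norm_ge0 _)).
  rewrite /cross_kernel /k; under [RHS]eq_Rintegral do rewrite mulrC.
  rewrite -[RHS]e; apply: eq_Rintegral => sigma _; rewrite mulrC; congr (_ * _).
  by apply: eq_Rintegral => w _; rewrite mulrC.
have mK : measurable_fun setT (cross_kernel h).
  apply: (@measurable_Rintegral_F _ _ _ _ _ (@leb1 R)
    (fun p => (\int[P]_w (Z w p.1 * Z' w p.2)) * h p.2)).
  apply: measurable_funM; last by apply: (measurableT_comp (L2_measurable h)); exact: measurable_snd.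
  apply: (@measurable_Rintegral_F _ _ _ _ _ P (fun q : (measurableTypeR R * measurableTypeR R) * Omega => Z q.2 q.1.1 * Z' q.2 q.1.2)).
  apply: measurable_funM.
    have : measurable_fun setT (fun q : (measurableTypeR R * measurableTypeR R) * Omega => (q.2, q.1.1)).
      apply/measurable_fun_pairP; split; first exact: measurable_snd.
      exact: (measurableT_comp measurable_fst measurable_fst).
    exact: (measurableT_comp mZ).
  have : measurable_fun setT (fun q : (measurableTypeR R * measurableTypeR R) * Omega => (q.2, q.1.2)).
    apply/measurable_fun_pairP; split; first exact: measurable_snd.
    exact: (measurableT_comp measurable_snd measurable_fst).
  exact: (measurableT_comp mZ').
have mZ2 : measurable_fun setT (fun p : Omega * measurableTypeR R => (Z p.1 p.2 ^+ 2)%:E).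
  by apply/measurable_EFinP; apply: measurable_funX.
have fin2 : (\int[leb]_tau \int[P]_w (Z w tau ^+ 2)%:E < +oo)%E.
  have <- : (\int[P]_w \int[leb]_tau (Z w tau ^+ 2)%:E = \int[leb]_tau \int[P]_w (Z w tau ^+ 2)%:E)%E.
    apply: (@fubini_tonelli _ _ _ _ _ P (@leb1 R) (fun p => (Z p.1 p.2 ^+ 2)%:E)) => //.
    by move=> p; rewrite lee_fin sqr_ge0.
  under eq_integral do rewrite -L2norm_int.
  case/integrableP : iZ => _; apply: le_lt_trans; apply: le_ge0_integral => w.
    by rewrite lee_fin sqr_ge0.
  by rewrite lee_fin ger0_norm ?sqr_ge0.
have mZP : measurable_fun setT (fun tau : measurableTypeR R => \int[P]_w (Z w tau ^+ 2)%:E)%E.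
  by apply: (@measurable_integral_G _ _ _ _ _ P (fun p => (Z p.1 p.2 ^+ 2)%:E)).
have K2 : (\int[leb]_tau (cross_kernel h tau ^+ 2)%:E < +oo)%E.
  pose B := \int[P]_w (W w ^+ 2).
  apply: (@le_lt_trans _ _ (\int[leb]_tau (B%:E * (\int[P]_w (Z w tau ^+ 2)%:E)))%E); last first.
    rewrite ge0_integralZl//.
    - rewrite lte_mul_pinfty// lee_fin; apply: Rintegral_ge0 => w _; exact: sqr_ge0.
    - by move=> tau _; apply: integral_ge0 => w _; rewrite lee_fin sqr_ge0.
    - by rewrite lee_fin; apply: Rintegral_ge0 => w _; exact: sqr_ge0.
  apply: le_ge0_integral_ae.
  - by move=> tau; rewrite lee_fin sqr_ge0.
  - move=> tau; rewrite mule_ge0//.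
      by rewrite lee_fin; apply: Rintegral_ge0 => w _; exact: sqr_ge0.
    by apply: integral_ge0 => w _; rewrite lee_fin sqr_ge0.
  have : leb.-integrable setT (fun tau => \int[P]_w (Z w tau ^+ 2)%:E)%E.
    apply/integrableP; split => //; apply: le_lt_trans fin2; apply: le_ge0_integral => tau //.
    by rewrite gee0_abs// integral_ge0// => w _; rewrite lee_fin sqr_ge0.
  move=> /(integrable_ae measurableT) i2.
  apply: (@filterS2 _ _ (ae_filter_ringOfSetsType leb)) i2 Kk => tau /(_ Logic.I) itau ->.
  have mZt : measurable_fun setT (fun w => Z w tau) by exact: random_element_at.
  have [|+ _] := Rintegral_cauchy_schwarz mZt mW _ iW.
    apply/integrableP; split; first by apply/measurable_EFinP; exact: measurable_funX.
    move: itau; rewrite ge0_fin_numE; last by apply: integral_ge0 => w _; rewrite lee_fin sqr_ge0.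
    by apply: le_lt_trans; apply: le_ge0_integral => // w; rewrite lee_fin ger0_norm ?sqr_ge0.
  have -> : (\int[P]_w (Z w tau ^+ 2)%:E = (\int[P]_w (Z w tau ^+ 2))%:E)%E by rewrite fineK.
  by rewrite -EFinM lee_fin mulrC.
have KE := toL2E mK K2; split=> //.
rewrite L2innerC -ek /L2inner KE; congr fine; apply: ae_eq_integral => //.
- by apply/measurable_EFinP; apply: measurable_funM => //; exact: L2_measurable.
- by apply/measurable_EFinP; apply: measurable_funM => //; exact: L2_measurable.
- apply: (@filterS _ _ (ae_filter_ringOfSetsType leb)) Kk => tau /= -> _ //.
Qed.

End cross_covariance.

Section autocovariance_operator.
Context {R : realType} {d : measure_display} {Omega : measurableType d}.
Variable P : probability Omega R.
Local Notation L2 := (L2 R).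
Variable X : int -> Omega -> L2.
Hypothesis mX : forall t, random_element (X t).
Hypothesis sX : strictly_stationary P X.
Hypothesis X_moments : forall k : nat, (2 <= k)%N ->
  (\int[P]_w ((L2norm (X 0 w)) ^+ k)%:E < +oo)%E.

Let sqr_integrable t : P.-integrable setT (EFin \o (fun w => L2norm (X t w) ^+ 2)).
Proof.
apply: integrable_le (moment_bound mX sX X_moments t 2) _.
  by apply: measurable_funX; exact: random_norm_measurable.
move=> w; rewrite ger0_norm ?sqr_ge0// lerXn2r ?nnegrE ?addr_ge0 ?L2norm_ge0//.
by rewrite lerDr.
Qed.

Let one : L2 := L2indic setT.

Let oneE x : one x = 1.
Proof. by rewrite /one L2indicE// indicE in_setT. Qed.

Let inner_one : L2inner one one = 1.
Proof.
rewrite /L2inner (eq_Rintegral _ (g := cst 1)) => [|x _]; last by rewrite !oneE mulr1.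
by rewrite Rintegral_cst// leb01T mulr1.
Qed.

Lemma inner_integrable t h : P.-integrable setT (EFin \o (fun w => L2inner (X t w) h)).
Proof.
apply: (@integrable_le _ _ _ _ _ (fun w => L2norm h * (1 + L2norm (X t w)) ^+ 1)).
- exact: random_inner_measurable.
- exact: (integrableZl measurableT (L2norm h) (moment_bound mX sX X_moments t 1)).
- move=> w /=; rewrite expr1; apply: (le_trans (L2_cauchy_schwarz _ _)); rewrite mulrC.
  by rewrite ler_wpM2l ?L2norm_ge0// lerDr.
Qed.

Lemma mean_funE : (toL2 (mean_fun P X) : R -> R) = mean_fun P X /\
  forall t h, \int[P]_w L2inner (X t w) h = L2inner (toL2 (mean_fun P X)) h.
Proof.
have m1 : random_element (fun _ : Omega => one).
  by apply: (measurableT_comp (L2_measurable one)); exact: measurable_snd.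
have i1 : P.-integrable setT (EFin \o (fun w : Omega => L2norm one ^+ 2)).
  exact: finite_measure_integrable_cst.
(* The mean is a covariance kernel with the constant function 1, so its square-integrability is an
   instance of [cross_kernel_inner]. *)
have E : mean_fun P X = cross_kernel P (X 0) (fun=> one) one.
  apply/funext => x; rewrite /mean_fun unlock /cross_kernel.
  rewrite (eq_Rintegral _ (g := cst (\int[P]_w X 0 w x))) => [|y _].
    by rewrite Rintegral_cst// leb01T mulr1.
  by rewrite oneE mulr1; apply: eq_Rintegral => w _; rewrite mulr1.
have C h := cross_kernel_inner (mX 0) m1 (sqr_integrable 0) i1 h one.
rewrite E; split=> [|t h]; first exact: (C 0).1.
rewrite (C h).2; transitivity (\int[P]_w L2inner (X 0 w) h).
  have := stationary_inner_prod mX sX (fun _ : 'I_1 => 0) t h [set: 'I_1]%SET.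
  have e u : \int[P]_w \prod_(j in [set: 'I_1]%SET) L2inner (X u w) h = \int[P]_w L2inner (X u w) h.
    by apply: eq_Rintegral => w _; rewrite prodr_const cardsT card_ord.
  by rewrite !e add0r.
by apply: eq_Rintegral => w _; rewrite inner_one mulr1.
Qed.

Lemma autocov_op_inner t g h : L2inner (autocov_op P X t g) h =
  \int[P]_w (L2inner (X t w) h * L2inner (X 0 w) g) -
  L2inner (toL2 (mean_fun P X)) h * L2inner (toL2 (mean_fun P X)) g.
Proof.
have [mE mI] := mean_funE; pose m := toL2 (mean_fun P X).
pose Z t w : L2 := X t w - m.
have mZ u : random_element (Z u).
  apply: measurable_funB; first exact: mX.
  by apply: (measurableT_comp (L2_measurable m)); exact: measurable_snd.
have iZ u : P.-integrable setT (EFin \o (fun w => L2norm (Z u w) ^+ 2)).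
  apply: (@integrable_le _ _ _ _ _ (fun w => 2 * (L2norm (X u w) ^+ 2) + 2 * L2norm m ^+ 2)).
  - by apply: measurable_funX; exact: random_norm_measurable.
  - apply: (@integrableD _ _ _ P setT measurableT (EFin \o (fun w => 2 * L2norm (X u w) ^+ 2)) (EFin \o cst (2 * L2norm m ^+ 2))).
      exact: (integrableZl measurableT 2 (sqr_integrable u)).
    exact: finite_measure_integrable_cst.
  - move=> w; rewrite ger0_norm ?sqr_ge0//.
    have := L2norm_triangle (X u w) (- m); rewrite L2normN.
    have := L2norm_ge0 (X u w - m); rewrite /Z.
    move: (L2norm (X u w - m)) (L2norm (X u w)) (L2norm m) => x y z x0 xyz.
    have : x ^+ 2 <= (y + z) ^+ 2 by rewrite lerXn2r ?nnegrE//; lra.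
    by have := sqr_ge0 (y - z); nra.
have -> : autocov_op P X t g = toL2 (cross_kernel P (Z t) (Z 0) g).
  congr toL2; apply/funext => tau; apply: eq_Rintegral => sigma _; congr (_ * _).
  rewrite /autocov_kernel unlock; apply: eq_Rintegral => w _.
  by rewrite /Z -[in LHS]mE.
rewrite (cross_kernel_inner (mZ t) (mZ 0) (iZ t) (iZ 0) h g).2.
have i1 u h' := inner_integrable u h'.
have i2 : P.-integrable setT (EFin \o (fun w => L2inner (X t w) h * L2inner (X 0 w) g)).
  have b u h' : P.-integrable setT (EFin \o (fun w => L2inner (X u w) h' ^+ 2)).
    apply: (@integrable_le _ _ _ _ _ (fun w => L2norm h' ^+ 2 * L2norm (X u w) ^+ 2)).
    - by apply: measurable_funX; exact: random_inner_measurable.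
    - exact: (integrableZl measurableT _ (sqr_integrable u)).
    - move=> w; rewrite ger0_norm ?sqr_ge0// mulrC -exprMn -[L2inner _ _ ^+ 2]real_normK ?num_real//.
      by rewrite lerXn2r ?nnegrE ?mulr_ge0 ?L2norm_ge0// L2_cauchy_schwarz.
  exact: (Rintegral_cauchy_schwarz (random_inner_measurable (mX t) h)
    (random_inner_measurable (mX 0) g) (b _ _) (b _ _)).2.
have E w : L2inner (Z t w) h * L2inner (Z 0 w) g = L2inner (X t w) h * L2inner (X 0 w) g -
    (L2inner m g * L2inner (X t w) h + L2inner m h * (L2inner (X 0 w) g - L2inner m g)).
  by rewrite /Z !L2innerBl; ring.
have ia : P.-integrable setT (EFin \o (fun w => L2inner m g * L2inner (X t w) h)).
  exact: (integrableZl measurableT _ (i1 t h)).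
have ic : P.-integrable setT (EFin \o cst (L2inner m g)) by exact: finite_measure_integrable_cst.
have ib' : P.-integrable setT (EFin \o (fun w => L2inner (X 0 w) g - L2inner m g)).
  exact: (@integrableB _ _ _ P setT measurableT _ _ (i1 0 g) ic).
have ib : P.-integrable setT (EFin \o (fun w => L2inner m h * (L2inner (X 0 w) g - L2inner m g))).
  exact: (integrableZl measurableT _ ib').
have iab : P.-integrable setT (EFin \o (fun w => L2inner m g * L2inner (X t w) h + L2inner m h * (L2inner (X 0 w) g - L2inner m g))).
  exact: (@integrableD _ _ _ P setT measurableT _ _ ia ib).
under eq_Rintegral do rewrite E; rewrite RintegralB// RintegralD// !RintegralZl//.
rewrite RintegralB// !mI.
have -> : \int[P]_x L2inner m g = L2inner m g.
  by rewrite (Rintegral_cst P)//= probability_setT mulr1.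
rewrite subrr mulr0 addr0.
by rewrite mulrC.
Qed.

End autocovariance_operator.

(** * Nuclear representations and series of nuclear operators *)

Section nuclear.
Variable R : realType.
Local Notation L2 := (L2 R).

(** A witness that the nuclear norm is at most a, with the bound put on partial sums to stay within
    the reals. Unlike the infimum, it can be tested on vectors and concatenated. *)
Definition nuclear_rep (A : L2 -> L2) (u v : nat -> L2) (a : R) :=
  (forall h, L2norm (\sum_(0 <= n < N) L2inner h (v n) *: u n - A h) @[N --> \oo] --> (0 : R)) /\
  (forall N, \sum_(0 <= n < N) L2norm (u n) * L2norm (v n) <= a).

Lemma nuclear_norm_le A u v a : nuclear_rep A u v a -> (nuclear_norm A <= a%:E)%E.
Proof.
move=> [cA sA]; apply: (@le_trans _ _ (\sum_(0 <= n <oo) (L2norm (u n) * L2norm (v n))%:E)%E).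
  apply: ereal_inf_lbound; exists u, v; split => // h.
  by apply/(L2_cvg_norm _ _).2; exact: cA.
apply: lime_le.
  by apply: is_cvg_nneseries => n _ _; rewrite lee_fin mulr_ge0 ?L2norm_ge0.
by apply: nearW => N; rewrite sumEFin lee_fin.
Qed.

Lemma nuclear_norm_rep A e : 0 < e -> (nuclear_norm A < +oo)%E ->
  exists u v, nuclear_rep A u v (fine (nuclear_norm A) + e).
Proof.
move=> e0 Ay.
have A0 : (0 <= nuclear_norm A)%E.
  apply: le_ereal_inf_tmp => _ [u [v [_ ->]]]; apply: nneseries_ge0 => n _ _.
  by rewrite lee_fin mulr_ge0 ?L2norm_ge0.
have fA : nuclear_norm A \is a fin_num by rewrite ge0_fin_numE.
have [s [u [v [cA ->]]] sA] := lb_ereal_inf_adherent e0 fA.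
exists u, v; split=> [h|N]; first by apply/(L2_cvg_norm _ _).1; exact: cA.
rewrite -lee_fin EFinD fineK//; apply: le_trans (ltW sA).
rewrite -sumEFin; apply: nneseries_lim_ge => n _ _.
by rewrite lee_fin mulr_ge0 ?L2norm_ge0.
Qed.

Lemma nuclear_rep_bound A u v a h : nuclear_rep A u v a -> L2norm (A h) <= a * L2norm h.
Proof.
move=> [cA sA]; have c1 := cA h.
have : L2norm (\sum_(0 <= n < N) L2inner h (v n) *: u n) @[N --> \oo] --> L2norm (A h).
  exact: L2_continuous_cvg (@L2norm_continuous R) c1.
move=> c2; apply: (@cvgr_to_le _ _ _ _ _ _ _ c2); apply: nearW => N.
apply: (le_trans (L2norm_sum _ _)); apply: (@le_trans _ _ (\sum_(0 <= n < N) (L2norm (u n) * L2norm (v n)) * L2norm h)).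
  apply: ler_sum => n _; rewrite L2normZ -mulrA mulrC; rewrite ler_wpM2l ?L2norm_ge0//.
  by rewrite mulrC; exact: L2_cauchy_schwarz.
by rewrite -mulr_suml ler_wpM2r ?L2norm_ge0.
Qed.

(** For each term of the representation, Cauchy-Schwarz over n and Bessel's inequality bound the sum
    of |<u_k, e_n> <v_k, e_n>| by the product of the norms of u_k and v_k. *)
Lemma nuclear_rep_trace A u v a (e : nat -> L2) N : nuclear_rep A u v a -> orthosystem (@L2inner R) e ->
  \sum_(n < N) `|L2inner (A (e n)) (e n)| <= a.
Proof.
move=> [cA sA] oe.
have c1 : \sum_(n < N) `|L2inner (\sum_(0 <= k < K) L2inner (e n) (v k) *: u k) (e n)| @[K --> \oo] -->
    \sum_(n < N) `|L2inner (A (e n)) (e n)|.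
  apply: cvg_sum_seq => n; apply: cvg_norm.
  exact: L2_continuous_cvg (@L2inner_continuous R (e n)) (cA (e n)).
apply: (@cvgr_to_le _ _ _ _ _ _ _ c1); apply: nearW => K.
apply: le_trans (sA K).
apply: (@le_trans _ _ (\sum_(n < N) \sum_(0 <= k < K) `|L2inner (v k) (e n)| * `|L2inner (u k) (e n)|)).
  apply: ler_sum => n _; rewrite L2inner_suml; apply: (le_trans (ler_norm_sum _ _ _)).
  by apply: ler_sum => k _; rewrite L2innerZl normrM L2innerC.
rewrite exchange_big/=; apply: ler_sum => k _; rewrite mulrC.
set x := fun n : 'I_N => `|L2inner (v k) (e n)|; set y := fun n : 'I_N => `|L2inner (u k) (e n)|.
have CS : (\sum_n x n * y n) ^+ 2 <= (\sum_n x n ^+ 2) * (\sum_n y n ^+ 2).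
  have := @psd_cauchy_schwarz R 'rV[R]_N (fun f g => \sum_n f 0 n * g 0 n) _ _ _ _ (\row_n x n) (\row_n y n).
  have E (z z' : 'I_N -> R) : \sum_n (\row_j z j) 0 n * (\row_j z' j) 0 n = \sum_n z n * z' n.
    by apply: eq_bigr => n _; rewrite !mxE.
  rewrite !E; apply.
  - by move=> f g; apply: eq_bigr => n _; rewrite mulrC.
  - by move=> f g h; rewrite -big_split/=; apply: eq_bigr => n _; rewrite mxE mulrDl.
  - by move=> c f g; rewrite mulr_sumr; apply: eq_bigr => n _; rewrite mxE mulrA.
  - by move=> f; apply: sumr_ge0 => n _; rewrite -expr2 sqr_ge0.
apply: le_of_sqr; first by rewrite mulr_ge0 ?L2norm_ge0.
apply: le_trans CS _; rewrite exprMn.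
apply: ler_pM; [by apply: sumr_ge0 => n _; exact: sqr_ge0|by apply: sumr_ge0 => n _; exact: sqr_ge0| |].
  by under eq_bigr do rewrite real_normK ?num_real//; exact: bessel.
by under eq_bigr do rewrite real_normK ?num_real//; exact: bessel.
Qed.

Lemma sum_seq_nat (V : nmodType) (f : nat -> V) (b : seq nat) m : uniq b ->
  (forall k, k \in b -> (k < m)%N) ->
  \sum_(k <- b) f k = \sum_(0 <= k < m) (if k \in b then f k else 0).
Proof.
move=> ub bm; rewrite -big_mkcond -[RHS]big_filter; apply: perm_big; apply: uniq_perm => //.
  by rewrite filter_uniq// iota_uniq.
move=> k; rewrite mem_filter mem_index_iota; apply/idP/andP => [kb|[]//].
by rewrite kb bm.
Qed.

(* The pairs (i, n) are enumerated through their codes in nat; a box of pairs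
   containing all the codes below K differs from the K-th partial sum by a
   piece of the tail. *)
Lemma nuclear_rep_countable (I : countType) (A : I -> L2 -> L2) (u v : I -> nat -> L2)
    (a : I -> R) (D : L2 -> L2) (M : R) :
  (forall i, nuclear_rep (A i) (u i) (v i) (a i)) ->
  (forall s : seq I, uniq s -> \sum_(i <- s) a i <= M) ->
  (forall h (s0 : seq I) (e : R), 0 < e -> exists s : seq I,
    [/\ uniq s, {subset s0 <= s} & L2norm (\sum_(i <- s) A i h - D h) < e]) ->
  exists u' v', nuclear_rep D u' v' M.
Proof.
move=> repA sumM limD.
pose u' k := if @pickle_inv (I * nat)%type k is Some p then u p.1 p.2 else 0.
pose v' k := if @pickle_inv (I * nat)%type k is Some p then v p.1 p.2 else 0.
pose c k := L2norm (u' k) * L2norm (v' k).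
have c0 k : 0 <= c k by rewrite mulr_ge0 ?L2norm_ge0.
have cpickle i n : c (pickle (i, n)) = L2norm (u i n) * L2norm (v i n).
  by rewrite /c /u' /v' pickleK_inv.
pose box (s : seq I) N := [seq pickle (i, n) | i <- s, n <- iota 0 N].
have ubox s N : uniq s -> uniq (box s N).
  move=> us; rewrite allpairs_uniq ?iota_uniq// => -[i n] [j m] _ _ /(pcan_inj pickleK).
  by [].
have sum_box (V : nmodType) (f : nat -> V) s N :
    \sum_(k <- box s N) f k = \sum_(i <- s) \sum_(0 <= n < N) f (pickle (i, n)).
  rewrite /box big_allpairs_dep/=; apply: eq_bigr => i _.
  by rewrite /index_iota subn0.
have box_in K : exists (s0 : seq I) (N0 : nat), forall (s : seq I) N, {subset s0 <= s} -> (N0 <= N)%N ->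
    forall k, (k < K)%N -> c k != 0 -> k \in box s N.
  exists (pmap (fun k => omap fst (@pickle_inv (I * nat)%type k)) (iota 0 K)).
  exists (\max_(k < K) (if @pickle_inv (I * nat)%type k is Some p then p.2.+1 else 0))%N.
  move=> s N s0s N0N k kK; rewrite /c /u' /v'.
  have := @pickle_invK (I * nat)%type k.
  case E : (pickle_inv k) => [[i n]|] /=; last by rewrite L2norm0 mul0r eqxx.
  move=> <- _; apply: allpairs_f.
    apply: s0s; rewrite mem_pmap; apply/mapP; exists k; rewrite ?mem_iota ?E//.
  rewrite mem_iota add0n; apply: leq_trans N0N.
  have := @leq_bigmax _ (fun k : 'I_K => if @pickle_inv (I * nat)%type k is Some p then p.2.+1 else 0)%N (Ordinal kK).
  by rewrite /= E.
have bnd (b : seq nat) K : exists2 m, (K <= m)%N & forall k, k \in b -> (k < m)%N.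
  exists (maxn K (\max_(k <- b) k).+1); first exact: leq_maxl.
  move=> k kb; rewrite leq_max ltnS; apply/orP; right.
  exact: (@leq_bigmax_seq _ b xpredT id k kb isT).
have lt_sum (V : nmodType) (f : nat -> V) K m : (K <= m)%N ->
    \sum_(0 <= k < K) f k = \sum_(0 <= k < m) (if (k < K)%N then f k else 0).
  by move=> Km; rewrite !big_mkord (big_ord_widen _ f Km) big_mkcond.
have cM K : \sum_(0 <= k < K) c k <= M.
  have [s0 [N0 sN]] := box_in K.
  pose s := undup s0; have us : uniq s by exact: undup_uniq.
  have s0s : {subset s0 <= s} by move=> x; rewrite mem_undup.
  apply: (@le_trans _ _ (\sum_(k <- box s N0) c k)).
    have [m Km bm] := bnd (box s N0) K.
    rewrite (lt_sum _ _ _ _ Km) (sum_seq_nat _ (ubox _ _ us) bm).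
    apply: ler_sum => k _; case: ifPn => kK; last by case: ifP.
    have [->|ck] := eqVneq (c k) 0; first by case: ifP.
    by rewrite (sN s N0 s0s (leqnn _) k kK ck).
  rewrite sum_box; apply: le_trans (sumM s us).
  apply: ler_sum => i _; under eq_bigr do rewrite cpickle.
  exact: (repA i).2.
exists u', v'; split => // h.
have cc : cvgn (fun K => \sum_(0 <= k < K) c k).
  apply: nondecreasing_is_cvgn.
    by move=> m n mn; rewrite (big_cat_nat _ mn)//= lerDl sumr_ge0.
  by exists M => _ [K _ <-]; exact: cM.
set l := lim _ in cc.
have cl K m : (K <= m)%N -> \sum_(0 <= k < m) c k <= l.
  move=> _; apply: nondecreasing_cvgn_le => //.
  by move=> i j ij; rewrite (big_cat_nat _ ij)//= lerDl sumr_ge0.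
pose f k := L2inner h (v' k) *: u' k.
have fc k : L2norm (f k) <= L2norm h * c k.
  rewrite /f /c L2normZ mulrCA mulrC ler_wpM2l ?L2norm_ge0//.
  exact: L2_cauchy_schwarz.
apply: (@cvg0_le _ _ (fun K => L2norm h * (l - \sum_(0 <= k < K) c k))); last first.
  have : L2norm h * (l - \sum_(0 <= k < K) c k) @[K --> \oo] --> L2norm h * (l - l).
    by apply: cvgM; [exact: cvg_cst|apply: cvgB => //; exact: cvg_cst].
  by rewrite subrr mulr0.
move=> K; rewrite ger0_norm ?L2norm_ge0// -/(f _).
(* The box lies within e / 2 of a finite sum of the [A i h], itself within e / 2 of [D h]; only its
   distance to the K-th partial sum is charged to the tail. *)
apply/ler_addgt0Pr => e e0; have e2 : 0 < e / 2 by rewrite divr_gt0.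
have [s0 [N0 sN]] := box_in K.
have [s [us s0s sD]] := limD h s0 _ e2.
have : \sum_(i <- s) L2norm (\sum_(0 <= n < N) L2inner h (v i n) *: u i n - A i h) @[N --> \oo] --> \sum_(i <- s) (0 : R).
  by apply: cvg_sum_seq => i; exact: (repA i).1.
rewrite big1// => /cvgrPdist_lt/(_ _ e2)[N1 _ hN1].
pose N := maxn N0 N1; have := hN1 N (leq_maxr _ _); rewrite /= sub0r normrN => hN.
have boxE : \sum_(k <- box s N) f k = \sum_(i <- s) \sum_(0 <= n < N) L2inner h (v i n) *: u i n.
  rewrite sum_box; apply: eq_bigr => i _; apply: eq_bigr => n _.
  by rewrite /f /u' /v' pickleK_inv.
have h1 : L2norm (\sum_(k <- box s N) f k - \sum_(i <- s) A i h) <= e / 2.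
  rewrite boxE -sumrB; apply: le_trans (L2norm_sum _ _) _.
  by apply: le_trans (ltW hN); exact: ler_norm.
have h2 : L2norm (\sum_(0 <= k < K) f k - \sum_(k <- box s N) f k) <= L2norm h * (l - \sum_(0 <= k < K) c k).
  have [m Km bm] := bnd (box s N) K.
  rewrite (lt_sum _ f _ _ Km) (sum_seq_nat _ (ubox _ _ us) bm) -sumrB.
  apply: le_trans (L2norm_sum _ _) _.
  apply: (@le_trans _ _ (\sum_(0 <= k < m) (L2norm h * (c k - (if (k < K)%N then c k else 0))))).
    apply: ler_sum => k _; case: ifPn => kK.
      rewrite subrr mulr0; have [ck|ck] := eqVneq (c k) 0.
        have := fc k; rewrite ck mulr0 => fk.
        by case: ifP => _; rewrite ?subrr ?L2norm0// subr0.
      by rewrite (sN s N s0s (leq_maxl _ _) k kK ck) subrr L2norm0.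
    by rewrite sub0r L2normN subr0; case: ifP => // _; rewrite L2norm0 mulr_ge0 ?L2norm_ge0.
  rewrite -mulr_sumr ler_wpM2l ?L2norm_ge0// sumrB -lt_sum// lerD2r.
  exact: cl Km.
have h3 := L2norm_triangleB (\sum_(0 <= k < K) f k) (\sum_(k <- box s N) f k) (D h).
have h4 := L2norm_triangleB (\sum_(k <- box s N) f k) (\sum_(i <- s) A i h) (D h).
by move: h1 h2 h3 h4 sD; lra.
Qed.


Definition sym_range m : seq int := [seq i%:Z - m%:Z | i <- index_iota 0 m.*2.+1].

Lemma mem_sym_range m t : (t \in sym_range m) = (`|t| <= m)%N.
Proof.
apply/mapP/idP => [[i]|tm].
  by rewrite mem_index_iota => /andP[_ im] ->; lia.
by exists (absz (t + m%:Z)); [rewrite mem_index_iota; lia|lia].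
Qed.

Lemma uniq_sym_range m : uniq (sym_range m).
Proof. by rewrite map_inj_uniq ?iota_uniq// => i j /addIr []. Qed.

Lemma big_sym_range (V : nmodType) (f : int -> V) m :
  \sum_(0 <= i < m.*2.+1) f (i%:Z - m%:Z) = \sum_(t <- sym_range m) f t.
Proof. by rewrite big_map. Qed.

Lemma sym_range_split (V : zmodType) (f : int -> V) m n : (m <= n)%N ->
  \sum_(t <- sym_range n | (m < `|t|)%N) f t = \sum_(t <- sym_range n) f t - \sum_(t <- sym_range m) f t.
Proof.
move=> mn; rewrite [in RHS](bigID (fun t : int => (m < `|t|)%N))/=.
have -> : \sum_(t <- sym_range n | ~~ (m < `|t|)%N) f t = \sum_(t <- sym_range m) f t; last by rewrite addrK.
rewrite -big_filter; apply: perm_big; apply: uniq_perm.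
- by rewrite filter_uniq// uniq_sym_range.
- exact: uniq_sym_range.
- by move=> t; rewrite mem_filter !mem_sym_range -leqNgt andb_idr// => /leq_trans; exact.
Qed.

Lemma ler_sum_subset (I : eqType) (f : I -> R) (s r : seq I) : (forall i, 0 <= f i) ->
  uniq s -> uniq r -> {subset s <= r} -> \sum_(i <- s) f i <= \sum_(i <- r) f i.
Proof.
move=> f0 us ur sr; rewrite [leRHS](bigID (mem s))/= -[X in _ <= X + _]big_filter.
have -> : \sum_(i <- [seq i <- r | i \in s]) f i = \sum_(i <- s) f i; last by rewrite lerDl sumr_ge0.
apply: perm_big; apply: uniq_perm => //; first exact: filter_uniq.
by move=> i; rewrite mem_filter andb_idr//; exact: sr.
Qed.

Variable A : int -> L2 -> L2.
Hypothesis sumA : (\esum_(t in [set: int]) nuclear_norm (A t) < +oo)%E.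

(** The infima defining the nuclear norms are approached up to errors 2^(-pickle t), whose total is
    at most 2. *)
Lemma nuclear_family : exists (a : int -> R) (u v : int -> nat -> L2),
  (forall t, nuclear_rep (A t) (u t) (v t) (a t)) /\
  exists M, forall s, uniq s -> \sum_(t <- s) a t <= M.
Proof.
have n0 t : (0 <= nuclear_norm (A t))%E.
  apply: le_ereal_inf_tmp => _ [u [v [_ ->]]]; apply: nneseries_ge0 => n _ _.
  by rewrite lee_fin mulr_ge0 ?L2norm_ge0.
have le_sum (s : seq int) : uniq s -> (\sum_(t <- s) nuclear_norm (A t) <= \esum_(t in [set: int]) nuclear_norm (A t))%E.
  move=> us; apply: esum_ge; exists [set` s]; first by split => //; exact: finite_seq.
  by rewrite -(fsbig_seq _ _ us).
have fin t : (nuclear_norm (A t) < +oo)%E.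
  by apply: le_lt_trans sumA; have := le_sum [:: t] isT; rewrite big_seq1.
have /choice[uv huv] : forall t, exists p : (nat -> L2) * (nat -> L2),
    nuclear_rep (A t) p.1 p.2 (fine (nuclear_norm (A t)) + 2^-1 ^+ pickle t).
  move=> t; have [|u [v h]] := @nuclear_norm_rep (A t) (2^-1 ^+ pickle t) _ (fin t).
    by rewrite exprn_gt0// invr_gt0.
  by exists (u, v).
exists (fun t => fine (nuclear_norm (A t)) + 2^-1 ^+ pickle t), (fun t => (uv t).1), (fun t => (uv t).2).
split=> //; exists (fine (\esum_(t in [set: int]) nuclear_norm (A t)) + 2) => s us.
rewrite big_split/=; apply: lerD.
  rewrite -lee_fin fineK; last by rewrite ge0_fin_numE// esum_ge0.
  rewrite -sumEFin; apply: le_trans (le_sum s us).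
  by apply: lee_sum => t _; rewrite fineK// ge0_fin_numE.
have ups : uniq (map pickle s) by rewrite map_inj_uniq//; exact: (pcan_inj pickleK).
rewrite -(big_map pickle xpredT (fun k => 2^-1 ^+ k)) (@sum_seq_nat _ _ _ (\max_(k <- map pickle s) k).+1 ups).
  set m := (_.+1); apply: (@le_trans _ _ (\sum_(0 <= k < m) 2^-1 ^+ k)).
    by apply: ler_sum => k _; case: ifP => // _; rewrite exprn_ge0.
  have -> : \sum_(0 <= k < m) 2^-1 ^+ k = 2 - 2 * 2^-1 ^+ m :> R.
    elim: (m) => [|n ih]; first by rewrite big_geq// expr0 mulr1 subrr.
    by rewrite big_nat_recr//= ih exprS; field.
  by rewrite gerBl mulr_ge0// exprn_ge0.
move=> k ks; rewrite ltnS; exact: (@leq_bigmax_seq _ _ xpredT id k ks isT).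
Qed.

(** C is obtained vector by vector from completeness. For convergence in nuclear norm, the N-th
    remainder, which is minus the sum of the [A t] over |t| > N, receives a representation of total
    weight l - s N by concatenation. The bounds [a t] are exported because they later control the
    norm and the trace of C. *)
Theorem nuclear_sum_exists : exists C : L2 -> L2, exists (a : int -> R) (M : R),
  [/\ nuclear_sum A C,
      (forall t h, L2norm (A t h) <= a t * L2norm h),
      (forall t e N, orthosystem (@L2inner R) e -> \sum_(n < N) `|L2inner (A t (e n)) (e n)| <= a t),
      (forall s, uniq s -> \sum_(t <- s) a t <= M) &
      (forall h, L2norm (\sum_(t <- sym_range N) A t h - C h) @[N --> \oo] --> (0 : R))].
Proof.
have [a [u [v [rep [M aM]]]]] := nuclear_family.
have a0 t : 0 <= a t by have := (rep t).2 0; rewrite big_geq.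
have Ab t h : L2norm (A t h) <= a t * L2norm h by exact: nuclear_rep_bound (rep t).
pose s m := \sum_(t <- sym_range m) a t.
have s_nd : {homo s : m n / (m <= n)%N >-> m <= n}.
  by move=> m n mn; rewrite -subr_ge0 -sym_range_split// sumr_ge0.
have sc : cvgn s.
  apply: nondecreasing_is_cvgn => //; exists M => _ [m _ <-]; apply: aM; exact: uniq_sym_range.
pose l := lim (s @ \oo); have sl m : s m <= l by exact: nondecreasing_cvgn_le.
have scl : s @ \oo --> l by [].
pose U h m := \sum_(t <- sym_range m) A t h.
have Ule h m n : (m <= n)%N -> L2norm (U h n - U h m) <= L2norm h * (s n - s m).
  move=> mn; rewrite /U /s -!sym_range_split// mulr_sumr.
  rewrite -big_filter -[leRHS]big_filter; apply: le_trans (L2norm_sum _ _) _.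
  by apply: ler_sum => t _; rewrite mulrC; exact: Ab.
have /choice[C hC] : forall h, exists f, L2norm (U h m - f) @[m --> \oo] --> (0 : R).
  move=> h; apply: L2_complete => e e0.
  have h1 : 0 < L2norm h + 1 by rewrite ltr_wpDl ?L2norm_ge0.
  have e1 : 0 < e / (L2norm h + 1) by rewrite divr_gt0.
  have /cvgrPdist_lt/(_ _ e1)[N _ hN] := scl; exists N.
  have key m n : (N <= m)%N -> (m <= n)%N -> L2norm (U h n - U h m) < e.
    move=> Nm mn; apply: le_lt_trans (Ule h m n mn) _.
    have := hN m Nm; rewrite /= ger0_norm ?subr_ge0// ltr_pdivlMr// => h2.
    have := sl n; have := L2norm_ge0 h; have := s_nd _ _ mn; move: h2.
    by rewrite -/(s m) -/(s n); move: (L2norm h) (s m) (s n) => x y z; nra.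
  move=> m n Nm Nn; have [mn|/ltnW nm] := leqP m n; last exact: key.
  by rewrite L2normB; exact: key.
exists C, a, M; split=> //; last by move=> t e N oe; exact: nuclear_rep_trace (rep t) oe.
rewrite /nuclear_sum.
pose D N (h : L2) : L2 := \sum_(0 <= i < N.*2.+1) A (i%:Z - N%:Z) h - C h.
rewrite (_ : (fun N => _) = fun N => nuclear_norm (D N))//.
have le N : (nuclear_norm (D N) <= (l - s N)%:E)%E.
  pose out (t : int) := (N < `|t|)%N.
  have [| | |u' [v' rp]] := @nuclear_rep_countable int (fun t => if out t then fun h => - A t h else fun=> 0)
    (fun t => if out t then fun n => - u t n else fun=> 0) v (fun t => if out t then a t else 0)
    (D N) (l - s N).
  - move=> t; case: (out t); last first.
      split=> [h|K]; last by rewrite big1// => n _; rewrite L2norm0 mul0r.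
      rewrite (_ : (fun N => _) = cst (0 : R)); first exact: cvg_cst.
      apply/funext => K; rewrite big1; first by rewrite subrr L2norm0.
      by move=> n _; rewrite scaler0.
    split=> [h|K].
      rewrite (_ : (fun N => _) = (fun K => L2norm (\sum_(0 <= n < K) L2inner h (v t n) *: u t n - A t h))).
        exact: (rep t).1 h.
      apply/funext => K; rewrite -[RHS]L2normN opprB opprK addrC; congr (L2norm (_ + _)).
      by rewrite -sumrN; apply: eq_bigr => n _; rewrite scalerN.
    by under eq_bigr do rewrite L2normN; exact: (rep t).2.
  - move=> q uq; pose m := maxn N (\max_(t <- q) `|t|)%N.
    have qm : {subset q <= sym_range m}.
      move=> t tq; rewrite mem_sym_range leq_max; apply/orP; right.
      exact: (@leq_bigmax_seq _ q xpredT (fun t : int => `|t|%N) t tq isT).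
    apply: (@le_trans _ _ (\sum_(t <- sym_range m) (if out t then a t else 0))).
      by apply: ler_sum_subset => //; [move=> t; case: ifP|exact: uniq_sym_range].
    by rewrite -big_mkcond sym_range_split ?leq_maxl// -/(s m) -/(s N) lerD2r.
  - move=> h q e e0; have /cvgrPdist_lt/(_ _ e0)[N1 _ hN] := hC h.
    pose m := maxn N (maxn N1 (\max_(t <- q) `|t|)%N); exists (sym_range m); split.
    + exact: uniq_sym_range.
    + move=> t tq; rewrite mem_sym_range !leq_max; apply/orP; right; apply/orP; right.
      exact: (@leq_bigmax_seq _ q xpredT (fun t : int => `|t|%N) t tq isT).
    + rewrite /D (big_sym_range (fun t => A t h)) (_ : \sum_(t <- sym_range m) _ = - (U h m - U h N)).
        have := hN m; rewrite /= sub0r normrN => /(_ _)/(le_lt_trans (ler_norm _)).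
        rewrite -L2normN (_ : - (U h m - C h) = - (U h m - U h N) - (U h N - C h)).
          by apply; rewrite /m /= !leq_max leqnn orbT.
        by rewrite -[RHS]opprD addrA subrK.
      rewrite /U -sym_range_split ?leq_maxl// -sumrN [RHS]big_mkcond; apply: eq_bigr => t _.
      by rewrite /out; case: ifP.
  exact: nuclear_norm_le rp.
apply: (@squeeze_cvge _ _ _ _ (cst 0%E) _ (fun N => (l - s N)%:E)).
- apply: nearW => N; rewrite le andbT.
  apply: le_ereal_inf_tmp => _ [u' [v' [_ ->]]]; apply: nneseries_ge0 => n _ _.
  by rewrite lee_fin mulr_ge0 ?L2norm_ge0.
- exact: cvg_cst.
- apply/cvg_EFin; first by apply: nearW.
  rewrite -(subrr l); apply: cvgB => //; exact: cvg_cst.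
Qed.

End nuclear.

(** * Projections of the normalized sums *)

Lemma gauss_moment_scale (R : realType) (c v : R) n : gauss_moment (c ^+ 2 * v) n = c ^+ n * gauss_moment v n.
Proof.
suff : gauss_moment (c ^+ 2 * v) n = c ^+ n * gauss_moment v n /\
  gauss_moment (c ^+ 2 * v) n.+1 = c ^+ n.+1 * gauss_moment v n.+1 by case.
elim: n => [|n [ih1 ih2]]; first by rewrite /= expr0 mulr1 mulr0.
split=> //; rewrite [LHS]/= ih1 [gauss_moment v n.+2]/= !exprS; ring.
Qed.

Lemma sym_rangeN N : perm_eq (sym_range N) [seq - t | t <- sym_range N].
Proof.
apply: uniq_perm; [exact: uniq_sym_range|rewrite map_inj_uniq; [exact: uniq_sym_range|exact: oppr_inj]|].
move=> t; apply/idP/mapP => [tN|[s sN ->]]; last by rewrite !mem_sym_range abszN in sN *.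
by exists (- t); rewrite ?opprK// !mem_sym_range abszN in tN *.
Qed.

Section projections_of_sums.
Context {R : realType} {d : measure_display} {Omega : measurableType d}.
Variable P : probability Omega R.
Local Notation L2 := (L2 R).
Variable X : int -> Omega -> L2.
Hypothesis mX : forall t, random_element (X t).
Hypothesis sX : strictly_stationary P X.
Hypothesis X_moments : forall k : nat, (2 <= k)%N ->
  (\int[P]_w ((L2norm (X 0 w)) ^+ k)%:E < +oo)%E.

Let mI := (mean_funE mX sX X_moments).2.

Lemma inner_prod_integrable k (t : 'I_k -> int) (h : L2) (B : {set 'I_k}) :
  P.-integrable setT (EFin \o (fun w => \prod_(j in B) L2inner (X (t j) w) h)).
Proof.
apply: (@integrable_le _ _ _ _ _ (fun w => (1 + L2norm h) ^+ k * \prod_(j < k) (1 + L2norm (X (t j) w)))).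
- under eq_fun do rewrite -big_enum; apply: measurable_prod => j _; exact: random_inner_measurable.
- exact: (integrableZl measurableT _ (mixed_moment_bound mX sX X_moments t)).
- move=> w; rewrite normr_prod big_mkcond/= -[X in _ ^+ X](card_ord k) -prodr_const.
  rewrite (eq_bigl xpredT)// -[X in _ <= X](big_split) /=.
  apply: ler_prod => j _; case: ifP => _.
    rewrite normr_ge0/=; apply: (le_trans (L2_cauchy_schwarz _ _)); rewrite mulrC.
    by apply: ler_pM; rewrite ?L2norm_ge0// lerDr.
  rewrite ler01/= -[leLHS]mulr1; apply: ler_pM => //; by rewrite lerDl L2norm_ge0.
Qed.

Lemma autocovarianceE h u : autocovariance P (fun t w => L2inner (X t w) h) u = L2inner (autocov_op P X u h) h.
Proof. by rewrite (autocov_op_inner mX sX X_moments) /autocovariance mI expr2. Qed.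

(** A shift by t exchanges the roles of the two times: the adjoint of R_t is R_(-t). *)
Lemma autocov_op_sym t g h : L2inner (autocov_op P X (- t) g) h = L2inner (autocov_op P X t h) g.
Proof.
rewrite (autocov_op_inner mX sX X_moments (- t) g h) (autocov_op_inner mX sX X_moments t h g).
rewrite (mulrC (L2inner (toL2 (mean_fun P X)) h)); apply: (congr1 (fun x => x - _)).
pose F (j : 'I_2) (f : L2) := L2inner f (if j == ord0 then h else g).
have := @stationary_integral _ _ _ P X sX 2 (fun j : 'I_2 => if j == ord0 then - t else 0) t F [set: 'I_2]%SET
  (fun j => @L2inner_continuous R _) (fun u j => random_inner_measurable (mX u) _) idfun (@measurable_id _ _ _).
have E (u : int -> int) : \int[P]_w \prod_(j in [set: 'I_2]%SET) F j (X (u (if j == ord0 then - t else 0)) w) =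
    \int[P]_w (L2inner (X (u (- t)) w) h * L2inner (X (u 0) w) g).
  apply: eq_Rintegral => w _; rewrite (eq_bigl xpredT) => [|j]; last by rewrite finset.in_setT.
  by rewrite !big_ord_recl big_ord0 mulr1.
rewrite /= (E (fun x => x + t)) (E idfun)/= addNr add0r => <-.
by apply: eq_Rintegral => w _; rewrite mulrC.
Qed.

Lemma normalized_sum_inner T h w :
  L2inner (normalized_sum P X T w) h = standardized_sum P (fun t w => L2inner (X t w) h) T w.
Proof.
rewrite /normalized_sum /standardized_sum /sum_until L2innerZl L2innerBl L2innerZl big_mkord L2inner_suml mI.
have [->|T0] := eqVneq T 0%N; first by rewrite sqrtr0 invr0 !mul0r.
have T0' : (0 : R) < T%:R by rewrite ltr0n lt0n.
rewrite -[in X in _ * (X^-1 * _ - _)](sqr_sqrtr (ltW T0')) -[in X in _ = _ * (_ - X * _)](sqr_sqrtr (ltW T0')).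
have : Num.sqrt T%:R != 0 :> R by rewrite gt_eqF// sqrtr_gt0.
by move: (Num.sqrt _) => s s0; field.
Qed.

Lemma normalized_sum_random T : random_element (normalized_sum P X T).
Proof.
have mm : random_element (fun _ : Omega => toL2 (mean_fun P X)).
  by apply: (measurableT_comp (L2_measurable _)); exact: measurable_snd.
have ms : random_element (fun w => \sum_(0 <= t < T) X t%:Z w).
  elim: T => [|T ih].
    by rewrite /random_element; under eq_fun do rewrite big_geq//; exact: measurable_cst.
  rewrite /random_element (_ : (fun p => _) =
    (fun p => (\sum_(0 <= t < T) X t%:Z p.1) p.2 + X T%:Z p.1 p.2)).
    exact: (measurable_funD ih (mX _)).
  by apply/funext => p; rewrite big_nat_recr.
apply: (@measurable_funM _ _ _ _ (cst (Num.sqrt T%:R))) => //.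
apply: measurable_funB => //.
exact: (@measurable_funM _ _ _ _ (cst (T%:R^-1))).
Qed.

Hypothesis X_cumulants : forall k : nat, (2 <= k)%N ->
  (\esum_(t in [set: k.-1.-tuple int])
     kernel_norm (cumulant_kernel P X (times_with_last0 t)) < +oo)%E.
Variable C : L2 -> L2.
Hypothesis CR : forall h, L2norm (\sum_(t <- sym_range N) autocov_op P X t h - C h) @[N --> \oo] --> (0 : R).

Lemma cov_cvg g h : \sum_(t <- sym_range N) L2inner (autocov_op P X t g) h @[N --> \oo] --> L2inner (C g) h.
Proof.
under eq_fun do rewrite -L2inner_suml.
exact: L2_continuous_cvg (@L2inner_continuous R h) (CR g).
Qed.

Lemma cov_unique g h (u : nat -> R) (l : R) :
  (forall N, \sum_(t <- sym_range N) L2inner (autocov_op P X t g) h = u N) -> u @ \oo --> l ->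
  L2inner (C g) h = l.
Proof.
move=> uE ul; have := @cov_cvg g h; under eq_fun do rewrite uE.
by move=> h1; exact: (cvg_unique _ h1 ul).
Qed.

Lemma cov_sym g h : L2inner (C g) h = L2inner (C h) g.
Proof.
apply: cov_unique (@cov_cvg h g) => N.
by rewrite (perm_big _ (sym_rangeN N)) big_map; apply: eq_bigr => t _; exact: autocov_op_sym.
Qed.

(** C was chosen vector by vector, so its linearity is not built in. Symmetry moves the argument to
    the other slot, where the form is linear. *)
Lemma covD f g h : L2inner (C (f + g)) h = L2inner (C f) h + L2inner (C g) h.
Proof. by rewrite !(cov_sym _ h) L2innerDr. Qed.

Lemma covZ a g h : L2inner (C (a *: g)) h = a * L2inner (C g) h.
Proof. by rewrite !(cov_sym _ h) L2innerZr. Qed.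

Let joint_finite h : L2norm h <= 1 -> forall k, (2 <= k)%N ->
  (\esum_(t in [set: k.-1.-tuple int])
    `|joint_cumulant P (fun (j : 'I_k) w => L2inner (X (times_with_last0 t j) w) h)|%:E < +oo)%E.
Proof.
move=> h1 k k2; apply: le_lt_trans (X_cumulants k2); apply: le_esum => t _.
exact: (inner_cumulant_bound mX h1 (mixed_moment_bound mX sX X_moments _)).
Qed.

Lemma inner_moments_cvg T h n :
  P.-integrable setT (EFin \o (fun w => L2inner (normalized_sum P X T w) h ^+ n)) /\
  \int[P]_w (L2inner (normalized_sum P X T w) h ^+ n) @[T --> \oo] --> gauss_moment (L2inner (C h) h) n.
Proof.
have h1 : 0 < L2norm h + 1 by rewrite ltr_wpDl ?L2norm_ge0.
(* The bound on cumulants holds in the unit ball; h is rescaled by its norm plus 1, which is never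
   0. *)
pose c := L2norm h + 1; pose g := c^-1 *: h.
have hE : h = c *: g by rewrite scalerA mulfV ?gt_eqF// scale1r.
have g1 : L2norm g <= 1.
  by rewrite L2normZ gtr0_norm ?invr_gt0// ler_pdivrMl// mulr1 lerDl.
pose Y t w := L2inner (X t w) g.
have iY k (t : 'I_k -> int) (B : {set 'I_k}) := inner_prod_integrable t g B.
have sY k (t : 'I_k -> int) s (B : {set 'I_k}) := stationary_inner_prod mX sX t s g B.
have E T' w : L2inner (normalized_sum P X T' w) h ^+ n = c ^+ n * standardized_sum P Y T' w ^+ n.
  by rewrite hE L2innerZr normalized_sum_inner exprMn.
have [_ i] := @standardized_sum_integrable _ _ _ P Y iY T n.
split.
  under eq_fun do rewrite E; exact: (integrableZl measurableT _ i).
rewrite (_ : gauss_moment _ n = c ^+ n * gauss_moment (L2inner (C g) g) n); last first.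
  by rewrite -gauss_moment_scale {1 2}hE covZ L2innerZr mulrA.
rewrite (_ : (fun T => _) = (fun T => c ^+ n * \int[P]_w (standardized_sum P Y T w ^+ n))); last first.
  apply/funext => T'; have [_ i'] := @standardized_sum_integrable _ _ _ P Y iY T' n.
  by under eq_Rintegral do rewrite E; rewrite RintegralZl.
apply: cvgM; first exact: cvg_cst.
apply: (@standardized_sum_moment_cvg _ _ _ P Y iY sY); last exact: joint_finite.
rewrite (_ : symmetric_sum _ = fun N => \sum_(t <- sym_range N) L2inner (autocov_op P X t g) g).
  exact: cov_cvg.
by apply/funext => N; rewrite /symmetric_sum (big_sym_range (autocovariance P Y)); apply: eq_bigr => t _; exact: autocovarianceE.
Qed.

(** The number is a limit of second moments. *)
Lemma cov_ge0 h : 0 <= L2inner (C h) h.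
Proof.
have := (inner_moments_cvg 0 h 2).2; rewrite /= mulr1 mul1r => c2.
by apply: (cvgr_to_ge c2); apply: nearW => T; apply: Rintegral_ge0 => w _; exact: sqr_ge0.
Qed.

Lemma inner_cos_cvg h th :
  \int[P]_w cos (L2inner (normalized_sum P X T w) h + th) @[T --> \oo] -->
  cos th * expR (- L2inner (C h) h / 2).
Proof.
apply: moments_cvg_cos => [T|T k|k].
- exact: random_inner_measurable (normalized_sum_random T) h.
- exact: (inner_moments_cvg T h k).1.
- exact: (inner_moments_cvg 0 h k).2.
Qed.

(** The second moment is a Cesaro mean of symmetric sums of <R_t h, h>, each at most b. The bound is
    uniform in T, as approximation by finitely many coordinates demands. *)
Lemma inner_second_moment_le T h b :
  (forall N, \sum_(t <- sym_range N) `|L2inner (autocov_op P X t h) h| <= b) ->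
  \int[P]_w (L2inner (normalized_sum P X T w) h ^+ 2) <= b.
Proof.
move=> hb; have b0 : 0 <= b by apply: le_trans (hb 0%N); exact: sumr_ge0.
pose Y t w := L2inner (X t w) h.
have iY k (t : 'I_k -> int) (B : {set 'I_k}) := inner_prod_integrable t h B.
have sY k (t : 'I_k -> int) s (B : {set 'I_k}) := stationary_inner_prod mX sX t s h B.
have le_b t : symmetric_sum (autocovariance P Y) t <= b.
  apply: le_trans (hb t); rewrite /symmetric_sum (big_sym_range (autocovariance P Y)).
  by apply: ler_sum => u _; rewrite autocovarianceE ler_norm.
under eq_Rintegral do rewrite normalized_sum_inner.
rewrite (@standardized_sum_second_moment _ _ _ P Y iY sY).
have [->|T0] := eqVneq T 0%N; first by rewrite big_geq// mulr0.
have T0' : (0 : R) < T%:R by rewrite ltr0n lt0n.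
rewrite exprVn (sqr_sqrtr (ltW T0')) ler_pdivrMl//.
apply: (@le_trans _ _ (\sum_(0 <= t < T) b)); first exact: ler_sum.
by rewrite sumr_const_nat subn0 mulr_natl.
Qed.

End projections_of_sums.

(** * Independent normal variables *)

Section normal_moments.
Variable R : realType.
Implicit Types (m s x : R).
Local Notation mu := (@lebesgue_measure R).

Lemma integral_normal_prob m s (f : R -> R) : measurable_fun setT f ->
  (normal_prob m s).-integrable setT (EFin \o f) ->
  \int[normal_prob m s]_x f x = \int[mu]_x (f x * normal_pdf m s x).
Proof.
move=> mf fi; congr fine.
rewrite -(Radon_Nikodym_change_of_variables (normal_prob_dominates m s))//=.
have mp : measurable_fun setT (fun x => (normal_pdf m s x)%:E).
  by apply/measurable_EFinP; exact: measurable_normal_pdf.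

rewrite [RHS](_ : _ = (\int[mu]_x ((f x)%:E * (normal_pdf m s x)%:E))%E); last first.
  by apply: eq_integral => x _; rewrite EFinM.
apply: ae_eq_integral => //.
- apply: emeasurable_funM; first exact/measurable_EFinP.
  apply: (measurable_int mu); apply: Radon_Nikodym_integrable; exact: normal_prob_dominates.
- by apply: emeasurable_funM => //; exact/measurable_EFinP.
- apply: ae_eqe_mul2l => /=; rewrite Radon_NikodymE//=; first exact: normal_prob_dominates.
  move=> dom; case: cid => /= h [h1 h2 h3]; apply: integral_ae_eq => //=.
  by move=> E _ mE; rewrite -h3.
Qed.

(** The density formula concerns functions already known to be integrable; it is applied to the
    truncations of |f| at k, and Fatou's lemma removes the truncation. *)
Lemma integrable_normal_prob m s (f : R -> R) : measurable_fun setT f ->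
  mu.-integrable setT (EFin \o (fun x => f x * normal_pdf m s x)) ->
  (normal_prob m s).-integrable setT (EFin \o f).
Proof.
move=> mf /integrableP[_ fp]; apply/integrableP; split; first exact/measurable_EFinP.
pose g (k : nat) x := Num.min `|f x| k%:R.
have g0 k x : 0 <= g k x by rewrite /g le_min normr_ge0 ler0n.
have mg k : measurable_fun setT (g k).
  by apply: measurable_minr => //; exact: measurableT_comp.
have gi k : (normal_prob m s).-integrable setT (EFin \o g k).
  apply: (@integrable_bdd _ _ _ _ _ k%:R); first exact: mg.
  by move=> x; rewrite ger0_norm// /g ge_min lexx orbT.
apply: le_lt_trans fp; apply: (@fatou_bound _ (measurableTypeR R) R (normal_prob m s) g (fun x => `|f x|) _ 0) => //.
- move=> x; apply: cvg_near_cst; near=> k.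
  by apply: min_idPl; apply: ltW; near: k; exact: nbhs_infty_gtr.
- move=> k _; rewrite (_ : (\int[_]_x _)%E = (\int[normal_prob m s]_x g k x)%:E); last first.
    by rewrite fineK//; apply: integrable_fin_num => //; exact: gi.
  rewrite integral_normal_prob//.
  have i : mu.-integrable setT (EFin \o (fun x => g k x * normal_pdf m s x)).
    apply: (@integrable_le _ (measurableTypeR R) R mu _ (fun x => k%:R * normal_pdf m s x)).
    - by apply: measurable_funM; [exact: mg|exact: measurable_normal_pdf].
    - exact: (integrableZl measurableT k%:R (integrable_normal_pdf m s)).
    - move=> x; rewrite ger0_norm ?mulr_ge0 ?normal_pdf_ge0//.
      by rewrite ler_wpM2r ?normal_pdf_ge0// /g ge_min lexx orbT.
  rewrite fineK; last by apply: integrable_fin_num => //; exact: i.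
  apply: ge0_le_integral => //.
  + by move=> x _; rewrite lee_fin mulr_ge0 ?normal_pdf_ge0.
  + by apply/measurable_EFinP; apply: measurable_funM; [exact: mg|exact: measurable_normal_pdf].
  + apply/measurable_EFinP; apply: measurableT_comp => //.
    by apply: measurable_funM; [exact: mf|exact: measurable_normal_pdf].
  + move=> x _; rewrite lee_fin normrM (ger0_norm (normal_pdf_ge0 m s x)).
    by rewrite ler_wpM2r ?normal_pdf_ge0// /g ge_min lexx.
Unshelve. all: by end_near. Qed.

(** The n-th power of y / n <= exp (y / n). *)
Lemma expn_le_expR n (y : R) : 0 <= y -> y ^+ n <= n%:R ^+ n * expR y.
Proof.
case: n => [|n] y0; first by rewrite !expr0 mul1r -expR0 ler_expR.
have n0 : (0 : R) < n.+1%:R by rewrite ltr0n.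
have h : y / n.+1%:R <= expR (y / n.+1%:R).
  by apply: le_trans (expR_ge1Dx _); rewrite lerDr.
have : (y / n.+1%:R) ^+ n.+1 <= expR (y / n.+1%:R) ^+ n.+1.
  by rewrite lerXn2r ?nnegrE ?divr_ge0 ?expR_ge0// ltW.
rewrite -expRM_natl mulrCA mulfV ?gt_eqF// mulr1 exprMn exprVn.
by rewrite ler_pdivrMr ?exprn_gt0// mulrC.
Qed.

Section nondegenerate.
Variables (m s : R).
Hypothesis s0 : s != 0.

(** Half of the exponent absorbs the polynomial: the product is dominated by the density itself plus
    a multiple of the normal density of twice the variance. *)
Lemma normal_pdf_moment_integrable n :
  mu.-integrable setT (EFin \o (fun x => (x - m) ^+ n * normal_pdf m s x)).
Proof.
pose s' := Num.sqrt 2 * s.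
have s2 : s' ^+ 2 = 2 * s ^+ 2 by rewrite exprMn sqr_sqrtr.
have s'0 : s' != 0 by rewrite mulf_neq0// gt_eqF// sqrtr_gt0.
have S0 : 0 < s ^+ 2 by rewrite exprn_even_gt0.
pose K := (4 * s ^+ 2) ^+ n * n%:R ^+ n * normal_peak s / normal_peak s'.
apply: (@integrable_le _ (measurableTypeR R) R mu _ (fun x => normal_pdf m s x + K * normal_pdf m s' x)).
- apply: measurable_funM; last exact: measurable_normal_pdf.
  by apply: measurable_funX; exact: measurable_funB.
- apply: (@integrableD _ _ _ mu setT measurableT (fun x => (normal_pdf m s x)%:E) (fun x => (K * normal_pdf m s' x)%:E)).
    exact: integrable_normal_pdf.
  exact: (integrableZl measurableT K (integrable_normal_pdf m s')).
- move=> x; rewrite normrM [X in _ * X]ger0_norm ?normal_pdf_ge0// normrX.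
  set z := `|x - m|; have z0 : 0 <= z by exact: normr_ge0.
  have zn : z ^+ n <= 1 + (z ^+ 2) ^+ n.
    have a0 : 0 <= z ^+ n by exact: exprn_ge0.
    by rewrite -exprM mulnC exprM; nra.
  have p0 := normal_pdf_ge0 m s x.
  apply: (le_trans (ler_wpM2r p0 zn)); rewrite mulrDl mul1r lerD2l.
  rewrite !normal_pdfE//= /normal_fun.
  pose y := z ^+ 2 / (4 * s ^+ 2).
  have y0 : 0 <= y by rewrite divr_ge0 ?sqr_ge0// mulr_ge0 ?sqr_ge0.
  have zy : z ^+ 2 = 4 * s ^+ 2 * y by rewrite /y; field; rewrite s0.
  have e1 : - (x - m) ^+ 2 / (s ^+ 2 *+ 2) = - y - y.
    by rewrite -[(x - m) ^+ 2]real_normK ?num_real// -/z /y -mulr_natr; field.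
  have e2 : - (x - m) ^+ 2 / (s' ^+ 2 *+ 2) = - y.
    rewrite s2 -[(x - m) ^+ 2]real_normK ?num_real// -/z /y -mulr_natr; field.
    by rewrite s0.
  rewrite e1 e2 expRD zy exprMn /K.
  have pk := normal_peak_gt0 s'0.
  rewrite [leRHS](_ : _ = (4 * s ^+ 2) ^+ n * (n%:R ^+ n * expR y) * (normal_peak s * (expR (- y) * expR (- y)))).
    apply: ler_wpM2r; first by rewrite !mulr_ge0 ?expR_ge0 ?normal_peak_ge0.
    by apply: ler_wpM2l; [apply: exprn_ge0; rewrite mulr_ge0// ltW|exact: expn_le_expR].
  have : expR y * expR (- y) = 1 by rewrite -expRD subrr expR0.
  move: pk; move: (expR y) (expR (- y)) (normal_peak s') => a b c c0 ab.
  transitivity ((4 * s ^+ 2) ^+ n * n%:R ^+ n * normal_peak s * b); first by field; rewrite gt_eqF.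
  rewrite [RHS](_ : _ = (4 * s ^+ 2) ^+ n * n%:R ^+ n * normal_peak s * b * (a * b)); last by ring.
  by rewrite ab mulr1.
Qed.

Lemma normal_pdf_derive n x :
  is_derive x 1 (fun y => (y - m) ^+ n * normal_pdf m s y)
    (n%:R * ((x - m) ^+ n.-1 * normal_pdf m s x) - (s ^+ 2)^-1 * ((x - m) ^+ n.+1 * normal_pdf m s x)).
Proof.
have dB : is_derive x 1 (@id R - cst m) (1 - 0).
  exact: is_deriveB.
have dX := is_deriveX n dB.
have dX2 := is_deriveX 2 dB.
have dE := is_deriveZ (- (s ^+ 2 *+ 2)^-1) dX2.
have dexp := is_derive1_comp (is_derive_expR ((- (s ^+ 2 *+ 2)^-1 \*: ((@id R - cst m) ^+ 2)) x)) dE.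
have dp := is_deriveZ (normal_peak s) dexp.
have h := is_deriveM dX dp.
have E y : normal_pdf m s y = normal_peak s * expR ((- (s ^+ 2 *+ 2)^-1 \*: ((@id R - cst m) ^+ 2)) y).
  rewrite normal_pdfE//= /normal_fun; congr (_ * expR _).
  by rewrite -[RHS]/(- _ * (y - m) ^+ 2) !mulNr mulrC.
rewrite (_ : (fun y => _) = (@id R - cst m) ^+ n *
  (normal_peak s \*: (expR \o (- (s ^+ 2 *+ 2)^-1 \*: (@id R - cst m) ^+ 2)))); last first.
  apply/funext => y; rewrite E -[RHS]/(((@id R - cst m) ^+ n) y * (normal_peak s * expR _)).
  by congr (_ * _); rewrite exprfctE.
apply: is_derive_eq; rewrite E.
set p := expR _; rewrite exprfctE.
rewrite -[LHS]/((x - m) ^+ n * (normal_peak s * (p * (- (s ^+ 2 *+ 2)^-1 * (2 * (x - m) * (1 - 0))))) +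
  normal_peak s * p * (n%:R * (x - m) ^+ n.-1 * (1 - 0))).
rewrite [(x - m) ^+ n.+1]exprS -[s ^+ 2 *+ 2]mulr_natr.
by move: ((x - m) ^+ n) ((x - m) ^+ n.-1) (normal_peak s) p => a b q p; field.
Qed.

Let F n x := (x - m) ^+ n * normal_pdf m s x.

Let F_continuous n : continuous (F n).
Proof.
move=> x; apply: differentiable_continuous; apply/derivable1_diffP.
by have d := normal_pdf_derive n x.
Qed.

Let f n x := n%:R * F n.-1 x - (s ^+ 2)^-1 * F n.+1 x.

Let f_continuous n : continuous (f n).
Proof.
by move=> x; apply: cvgB; (apply: cvgM; [exact: cvg_cst|exact: F_continuous]).
Qed.

Let FTC n (a b : R) : a < b -> (\int[mu]_(x in `[a, b]) (f n x)%:E = (F n b - F n a)%:E)%E.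
Proof.
move=> ab; rewrite EFinB; apply: continuous_FTC2 => //.
- by apply: continuous_subspaceT; exact: f_continuous.
- split.
  + by move=> x _; have d := normal_pdf_derive n x.
  + by apply: cvg_at_right_filter; exact: F_continuous.
  + by apply: cvg_at_left_filter; exact: F_continuous.
- by move=> x _; rewrite derive1E; have d := normal_pdf_derive n x; rewrite derive_val.
Qed.

(** This decay makes the boundary terms of the integration by parts vanish at infinity. *)
Let F_bound n : exists c, forall x, x != m -> `|F n x| <= c / `|x - m|.
Proof.
exists (normal_peak s * (1 + n.+1%:R ^+ n.+1 * (s ^+ 2 *+ 2) ^+ n.+1)) => x xm.
have S0 : 0 < s ^+ 2 by rewrite exprn_even_gt0.
set z := `|x - m|; have z0 : 0 < z by rewrite normr_gt0 subr_eq0.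
rewrite /F normrM normrX -/z (ger0_norm (normal_pdf_ge0 m s x)) normal_pdfE//= /normal_fun.
pose y := z ^+ 2 / (s ^+ 2 *+ 2); have S20 : 0 < s ^+ 2 *+ 2 by rewrite pmulrn_lgt0.
have y0 : 0 <= y by rewrite divr_ge0 ?sqr_ge0// ltW.
rewrite mulNr -[(x - m) ^+ 2]real_normK ?num_real// -/z -/y expRN.
have := expn_le_expR n.+1 y0; rewrite {1}/y exprMn exprVn ler_pdivrMr ?exprn_gt0// => h.
have e0 : 0 < expR y by exact: expR_gt0.
have e1 : 1 <= expR y by rewrite -[leLHS]expR0 ler_expR.
have zn : z ^+ n.+1 <= 1 + (z ^+ 2) ^+ n.+1.
  have a0 : 0 <= z ^+ n.+1 by exact: exprn_ge0 (ltW z0).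
  by rewrite -exprM mulnC exprM; nra.
rewrite ler_pdivlMr// (_ : z ^+ n * _ * z = normal_peak s * (z ^+ n.+1 / expR y)); last by rewrite exprSr; ring.
rewrite ler_wpM2l ?normal_peak_ge0// ler_pdivrMr//; apply: (le_trans zn).
by rewrite mulrDl mul1r; apply: lerD => //; rewrite mulrAC.
Qed.

Let f_integrable n : mu.-integrable setT (EFin \o f n).
Proof.
have i1 : mu.-integrable setT (EFin \o (fun x => n%:R * F n.-1 x)).
  exact: (integrableZl measurableT _ (normal_pdf_moment_integrable n.-1)).
have i2 : mu.-integrable setT (EFin \o (fun x => (s ^+ 2)^-1 * F n.+1 x)).
  exact: (integrableZl measurableT _ (normal_pdf_moment_integrable n.+1)).
exact: (@integrableB _ _ _ mu setT measurableT _ _ i1 i2).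
Qed.

Let int_f n : \int[mu]_x f n x = 0.
Proof.
pose A k : set (measurableTypeR R) := `[m - k.+1%:R, m + k.+1%:R]%classic.
have mf : measurable_fun setT (f n) by apply: continuous_measurable_fun; exact: f_continuous.
have mA k : measurable (A k) by exact: measurable_itv.
pose fk k x := \1_(A k) x * f n x.
have mfk k : measurable_fun setT (fk k) by apply: measurable_funM; [exact: measurable_indic (mA k)|exact: mf].
have [c1 _] : (\int[mu]_x fk k x) @[k --> \oo] --> \int[mu]_x f n x /\ mu.-integrable setT (EFin \o f n).
  apply: (@Rintegral_dct _ (measurableTypeR R) R mu fk (f n) (fun x => `|f n x|)).
  - exact: mfk.
  - move=> x; apply: cvg_near_cst; near=> k; rewrite /fk indicE mem_set ?mul1r// /A /= in_itv/=.
    have : `|x - m| < k.+1%:R.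
      by apply: (@lt_trans _ _ k%:R); [near: k; exact: nbhs_infty_gtr|rewrite ltr_nat].
    by rewrite ltr_norml => /andP[? ?]; apply/andP; split; lra.
  - exact: integrable_abse (f_integrable n).
  - by move=> k x; rewrite /fk normrM ler_piMl// indicE; case: (_ \in _); rewrite ?normr1 ?normr0.
have [c hc] := F_bound n.
suff c2 : (\int[mu]_x fk k x) @[k --> \oo] --> (0 : R) by exact: (cvg_unique _ c1 c2).
apply: (@cvg0_le _ _ (fun k => 2 * c * harmonic k)); last first.
  by rewrite -(mulr0 (2 * c)); apply: cvgM; [exact: cvg_cst|exact: cvg_harmonic].
move=> k; have k0 : (0 : R) < k.+1%:R by rewrite ltr0n.
have -> : \int[mu]_x fk k x = F n (m + k.+1%:R) - F n (m - k.+1%:R).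
  apply: EFin_inj; rewrite -FTC; last lra.
  rewrite fineK; last first.
    apply: integrable_fin_num => //; apply: (@integrable_le _ (measurableTypeR R) R mu _ (fun x => `|f n x|)).
    - exact: mfk.
    - exact: integrable_abse (f_integrable n).
    - by move=> x; rewrite /fk normrM ler_piMl// indicE; case: (_ \in _); rewrite ?normr1 ?normr0.
  rewrite [RHS]integral_mkcond; apply: eq_integral => x _.
  by rewrite patchE /fk indicE /A; case: ifP => _; rewrite ?mul1r ?mul0r.
have b (y : R) : `|y - m| = k.+1%:R -> `|F n y| <= c * harmonic k.
  move=> ym; have := hc y; rewrite ym; apply.
  by apply: contra_eq_neq ym => ->; rewrite subrr normr0 lt_eqF.
apply: (le_trans (ler_normB _ _)); rewrite -mulrA mulr_natl mulr2n; apply: lerD; apply: b.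
  by rewrite addrAC subrr add0r ger0_norm// ltW.
by rewrite addrAC subrr add0r normrN ger0_norm// ltW.
Unshelve. all: by end_near. Qed.

(** Integration by parts: the derivative of (x - m)^k times the density has integral 0, which links
    the moments of orders k + 1 and k - 1. *)
Lemma normal_pdf_moment n :
  \int[mu]_x ((x - m) ^+ n * normal_pdf m s x) = gauss_moment (s ^+ 2) n.
Proof.
have rec k : \int[mu]_x F k.+1 x = s ^+ 2 * (k%:R * \int[mu]_x F k.-1 x).
  have := int_f k; rewrite /f RintegralB//.
  - rewrite !RintegralZl//; try exact: normal_pdf_moment_integrable.
    move/eqP; rewrite subr_eq0 => /eqP ->; rewrite mulrA mulfV ?mul1r//.
    by rewrite expf_neq0.
  - exact: (integrableZl measurableT _ (normal_pdf_moment_integrable k.-1)).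
  - exact: (integrableZl measurableT _ (normal_pdf_moment_integrable k.+1)).
suff : \int[mu]_x F n x = gauss_moment (s ^+ 2) n /\ \int[mu]_x F n.+1 x = gauss_moment (s ^+ 2) n.+1 by case.
elim: n => [|n [ih1 ih2]].
  split; last by rewrite rec mul0r mulr0.
  transitivity (\int[mu]_x normal_pdf m s x); last by rewrite /Rintegral integral_normal_pdf.
  by apply: eq_Rintegral => x _; rewrite /F expr0 mul1r.
by split=> //; rewrite rec ih1 /=; ring.
Qed.

End nondegenerate.

End normal_moments.

Lemma bounded_fubini (R : realType) (d1 d2 : measure_display) (T1 : measurableType d1) (T2 : measurableType d2)
    (P1 : probability T1 R) (P2 : probability T2 R) (F : T1 * T2 -> R) (M : R) :
  measurable_fun setT F -> (forall p, `|F p| <= M) ->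
  \int[(P1 \x P2)%E]_p F p = \int[P1]_x \int[P2]_y F (x, y) /\
  \int[P1]_x \int[P2]_y F (x, y) = \int[P2]_y \int[P1]_x F (x, y).
Proof.
move=> mF FM.
have iF : ((P1 \x P2)%E).-integrable setT (EFin \o F).
  pose PP : probability (T1 * T2)%type R := (P1 \x P2)%E.
  exact: (@integrable_bdd _ (T1 * T2)%type R PP F M mF FM).
have cst1 (d : measure_display) (D : measurableType d) (Q : probability D R) (c : R) :
    (\int[Q]_(_ in setT) c%:E = c%:E)%E.
  have := @integral_cst _ D R Q setT measurableT c%:E; rewrite /cst => ->.
  by rewrite -[RHS]mule1; congr (_ * _)%E; exact: probability_setT.
have fF : (\int[P1]_x \int[P2]_y `|F (x, y)|%:E < +oo)%E.
  apply: (@le_lt_trans _ _ (\int[P1]_x \int[P2]_y M%:E)%E); last by rewrite cst1 cst1 ltry.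
  apply: le_ge0_integral => [x|x]; first exact: integral_ge0.
  by apply: le_ge0_integral => y; rewrite lee_fin.
have [e1 _ _ _] := @Rfubini _ _ T1 T2 R P1 P2 F mF fF; split => //.
rewrite /Rintegral; transitivity (fine (\int[P1]_x fubini_F P2 (EFin \o F) x)%E).
  by rewrite (@integral12_prod_meas1 _ _ T1 T2 R P1 P2 _ iF).
congr fine; apply: eq_integral => x _; rewrite fineK//; apply: integrable_fin_num => //.
apply: (@integrable_bdd _ T2 R P2 (fun y => F (x, y)) M) => //.
exact: (measurableT_comp mF (measurable_pair1 x)).
Qed.

Definition image_measure (d1 d2 : measure_display) (T1 : measurableType d1) (T2 : measurableType d2)
    (R : realType) (m : {measure set T1 -> \bar R}) (f : T1 -> T2) (mf : measurable_fun setT f) :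
    {measure set T2 -> \bar R} :=
  measure_function_pushforward__canonical__measure_function_Measure m mf.

(** * The uniform law and its self-similarity *)

Section rays.
Variable R : realType.
Local Notation T := (measurableTypeR R).

Lemma measure_eq_on_rays (m1 m2 : {measure set T -> \bar R}) :
  (m1 setT < +oo)%E -> (forall x : R, m1 `]x, +oo[%classic = m2 `]x, +oo[%classic) ->
  forall A, measurable A -> m1 A = m2 A.
Proof.
move=> fin1 ray A mA.
apply: (@measure_unique _ R T (@RGenOInfty.G R) (fun n => `](- n%:R)%R, +oo[%classic) _ _ _ _ m1 m2) => //.
- exact: RGenOInfty.measurableE.
- move=> _ _ [x ->] [y ->]; exists (Num.max x y); apply/seteqP; split => z /=.
    by rewrite !in_itv/= !andbT => -[xz yz]; rewrite gt_max xz yz.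
  by rewrite !in_itv/= !andbT gt_max => /andP[].
- by move=> n; exists (- n%:R).
- apply/seteqP; split => // x _; exists (Num.truncn `|x|).+1 => //=.
  rewrite in_itv/= andbT ltrNl; apply: le_lt_trans (truncnS_gt _).
  by rewrite -normrN ler_norm.
- by move=> _ [x ->].
- move=> n; apply: le_lt_trans fin1; apply: le_measure; rewrite ?inE//.
Qed.

Definition unit_itv : set T := `]0%R, 1%R[%classic.

Lemma measurable_unit_itv : measurable unit_itv.
Proof. exact: measurable_itv. Qed.

Definition unif : set T -> \bar R := mrestr lebesgue_measure measurable_unit_itv.

HB.instance Definition _ := Measure.on unif.

Lemma unifT : unif setT = 1%E.
Proof.
by rewrite /unif /mrestr setTI /= lebesgue_measure_itv/= lte_fin ltr01 oppr0 adde0.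
Qed.

HB.instance Definition _ := Measure_isProbability.Build _ _ R unif unifT.

Lemma unif_eq (A B : set T) : A `&` unit_itv = B `&` unit_itv -> unif A = unif B.
Proof. by move=> AB; rewrite /unif /mrestr AB. Qed.

(** The probability that a uniform variable exceeds x. *)
Definition tail_unif (x : R) : R := if x < 0 then 1 else if x < 1 then 1 - x else 0.

Lemma unif_ray x : unif `]x, +oo[%classic = (tail_unif x)%:E.
Proof.
rewrite /unif /mrestr /tail_unif; have [x0|x0] := ltP x 0.
  rewrite (_ : _ `&` _ = unit_itv); first by have := unifT; rewrite /unif /mrestr setTI.
  apply/setIidPr => y; rewrite /unit_itv /= !in_itv/= => /andP[y0 _].
  by rewrite (lt_trans x0 y0).
have [x1|x1] := ltP x 1.
  rewrite (_ : _ `&` _ = `]x, 1[%classic).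
    by rewrite lebesgue_measure_itv/= lte_fin x1.
  apply/seteqP; split => y; rewrite /unit_itv /= !in_itv/=.
    by move=> [/andP[-> _] /andP[_ ->]].
  by move=> /andP[xy y1]; rewrite xy y1 (le_lt_trans x0 xy).
rewrite (_ : _ `&` _ = set0) ?measure0//.
apply/seteqP; split => y //; rewrite /unit_itv /= !in_itv/= => -[/andP[xy _] /andP[_ y1]].
by have := lt_trans (le_lt_trans x1 xy) y1; rewrite ltxx.
Qed.

Lemma tail_unif_half x : tail_unif x = 2^-1 * tail_unif (2 * x) + 2^-1 * tail_unif (2 * x - 1).
Proof.
rewrite /tail_unif; case: (ltP x 0) => ?; case: (ltP x 1) => ?; case: (ltP (2 * x) 0) => ?;
  case: (ltP (2 * x) 1) => ?; case: (ltP (2 * x - 1) 0) => ?; case: (ltP (2 * x - 1) 1) => ?; lra.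
Qed.

Lemma tail_unif_ge0 x : 0 <= tail_unif x.
Proof. by rewrite /tail_unif; case: ltP => // _; case: ltP => //; lra. Qed.

Lemma tail_unif_le1 x : tail_unif x <= 1.
Proof. by rewrite /tail_unif; case: ltP => // ?; case: ltP => //; lra. Qed.

(** Splitting on the first binary digit: the uniform law is the even mixture of its images under w /
    2 and (w + 1) / 2. Both sides are measures, compared on rays. *)
Lemma unif_halves (A : set R) : measurable (A : set T) ->
  unif A = (2^-1%:E * unif [set w : R | A (w / 2)%R] + 2^-1%:E * unif [set w : R | A ((w + 1) / 2)%R])%E.
Proof.
pose h0 : T -> T := fun w => w / 2; pose h1 : T -> T := fun w => (w + 1) / 2.
have mh0 : measurable_fun setT h0 by exact: measurable_funM.
have mh1 : measurable_fun setT h1 by apply: measurable_funM => //; exact: measurable_funD.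
have half0 : (0 : R) <= 2^-1 by [].
pose half : {nonneg R} := NngNum half0.
pose m2 : {measure set T -> \bar R} :=
  measure_add (mscale half (image_measure unif mh0)) (mscale half (image_measure unif mh1)).
have m2E B : m2 B = (2^-1%:E * unif [set w : R | B (w / 2)%R] + 2^-1%:E * unif [set w : R | B ((w + 1) / 2)%R])%E.
  exact: measure_addE.
move=> mA; rewrite -(m2E A); apply: (measure_eq_on_rays _ _ mA).
  by apply: le_lt_trans (probability_le1 unif measurableT) (ltry _).
move=> x; rewrite m2E.
have e0 : [set w : R | `]x, +oo[%classic (w / 2)] = `](2 * x), +oo[%classic.
  by apply/seteqP; split => w /=; rewrite !in_itv/= !andbT; lra.
have e1 : [set w : R | `]x, +oo[%classic ((w + 1) / 2)] = `](2 * x - 1), +oo[%classic.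
  by apply/seteqP; split => w /=; rewrite !in_itv/= !andbT; lra.
rewrite e0 e1 -[LHS]/(unif `]x, +oo[%classic) (unif_ray x) (unif_ray (2 * x)) (unif_ray (2 * x - 1)).
by rewrite -!EFinM -EFinD -tail_unif_half.
Qed.

End rays.

(** * Independence of even and odd binary digits *)

Section digits.
Variable R : realType.
Local Notation T := (measurableTypeR R).
Local Notation unif := (@unif R).

Definition digit (w : R) : R := if w < 2^-1 then 0 else 1.

(** The doubling map, which drops the first binary digit. *)
Definition shift (w : R) : R := 2 * w - digit w.

Lemma measurable_digit : measurable_fun setT (digit : T -> T).
Proof.
rewrite (_ : digit = \1_(`[2^-1, +oo[%classic : set T)); first by apply: measurable_indic; exact: measurable_itv.
apply/funext => w; rewrite indicE /digit; have [w2|w2] := ltP w 2^-1.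
  by rewrite memNset// /= in_itv/= andbT => /le_lt_trans/(_ w2); rewrite ltxx.
by rewrite mem_set//= in_itv/= andbT.
Qed.

Lemma measurable_shift : measurable_fun setT (shift : T -> T).
Proof. by apply: measurable_funB; [exact: measurable_funM|exact: measurable_digit]. Qed.

Lemma measurable_iter_shift k : measurable_fun setT (iter k shift : T -> T).
Proof.
elim: k => [|k ih]; first exact: measurable_id.
exact: measurableT_comp measurable_shift ih.
Qed.

Let bit j w := 2^-1 ^+ j.+1 * digit (iter j.*2 shift w).

Let digit01 w : 0 <= digit w <= 1.
Proof. by rewrite /digit; case: ltP; rewrite ?lexx ?ler01. Qed.

Let bits_le n w : \sum_(0 <= j < n) bit j w <= 1 - 2^-1 ^+ n.
Proof.
elim: n => [|n ih]; first by rewrite big_geq// expr0 subrr.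
rewrite big_nat_recr//= (_ : 1 - _ = 1 - 2^-1 ^+ n + 2^-1 ^+ n.+1 * 1); last by rewrite exprS; field.
by apply: lerD => //; rewrite ler_wpM2l ?exprn_ge0//; have /andP[] := digit01 (iter n.*2 shift w).
Qed.

Let bits_nd w : {homo (fun n => \sum_(0 <= j < n) bit j w) : m n / (m <= n)%N >-> m <= n}.
Proof.
move=> m n mn; rewrite (big_cat_nat _ mn)//= lerDl sumr_ge0// => j _.
by rewrite mulr_ge0 ?exprn_ge0//; have /andP[] := digit01 (iter j.*2 shift w).
Qed.

Let bits_cvg w : cvgn (fun n => \sum_(0 <= j < n) bit j w).
Proof.
apply: nondecreasing_is_cvgn; first exact: bits_nd.
by exists 1 => _ [n _ <-]; apply: (le_trans (bits_le n w)); rewrite gerBl exprn_ge0.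
Qed.

(** The number whose binary digits are those of w at the even positions, counted from 0: [bit j]
    carries the digit of index 2j to the place j + 1. *)
Definition even_digits (w : R) : R := limn (fun n => \sum_(0 <= j < n) bit j w).

Definition odd_digits (w : R) : R := even_digits (shift w).

Lemma even_digitsE w : even_digits w = 2^-1 * digit w + 2^-1 * odd_digits (shift w).
Proof.
have h1 : (fun n => \sum_(0 <= j < n.+1) bit j w) @ \oo --> even_digits w.
  by have := @bits_cvg w; rewrite -cvg_shiftS.
have h2 : 2^-1 * digit w + 2^-1 * (\sum_(0 <= j < n) bit j (shift (shift w))) @[n --> \oo] -->
    2^-1 * digit w + 2^-1 * odd_digits (shift w).
  by apply: cvgD; [exact: cvg_cst|apply: cvgM; [exact: cvg_cst|exact: (@bits_cvg (shift (shift w)))]].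
rewrite (_ : (fun n => _) = fun n => \sum_(0 <= j < n.+1) bit j w) in h2.
  exact: (cvg_unique _ h1 h2).
apply/funext => n; rewrite big_nat_recl//; congr (_ + _).
rewrite mulr_sumr; apply: eq_bigr => j _.
by rewrite /bit mulrA -exprS doubleS -!iterSr.
Qed.

Lemma even_digits_itv w : 0 <= even_digits w <= 1.
Proof.
apply/andP; split.
  apply: (cvgr_to_ge (@bits_cvg w)); apply: nearW => n; apply: sumr_ge0 => j _.
  by rewrite mulr_ge0 ?exprn_ge0//; have /andP[] := digit01 (iter j.*2 shift w).
apply: (cvgr_to_le (@bits_cvg w)); apply: nearW => n.
by apply: (le_trans (bits_le n w)); rewrite gerBl exprn_ge0.
Qed.

Lemma measurable_even_digits : measurable_fun setT (even_digits : T -> T).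
Proof.
apply: (@measurable_fun_cvg _ T R setT (fun n w => \sum_(0 <= j < n) bit j w)) => [n|w _].
  apply: measurable_sum => j; apply: measurable_funM => //.
  exact: measurableT_comp measurable_digit (measurable_iter_shift _).
exact: (@bits_cvg w).
Qed.

Lemma measurable_odd_digits : measurable_fun setT (odd_digits : T -> T).
Proof. exact: measurableT_comp measurable_even_digits measurable_shift. Qed.

Lemma shift_half0 w : @unit_itv R w -> digit (w / 2) = 0 /\ shift (w / 2) = w.
Proof.
rewrite /unit_itv /= in_itv/= => /andP[w0 w1]; rewrite /shift /digit.
by case: ltP => h; split; lra.
Qed.

Lemma shift_half1 w : @unit_itv R w -> digit ((w + 1) / 2) = 1 /\ shift ((w + 1) / 2) = w.
Proof.
rewrite /unit_itv /= in_itv/= => /andP[w0 w1]; rewrite /shift /digit.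
by case: ltP => h; split; lra.
Qed.

Let U := even_digits.
Let V := odd_digits.

Let joint (x y : R) := unif [set w | x < U w /\ y < V w].

Let mUV x y : measurable ([set w | x < U w /\ y < V w] : set T).
Proof.
rewrite (_ : [set w | _] = U @^-1` `]x, +oo[ `&` V @^-1` `]y, +oo[).
  apply: measurableI; rewrite -[X in measurable X]setTI.
    exact: measurable_even_digits.
  exact: measurable_odd_digits.
by apply/seteqP; split => w /=; rewrite !in_itv/= !andbT.
Qed.

(** Halving w prepends a digit 0 and exchanges the two subsequences: U (w / 2) = V w / 2 and V (w /
    2) = U w; likewise (w + 1) / 2 prepends a digit 1. The joint tail thus satisfies a
    self-similarity equation. *)
Let joint_half x y : joint x y = (2^-1%:E * joint y (2 * x)%R + 2^-1%:E * joint y (2 * x - 1)%R)%E.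
Proof.
rewrite /joint (unif_halves (mUV x y)).
have E0 w : @unit_itv R w -> U (w / 2) = V w / 2 /\ V (w / 2) = U w.
  move=> wu; have [d s] := shift_half0 wu; rewrite /V /odd_digits s; split=> //.
  by rewrite /U even_digitsE d s mulr0 add0r mulrC.
have E1 w : @unit_itv R w -> U ((w + 1) / 2) = (1 + V w) / 2 /\ V ((w + 1) / 2) = U w.
  move=> wu; have [d s] := shift_half1 wu; rewrite /V /odd_digits s; split=> //.
  by rewrite /U even_digitsE d s mulr1 mulrDl mul1r [_ / 2]mulrC.
congr (_ * _ + _ * _)%E; apply: unif_eq; apply/seteqP; split => w /= [+ wu].
- by have [-> ->] := E0 w wu => -[h1 h2]; split => //; split => //; lra.
- by have [-> ->] := E0 w wu => -[h1 h2]; split => //; split => //; lra.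
- by have [-> ->] := E1 w wu => -[h1 h2]; split => //; split => //; lra.
- by have [-> ->] := E1 w wu => -[h1 h2]; split => //; split => //; lra.
Qed.

Let fin_joint x y : joint x y = (fine (joint x y))%:E.
Proof. by rewrite fineK// fin_num_measure. Qed.

Let joint01 x y : 0 <= fine (joint x y) <= 1.
Proof.
rewrite -!lee_fin -fin_joint measure_ge0/=; exact: probability_le1.
Qed.

(* The recursion halves the supremum of |f|, because one of 2 z and 2 z - 1 lies
   outside [0, 1[. *)
Lemma half_contraction (f : R -> R -> R) : (forall x y, `|f x y| <= 1) ->
  (forall x y, exists x' z, f x y = 2^-1 * f x' (2 * z) + 2^-1 * f x' (2 * z - 1)) ->
  (forall x y, y < 0 -> f x y = 0) -> (forall x y, 1 <= y -> f x y = 0) ->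
  forall x y, f x y = 0.
Proof.
move=> f1 frec f0 f1' x y.
have key n : forall x y, `|f x y| <= 2^-1 ^+ n.
  elim: n => [|n ih] a b; first by rewrite expr0.
  have [a' [c ->]] := frec a b; rewrite exprS; have [c1|c1] := ltP (2 * c) 1.
    rewrite (f0 a' (2 * c - 1)); last lra.
    by rewrite mulr0 addr0 normrM ger0_norm// ler_wpM2l.
  by rewrite (f1' a' (2 * c))// mulr0 add0r normrM ger0_norm// ler_wpM2l.
apply/eqP; rewrite -normr_le0; apply/ler_addgt0Pr => e e0; rewrite add0r.
have h : (fun n => (2^-1 : R) ^+ n) @ \oo --> (0 : R) by apply: cvg_expr; rewrite ger0_norm// invf_lt1// ltr1n.
have /cvgrPdist_lt/(_ _ e0)[n _ hn] := h.
have := hn n (leqnn _); rewrite /= sub0r normrN ger0_norm ?exprn_ge0// => hn'.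
exact: le_trans (key n x y) (ltW hn').
Qed.

Lemma even_digits_ray x : unif [set w | x < U w] = (tail_unif x)%:E.
Proof.
have E z y : y < 0 -> [set w | z < U w /\ y < V w] = [set w | z < U w].
  move=> y0; apply/seteqP; split => w /=; first by case.
  by move=> zU; split => //; apply: lt_le_trans y0 _; have /andP[] := even_digits_itv (shift w).
(* U and V have the same law: V is U after the doubling map, which preserves the uniform law. A
   negative argument makes its constraint void. *)
have E' y z : y < 0 -> joint y z = joint z y.
  move=> y0; rewrite /joint (E z y y0) (_ : [set w | y < U w /\ _] = shift @^-1` [set w | z < U w]); last first.
    apply/seteqP; split => w /=; first by case.
    by move=> zU; split => //; apply: lt_le_trans y0 _; have /andP[] := even_digits_itv w.
  have mA : measurable ([set w | z < U w] : set T) by have := mUV z y; rewrite E.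
  rewrite unif_halves; last first.
    by rewrite -[X in measurable X]setTI; exact: measurable_shift.
  rewrite (_ : unif [set w | _] = unif [set w | z < U w]); last first.
    by apply: unif_eq; apply/seteqP; split => w /= [+ wu]; have [_ ->] := shift_half0 wu.
  rewrite (_ : unif [set w | (shift @^-1` _) ((w + 1) / 2)] = unif [set w | z < U w]); last first.
    by apply: unif_eq; apply/seteqP; split => w /= [+ wu]; have [_ ->] := shift_half1 wu.
  have : unif [set w | z < U w] \is a fin_num by rewrite fin_num_measure.
  by case: (unif _) => // r _; rewrite -!EFinM -EFinD; congr EFin; lra.
(* The first argument is a dummy, and -1 makes the constraint on V void. *)
pose f (a b : R) := fine (joint b (-1)) - tail_unif b.
have f0 : forall a b, f a b = 0.
  apply: half_contraction => [a b|a b|a b b0|a b b1]; rewrite /f.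
  - have := joint01 b (-1); have := tail_unif_ge0 b; have := tail_unif_le1 b.
    by rewrite ler_norml; lra.
  - exists a, b; have m1 : (-1 : R) < 0 by rewrite ltrN10.
    rewrite [tail_unif b]tail_unif_half joint_half (E' (-1) (2 * b) m1) (E' (-1) (2 * b - 1) m1).
    rewrite (fin_joint (2 * b) (-1)) (fin_joint (2 * b - 1) (-1)) -!EFinM -EFinD /=.
    by lra.
  - rewrite /tail_unif b0 (_ : joint b (-1) = 1%E) ?subrr// /joint.
    rewrite (_ : [set w | _] = setT) ?unifT//; apply/seteqP; split => // w _ /=; split.
      by apply: lt_le_trans b0 _; have /andP[] := even_digits_itv w.
    by apply: (@lt_le_trans _ _ 0); [rewrite ltrN10|have /andP[] := even_digits_itv (shift w)].
  - rewrite /tail_unif; have -> : (b < 0) = false by apply/negbTE; rewrite -leNgt; lra.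
    have -> : (b < 1) = false by apply/negbTE; rewrite -leNgt.
    rewrite subr0 /joint (_ : [set w | _] = set0) ?measure0//; apply/seteqP; split => // w /= [bU _].
    have /andP[_ U1] := even_digits_itv w.
    by have := lt_le_trans bU (le_trans U1 b1); rewrite ltxx.
have m1 : (-1 : R) < 0 by rewrite ltrN10.
by rewrite -(E _ _ m1) -/(joint x (-1)) fin_joint; congr EFin; have := f0 0 x; rewrite /f; lra.
Qed.

(** The product of the marginal tails satisfies the same self-similarity equation as the joint tail
    and agrees with it when y is outside [0, 1[, so the contraction forces equality. *)
Lemma digits_rays x y : unif [set w | x < U w /\ y < V w] = (tail_unif x * tail_unif y)%:E.
Proof.
pose f (a b : R) := fine (joint a b) - tail_unif a * tail_unif b.
have f0 : forall a b, f a b = 0.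
  apply: half_contraction => [a b|a b|a b b0|a b b1]; rewrite /f.
  - have /andP[? ?] := joint01 a b; have ? := tail_unif_ge0 b; have ? := tail_unif_le1 b.
    have ? := tail_unif_ge0 a; have ? := tail_unif_le1 a.
    have : 0 <= tail_unif a * tail_unif b <= 1 by apply/andP; split; nra.
    by move=> /andP[? ?]; rewrite ler_norml; apply/andP; split; lra.
  - exists b, a; rewrite [tail_unif a]tail_unif_half joint_half.
    rewrite (fin_joint b (2 * a)) (fin_joint b (2 * a - 1)) -!EFinM -EFinD /=.
    by lra.
  - rewrite {2}/tail_unif b0 mulr1 /joint (_ : [set w | _] = [set w | a < U w]).
      by rewrite even_digits_ray subrr.
    apply/seteqP; split => w /=; first by case.
    by move=> aU; split => //; apply: lt_le_trans b0 _; have /andP[] := even_digits_itv (shift w).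
  - rewrite {2}/tail_unif; have -> : (b < 0) = false by apply/negbTE; rewrite -leNgt; lra.
    have -> : (b < 1) = false by apply/negbTE; rewrite -leNgt.
    rewrite mulr0 subr0 /joint (_ : [set w | _] = set0) ?measure0//; apply/seteqP; split => // w /= [_ bU].
    have /andP[_ U1] := even_digits_itv (shift w).
    by have := lt_le_trans bU (le_trans U1 b1); rewrite ltxx.
by rewrite -/(joint x y) fin_joint; congr EFin; have := f0 x y; rewrite /f; lra.
Qed.

Lemma digits_rectangle (A B : set T) : measurable A -> measurable B ->
  unif (U @^-1` A `&` V @^-1` B) = (unif A * unif B)%E.
Proof.
move=> mA mB.
have pre (W : T -> T) (D : set T) : measurable_fun setT W -> measurable D -> measurable (W @^-1` D).
  by move=> mW mD; rewrite -[X in measurable X]setTI; exact: mW.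
have mU : measurable_fun setT (U : T -> T) by exact: measurable_even_digits.
have mV : measurable_fun setT (V : T -> T) by exact: measurable_odd_digits.
have mray y : measurable (`]y, +oo[%classic : set T) by exact: measurable_itv.
have ray1 y : unif (U @^-1` A `&` V @^-1` `]y, +oo[) = (unif A * (tail_unif y)%:E)%E.
  pose m1 : {measure set T -> \bar R} := image_measure (mrestr unif (pre V _ mV (mray y))) mU.
  pose m2 : {measure set T -> \bar R} := mscale (NngNum (tail_unif_ge0 y)) unif.
  have h : m1 A = m2 A.
    apply: measure_eq_on_rays mA.
      rewrite /m1 -[X in (X < _)%E]/(unif (U @^-1` setT `&` V @^-1` `]y, +oo[)).
      apply: le_lt_trans (probability_le1 _ _) (ltry _).
      by apply: measurableI; [exact (pre _ _ mU measurableT)|exact (pre _ _ mV (mray y))].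
    move=> x; rewrite -[LHS]/(unif (U @^-1` `]x, +oo[ `&` V @^-1` `]y, +oo[)).
    rewrite -[RHS]/((tail_unif y)%:E * unif `]x, +oo[%classic)%E unif_ray -EFinM mulrC -digits_rays.
    by congr unif; apply/seteqP; split => w /=; rewrite !in_itv/= !andbT.
  by rewrite -[LHS]/(m1 A) h muleC.
pose m1 : {measure set T -> \bar R} := image_measure (mrestr unif (pre U _ mU mA)) mV.
have nng : 0 <= fine (unif A) by rewrite fine_ge0.
pose m2 : {measure set T -> \bar R} := mscale (NngNum nng) unif.
have fA : unif A = (fine (unif A))%:E by rewrite fineK// fin_num_measure.
have h : m1 B = m2 B.
  apply: measure_eq_on_rays mB.
    rewrite /m1 -[X in (X < _)%E]/(unif (V @^-1` setT `&` U @^-1` A)).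
    apply: le_lt_trans (probability_le1 _ _) (ltry _).
    by apply: measurableI; [exact (pre _ _ mV measurableT)|exact (pre _ _ mU mA)].
  move=> y; rewrite -[LHS]/(unif (V @^-1` `]y, +oo[ `&` U @^-1` A)) setIC ray1.
  by rewrite -[RHS]/((fine (unif A))%:E * unif `]y, +oo[%classic)%E -fA unif_ray.
by rewrite setIC -[LHS]/(m1 B) h -[LHS]/((fine (unif A))%:E * unif B)%E -fA.
Qed.

Lemma digits_fubini (F : T * T -> R) (M : R) : measurable_fun setT F -> (forall p, `|F p| <= M) ->
  \int[unif]_w F (U w, V w) = \int[unif]_v \int[unif]_u F (u, v).
Proof.
move=> mF FM.
have mU : measurable_fun setT (U : T -> T) by exact: measurable_even_digits.
have mV : measurable_fun setT (V : T -> T) by exact: measurable_odd_digits.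
have mUV' : measurable_fun setT (fun w : T => (U w, V w)) by apply/measurable_fun_pairP.
have law (X : set (T * T)) : measurable X -> (unif \x unif)%E X = unif ((fun w => (U w, V w)) @^-1` X).
  move=> mX.
  pose m' := @image_measure _ _ T (T * T)%type R unif _ mUV'.
  have h := @product_measure_unique _ _ T T R unif unif m' _ X mX.
  by apply: h => A B mA mB; exact: (digits_rectangle mA mB).
have mFUV : measurable_fun setT (fun w : T => F (U w, V w)) by exact: (measurableT_comp mF mUV').
rewrite -(@equal_law_integral R _ _ _ _ (unif \x unif)%E unif F (fun w => F (U w, V w)) mF mFUV _ idfun) //; last 2 first.
- move=> B mB; apply: law; rewrite -[X in measurable X]setTI; exact: mF.
- exact: measurable_id.
have [h1 h2] := bounded_fubini unif unif mF FM; exact: (etrans h1 h2).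
Qed.

End digits.

(** * Quantile transform *)

Section quantile.
Variables (R : realType) (P : probability (measurableTypeR R) R).
Local Notation T := (measurableTypeR R).

Let t (x : R) : R := fine (P `]x, +oo[%classic).

(** A generalized inverse of the tail, hence nonincreasing on ]0, 1[. The value outside that
    interval concerns a null set. *)
Definition tail_quantile (u : R) : R := if 0 < u < 1 then inf [set x | t x <= u] else 0.

Let idR : T -> R := idfun.

#[local] HB.instance Definition _ :=
  @isMeasurableFun.Build _ _ _ _ idR (@measurable_id _ _ setT).

Let ccdfE (x : R) : ccdf (idR : {RV P >-> R}) x = (t x)%:E.
Proof.
rewrite /ccdf /distribution /pushforward /t fineK//; by rewrite fin_num_measure.
Qed.

Let t_le x y : x <= y -> t y <= t x.
Proof. by move=> xy; rewrite -lee_fin -!ccdfE; exact: ccdf_nonincreasing. Qed.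

(** The Galois connection between a monotone function and its generalized inverse; the implication
    from right to left uses the right-continuity of the tail. *)
Lemma tail_quantileE u x : 0 < u < 1 -> (x < tail_quantile u) = (u < t x).
Proof.
move=> u01; rewrite /tail_quantile u01; move/andP: u01 => [u0 u1].
have ccdf_cvg (F : set_system R) (FF : Filter F) (l : R) :
    ccdf (idR : {RV P >-> R}) z @[z --> F] --> l%:E -> t z @[z --> F] --> l.
  move=> h; have := @fine_cvg _ _ F FF _ _ h.
  by rewrite (_ : fine \o _ = t)//; apply/funext => z /=; rewrite ccdfE.
have [a ta] : exists a, t a <= u.
  have h : t z @[z --> +oo] --> (0 : R) by apply: ccdf_cvg; exact: cvg_ccdfy0.
  have [a] := filter_ex (cvgr_lt _ h _ u0).
  by exists a; exact: ltW.
have [b tb] : exists b, u < t b.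
  have h : t z @[z --> -oo] --> (1 : R) by apply: ccdf_cvg; exact: cvg_ccdfNy1.
  by have [b] := filter_ex (cvgr_gt _ h _ u1); exists b.
have lb z y : u < t z -> t y <= u -> z <= y.
  move=> uz ty; rewrite leNgt; apply/negP => yz.
  by have := lt_le_trans uz (le_trans (t_le (ltW yz)) ty); rewrite ltxx.
apply/idP/idP => [xq|utx].
  rewrite ltNge; apply/negP => tx.
  have : inf [set x | t x <= u] <= x by apply: ge_inf => //; exists b => y; exact: lb.
  by move=> /(lt_le_trans xq); rewrite ltxx.
have h : t z @[z --> x^'+] --> t x.
  by apply: ccdf_cvg; rewrite -ccdfE; exact: ccdf_right_continuous.
have [z [xz tz]] := filter_ex (filterI (nbhs_right_gt x) (cvgr_gt _ h _ utx)).
apply: (lt_le_trans xz); apply: lb_le_inf; first by exists a.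
by move=> y; exact: lb.
Qed.

Lemma measurable_tail_quantile : measurable_fun setT (tail_quantile : T -> T).
Proof.
apply: (measurability _ (RGenOInfty.measurableE R)) => _ [_ [x ->] <-]; rewrite setTI.
have mray : measurable (`]-oo, (t x)[%classic : set T) by exact: measurable_itv.
rewrite (_ : _ @^-1` _ = (@unit_itv R `&` `]-oo, (t x)[%classic) `|` (~` @unit_itv R `&` [set _ | x < 0])).
  apply: measurableU; first by apply: measurableI => //; exact: measurable_unit_itv.
  apply: measurableI; first by apply: measurableC; exact: measurable_unit_itv.
  have [x0|x0] := boolP (x < 0); first by rewrite (_ : [set _ | _] = setT)//; apply/seteqP; split.
  by rewrite (_ : [set _ | _] = set0)//; apply/seteqP; split => // y /=; rewrite (negbTE x0).
have unitE u : @unit_itv R u <-> 0 < u < 1 by rewrite /unit_itv /= in_itv.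
apply/seteqP; split => u /=; rewrite !in_itv/= ?andbT.
  move=> xq; have [u01|u01] := boolP (0 < u < 1).
    by left; split; [exact/unitE|rewrite -tail_quantileE].
  by right; split; [move/unitE; exact/negP|move: xq; rewrite /tail_quantile (negbTE u01)].
move=> [[/unitE u01]|[nu x0]]; first by rewrite tail_quantileE.
rewrite /tail_quantile ifN//; apply/negP => u01; exact: nu.
Qed.

Lemma tail_quantile_law (B : set T) : measurable B -> unif (tail_quantile @^-1` B) = P B.
Proof.
move=> mB; rewrite -[LHS]/(image_measure (@unif R) measurable_tail_quantile B).
apply: measure_eq_on_rays mB => [|x].
  exact: le_lt_trans (probability_le1 (@unif R) measurableT) (ltry _).
rewrite -[LHS]/(unif (tail_quantile @^-1` `]x, +oo[%classic)).
have tx1 : t x <= 1 by rewrite -lee_fin -ccdfE; exact: probability_le1.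
have tx0 : 0 <= t x by rewrite fine_ge0.
rewrite /unif /mrestr (_ : _ `&` _ = `]0, (t x)[%classic).
  rewrite lebesgue_measure_itv/= lte_fin oppr0 adde0.
  have tE : (t x)%:E = P `]x, +oo[%classic by rewrite /t fineK// fin_num_measure.
  by move: tx0; rewrite le_eqVlt => /predU1P[t0|->//]; rewrite -tE -t0 ltxx.
apply/seteqP; split => u /=; rewrite /unit_itv /= !in_itv/= ?andbT.
  by move=> [+ u01]; rewrite tail_quantileE// => ->; case/andP: u01 => ->.
move=> /andP[u0 ut]; have u1 := lt_le_trans ut tx1.
by rewrite u0 u1 tail_quantileE ?u0 ?u1.
Qed.

Lemma tail_quantile_integral (f : R -> R) : measurable_fun setT (f : T -> T) ->
  \int[unif (R := R)]_u f (tail_quantile u) = \int[P]_x f x.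
Proof.
move=> mf; apply: (@equal_law_integral R _ _ T T (@unif R) P tail_quantile idfun) => //.
- exact: measurable_tail_quantile.
- exact: measurable_id.
- by move=> B mB; exact: (@tail_quantile_law B mB).
Qed.

End quantile.

(** * Cosine transforms of a sequence of normal variables *)

Section independent_normals.
Variable R : realType.
Local Notation T := (measurableTypeR R).
Local Notation unif := (@unif R).

Let N01 : probability T R := normal_prob 0 1.

Lemma measurable_cos_affine (a th : R) : measurable_fun setT (fun x : T => cos (a * x + th) : T).
Proof.
apply: (@measurableT_comp _ _ _ T T T (cos : T -> T)).
  by apply: continuous_measurable_fun; exact: continuous_cos.
by apply: measurable_funD => //; apply: measurable_funM.
Qed.

(** The moment method applied to a constant sequence, in place of a computation of the Fourier
    integral. *)
Lemma normal_prob_cos_affine (s a th : R) : s != 0 ->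
  \int[normal_prob 0 s]_x cos (a * x + th) = cos th * expR (- (a ^+ 2 * s ^+ 2) / 2).
Proof.
move=> s0; pose Ns : probability T R := normal_prob 0 s.
have mX k : measurable_fun setT (fun x : T => (x ^+ k) : T) by exact: measurable_funX.
have iX k : Ns.-integrable setT (EFin \o (fun x : T => x ^+ k)).
  apply: integrable_normal_prob => //; have := normal_pdf_moment_integrable 0 s0 k.
  by apply: eq_integrable => //= x _; rewrite subr0.
have h : (fun _ : nat => \int[Ns]_x cos (a * x + th)) @ \oo --> cos th * expR (- (a ^+ 2 * s ^+ 2) / 2).
  apply: (@moments_cvg_cos R _ T Ns (fun _ (x : T) => a * x) (a ^+ 2 * s ^+ 2) th) => [n|n k|k].
  - by apply: measurable_funM.
  - rewrite (_ : EFin \o _ = fun x : T => ((a ^+ k)%:E * (x ^+ k)%:E)%E); last first.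
      by apply/funext => x /=; rewrite exprMn EFinM.
    exact: (integrableZl measurableT (a ^+ k) (iX k)).
  - rewrite (_ : (fun _ : nat => _) = fun _ => gauss_moment (a ^+ 2 * s ^+ 2) k); first exact: cvg_cst.
    apply/funext => _; rewrite gauss_moment_scale -(normal_pdf_moment 0 s0 k).
    rewrite (@eq_Rintegral _ _ _ Ns setT (fun x : T => a ^+ k * x ^+ k)); last first.
      by move=> x _; rewrite exprMn.
    rewrite (RintegralZl (a ^+ k) measurableT (iX k)).
    rewrite (integral_normal_prob (mX k) (iX k)).
    by congr (_ * _); apply: eq_Rintegral => x _; rewrite subr0.
exact: (cvg_unique _ (@cvg_cst _ _ _ _ _) h).
Qed.

Lemma standard_normal_cos (a th : R) :
  \int[N01]_x cos (a * x + th) = cos th * expR (- a ^+ 2 / 2).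
Proof. by rewrite normal_prob_cos_affine ?oner_eq0// expr1n mulr1. Qed.

(** The n-th variable reads the even digits of what remains after passing n times to the odd digits,
    so that the variables use disjoint sets of digits. *)
Definition std_normal (n : nat) (w : R) : R := tail_quantile N01 (even_digits (iter n (@odd_digits R) w)).

Lemma measurable_std_normal n : measurable_fun setT (std_normal n : T -> T).
Proof.
apply: (measurableT_comp (measurable_tail_quantile N01)).
apply: (measurableT_comp (@measurable_even_digits R)).
elim: n => [|n ih]; first exact: measurable_id.
exact: (measurableT_comp (@measurable_odd_digits R) ih).
Qed.

Lemma measurable_normal_sum (a : nat -> R) N :
  measurable_fun setT ((fun w => \sum_(n < N) a n * std_normal n w) : T -> T).
Proof. by apply: measurable_sum => n; apply: measurable_funM => //; exact: measurable_std_normal. Qed.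

(** The first variable depends on the even digits and all others on the odd ones; Fubini integrates
    the first one out as a factor exp (- a_0^2 / 2). *)
Lemma std_normals_cos N (a : nat -> R) (th : R) :
  \int[unif]_w cos (\sum_(n < N) a n * std_normal n w + th) =
  cos th * expR (- (\sum_(n < N) a n ^+ 2) / 2).
Proof.
elim: N a th => [|N ih] a th.
  rewrite (@eq_Rintegral _ _ _ unif setT (fun=> cos th)); last by move=> w _; rewrite big_ord0 add0r.
  rewrite Rintegral_cst// big_ord0 oppr0 mul0r expR0; congr (_ * _).
  by rewrite -[LHS]/(fine (unif setT)) unifT.
pose S (v : T) := \sum_(n < N) a n.+1 * std_normal n v.
have mS : measurable_fun setT (S : T -> T) by exact: (measurable_normal_sum (fun n => a n.+1)).
pose F (p : T * T) := cos (a 0 * tail_quantile N01 p.1 + (S p.2 + th)).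
have mcos (d : measure_display) (D : measurableType d) (g : D -> T) :
    measurable_fun setT g -> measurable_fun setT (fun x => cos (g x) : T).
  move=> mg; apply: (measurableT_comp _ mg); apply: continuous_measurable_fun; exact: continuous_cos.
have mF : measurable_fun setT F.
  apply: mcos; apply: measurable_funD.
    apply: measurable_funM => //.
    exact: (measurableT_comp (measurable_tail_quantile N01) measurable_fst).
  by apply: measurable_funD => //; exact: (measurableT_comp mS measurable_snd).
have FM p : `|F p| <= 1 by rewrite ler_norml cos_geN1 cos_le1.
have := digits_fubini mF FM; rewrite /F /=.
under [in X in X = _ -> _]eq_Rintegral => w _.
  rewrite addrA (_ : _ + S _ = \sum_(n < N.+1) a n * std_normal n w); last first.
    rewrite big_ord_recl /=; congr (_ + _); apply: eq_bigr => n _.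
    by rewrite /std_normal /= -iterSr.
  over.
move=> ->.
rewrite (@eq_Rintegral _ _ _ unif setT (fun v => expR (- a 0 ^+ 2 / 2) * cos (S v + th))); last first.
  move=> v _; rewrite mulrC -standard_normal_cos.
  by rewrite (tail_quantile_integral N01 (measurable_cos_affine (a 0) (S v + th))).
rewrite RintegralZl//; last first.
  apply: (@integrable_bdd _ T R unif _ 1); first by apply: mcos; exact: measurable_funD.
  by move=> x; rewrite ler_norml cos_geN1 cos_le1.
rewrite [X in _ * X](ih (fun n => a n.+1)) mulrCA -expRD big_ord_recl; congr (_ * expR _).
by rewrite opprD mulrDl.
Qed.

(** 2 m^2 (1 - cos (Y / m)) tends to Y^2, and its expectation 2 m^2 (1 - exp (- s / (2 m^2))) is at
    most s; Fatou's lemma concludes, before Y^2 is known to be integrable. *)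
Lemma second_moment_of_cos (d : measure_display) (D : measurableType d) (P : probability D R)
    (Y : D -> R) (s : R) : measurable_fun setT Y ->
  (forall u : R, \int[P]_w cos (u * Y w) = expR (- (u ^+ 2 * s) / 2)) ->
  (\int[P]_w (Y w ^+ 2)%:E <= s%:E)%E.
Proof.
move=> mY Ycos.
pose f (n : nat) w := 2 * n.+1%:R ^+ 2 * (1 - cos (n.+1%:R^-1 * Y w)).
have mf n : measurable_fun setT (f n).
  apply: measurable_funM => //; apply: measurable_funB => //.
  apply: (@measurableT_comp _ _ _ _ T T (cos : T -> T)); first by apply: continuous_measurable_fun; exact: continuous_cos.
  exact: measurable_funM.
have c2 (n : nat) : 0 <= 2 * n.+1%:R ^+ 2 :> R by rewrite mulr_ge0// exprn_ge0.
apply: (@fatou_bound _ D R P f _ _ 0 mf) => [n x|x|n _].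
- by rewrite mulr_ge0// subr_ge0 cos_le1.
- have : f n x - Y x ^+ 2 @[n --> \oo] --> (0 : R).
    (* The Taylor bound of order 3 leaves an error |Y|^3 / (3 m). *)
    apply: (@cvg0_le _ _ (fun n => `|Y x| ^+ 3 / 3 * n.+1%:R^-1)).
      move=> n; have := cos_taylor_bound 3 0 (n.+1%:R^-1 * Y x).
      rewrite addr0 /cos_taylor !big_ord_recr big_ord0 /= /cos_coef !add0r mulr0n mulr1n cos0 cos_pihalf.
      rewrite (_ : pi / 2 *+ 2 = pi); last by rewrite -mulr_natr; field.
      rewrite cospi mul0r addr0 expr0 divr1 mulr1 !factS fact0 /f => h.
      set m : R := n.+1%:R in h *; set y := Y x in h *.
      have m0 : 0 < m by rewrite /m ltr0n.
      have -> : 2 * m ^+ 2 * (1 - cos (m^-1 * y)) - y ^+ 2 =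
          - (2 * m ^+ 2) * (cos (m^-1 * y) - (1 + -1 * ((m^-1 * y) ^+ 2 / (2 * (1 * 1))%N%:R))).
        by rewrite !mul1n exprMn exprVn; field; rewrite gt_eqF.
      rewrite normrM normrN (ger0_norm (c2 n)).
      have -> : `|y| ^+ 3 / 3 / m = 2 * m ^+ 2 * (`|m^-1 * y| ^+ 3 / (3 * (2 * (1 * 1)))%N%:R).
        rewrite !mul1n normrM exprMn (ger0_norm (ltW _)) ?invr_gt0//; field; rewrite gt_eqF//.
      by apply: ler_wpM2l; [exact: c2|exact: h].
    rewrite -[X in _ --> X](mulr0 (`|Y x| ^+ 3 / 3)); apply: cvgM; first exact: cvg_cst.
    exact: cvg_harmonic.
  move=> h; have h2 : (f n x - Y x ^+ 2) + Y x ^+ 2 @[n --> \oo] --> 0 + Y x ^+ 2.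
    by apply: cvgD => //; exact: cvg_cst.
  by rewrite add0r in h2; under eq_fun do rewrite -[f _ x](subrK (Y x ^+ 2)).
- have icos : P.-integrable setT (EFin \o (fun w => cos (n.+1%:R^-1 * Y w))).
    apply: (@integrable_bdd _ _ _ _ _ 1).
      apply: (@measurableT_comp _ _ _ _ T T (cos : T -> T)); first by apply: continuous_measurable_fun; exact: continuous_cos.
      exact: measurable_funM.
    by move=> w; rewrite ler_norml cos_geN1 cos_le1.
  have i1 : P.-integrable setT (EFin \o (fun w : D => 1 : R)).
    by apply: (@integrable_bdd _ _ _ _ _ 1) => // w; rewrite normr1.
  have i2 : P.-integrable setT (EFin \o (fun w => 1 - cos (n.+1%:R^-1 * Y w))).
    exact: (@integrableB _ _ _ P setT measurableT _ _ i1 icos).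
  have i3 : P.-integrable setT (EFin \o f n) by exact: (integrableZl measurableT (2 * n.+1%:R ^+ 2) i2).
  rewrite -[X in (X <= _)%E]fineK ?integrable_fin_num// lee_fin -[X in X <= _]/(\int[P]_w f n w).
  rewrite /f RintegralZl// RintegralB// Ycos Rintegral_cst// -[fine _]/(fine (P setT)) probability_setT mulr1.
  have := expR_ge1Dx (- (n.+1%:R^-1 ^+ 2 * s) / 2).
  set m : R := n.+1%:R; set E := expR _ => h.
  have -> : s = 2 * m ^+ 2 * (m^-1 ^+ 2 * s / 2).
    have : m != 0 by rewrite pnatr_eq0.
    by clear; clearbody m; rewrite exprVn => m0; field.
  by apply: ler_wpM2l => //; [exact: c2|by rewrite mulNr in h; rewrite lerBlDr -lerBlDl].
Qed.

End independent_normals.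

(** * Gaussian laws on L^2([0,1]) *)

Section image_law.
Context {R : realType} {d1 d2 : measure_display} {D1 : measurableType d1} {D2 : measurableType d2}.
Variables (P : probability D1 R) (X : D1 -> D2).
Hypothesis mX : measurable_fun setT X.

Definition law_of : set D2 -> \bar R := image_measure P mX.

HB.instance Definition _ := Measure.on law_of.

Let law_ofT : law_of setT = 1%E.
Proof. exact: probability_setT. Qed.

HB.instance Definition _ := Measure_isProbability.Build _ _ R law_of law_ofT.

Lemma law_of_integral (f : D2 -> R) : measurable_fun setT f ->
  \int[law_of]_y f y = \int[P]_w f (X w).
Proof.
move=> mf; have mfX : measurable_fun setT (fun w => f (X w)) by exact: (measurableT_comp mf mX).
have mid : measurable_fun setT (idfun : measurableTypeR R -> measurableTypeR R) by exact: measurable_id.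
exact: (@equal_law_integral R _ _ D2 D1 law_of P f (fun w => f (X w)) mf mfX _ idfun mid).
Qed.

End image_law.

(** * Expansions in a Gram-Schmidt system *)

Section gram_schmidt_expansion.
Variables (R : realType) (V : lmodType R) (B : V -> V -> R).
Hypothesis Bsym : forall f g, B f g = B g f.
Hypothesis BD : forall f g h, B (f + g) h = B f h + B g h.
Hypothesis BZ : forall a f g, B (a *: f) g = a * B f g.
Hypothesis Bpos : forall f, 0 <= B f f.
Variables (g e : nat -> V).
Hypothesis oe : orthosystem B e.
Hypothesis ge : forall n, B (g n - \sum_(k < n.+1) B (g n) (e k) *: e k)
              (g n - \sum_(k < n.+1) B (g n) (e k) *: e k) = 0.

Let expand n f : B (g n) f = \sum_(k < n.+1) B (g n) (e k) * B (e k) f.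
Proof.
have r0 : B (g n - \sum_(k < n.+1) B (g n) (e k) *: e k) f = 0.
  by apply: (psd_null Bsym BD BZ Bpos); exact: ge.
move: r0; rewrite BD -scaleN1r BZ mulN1r (@psd_suml R V B BD BZ) => /eqP; rewrite subr_eq0 => /eqP ->.
by apply: eq_bigr => k _; rewrite BZ.
Qed.

Lemma gram_schmidt_coef0 n j : (n < j)%N -> B (g n) (e j) = 0.
Proof.
move=> nj; rewrite expand big1// => k _; rewrite oe.1 ?mulr0// ltn_eqF//.
exact: leq_trans (ltn_ord k) nj.
Qed.

Lemma gram_schmidt_expand n N f : (n < N)%N -> B (g n) f = \sum_(k < N) B (g n) (e k) * B (e k) f.
Proof.
move=> nN; rewrite expand -(big_mkord xpredT (fun k => B (g n) (e k) * B (e k) f)).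
rewrite -[in RHS](big_mkord xpredT (fun k => B (g n) (e k) * B (e k) f)) (@big_cat_nat _ _ _ n.+1 0 N)//=.
rewrite [X in _ = _ + X]big_nat_cond [X in _ = _ + X]big1 ?addr0// => k /andP[/andP[nk _] _].
by rewrite gram_schmidt_coef0 ?mul0r.
Qed.

(** f lies in the span of the first N generators, whose residuals are null for the form; hence the
    finite sum is exact. *)
Lemma gram_schmidt_parseval N (c : nat -> R) (f := \sum_(n < N) c n *: g n) :
  B f f = \sum_(k < N) B f (e k) ^+ 2.
Proof.
rewrite {1}/f (@psd_suml R V B BD BZ).
under eq_bigr => n _ do rewrite BZ (gram_schmidt_expand f (ltn_ord n)) mulr_sumr.
rewrite exchange_big /=; apply: eq_bigr => k _.
have Bf : B f (e k) = \sum_(n < N) c n * B (g n) (e k).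
  by rewrite /f (@psd_suml R V B BD BZ); apply: eq_bigr => n _; rewrite BZ.
rewrite expr2 {1}Bf mulr_suml; apply: eq_bigr => n _.
by rewrite (Bsym (e k)) mulrA.
Qed.

End gram_schmidt_expansion.

(** * Borel measurability from coordinates *)

Section borel.
Variable R : realType.
Local Notation L2 := (L2 R).
Variable e : nat -> L2.
Hypothesis oe : orthosystem (@L2inner R) e.
Hypothesis te : forall f : L2, L2norm (f - proj e n f) @[n --> \oo] --> (0 : R).

Lemma norm_proj_cvg f : \sum_(k < n) L2inner f (e k) ^+ 2 @[n --> \oo] --> L2norm f ^+ 2.
Proof.
under eq_fun do rewrite -(norm_proj oe) expr2; rewrite expr2.
have h : L2norm (proj e n f) @[n --> \oo] --> L2norm f.
  have tf : L2norm (proj e n f - f) @[n --> \oo] --> (0 : R).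
    by under eq_fun do rewrite -opprB L2normN; exact: te.
  exact: (L2_continuous_cvg (@L2norm_continuous R) tf).
exact: cvgM.
Qed.

Let rat_comb (s : seq rat) : L2 := \sum_(i < size s) (ratr s`_i : R) *: e i.

Let rat_comb_dense f (r : R) : 0 < r -> exists s, L2norm (f - rat_comb s) < r.
Proof.
move=> r0; have r20 : 0 < r / 2 by rewrite divr_gt0.
have /cvgrPdist_lt/(_ _ r20)[N _ hN] := te f.
have := hN N (leqnn N); rewrite /= sub0r normrN ger0_norm ?L2norm_ge0// => fN.
have dN : 0 < r / 2 / N.+1%:R by rewrite divr_gt0.
have /choice [q qh] : forall i : nat, exists q : rat, L2inner f (e i) < ratr q < L2inner f (e i) + r / 2 / N.+1%:R.
  by move=> i; have [q] := @rat_in_itvoo R (L2inner f (e i)) (L2inner f (e i) + r / 2 / N.+1%:R) ltac:(rewrite ltrDl//);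
    rewrite in_itv /=; exists q.
exists (mkseq q N); rewrite /rat_comb size_mkseq.
rewrite (_ : f - _ = (f - proj e N f) + (\sum_(i < N) (L2inner f (e i) - ratr (q i)) *: e i)); last first.
  rewrite -addrA; congr (f + _).
  rewrite /proj -!sumrN -big_split; apply: eq_bigr => i _ /=.
  by rewrite nth_mkseq// scalerBl addrA addNr add0r.
apply: (le_lt_trans (L2norm_triangle _ _)).
have -> : r = r / 2 + r / 2 by rewrite -splitr.
apply: ltr_leD => //.
apply: (le_trans (L2norm_sum _ _)).
apply: (@le_trans _ _ (\sum_(i < N) (r / 2 / N.+1%:R))).
  apply: ler_sum => i _; rewrite L2normZ -[X in _ <= X]mulr1; apply: ler_pM => //.
  - exact: L2norm_ge0.
  - move: (qh i); move: (L2inner f (e i)) (ratr (q i)) (r / 2 / N.+1%:R) => a b c /andP[? ?].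
    by rewrite ler_norml; apply/andP; split; lra.
  - apply: le_of_sqr; rewrite ?L2norm_ge0// L2normE expr1n.
    by have [->|->] := oe.2 i; rewrite ?L2inner0r.
rewrite sumr_const card_ord -[leLHS]mulr_natr -mulrA -[leRHS]mulr1; apply: ler_wpM2l; first exact: ltW.
by rewrite mulrC ler_pdivrMr// mul1r ler_nat.
Qed.

Context {d : measure_display} {D : measurableType d}.
Variable X : D -> L2.
Hypothesis mX : forall k, measurable_fun setT (fun w => L2inner (X w) (e k)).

(** The rational combinations of the [e i] are dense, so an open set is a countable union of balls
    centred at them with radii 1 / (p + 1). The squared distance to a fixed centre is a limit of
    finite sums over coordinates, hence measurable. *)
Lemma measurable_L2borel : measurable_fun setT (X : D -> L2borel R).
Proof.
have mball f r : measurable [set w | L2norm (f - X w) < r].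
  have mnorm : measurable_fun setT (fun w => L2norm (f - X w) ^+ 2).
    apply: (@measurable_fun_cvg _ _ R setT (fun n w => \sum_(k < n) L2inner (f - X w) (e k) ^+ 2)) => [n|w _].
      apply: measurable_sum => k; apply: measurable_funX.
      by under eq_fun do rewrite L2innerBl; exact: measurable_funB.
    exact: norm_proj_cvg.
  have [r0|r0] := leP r 0.
    rewrite (_ : [set w | _] = set0)//; apply/seteqP; split => // w /=.
    by move=> /lt_le_trans/(_ r0); rewrite ltNge L2norm_ge0.
  rewrite (_ : [set w | _] = (fun w => L2norm (f - X w) ^+ 2) @^-1` `]-oo, (r ^+ 2)[%classic).
    by rewrite -[X in measurable X]setTI; exact: mnorm.
  apply/seteqP; split => w /=; rewrite in_itv /= ltr_pXn2r// ?nnegrE ?L2norm_ge0// ltW//.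
apply: (@measurability _ _ D (L2borel R) setT X (@open L2) erefl) => _ [A oA <-]; rewrite setTI.
pose good (p : seq rat * nat) := `[< forall g, L2norm (rat_comb p.1 - g) < p.2.+1%:R^-1 -> A g >].
rewrite (_ : X @^-1` A = \bigcup_(p in [set p | good p]) [set w | L2norm (rat_comb p.1 - X w) < p.2.+1%:R^-1]).
  rewrite bigcup_mkcond; apply: countable_bigcupT_measurable; first exact: countableP.
  by move=> p; case: ifP.
apply/seteqP; split => [w Aw|w [p /asboolP gp]]; last exact: gp.
have /= [r /= r0 hr] : exists2 r : R, 0 < r & forall g, L2norm (X w - g) < r -> A g.
  have /nbhs_ballP[r /= r0 hr] : nbhs (X w : L2) A by exact: open_nbhs_nbhs.
  by exists r => // g; exact: hr.
pose m := Num.truncn (2 / r).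
(* Twice this radius stays below r, so a ball around a rational combination that contains [X w]
   remains in A. *)
have mr : m.+1%:R^-1 < r / 2.
  by rewrite -[X in _ < X]invrK ltf_pV2 ?posrE ?invr_gt0 ?divr_gt0// invfM invrK mulrC truncnS_gt.
have m0 : (0 : R) < m.+1%:R^-1 by rewrite invr_gt0.
have [s sX] := rat_comb_dense (X w) m0.
have sX' : L2norm (rat_comb s - X w) < m.+1%:R^-1 by rewrite -opprB L2normN.
exists (s, m) => //; apply/asboolP => g /= gs; apply: hr.
rewrite (_ : X w - g = (X w - rat_comb s) + (rat_comb s - g)); last by rewrite addrA subrK.
apply: (le_lt_trans (L2norm_triangle _ _)); rewrite (splitr r).
exact: ltrD (lt_trans sX mr) (lt_trans gs mr).
Qed.

End borel.

(** * Construction of the Gaussian law *)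

Section gaussian_element.
Variable R : realType.
Local Notation L2 := (L2 R).
Local Notation T := (measurableTypeR R).
Local Notation unif := (@unif R).
Variable C : L2 -> L2.
Hypothesis Csym : forall g h, L2inner (C g) h = L2inner (C h) g.
Hypothesis CD : forall f g h, L2inner (C (f + g)) h = L2inner (C f) h + L2inner (C g) h.
Hypothesis CZ : forall a g h, L2inner (C (a *: g)) h = a * L2inner (C g) h.
Hypothesis Cpos : forall h, 0 <= L2inner (C h) h.
Variables (e : nat -> L2) (K M : R).
Hypothesis oe : orthosystem (@L2inner R) e.
Hypothesis te : forall f : L2, L2norm (f - proj e n f) @[n --> \oo] --> (0 : R).
Hypothesis CK : forall h, L2norm (C h) <= K * L2norm h.
Hypothesis CM : forall N, \sum_(n < N) L2inner (C (e n)) (e n) <= M.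

Let quad_cvg h : L2inner (C (proj e n h)) (proj e n h) @[n --> \oo] --> L2inner (C h) h.
Proof.
have tf : L2norm (proj e n h - h) @[n --> \oo] --> (0 : R).
  by under eq_fun do rewrite -opprB L2normN; exact: te.
have K0 : 0 <= `|K| by [].
suff : L2inner (C (proj e n h)) (proj e n h) - L2inner (C h) h @[n --> \oo] --> (0 : R).
  move=> h0; have h2 : (L2inner (C (proj e n h)) (proj e n h) - L2inner (C h) h) + L2inner (C h) h
      @[n --> \oo] --> 0 + L2inner (C h) h by apply: cvgD => //; exact: cvg_cst.
  by rewrite add0r in h2; under eq_fun do rewrite -[L2inner _ _](subrK (L2inner (C h) h)).
apply: (@cvg0_le _ _ (fun n => L2norm (proj e n h - h) * (`|K| * (L2norm h + L2norm h)))) => [n|].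
  have -> : L2inner (C (proj e n h)) (proj e n h) - L2inner (C h) h =
      L2inner (proj e n h - h) (C (proj e n h) + C h).
    rewrite L2innerDr !L2innerBl !(L2innerC _ (C _)) (Csym h (proj e n h)); lra.
  apply: (le_trans (L2_cauchy_schwarz _ _)); apply: ler_wpM2l; first exact: L2norm_ge0.
  apply: (le_trans (L2norm_triangle _ _)); rewrite mulrDr.
  have CK' f : L2norm (C f) <= `|K| * L2norm f.
    by apply: (le_trans (CK f)); apply: ler_wpM2r; [exact: L2norm_ge0|exact: ler_norm].
  apply: lerD => //; apply: (le_trans (CK' _)); apply: ler_wpM2l => //.
  exact: norm_proj_le.
rewrite -[X in _ --> X](mul0r (`|K| * (L2norm h + L2norm h))).
by apply: cvgM => //; exact: cvg_cst.
Qed.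

(** The [Y n] have covariances <C e_m, e_n>, so their finite combinations have the right cosine
    transforms. The trace bound M makes the sum of their squares almost surely finite, so the series
    G of the Y_n e_n converges. The transforms pass to the limit by boundedness of the cosine on one
    side and continuity of the quadratic form on the other. *)
Lemma exists_gaussian_law : exists nu : probability (L2borel R) R, forall h th,
  \int[nu]_f cos (L2inner (f : L2) h + th) = cos th * expR (- L2inner (C h) h / 2).
Proof.
pose B f g := L2inner (C f) g.
have [e' oe' ee'] := @gram_schmidt R L2 B Csym CD CZ Cpos e.
pose b n k := B (e n) (e' k).
pose Y n (w : T) := \sum_(k < n.+1) b n k * std_normal k w.
have mY n : measurable_fun setT (Y n : T -> T) by exact: (measurable_normal_sum (b n)).
have Ycomb N (c : nat -> R) w : \sum_(n < N) c n * Y n w =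
    \sum_(k < N) B (\sum_(n < N) c n *: e n) (e' k) * std_normal k w.
  under [RHS]eq_bigr => k _ do rewrite (@psd_suml R L2 B CD CZ) mulr_suml.
  rewrite exchange_big /=; apply: eq_bigr => n _; rewrite /Y mulr_sumr.
  rewrite -(big_mkord xpredT (fun k => c n * (b n k * std_normal k w))).
  rewrite -[RHS](big_mkord xpredT (fun k => B (c n *: e n) (e' k) * std_normal k w)).
  rewrite [RHS](@big_cat_nat _ _ _ n.+1 0 N)//= [X in _ = _ + X]big_nat_cond [X in _ = _ + X]big1 ?addr0.
    by apply: eq_bigr => k _; rewrite /B CZ mulrA.
  move=> k /andP[/andP[nk _] _].
  by rewrite /B CZ (gram_schmidt_coef0 Csym CD CZ Cpos oe' ee' nk) mulr0 mul0r.
have Ycos N (c : nat -> R) th (f := \sum_(n < N) c n *: e n) :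
    \int[unif]_w cos (\sum_(n < N) c n * Y n w + th) = cos th * expR (- B f f / 2).
  under eq_Rintegral => w _ do rewrite Ycomb.
  rewrite (std_normals_cos N (fun k => B f (e' k))).
  by rewrite -(gram_schmidt_parseval Csym CD CZ Cpos oe' ee').
have Y2 n : (\int[unif]_w (Y n w ^+ 2)%:E <= (B (e n) (e n))%:E)%E.
  apply: second_moment_of_cos; first exact: mY.
  move=> u.
  (* These coefficients single out u times [Y n], which gives its cosine transform and thereby the
     bound on its second moment. *)
  pose c (i : nat) : R := if i == n then (u : R) else 0.
  have cY : forall w, \sum_(i < n.+1) c i * Y i w = u * Y n w.
    move=> w; rewrite big_ord_recr /= big1 ?add0r /c ?eqxx// => i _.
    by rewrite ltn_eqF ?mul0r.
  have := Ycos n.+1 c 0; cbv zeta; rewrite cos0 mul1r.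
  under eq_Rintegral => w _ do rewrite cY addr0.
  have -> : \sum_(i < n.+1) c i *: e i = u *: e n.
    rewrite big_ord_recr /= big1 ?add0r /c ?eqxx// => i _.
    by rewrite ltn_eqF ?scale0r.
  have -> : B (u *: e n) (u *: e n) = u ^+ 2 * B (e n) (e n).
    by rewrite /B CZ Csym CZ mulrA.
  by [].
have mY2 n : measurable_fun setT (fun w : T => (Y n w ^+ 2)%:E).
  by apply/measurable_EFinP; apply: measurable_funX; exact: mY.
pose s w : \bar R := (\sum_(n <oo) (Y n w ^+ 2)%:E)%E.
have ms : measurable_fun setT s.
  apply: ge0_emeasurable_sum => [n w _ _|n _]; first by rewrite lee_fin sqr_ge0.
  exact: mY2.
have s_fin : (\int[unif]_w s w < +oo)%E.
  rewrite integral_nneseries//; last first.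
  - by move=> n w _; rewrite lee_fin sqr_ge0.
  apply: (@le_lt_trans _ _ M%:E); last exact: ltry.
  apply: lime_le.
    by apply: is_cvg_nneseries => n _ _; apply: integral_ge0 => w _; rewrite lee_fin sqr_ge0.
  apply: nearW => N; apply: (@le_trans _ _ (\sum_(0 <= n < N) (B (e n) (e n))%:E)%E).
    by apply: lee_sum => n _; exact: Y2.
  by rewrite sumEFin lee_fin big_mkord; exact: CM.
pose Om := [set w : T | (s w < +oo)%E].
have mOm : measurable Om.
  rewrite (_ : Om = s @^-1` `]-oo, +oo%E[%classic).
    by rewrite -[X in measurable X]setTI; apply: ms => //; exact: emeasurable_itv.
  by apply/seteqP; split => w; rewrite /Om /= in_itv.
have s0 w : (0 <= s w)%E by apply: nneseries_ge0 => n _ _; rewrite lee_fin sqr_ge0.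
have Om1 : {ae unif, forall w, Om w}.
  have is_ : (unif).-integrable setT s.
    apply/integrableP; split => //.
    by rewrite (eq_integral s)// => w _; rewrite gee0_abs.
  have := integrable_ae measurableT is_.
  apply: (@filterS _ _ (ae_filter_ringOfSetsType unif)) => w /(_ I) sw.
  by rewrite /Om /=; move: (s0 w) sw; case: (s w) => [x| |]// _ _; rewrite ltry.
(* Set to 0 on the null set where the squares are not summable, so that the series defining G
   converges at every point. *)
pose Y' n w := if (s w < +oo)%E then Y n w else 0.
have Y'bound w N : \sum_(n < N) Y' n w ^+ 2 <= fine (s w).
  have [sw|sw] := boolP (s w < +oo)%E; last first.
    by rewrite big1 ?fine_ge0// => n _; rewrite /Y' (negbTE sw) expr0n.
  rewrite /Y' sw.
  rewrite -lee_fin fineK; last by rewrite ge0_fin_numE.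
  rewrite -(big_mkord xpredT (fun n => Y n w ^+ 2)) -sumEFin.
  by apply: nneseries_lim_ge => n _ _; rewrite lee_fin sqr_ge0.
have /choice[G GY] : forall w : T, exists f : L2, L2norm (\sum_(k < n) Y' k w *: e k - f) @[n --> \oo] --> (0 : R).
  by move=> w; exact: (@ortho_series_cvg _ e oe (fun k => Y' k w) _ (Y'bound w)).
have GE w h : \sum_(n < N) L2inner h (e n) * Y' n w @[N --> \oo] --> L2inner (G w) h.
  have := L2_continuous_cvg (@L2inner_continuous R h) (GY w).
  under eq_fun do rewrite L2inner_suml.
  by under eq_fun do under eq_bigr do rewrite L2innerZl mulrC L2innerC.
have mY' n : measurable_fun setT (Y' n : T -> T).
  rewrite (_ : Y' n = fun w => \1_Om w * Y n w).
    by apply: measurable_funM; [exact: (measurable_indic mOm)|exact: mY].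
  apply/funext => w; rewrite /Y' indicE; case: ifPn => sw; first by rewrite mem_set// mul1r.
  by rewrite memNset ?mul0r//; exact/negP.
have mG : measurable_fun setT (G : T -> L2borel R).
  apply: (measurable_L2borel oe te) => k.
  apply: (@measurable_fun_cvg _ T R setT (fun N w => \sum_(n < N) L2inner (e k) (e n) * Y' n w)) => [N|w _].
    by apply: measurable_sum => n; apply: measurable_funM; [exact: measurable_cst|exact: mY'].
  exact: GE.
exists (law_of unif mG) => h th.
have mcos (d : measure_display) (D : measurableType d) (g : D -> T) :
    measurable_fun setT g -> measurable_fun setT (fun x => cos (g x + th) : T).
  move=> mg; apply: (@measurableT_comp _ _ _ _ T T (cos : T -> T)).
    by apply: continuous_measurable_fun; exact: continuous_cos.
  exact: measurable_funD.
rewrite (law_of_integral unif mG (f := fun f => cos (L2inner (f : L2) h + th))); last first.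
  by apply: mcos; apply: L2borel_measurable; exact: L2inner_continuous.
have c1 : \int[unif]_w cos (\sum_(n < N) L2inner h (e n) * Y' n w + th) @[N --> \oo] -->
    \int[unif]_w cos (L2inner (G w) h + th).
  apply: (@Rintegral_bdd_dct _ T R unif _ _ 1) => [N|w|N w].
  - by apply: mcos; apply: measurable_sum => n; apply: measurable_funM; [exact: measurable_cst|exact: mY'].
  - have h1 : \sum_(n < N) L2inner h (e n) * Y' n w + th @[N --> \oo] --> L2inner (G w) h + th.
      by apply: cvgD; [exact: GE|exact: cvg_cst].
    exact: (continuous_cvg _ (@continuous_cos R _) h1).
  - by rewrite ler_norml cos_geN1 cos_le1.
have c2 : \int[unif]_w cos (\sum_(n < N) L2inner h (e n) * Y' n w + th) @[N --> \oo] -->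
    cos th * expR (- B h h / 2).
  rewrite (_ : (fun N => _) = fun N => cos th * expR (- B (proj e N h) (proj e N h) / 2)).
    apply: cvgM; first exact: cvg_cst.
    have h1 : - B (proj e N h) (proj e N h) / 2 @[N --> \oo] --> - B h h / 2.
      by apply: cvgM; [apply: cvgN; exact: quad_cvg|exact: cvg_cst].
    exact: (continuous_cvg _ (@continuous_expR R _) h1).
  apply/funext => N; rewrite -(Ycos N (fun n => L2inner h (e n)) th).
  congr fine; apply: (@ae_eq_integral _ T R unif) => //.
  - by apply/measurable_EFinP; apply: mcos; apply: measurable_sum => n; apply: measurable_funM; [exact: measurable_cst|exact: mY'].
  - by apply/measurable_EFinP; apply: mcos; apply: measurable_sum => n; apply: measurable_funM; [exact: measurable_cst|exact: mY].
  - apply: (@filterS _ _ (ae_filter_ringOfSetsType unif)) Om1 => w Omw _; rewrite /Y'.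
    by move: Omw; rewrite /Om /= => ->.
exact: (cvg_unique _ c1 c2).
Qed.

End gaussian_element.

(** * From characteristic functions to convergence in law *)

Lemma cvg_uniform_approx (R : realType) (u : nat -> R) (l : R) :
  (forall eps, 0 < eps -> exists (v : nat -> R) (l' : R),
    [/\ v @ \oo --> l', forall n, `|u n - v n| <= eps & `|l - l'| <= eps]) ->
  u @ \oo --> l.
Proof.
move=> h; apply/cvgrPdist_lt => eps eps0.
have [|v [l' [vl uv ll]]] := h (eps / 4); first by rewrite divr_gt0.
have /cvgrPdist_lt/(_ (eps / 4)) hv := vl.
have [|N _ hN] := hv _; first by rewrite divr_gt0.
exists N => // n /hN /=; have := uv n => un ln.
rewrite (_ : l - u n = (l - l') + (l' - v n) - (u n - v n)); last ring.
apply: (le_lt_trans (ler_normB _ _)); have := ler_normD (l - l') (l' - v n); lra.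
Qed.

(** * Gaussian smoothing of Lipschitz functions with compact support *)

Section smoothing.
Variables (R : realType) (psi : R -> R) (L K : R).
Local Notation T := (measurableTypeR R).
Hypothesis psi_lip : forall a b, `|psi a - psi b| <= L * `|a - b|.
Hypothesis psi_supp : forall a, K < `|a| -> psi a = 0.
Hypothesis psi1 : forall a, `|psi a| <= 1.

Let N01 : probability T R := normal_prob 0 1.
Let L0 : 0 <= L.
Proof. by have := psi_lip 1 0; rewrite subr0 normr1 mulr1; apply: le_trans. Qed.

Lemma lipschitz_measurable : measurable_fun setT (psi : T -> T).
Proof.
apply: continuous_measurable_fun => x; apply/cvgrPdist_lt => eps eps0.
have L1 : 0 < L + 1 by rewrite ltr_wpDl.
near=> y; apply: (le_lt_trans (psi_lip _ _)).
apply: (@le_lt_trans _ _ ((L + 1) * `|x - y|)); first by apply: ler_wpM2r => //; rewrite lerDl.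
rewrite mulrC -ltr_pdivlMr//; near: y.
by apply: cvgr_dist_lt; rewrite ?divr_gt0//; exact: cvg_id.
Unshelve. all: by end_near. Qed.

(* [psi] divided by the standard normal density, so that the convolution below is
   an integral over a product of two standard normal laws. *)
Let weight y := psi y * ((normal_peak 1)^-1 * expR (y ^+ 2 / 2)).

Let W := (normal_peak 1)^-1 * expR (K ^+ 2 / 2).

Let peak1 : 0 < normal_peak 1 :> R.
Proof. by apply: normal_peak_gt0; rewrite oner_eq0. Qed.

Let weight_le y : `|weight y| <= W.
Proof.
have W0 : 0 <= W by rewrite mulr_ge0 ?expR_ge0// invr_ge0 ltW.
rewrite /weight normrM; have [yK|yK] := ltP K `|y|; first by rewrite psi_supp// normr0 mul0r.
have a0 : 0 <= (normal_peak 1)^-1 * expR (y ^+ 2 / 2) by rewrite mulr_ge0 ?expR_ge0// invr_ge0 ltW.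
rewrite -[leRHS]mul1r; apply: ler_pM => //.
rewrite (ger0_norm a0); apply: ler_wpM2l; first by rewrite invr_ge0 ltW.
rewrite ler_expR ler_pM2r ?invr_gt0// -(real_normK (num_real y)).
by rewrite ler_pXn2r ?nnegrE//; exact: le_trans yK.
Qed.

Let measurable_weight : measurable_fun setT (weight : T -> T).
Proof.
apply: measurable_funM; first exact: lipschitz_measurable.
apply: measurable_funM => //; apply: (@measurableT_comp _ _ _ _ T T (expR : T -> T)).
  by apply: continuous_measurable_fun; exact: continuous_expR.
by apply: measurable_funM => //; exact: measurable_funX.
Qed.

Let weightE y : weight y * normal_pdf 0 1 y = psi y.
Proof.
rewrite normal_pdfE ?oner_eq0// /normal_fun subr0 expr1n /weight.
rewrite (_ : - y ^+ 2 / (1 *+ 2) = - (y ^+ 2 / 2)); last by rewrite mulNr.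
by rewrite expRN; field; rewrite ?gt_eqF ?expR_gt0.
Qed.

(** With p = (y, u) under two standard normal laws, integrating over u turns the cosine into exp (-
    (y - x)^2 / (2 eps^2)). What remains is the convolution of psi with N(0, eps^2), written as a
    mixture of cosines of x. *)
Definition smooth_kernel (eps : R) (p : R * R) (x : R) :=
  weight p.1 * normal_peak eps * cos (p.2 * ((p.1 - x) / eps)).

Let kap : probability (T * T)%type R := (N01 \x N01)%E.

Definition smooth (eps x : R) : R := \int[kap]_p smooth_kernel eps p x.

Let mcos (d : measure_display) (D : measurableType d) (g : D -> T) :
  measurable_fun setT g -> measurable_fun setT (fun x => cos (g x) : T).
Proof.
move=> mg; apply: (@measurableT_comp _ _ _ _ T T (cos : T -> T)) => //.
by apply: continuous_measurable_fun; exact: continuous_cos.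
Qed.

Lemma measurable_smooth_kernel eps :
  measurable_fun setT (fun q : (T * T) * T => smooth_kernel eps q.1 q.2 : T).
Proof.
have m11 : measurable_fun setT (fun q : (T * T) * T => q.1.1 : T).
  exact: (measurableT_comp measurable_fst measurable_fst).
have m12 : measurable_fun setT (fun q : (T * T) * T => q.1.2 : T).
  exact: (measurableT_comp measurable_snd measurable_fst).
apply: measurable_funM.
  by apply: measurable_funM => //; exact: (measurableT_comp measurable_weight m11).
apply: mcos; apply: measurable_funM => //; apply: measurable_funM => //.
by apply: measurable_funB => //; exact: measurable_snd.
Qed.

Lemma smooth_kernel_le eps p x : 0 < eps -> `|smooth_kernel eps p x| <= W * normal_peak eps.
Proof.
move=> e0; have pk : 0 <= normal_peak eps by exact: normal_peak_ge0.
rewrite /smooth_kernel -[leRHS]mulr1 normrM; apply: ler_pM => //.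
  by rewrite normrM (ger0_norm pk); apply: ler_wpM2r => //; exact: weight_le.
by rewrite ler_norml cos_geN1 cos_le1.
Qed.

Let smoothE eps x : 0 < eps -> smooth eps x = \int[normal_prob x eps]_y psi y.
Proof.
move=> e0.
have en0 : eps != 0 by rewrite gt_eqF.
have mk : measurable_fun setT (fun p : T * T => smooth_kernel eps p x : T).
  exact: (measurableT_comp (measurable_smooth_kernel eps) (measurable_pair2 x)).
rewrite /smooth (bounded_fubini N01 N01 mk (fun p => smooth_kernel_le p x e0)).1.
have bp (Q : probability T R) : Q.-integrable setT (EFin \o psi).
  by apply: (@integrable_bdd _ T R Q psi 1) => //; exact: lipschitz_measurable.
rewrite (integral_normal_prob (lipschitz_measurable) (bp _)).
have cE y : \int[N01]_u smooth_kernel eps (y, u) x = weight y * normal_pdf x eps y.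
  have := standard_normal_cos ((y - x) / eps) 0; rewrite cos0 mul1r => h.
  rewrite (@eq_Rintegral _ _ _ N01 setT (fun u => weight y * normal_peak eps * cos ((y - x) / eps * u + 0))); last first.
    by move=> u _; rewrite /smooth_kernel /= addr0 [u * _]mulrC.
  rewrite RintegralZl//; last first.
    apply: (@integrable_bdd _ T R N01 _ 1); first exact: measurable_cos_affine.
    by move=> u; rewrite ler_norml cos_geN1 cos_le1.
  rewrite h -mulrA; congr (_ * _); rewrite normal_pdfE// /normal_fun; congr (_ * expR _).
  by rewrite -[eps ^+ 2 *+ 2]mulr_natr expr_div_n; field.
rewrite (@eq_Rintegral _ _ _ N01 setT (fun y => weight y * normal_pdf x eps y)); last by move=> y _; rewrite -cE.
have mw : measurable_fun setT (fun y : T => weight y * normal_pdf x eps y : T).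
  by apply: measurable_funM; [exact: measurable_weight|exact: measurable_normal_pdf].
rewrite (integral_normal_prob mw); last first.
  apply: (@integrable_bdd _ T R N01 _ (W * normal_peak eps)) => // y.
  rewrite normrM; apply: ler_pM => //.
  by rewrite ger0_norm ?normal_pdf_ge0// normal_pdf_ub.
by apply: eq_Rintegral => y _; rewrite mulrAC weightE.
Qed.

(** Young's inequality |y - x| <= eps / 2 + (y - x)^2 / (2 eps), whose right-hand side has mean eps
    under N(x, eps^2). *)
Lemma smooth_approx eps x : 0 < eps -> `|smooth eps x - psi x| <= L * eps.
Proof.
move=> e0; rewrite smoothE//.
have en0 : eps != 0 by rewrite gt_eqF.
pose Nx : probability T R := normal_prob x eps.
have m2 : measurable_fun setT (fun y : T => (y - x) ^+ 2 : T).
  by apply: measurable_funX; exact: measurable_funB.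
have i2 : Nx.-integrable setT (EFin \o (fun y => (y - x) ^+ 2)).
  by apply: integrable_normal_prob => //; exact: normal_pdf_moment_integrable.
have c2 : \int[Nx]_y ((y - x) ^+ 2) = eps ^+ 2.
  by rewrite (integral_normal_prob m2 i2) normal_pdf_moment//= mulr1 mul1r.
have ip : Nx.-integrable setT (EFin \o psi).
  by apply: (@integrable_bdd _ T R Nx psi 1) => //; exact: lipschitz_measurable.
have ic (c : R) : Nx.-integrable setT (EFin \o (fun _ : T => c)).
  by apply: (@integrable_bdd _ T R Nx (fun=> c) `|c|).
have intc (c : R) : \int[Nx]_(_ in setT) c = c.
  by rewrite Rintegral_cst// -[fine _]/(fine (Nx setT)) probability_setT mulr1.
rewrite -[X in `|_ - X| <= _](intc (psi x)) -/Nx -RintegralB//.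
have i3 : Nx.-integrable setT (EFin \o (fun y => psi y - psi x)).
  exact: (@integrableB _ _ _ Nx setT measurableT _ _ ip (ic (psi x))).
have i4 : Nx.-integrable setT (EFin \o (fun y => L / (2 * eps) * (y - x) ^+ 2)).
  exact: (integrableZl measurableT (L / (2 * eps)) i2).
apply: (@le_trans _ _ (\int[Nx]_y (L * eps / 2 + L / (2 * eps) * (y - x) ^+ 2))).
  apply: (le_trans (le_normr_Rintegral _ i3)) => //.
  apply: le_Rintegral => //.
  - by have := integrable_norm i3; apply: eq_integrable => //=.
  - exact: (@integrableD _ _ _ Nx setT measurableT _ _ (ic (L * eps / 2)) i4).
  - move=> y _; apply: (le_trans (psi_lip y x)).
    rewrite (_ : L * eps / 2 + _ = L * (eps / 2 + (y - x) ^+ 2 / (2 * eps))); last by field.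
    apply: ler_wpM2l => //; rewrite -(real_normK (num_real (y - x))).
    rewrite -subr_ge0 (_ : _ - _ = (`|y - x| - eps) ^+ 2 / (2 * eps)); last by field.
    by rewrite divr_ge0 ?sqr_ge0// mulr_ge0// ltW.
rewrite RintegralD// intc RintegralZl// c2.
by rewrite (_ : _ + _ = L * eps)//; field.
Qed.

Lemma measurable_smooth eps : measurable_fun setT (smooth eps : T -> T).
Proof.
have swap : measurable_fun setT (fun q : T * (T * T) => (q.2, q.1)).
  by apply/measurable_fun_pairP; split; [exact: measurable_snd|exact: measurable_fst].
have mk := measurableT_comp (measurable_smooth_kernel eps) swap.
exact: (measurable_Rintegral_F kap mk).
Qed.

(** For fixed p the smoothed integrand is Psi times a cosine of x, covered by the hypothesis;
    dominated convergence in p gives the smoothed function, and the smoothing error is uniform in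
    the law. The factor Psi allows coordinates to be added one by one. *)
Lemma cvg_lipschitz_test (d : measure_display) (D : measurableType d) (Q_ : nat -> probability D R)
    (Q : probability D R) (Psi x : D -> R) (M : R) :
  measurable_fun setT Psi -> measurable_fun setT x -> (forall w, `|Psi w| <= M) ->
  (forall u th, \int[Q_ n]_w (Psi w * cos (u * x w + th)) @[n --> \oo] -->
    \int[Q]_w (Psi w * cos (u * x w + th))) ->
  \int[Q_ n]_w (Psi w * psi (x w)) @[n --> \oo] --> \int[Q]_w (Psi w * psi (x w)).
Proof.
move=> mPsi mx PsiM hcos.
pose H eps (Q' : probability D R) p := \int[Q']_w (Psi w * smooth_kernel eps p (x w)).
have M0 : 0 <= M by apply: le_trans (PsiM point).
have bd eps q w : 0 < eps -> `|Psi w * smooth_kernel eps q (x w)| <= M * (W * normal_peak eps).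
  by move=> e0; rewrite normrM; apply: ler_pM => //; exact: smooth_kernel_le.
have mF eps : measurable_fun setT (fun z : D * (T * T) => Psi z.1 * smooth_kernel eps z.2 (x z.1) : T).
  apply: measurable_funM; first exact: (measurableT_comp mPsi measurable_fst).
  have pair : measurable_fun setT (fun z : D * (T * T) => (z.2, x z.1)).
    apply/measurable_fun_pairP; split; first exact: measurable_snd.
    exact: (measurableT_comp mx measurable_fst).
  exact: (measurableT_comp (measurable_smooth_kernel eps) pair).
have HE eps (Q' : probability D R) : 0 < eps ->
    \int[Q']_w (Psi w * smooth eps (x w)) = \int[kap]_p H eps Q' p.
  move=> e0; rewrite -(bounded_fubini Q' kap (mF eps) (fun z => bd eps z.2 z.1 e0)).2.
  apply: eq_Rintegral => w _; rewrite /= /smooth -RintegralZl//.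
  apply: (@integrable_bdd _ (T * T)%type R kap _ (W * normal_peak eps)) => [|p].
    exact: (measurableT_comp (measurable_smooth_kernel eps) (measurable_pair2 (x w))).
  exact: smooth_kernel_le.
have Hcvg eps : 0 < eps -> \int[kap]_p H eps (Q_ n) p @[n --> \oo] --> \int[kap]_p H eps Q p.
  move=> e0; apply: (@Rintegral_bdd_dct _ (T * T)%type R kap _ _ (M * (W * normal_peak eps))) => [n|p|n p].
  - have swap : measurable_fun setT (fun q : (T * T) * D => (q.2, q.1)).
      by apply/measurable_fun_pairP; split; [exact: measurable_snd|exact: measurable_fst].
    exact: (measurable_Rintegral_F (Q_ n) (measurableT_comp (mF eps) swap)).
  - pose c := weight p.1 * normal_peak eps.
    have HcE (Q' : probability D R) : H eps Q' p =
        c * \int[Q']_w (Psi w * cos (- (p.2 / eps) * x w + p.2 * p.1 / eps)).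
      rewrite -RintegralZl//; last first.
        apply: (@integrable_bdd _ D R Q' _ M) => [|w].
          apply: measurable_funM => //; apply: mcos; apply: measurable_funD => //.
          exact: measurable_funM.
        by rewrite normrM -[leRHS]mulr1; apply: ler_pM => //; rewrite ler_norml cos_geN1 cos_le1.
      apply: eq_Rintegral => w _; rewrite /smooth_kernel mulrCA; congr (_ * (_ * cos _)); ring.
    under eq_fun do rewrite HcE; rewrite HcE; apply: cvgM; first exact: cvg_cst.
    exact: hcos.
  - apply: Rintegral_le_bdd => [|w]; last exact: bd.
    apply: measurable_funM => //.
    have pair := measurableT_comp (measurable_pair1 p) mx.
    exact: (measurableT_comp (measurable_smooth_kernel eps) pair).
apply: cvg_uniform_approx => eta eta0.
(* Makes the error M L eps at most eta; the added units avoid division by 0. *)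
pose eps := eta / ((L + 1) * (M + 1)).
have LM : 0 < (L + 1) * (M + 1) by rewrite mulr_gt0// ltr_wpDl.
have e0 : 0 < eps by rewrite divr_gt0.
exists (fun n => \int[Q_ n]_w (Psi w * smooth eps (x w))), (\int[Q]_w (Psi w * smooth eps (x w))).
have mpx : measurable_fun setT (fun w => psi (x w)) by exact: (measurableT_comp lipschitz_measurable mx).
have msx : measurable_fun setT (fun w => smooth eps (x w)) by exact: (measurableT_comp (measurable_smooth eps) mx).
have err (Q' : probability D R) :
    `|\int[Q']_w (Psi w * psi (x w)) - \int[Q']_w (Psi w * smooth eps (x w))| <= eta.
  rewrite -RintegralB//; last 2 first.
  - apply: (@integrable_bdd _ D R Q' _ (M * 1)) => [|w]; first exact: measurable_funM.
    by rewrite normrM; apply: ler_pM.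
  - apply: (@integrable_bdd _ D R Q' _ (M * (1 + L * eps))) => [|w]; first exact: measurable_funM.
    rewrite normrM; apply: ler_pM => //.
    rewrite -[smooth _ _](subrK (psi (x w))) addrC; apply: (le_trans (ler_normD _ _)).
    by apply: lerD => //; exact: smooth_approx.
  apply: Rintegral_le_bdd => [|w]; first by apply: measurable_funB; exact: measurable_funM.
  rewrite -mulrBr normrM distrC; apply: (@le_trans _ _ (M * (L * eps))).
    by apply: ler_pM => //; exact: smooth_approx.
  rewrite mulrA /eps mulrA ler_pdivrMr// [leRHS]mulrC; apply: ler_wpM2r; first exact: ltW.
  rewrite mulrC; apply: ler_pM => //; by rewrite lerDl.
split => //; rewrite HE//; under eq_fun do rewrite HE//; exact: Hcvg.
Qed.

End smoothing.

(** * Piecewise linear cutoffs and a partition of unity *)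

Section ramps.
Variable R : realType.

Definition ramp (x : R) : R := Num.max 0 (Num.min x 1).

Lemma rampE (x : R) : ramp x = if x <= 0 then 0 else if x <= 1 then x else 1.
Proof.
rewrite /ramp; have [x0|x0] := leP x 0.
  by rewrite min_l ?max_l//; lra.
have [x1|x1] := leP x 1; first by rewrite max_r// ltW.
by rewrite max_r.
Qed.

Lemma ramp_itv (x : R) : 0 <= ramp x <= 1.
Proof.
rewrite rampE; case: (leP x 0) => ?; first by rewrite lexx ler01.
by case: (leP x 1) => ?; apply/andP; split; lra.
Qed.

Lemma ramp_eq0 (x : R) : x <= 0 -> ramp x = 0.
Proof. by rewrite rampE => ->. Qed.

Lemma ramp_eq1 (x : R) : 1 <= x -> ramp x = 1.
Proof. by move=> x1; rewrite rampE; case: leP => ?; [lra|case: leP => ?; lra]. Qed.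

Lemma ramp_lip (x y : R) : `|ramp x - ramp y| <= `|x - y|.
Proof.
rewrite !rampE; have := ler_norm (x - y); have := ler_norm (y - x); rewrite (distrC y x) => ? ?.
by case: (leP x 0) => ?; case: (leP y 0) => ?; case: (leP x 1) => ?; case: (leP y 1) => ?;
  rewrite ler_norml; apply/andP; split; lra.
Qed.

(** A hat on [0, 2] with summit at 1. Its integer translates telescope to a difference of two ramps,
    hence sum to 1 away from the ends. *)
Definition tent (x : R) : R := ramp x - ramp (x - 1).

Lemma tent_itv (x : R) : 0 <= tent x <= 1.
Proof.
rewrite /tent !rampE; case: (leP x 0) => ?; case: (leP x 1) => ?; case: (leP (x - 1) 0) => ?;
  case: (leP (x - 1) 1) => ?; apply/andP; split; lra.
Qed.

Lemma tent_le1 (x : R) : `|tent x| <= 1.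
Proof. by have /andP[? ?] := tent_itv x; rewrite ger0_norm. Qed.

Lemma tent_lip (x y : R) : `|tent x - tent y| <= 2 * `|x - y|.
Proof.
rewrite /tent (_ : _ - _ - _ = (ramp x - ramp y) - (ramp (x - 1) - ramp (y - 1))); last ring.
apply: (le_trans (ler_normB _ _)); have := ramp_lip x y; have := ramp_lip (x - 1) (y - 1).
by rewrite (_ : x - 1 - (y - 1) = x - y); [lra|ring].
Qed.

Lemma tent_supp (x : R) : tent x != 0 -> `|x| <= 2.
Proof.
apply: contraR; rewrite -ltNge => x2; apply/eqP.
have [x0|x0] := leP 0 x.
  rewrite ger0_norm// in x2; rewrite /tent !rampE.
  by do ![case: leP => ?]; lra.
rewrite ltr0_norm// in x2; rewrite /tent !rampE.
by do ![case: leP => ?]; lra.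
Qed.

Lemma sum_tent (x : R) n : \sum_(i < n) tent (x - i%:R) = ramp x - ramp (x - n%:R).
Proof.
elim: n => [|n ih]; first by rewrite big_ord0 subr0 subrr.
by rewrite big_ord_recr /= ih /tent -natr1; rewrite (_ : x - n%:R - 1 = x - (n%:R + 1)); ring.
Qed.

End ramps.

(** * Convergence of expectations of continuous functionals *)

Section functional_convergence.
Variable R : realType.
Local Notation L2 := (L2 R).
Local Notation B := (L2borel R).
Variables (Q_ : nat -> probability B R) (Q : probability B R).
Hypothesis hcos : forall (h : L2) th,
  \int[Q_ n]_f cos (L2inner (f : L2) h + th) @[n --> \oo] --> \int[Q]_f cos (L2inner (f : L2) h + th).

Let cvg_integral (F : B -> R) := \int[Q_ n]_f F f @[n --> \oo] --> \int[Q]_f F f.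

(** The cosine is a free slot: through it the class is stable under multiplication by a tent of a
    further coordinate. *)
Let good (Psi : B -> R) := [/\ measurable_fun setT Psi, exists M, forall f, `|Psi f| <= M &
  forall (h : L2) th, cvg_integral (fun f => Psi f * cos (L2inner (f : L2) h + th))].

Let m_inner (h : L2) : measurable_fun setT (fun f : B => L2inner (f : L2) h).
Proof. by apply: L2borel_measurable; exact: L2inner_continuous. Qed.

Let m_cos (h : L2) th : measurable_fun setT (fun f : B => cos (L2inner (f : L2) h + th)).
Proof.
apply: (@measurableT_comp _ _ _ B (measurableTypeR R) (measurableTypeR R) (cos : R -> R)).
  by apply: continuous_measurable_fun; exact: continuous_cos.
exact: measurable_funD.
Qed.

Let good1 : good (fun=> 1).
Proof.
split; first exact: measurable_cst; first by exists 1 => f; rewrite normr1.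
move=> h th; rewrite /cvg_integral.
have E (Q' : probability B R) : \int[Q']_f (1 * cos (L2inner (f : L2) h + th)) =
    \int[Q']_f cos (L2inner (f : L2) h + th).
  by apply: eq_Rintegral => f _; rewrite mul1r.
by rewrite E; under eq_fun do rewrite E; exact: hcos.
Qed.

Let good_cvg Psi : good Psi -> cvg_integral Psi.
Proof.
move=> [_ _ /(_ 0 0)]; rewrite /cvg_integral.
have E (Q' : probability B R) : \int[Q']_f (Psi f * cos (L2inner (f : L2) 0 + 0)) = \int[Q']_f Psi f.
  by apply: eq_Rintegral => f _; rewrite L2inner0r addr0 cos0 mulr1.
by rewrite E; under eq_fun do rewrite E.
Qed.

Let good_tent Psi (g : L2) (c s : R) : good Psi ->
  good (fun f => Psi f * tent (c * L2inner (f : L2) g + s)).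
Proof.
move=> [mPsi [M PsiM] Psicos]; pose psi x := tent (c * x + s).
have psi_lip a b : `|psi a - psi b| <= (2 * `|c|) * `|a - b|.
  apply: (le_trans (tent_lip _ _)); rewrite -mulrA -normrM.
  by rewrite (_ : c * a + s - (c * b + s) = c * (a - b)); last ring.
have mpsi : measurable_fun setT (psi : measurableTypeR R -> measurableTypeR R) by exact: lipschitz_measurable psi_lip.
have mP : measurable_fun setT (fun f : B => Psi f * psi (L2inner (f : L2) g)).
  by apply: measurable_funM => //; exact: (measurableT_comp mpsi (m_inner g)).
split => //.
  exists (M * 1) => f; rewrite normrM; apply: ler_pM => //; exact: tent_le1.
move=> h th; rewrite /cvg_integral.
(* For c = 0 the tent is a constant factor, not compactly supported in the coordinate. *)
have [c0|c0] := eqVneq c 0.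
  have E (Q' : probability B R) : \int[Q']_f (Psi f * tent (c * L2inner (f : L2) g + s) * cos (L2inner (f : L2) h + th)) =
      tent s * \int[Q']_f (Psi f * cos (L2inner (f : L2) h + th)).
    rewrite -RintegralZl//; last first.
      apply: (@integrable_bdd _ B R Q' _ (M * 1)) => [|f]; first exact: measurable_funM.
      by rewrite normrM; apply: ler_pM => //; rewrite ler_norml cos_geN1 cos_le1.
    by apply: eq_Rintegral => f _; rewrite c0 mul0r add0r; ring.
  by rewrite E; under eq_fun do rewrite E; apply: cvgM; [exact: cvg_cst|exact: Psicos].
pose Psi' f := Psi f * cos (L2inner (f : L2) h + th).
have mPsi' : measurable_fun setT Psi' by exact: measurable_funM.
have E (Q' : probability B R) : \int[Q']_f (Psi f * tent (c * L2inner (f : L2) g + s) * cos (L2inner (f : L2) h + th)) =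
    \int[Q']_f (Psi' f * psi (L2inner (f : L2) g)).
  by apply: eq_Rintegral => f _; rewrite mulrAC.
rewrite E; under eq_fun do rewrite E.
apply: (@cvg_lipschitz_test R psi (2 * `|c|) ((2 + `|s|) / `|c|) psi_lip _ _ _ B Q_ Q Psi' _ (M * 1)) => //.
- move=> a; rewrite ltr_pdivrMr ?normr_gt0// => ca; apply/eqP; apply: contraLR (ca) => /tent_supp.
  rewrite -leNgt => h2; rewrite -normrM mulrC (_ : c * a = (c * a + s) - s); last ring.
  by apply: (le_trans (ler_normB _ _)); rewrite lerD.
- by move=> a; exact: tent_le1.
- by move=> f; rewrite normrM; apply: ler_pM => //; rewrite ler_norml cos_geN1 cos_le1.
move=> u eta.
(* Product-to-sum formula: the two cosines merge into cosines of h + u g and h - u g, for which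
   convergence is known. *)
have E2 (Q' : probability B R) : \int[Q']_f (Psi' f * cos (u * L2inner (f : L2) g + eta)) =
    2^-1 * (\int[Q']_f (Psi f * cos (L2inner (f : L2) (h + u *: g) + (th + eta))) +
            \int[Q']_f (Psi f * cos (L2inner (f : L2) (h - u *: g) + (th - eta)))).
  have ip (h' : L2) th' : Q'.-integrable setT (EFin \o (fun f => Psi f * cos (L2inner (f : L2) h' + th'))).
    apply: (@integrable_bdd _ B R Q' _ (M * 1)) => [|f]; first exact: measurable_funM.
    by rewrite normrM; apply: ler_pM => //; rewrite ler_norml cos_geN1 cos_le1.
  rewrite -RintegralD// -RintegralZl//; last exact: (@integrableD _ _ _ Q' setT measurableT _ _ (ip _ _) (ip _ _)).
  apply: eq_Rintegral => f _; rewrite /Psi' L2innerDr L2innerBr L2innerZr.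
  set a := L2inner f h; set b := L2inner f g.
  rewrite (_ : a + u * b + (th + eta) = (a + th) + (u * b + eta)); last ring.
  rewrite (_ : a - u * b + (th - eta) = (a + th) - (u * b + eta)); last ring.
  by move: (a + th) (u * b + eta) => p q; rewrite cosD cosB; field.
rewrite E2; under eq_fun do rewrite E2.
by apply: cvgM; [exact: cvg_cst|apply: cvgD; exact: Psicos].
Qed.

Variables (e : nat -> L2) (b : nat -> R) (M : R).
Hypothesis oe : orthosystem (@L2inner R) e.
Hypothesis te : forall f : L2, L2norm (f - proj e n f) @[n --> \oo] --> (0 : R).
Hypothesis Q_b : forall T n, (\int[Q_ T]_f (L2inner (f : L2) (e n) ^+ 2)%:E <= (b n)%:E)%E.
Hypothesis Qb : forall n, (\int[Q]_f (L2inner (f : L2) (e n) ^+ 2)%:E <= (b n)%:E)%E.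
Hypothesis b_sum : forall N, \sum_(n < N) b n <= M.

Let b0 n : 0 <= b n.
Proof. by rewrite -lee_fin; apply: le_trans (Qb n); apply: integral_ge0 => f _; rewrite lee_fin sqr_ge0. Qed.

Let cvg_uniform (F : B -> R) :
  (forall eps, 0 < eps -> exists2 G : B -> R, cvg_integral G &
    (forall T, `|\int[Q_ T]_f F f - \int[Q_ T]_f G f| <= eps) /\ `|\int[Q]_f F f - \int[Q]_f G f| <= eps) ->
  cvg_integral F.
Proof.
move=> h; apply: cvg_uniform_approx => eps eps0; have [G Gc [G1 G2]] := h eps eps0.
by exists (fun n => \int[Q_ n]_f G f), (\int[Q]_f G f).
Qed.

(** The error c1 + c2 X, with X bounded in mean only, accommodates approximations that fail far out;
    X will be a squared coordinate or a squared remainder. *)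
Let integral_dist (Q' : probability B R) (F G X : B -> R) (MF MG c1 c2 v : R) :
  measurable_fun setT F -> measurable_fun setT G -> measurable_fun setT X ->
  (forall f, `|F f| <= MF) -> (forall f, `|G f| <= MG) -> 0 <= c1 -> 0 <= c2 ->
  (forall f, `|F f - G f| <= c1 + c2 * X f) -> (forall f, 0 <= X f) ->
  (\int[Q']_f (X f)%:E <= v%:E)%E ->
  `|\int[Q']_f F f - \int[Q']_f G f| <= c1 + c2 * v.
Proof.
move=> mF mG mX FM GM c10 c20 FG X0 Xv.
have iF := integrable_bdd Q' mF FM; have iG := integrable_bdd Q' mG GM.
have iX : Q'.-integrable setT (EFin \o X).
  apply/integrableP; split; first exact/measurable_EFinP.
  rewrite (@eq_integral _ _ _ _ _ (EFin \o X)) ?(le_lt_trans Xv) ?ltry// => f _.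
  by rewrite /= ger0_norm.
have iB : Q'.-integrable setT (EFin \o (fun f => F f - G f)) by exact: (@integrableB _ _ _ Q' setT measurableT _ _ iF iG).
have ic : Q'.-integrable setT (EFin \o (fun _ : B => c1)) by apply: (@integrable_bdd _ B R Q' (fun=> c1) `|c1|).
have icX := integrableZl measurableT c2 iX.
rewrite -RintegralB//; apply: (le_trans (le_normr_Rintegral _ iB)) => //.
apply: (@le_trans _ _ (\int[Q']_f (c1 + c2 * X f))).
  apply: le_Rintegral => //.
  - by have := integrable_norm iB; apply: eq_integrable.
  - exact: (@integrableD _ _ _ Q' setT measurableT _ _ ic icX).
rewrite RintegralD// RintegralZl// Rintegral_cst// -[fine _]/(fine (Q' setT)) probability_setT mulr1.
rewrite lerD2l; apply: ler_wpM2l => //.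
by rewrite -lee_fin /Rintegral fineK// integrable_fin_num.
Qed.

Let projB N f g : proj e N (f - g) = proj e N f - proj e N g.
Proof.
rewrite /proj -sumrN -big_split; apply: eq_bigr => i _.
by rewrite /= L2innerBl scalerBl.
Qed.

Let measurable_proj (F : L2 -> R) (K : R) (N : nat) (g : L2) : (forall f g, `|F f - F g| <= K * L2norm (f - g)) ->
  measurable_fun setT (fun f : B => F (proj e N (f : L2) + g)).
Proof.
move=> FK; have K0 : 0 <= `|K| by [].
apply: (@L2borel_measurable R (fun f => F (proj e N f + g))).
apply: (@L2_lipschitz_continuous R _ `|K|) => f f'.
apply: (le_trans (FK _ _)); rewrite (_ : _ - _ = proj e N (f - f')); last first.
  by rewrite projB opprD addrACA subrr addr0.
apply: (@le_trans _ _ (`|K| * L2norm (proj e N (f - f')))).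
  by apply: ler_wpM2r; [exact: L2norm_ge0|exact: ler_norm].
by apply: ler_wpM2l => //; exact: norm_proj_le.
Qed.

(* Adding the coordinate [<f, e N>] to a function of the first [N] ones: the
   new coordinate is discretized by a partition of unity made of tents. *)
Let proj_cvg N : forall (F : L2 -> R) (K A : R) (g : L2),
  (forall f g, `|F f - F g| <= K * L2norm (f - g)) -> (forall f, `|F f| <= A) ->
  forall Psi, good Psi -> cvg_integral (fun f => Psi f * F (proj e N (f : L2) + g)).
Proof.
elim: N => [|N ih] F K A g FK FA Psi gPsi.
  rewrite /cvg_integral.
  have [mPsi [MP PsiM] _] := gPsi.
  have E (Q' : probability B R) : \int[Q']_f (Psi f * F (proj e 0 (f : L2) + g)) = F g * \int[Q']_f Psi f.
    rewrite -RintegralZl//; last exact: (integrable_bdd Q' mPsi PsiM).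
    by apply: eq_Rintegral => f _; rewrite /proj big_ord0 add0r mulrC.
  by rewrite E; under eq_fun do rewrite E; apply: cvgM; [exact: cvg_cst|exact: good_cvg].
have A0 : 0 <= A by apply: le_trans (FA 0).
have K0 : 0 <= `|K| by [].
have FK' f f' : `|F f - F f'| <= `|K| * L2norm (f - f').
  by apply: (le_trans (FK _ _)); apply: ler_wpM2r; [exact: L2norm_ge0|exact: ler_norm].
have [mPsi [MP PsiM] _] := gPsi.
have MP0 : 0 <= MP by apply: le_trans (PsiM point).
have en1 : L2norm (e N) <= 1.
  apply: le_of_sqr; rewrite ?L2norm_ge0// L2normE expr1n.
  by have [->|->] := oe.2 N; rewrite ?L2inner0r.
apply: cvg_uniform => eps eps0.
(* The mesh of the grid; moving the coordinate to a node at distance at most 2 del costs at most eps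
   / 2 in all. *)
pose del := eps / (4 * (MP + 1) * (`|K| + 1)).
have K1 : 0 < `|K| + 1 by rewrite ltr_wpDl.
have MP1 : 0 < MP + 1 by rewrite ltr_wpDl.
have del0 : 0 < del by apply: divr_gt0 => //; apply: mulr_gt0 => //; rewrite mulr_gt0.
(* Enough nodes for the part of the coordinate beyond the grid to cost at most eps / 4, by
   Chebyshev's inequality with the second moment [b N]. *)
pose m := (Num.truncn (4 * MP * A * (b N + 1) / del ^+ 2 / eps)).+1.
have hm : 4 * MP * A * (b N + 1) / del ^+ 2 / eps < m%:R by exact: truncnS_gt.
pose c (i : 'I_(m.+1).*2) : R := i%:R - m.+1%:R.
pose G f := \sum_(i < (m.+1).*2) (Psi f * tent (del^-1 * L2inner (f : L2) (e N) + - c i)) *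
   F (proj e N (f : L2) + (g + (del * c i) *: e N)).
have mG i : measurable_fun setT (fun f : B => (Psi f * tent (del^-1 * L2inner (f : L2) (e N) + - c i)) *
   F (proj e N (f : L2) + (g + (del * c i) *: e N))).
  apply: measurable_funM; last exact: measurable_proj.
  by have [] := good_tent (e N) del^-1 (- c i) gPsi.
have bG i f : `|(Psi f * tent (del^-1 * L2inner (f : L2) (e N) + - c i)) *
   F (proj e N (f : L2) + (g + (del * c i) *: e N))| <= MP * 1 * A.
  by rewrite !normrM; apply: ler_pM => //; apply: ler_pM => //; exact: tent_le1.
exists G.
  have E (Q' : probability B R) : \int[Q']_f G f = \sum_(i < (m.+1).*2)
      \int[Q']_f ((Psi f * tent (del^-1 * L2inner (f : L2) (e N) + - c i)) *
        F (proj e N (f : L2) + (g + (del * c i) *: e N))).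
    have iG i := integrable_bdd Q' (mG i) (bG i).
    by have [-> _] := @Rintegral_sum _ B R Q' _ (index_enum 'I_(m.+1).*2) (fun i f =>
      (Psi f * tent (del^-1 * L2inner (f : L2) (e N) + - c i)) *
        F (proj e N (f : L2) + (g + (del * c i) *: e N))) iG.
  rewrite /cvg_integral E; under eq_fun do rewrite E.
  apply: cvg_sum_seq => i; apply: (ih F K A _ FK FA).
  exact: good_tent.
have key f : `|Psi f * F (proj e N.+1 (f : L2) + g) - G f| <=
    MP * (2 * `|K| * del) + MP * (A / (del * m%:R) ^+ 2) * L2inner (f : L2) (e N) ^+ 2.
  set x := L2inner (f : L2) (e N); pose t := del^-1 * x.
  have xt : x = del * t by rewrite /t mulrA mulfV ?mul1r// gt_eqF.
  pose S := \sum_(i < (m.+1).*2) tent (t + - c i).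
  have SE : S = ramp (t + m.+1%:R) - ramp (t - m.+1%:R).
    have := sum_tent (t + m.+1%:R) (m.+1).*2; rewrite (_ : t + m.+1%:R - _ = t - m.+1%:R); last first.
      by rewrite -mul2n natrM; ring.
    by move=> <-; apply: eq_bigr => i _; congr tent; rewrite /c; ring.
  have S01 : 0 <= S <= 1.
    apply/andP; split; first by apply: sumr_ge0 => i _; have /andP[] := tent_itv (t + - c i).
    by rewrite SE; have /andP[_ ?] := ramp_itv (t + m.+1%:R); have /andP[? _] := ramp_itv (t - m.+1%:R); lra.
  (* The tents sum to 1 for |t| <= m; beyond, the quadratic bound is at least 1. *)
  have S1 : 1 - S <= (t / m%:R) ^+ 2.
    have m0 : (0 : R) < m%:R by rewrite ltr0n.
    have [tm|tm] := leP `|t| m%:R.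
      rewrite (_ : S = 1) ?subrr ?sqr_ge0// SE.
      move: tm; rewrite ler_norml -natr1 => /andP[? ?].
      by rewrite ramp_eq1 ?ramp_eq0 ?subr0//; lra.
    apply: (@le_trans _ _ 1); first by have /andP[? ?] := S01; lra.
    rewrite -(real_normK (num_real (t / m%:R))) exprn_ege1// normrM normfV (ger0_norm (ltW m0)).
    by rewrite ler_pdivlMr// mul1r ltW.
  set p := proj e N (f : L2) + g.
  have pE : proj e N.+1 (f : L2) + g = p + x *: e N by rewrite /proj big_ord_recr /= addrAC.
  pose F' i := F (p + (del * c i) *: e N).
  have GE : G f = Psi f * \sum_(i < (m.+1).*2) tent (t + - c i) * F' i.
    by rewrite mulr_sumr; apply: eq_bigr => i _; rewrite mulrA /F' /p addrA.
  have -> : MP * (2 * `|K| * del) + MP * (A / (del * m%:R) ^+ 2) * x ^+ 2 =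
      MP * (2 * `|K| * del + A / (del * m%:R) ^+ 2 * x ^+ 2) by rewrite mulrDr [X in _ = _ + X]mulrA.
  rewrite GE -mulrBr normrM pE; apply: ler_pM => //.
  set F0 := F (p + x *: e N).
  (* The error splits into the mass missing from the partition of unity and the oscillation of F
     over one tent. *)
  have -> : F0 - \sum_(i < (m.+1).*2) tent (t + - c i) * F' i =
      F0 * (1 - S) + \sum_(i < (m.+1).*2) tent (t + - c i) * (F0 - F' i).
    under [in RHS]eq_bigr do rewrite mulrBr.
    by rewrite sumrB -mulr_suml -/S; ring.
  apply: (le_trans (ler_normD _ _)); rewrite addrC; apply: lerD.
    apply: (le_trans (ler_norm_sum _ _ _)).
    apply: (@le_trans _ _ (\sum_(i < (m.+1).*2) tent (t + - c i) * (2 * `|K| * del))).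
      apply: ler_sum => i _; have /andP[bu0 _] := tent_itv (t + - c i).
      rewrite normrM (ger0_norm bu0).
      have [bu|/tent_supp bu] := eqVneq (tent (t + - c i)) 0; first by rewrite bu !mul0r.
      apply: ler_wpM2l => //; apply: (le_trans (FK' _ _)).
      rewrite (_ : _ - _ = (del * (t + - c i)) *: e N); last first.
        by rewrite opprD addrACA subrr add0r -scalerBl xt -mulrBr.
      rewrite L2normZ normrM (ger0_norm (ltW del0)) (_ : 2 * `|K| * del = `|K| * (del * 2 * 1)); last ring.
      apply: ler_wpM2l => //; apply: ler_pM => //; first by rewrite mulr_ge0// ltW.
        exact: L2norm_ge0.
      by apply: ler_wpM2l => //; exact: ltW.
    rewrite -mulr_suml -/S -[leRHS]mul1r; apply: ler_wpM2r; last by case/andP: S01.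
    by apply: mulr_ge0; [rewrite mulr_ge0|exact: ltW].
  have /andP[_ S1'] := S01.
  rewrite normrM; apply: (@le_trans _ _ (A * (t / m%:R) ^+ 2)).
    have S0 : 0 <= 1 - S by rewrite subr_ge0.
    by rewrite (ger0_norm S0); apply: ler_pM => //; exact: FA.
  rewrite xt (_ : A / _ ^+ 2 * _ = A * (t / m%:R) ^+ 2)//.
  by field; rewrite (gt_eqF del0) pnatr_eq0.
have bound (Q' : probability B R) : (\int[Q']_f (L2inner (f : L2) (e N) ^+ 2)%:E <= (b N)%:E)%E ->
    `|\int[Q']_f (Psi f * F (proj e N.+1 (f : L2) + g)) - \int[Q']_f G f| <= eps.
  move=> hb.
  apply: (@le_trans _ _ (MP * (2 * `|K| * del) + MP * (A / (del * m%:R) ^+ 2) * b N)).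
    apply: (@integral_dist Q' _ _ (fun f => L2inner (f : L2) (e N) ^+ 2) (MP * A) (\sum_(i < (m.+1).*2) (MP * 1 * A))).
    - by apply: measurable_funM => //; exact: measurable_proj.
    - exact: measurable_sum.
    - exact: measurable_funX.
    - by move=> f; rewrite normrM; apply: ler_pM.
    - by move=> f; apply: (le_trans (ler_norm_sum _ _ _)); apply: ler_sum => i _; exact: bG.
    - by apply: mulr_ge0 => //; apply: mulr_ge0; [rewrite mulr_ge0|exact: ltW].
    - by apply: mulr_ge0 => //; apply: divr_ge0 => //; exact: sqr_ge0.
    - exact: key.
    - by move=> f; exact: sqr_ge0.
    - exact: hb.
  have m1 : (1 : R) <= m%:R by rewrite ler1n.
  have m0 : (0 : R) < m%:R by apply: lt_le_trans m1.
  have r1 : MP * (2 * `|K| * del) <= eps / 2.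
    rewrite /del (_ : MP * _ = (MP * `|K| * eps) / (2 * ((MP + 1) * (`|K| + 1)))); last first.
      by field; rewrite (gt_eqF MP1) (gt_eqF K1).
    rewrite ler_pdivrMr ?mulr_gt0// (_ : eps / 2 * _ = (MP + 1) * (`|K| + 1) * eps); last by field.
    by apply: ler_wpM2r; [exact: ltW|apply: ler_pM => //; rewrite lerDl].
  pose Y := MP * A * (b N + 1) / del ^+ 2.
  have Y0 : 0 <= Y.
    apply: divr_ge0; last exact: sqr_ge0.
    by apply: mulr_ge0; [rewrite mulr_ge0|rewrite addr_ge0].
  have r2 : MP * (A / (del * m%:R) ^+ 2) * b N <= eps / 4.
    apply: (@le_trans _ _ (Y / m%:R)).
      rewrite (_ : _ * b N = (MP * A * b N / del ^+ 2) / m%:R / m%:R); last first.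
        by field; rewrite (gt_eqF del0) pnatr_eq0.
      rewrite ler_pM2r ?invr_gt0// ler_pdivrMr// -[leLHS]mulr1; apply: ler_pM => //.
        by apply: divr_ge0; [apply: mulr_ge0 => //; rewrite mulr_ge0|exact: sqr_ge0].
      rewrite ler_pM2r ?invr_gt0 ?exprn_gt0//; apply: ler_wpM2l; first by rewrite mulr_ge0.
      by rewrite lerDl.
    rewrite ler_pdivrMr//; move: hm; rewrite ltr_pdivrMr// (_ : 4 * MP * A * (b N + 1) / _ = 4 * Y).
      lra.
    by rewrite /Y; ring.
  lra.
by split => [T|]; apply: bound.
Qed.

Let tail_le eta : 0 < eta -> exists N, forall k, \sum_(j < k) b (N + j)%N <= eta.
Proof.
move=> eta0; pose s n := \sum_(i < n) b i.
have snd : {homo s : m n / (m <= n)%N >-> m <= n}.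
  move=> m n mn; rewrite /s -(subnKC mn) big_split_ord /= lerDl.
  by apply: sumr_ge0 => j _; exact: b0.
have sc : cvgn s by apply: nondecreasing_is_cvgn => //; exists M => _ [n _ <-]; exact: b_sum.
have /cvgrPdist_lt/(_ _ eta0)[N _ hN] := sc.
exists N => k; have := hN N (leqnn N); rewrite /= ltr_norml => /andP[_ h].
have : s (N + k)%N <= limn s by exact: nondecreasing_cvgn_le.
by rewrite {1}/s big_split_ord /= -/(s N); lra.
Qed.

Let tail_integral (Q' : probability B R) N k :
  (forall n, (\int[Q']_f (L2inner (f : L2) (e n) ^+ 2)%:E <= (b n)%:E)%E) ->
  (\int[Q']_f (\sum_(j < k) L2inner (f : L2) (e (N + j)%N) ^+ 2)%:E <= (\sum_(j < k) b (N + j)%N)%:E)%E.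
Proof.
move=> hb; under eq_integral do rewrite -sumEFin; rewrite ge0_integral_sum//.
- by rewrite -sumEFin; apply: lee_sum => j _; exact: hb.
- by move=> j; apply/measurable_EFinP; apply: measurable_funX; exact: m_inner.
- by move=> j f _; rewrite lee_fin sqr_ge0.
Qed.

(** By Parseval the squared remainder is the sum of the squared coordinates from N on; Fatou's lemma
    carries over the bound on finite blocks. *)
Let remainder_integral (Q' : probability B R) N eta :
  (forall n, (\int[Q']_f (L2inner (f : L2) (e n) ^+ 2)%:E <= (b n)%:E)%E) ->
  (forall k, \sum_(j < k) b (N + j)%N <= eta) ->
  (\int[Q']_f (L2norm ((f : L2) - proj e N f) ^+ 2)%:E <= eta%:E)%E.
Proof.
move=> hb hN.
apply: (@fatou_bound _ B R Q' (fun k f => \sum_(j < k) L2inner (f : L2) (e (N + j)%N) ^+ 2) _ _ 0) => [k|k f|f|k _].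
- by apply: measurable_sum => j; apply: measurable_funX; exact: m_inner.
- by apply: sumr_ge0 => j _; exact: sqr_ge0.
- have := @norm_proj_cvg _ _ oe te f; rewrite -(cvg_shiftn N) => h.
  rewrite norm_subproj//.
  have h2 : \sum_(j < k) L2inner (f : L2) (e (N + j)%N) ^+ 2 @[k --> \oo] -->
      L2norm (f : L2) ^+ 2 - \sum_(k < N) L2inner (f : L2) (e k) ^+ 2.
    under eq_fun => k.
      rewrite (_ : \sum_(j < k) _ = \sum_(j < k + N) L2inner (f : L2) (e j) ^+ 2 - \sum_(k < N) L2inner (f : L2) (e k) ^+ 2); last first.
        by rewrite addnC big_split_ord /= addrAC subrr add0r.
      over.
    by apply: cvgB; [exact: h|exact: cvg_cst].
  exact: h2.
- by apply: (le_trans (tail_integral _ _ hb)); rewrite lee_fin.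
Qed.

(** The projection on N coordinates is within del of the identity in mean square, uniformly in the
    law, and x <= del + x^2 / del makes the error linear in the squared remainder. *)
Lemma lipschitz_cvg_integral (F : L2 -> R) K A :
  (forall f g, `|F f - F g| <= K * L2norm (f - g)) -> (forall f, `|F f| <= A) ->
  cvg_integral F.
Proof.
move=> FK FA; apply: cvg_uniform => eps eps0.
have K0 : 0 <= `|K| by [].
have K1 : 0 < `|K| + 1 by rewrite ltr_wpDl.
pose del := eps / (2 * (`|K| + 1)).
have del0 : 0 < del by rewrite divr_gt0// mulr_gt0.
have [N hN] := tail_le (exprn_gt0 2 del0).
exists (fun f => 1 * F (proj e N (f : L2) + 0)); first exact: (proj_cvg FK FA good1).
have bound (Q' : probability B R) :
    (forall n, (\int[Q']_f (L2inner (f : L2) (e n) ^+ 2)%:E <= (b n)%:E)%E) ->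
    `|\int[Q']_f F f - \int[Q']_f (1 * F (proj e N (f : L2) + 0))| <= eps.
  move=> hb; apply: (@le_trans _ _ (`|K| * del + `|K| / del * del ^+ 2)); last first.
    rewrite (_ : _ + _ = 2 * `|K| * del); last by field; rewrite gt_eqF.
    rewrite /del mulrA ler_pdivrMr ?mulr_gt0// mulrC; apply: ler_wpM2l; first exact: ltW.
    by rewrite ler_pM2l// lerDl.
  apply: (@integral_dist Q' _ _ (fun f => L2norm ((f : L2) - proj e N f) ^+ 2) A A).
  - apply: L2borel_measurable; exact: (L2_lipschitz_continuous FK).
  - by apply: measurable_funM => //; exact: (measurable_proj _ _ FK).
  - apply: measurable_funX; apply: L2borel_measurable; apply: (@L2_lipschitz_continuous R _ 2) => f g.
    apply: (le_trans (L2norm_dist _ _)).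
    rewrite (_ : f - proj e N f - (g - proj e N g) = (f - g) - proj e N (f - g)).
      apply: (le_trans (L2norm_triangle _ _)); rewrite L2normN mulrDl mul1r lerD2l; exact: norm_proj_le.
    by rewrite projB (opprD g) opprK addrACA opprB [- proj e N f + _]addrC.
  - exact: FA.
  - by move=> f; rewrite mul1r.
  - by rewrite mulr_ge0// ltW.
  - by rewrite divr_ge0// ltW.
  - move=> f; rewrite mul1r addr0; set x := L2norm ((f : L2) - proj e N f).
    apply: (@le_trans _ _ (`|K| * x)).
      by apply: (le_trans (FK _ _)); apply: ler_wpM2r; [exact: L2norm_ge0|exact: ler_norm].
    rewrite (_ : `|K| * del + _ = `|K| * (del + x ^+ 2 / del)); last ring.
    apply: ler_wpM2l => //; rewrite -subr_ge0 (_ : _ - x = ((x - del / 2) ^+ 2 + 3 / 4 * del ^+ 2) / del); last first.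
      by field; rewrite gt_eqF.
    apply: divr_ge0; last exact: ltW.
    apply: addr_ge0; first exact: sqr_ge0.
    by apply: mulr_ge0; [rewrite divr_ge0|exact: sqr_ge0].
  - by move=> f; exact: sqr_ge0.
  - exact: remainder_integral.
by split => [T|]; apply: bound.
Qed.

(** * Lipschitz approximation from below *)

Section infimal_convolution.
Variables (F : L2 -> R) (A : R).
Hypothesis cF : continuous F.
Hypothesis FA : forall f, `|F f| <= A.

Let values k f := [set F g + k%:R * L2norm (f - g) | g in [set: L2]].

(** The largest k-Lipschitz function below F; it increases to F with k. *)
Definition inf_conv (k : nat) (f : L2) : R := inf (values k f).

Let FgeNA f : - A <= F f.
Proof. by have := FA f; rewrite ler_norml => /andP[]. Qed.

Let values_lb k f : lbound (values k f) (- A).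
Proof. by move=> _ [g _ <-]; have := FgeNA g; have := mulr_ge0 (ler0n R k) (L2norm_ge0 (f - g)); lra. Qed.

Let values_nonempty k f : values k f !=set0.
Proof. by exists (F f + k%:R * L2norm (f - f)), f. Qed.

Let inf_conv_leE k f g : inf_conv k f <= F g + k%:R * L2norm (f - g).
Proof. by apply: ge_inf; [exists (- A); exact: values_lb|exists g]. Qed.

Let inf_conv_le k f : inf_conv k f <= F f.
Proof. by have := inf_conv_leE k f f; rewrite subrr L2norm0 mulr0 addr0. Qed.

Let inf_conv_bdd k f : `|inf_conv k f| <= A.
Proof.
rewrite ler_norml; apply/andP; split; first by apply: lb_le_inf => //; exact: values_lb.
by apply: (le_trans (inf_conv_le k f)); have := FA f; rewrite ler_norml => /andP[].
Qed.

Let inf_conv_lip k f g : `|inf_conv k f - inf_conv k g| <= k%:R * L2norm (f - g).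
Proof.
have key f1 g1 : inf_conv k f1 - k%:R * L2norm (f1 - g1) <= inf_conv k g1.
  apply: lb_le_inf => // _ [g2 _ <-]; rewrite lerBlDr.
  apply: (le_trans (inf_conv_leE k f1 g2)); rewrite -addrA lerD2l -mulrDr; apply: ler_wpM2l => //.
  by have := L2norm_triangle (f1 - g1) (g1 - g2); rewrite addrA subrK [leRHS]addrC.
rewrite ler_norml; apply/andP; split.
  by have := key g f; rewrite -(opprB f g) L2normN; lra.
by have := key f g; lra.
Qed.

Let inf_conv_cvg f : inf_conv k f @[k --> \oo] --> F f.
Proof.
apply/cvgrPdist_le => eps eps0.
have /cvgrPdist_lt/(_ _ eps0) := @cF f; rewrite nearE => /nbhs_ballP[d d0 hd].
(* Beyond the radius d of continuity the penalty k d exceeds 2 A, which bounds the oscillation of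
   F. *)
pose N := (Num.truncn (2 * A / d)).+1.
exists N => // k /= Nk; rewrite ger0_norm ?subr_ge0 ?inf_conv_le//.
rewrite lerBlDr addrC -lerBlDr; apply: lb_le_inf => // _ [g _ <-].
have kx : 0 <= k%:R * L2norm (f - g) by rewrite mulr_ge0// L2norm_ge0.
have [fg|fg] := ltP (L2norm (f - g)) d.
  by have := hd g fg; rewrite /= ltr_norml => /andP[_ ?]; lra.
have : 2 * A <= k%:R * L2norm (f - g).
  have h : 2 * A / d < N%:R by exact: truncnS_gt.
  have d0' : 0 < d := d0.
  rewrite ltr_pdivrMr// in h; apply: (le_trans (ltW h)); apply: ler_pM => //; first exact: ltW.
  by rewrite ler_nat.
have := FgeNA g; have := FA f; rewrite ler_norml => /andP[_ ?] ? ?; lra.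
Qed.

(** Approximation from below yields only a lower bound: [inf_conv k] is below F under [Q_ n] and
    close to F in mean under Q. The upper bound comes from - F. *)
Lemma continuous_integral_ge eps : 0 < eps ->
  \forall n \near \oo, \int[Q]_f F f - eps < \int[Q_ n]_f F f.
Proof.
move=> eps0.
have mk k : measurable_fun setT (inf_conv k : B -> R).
  by apply: L2borel_measurable; exact: L2_lipschitz_continuous (inf_conv_lip k).
have mF : measurable_fun setT (F : B -> R) by exact: L2borel_measurable.
have h1 : \int[Q]_f inf_conv k f @[k --> \oo] --> \int[Q]_f F f.
  exact: (@Rintegral_bdd_dct _ B R Q inf_conv F A mk inf_conv_cvg inf_conv_bdd).
have e2 : 0 < eps / 2 by rewrite divr_gt0.
have /cvgrPdist_lt/(_ _ e2)[k _ /(_ k (leqnn k))] := h1.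
rewrite /= ltr_norml => /andP[_ hk].
have /cvgrPdist_lt/(_ _ e2) := lipschitz_cvg_integral (inf_conv_lip k) (inf_conv_bdd k).
apply: filterS => n; rewrite ltr_norml => /andP[_ hn].
have : \int[Q_ n]_f inf_conv k f <= \int[Q_ n]_f F f.
  apply: le_Rintegral => //; [exact: (integrable_bdd _ (mk k) (inf_conv_bdd k))|exact: (integrable_bdd _ mF FA)].
lra.
Qed.

End infimal_convolution.

Lemma continuous_cvg_integral (F : L2 -> R) (A : R) : continuous F -> (forall f, `|F f| <= A) -> cvg_integral F.
Proof.
move=> cF FA; apply/cvgrPdist_lt => eps eps0.
have cNF : continuous ((fun f => - F f) : L2 -> R).
  by move=> f; apply: (@cvgN _ _ _ (nbhs (f : L2)) _ F (F f)); exact: (cF f).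
have NFA f : `|- F f| <= A by rewrite normrN.
have mF : measurable_fun setT (F : B -> R) by exact: L2borel_measurable.
have EN (Q' : probability B R) : \int[Q']_f (- F f) = - \int[Q']_f F f.
  have := @RintegralZl _ B R Q' setT F (-1) measurableT (integrable_bdd _ mF FA).
  by under eq_Rintegral do rewrite mulN1r; rewrite mulN1r.
have [N1 _ h1] := continuous_integral_ge cF FA eps0.
have [N2 _ h2] := continuous_integral_ge cNF NFA eps0.
exists (maxn N1 N2) => // n /=; rewrite geq_max => /andP[/h1 /= {}h1 /h2 /= {}h2].
rewrite !EN in h2.
by rewrite ltr_norml; apply/andP; split; lra.
Qed.

End functional_convergence.

(** * The limit law and the theorem *)

Section cos_transform.
Variable R : realType.
Local Notation T := (measurableTypeR R).

(** A Lipschitz function with compact support that approaches the indicator of ]x, +oo[: the first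
    ramp rises from x with slope n + 1, the second one cuts off beyond n. *)
Definition step_test (x : R) (n : nat) (y : R) : R := ramp (n.+1%:R * (y - x)) - ramp (y - n%:R).

Lemma step_test_lip x n (a b : R) : `|step_test x n a - step_test x n b| <= (n.+1%:R + 1) * `|a - b|.
Proof.
rewrite /step_test (_ : _ - _ - _ = (ramp (n.+1%:R * (a - x)) - ramp (n.+1%:R * (b - x))) -
  (ramp (a - n%:R) - ramp (b - n%:R))); last ring.
apply: (le_trans (ler_normB _ _)); rewrite mulrDl mul1r; apply: lerD.
  apply: (le_trans (ramp_lip _ _)); rewrite -mulrBr normrM ger0_norm//.
  by rewrite (_ : a - x - (b - x) = a - b)//; ring.
apply: (le_trans (ramp_lip _ _)).
by rewrite (_ : a - n%:R - (b - n%:R) = a - b)//; ring.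
Qed.

Lemma step_test_le1 x n y : `|step_test x n y| <= 1.
Proof.
have /andP[? ?] := ramp_itv (n.+1%:R * (y - x)); have /andP[? ?] := ramp_itv (y - n%:R).
by rewrite /step_test ler_norml; apply/andP; split; lra.
Qed.

Lemma step_test_supp x n y : `|x| + n%:R + 2 < `|y| -> step_test x n y = 0.
Proof.
have n1 : (1 : R) <= n.+1%:R by rewrite ler1n.
have n0 : (0 : R) <= n%:R by [].
have xx := ler_norm x; have xx' : - x <= `|x| by rewrite -normrN ler_norm.
have [y0|y0] := leP 0 y => h; rewrite /step_test.
  rewrite (ger0_norm y0) in h.
  rewrite (@ramp_eq1 _ (n.+1%:R * (y - x))) ?(@ramp_eq1 _ (y - n%:R)) ?subrr//; first lra.
  by rewrite -[leLHS]mulr1; apply: ler_pM => //; lra.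
rewrite (ltr0_norm y0) in h.
rewrite (@ramp_eq0 _ (n.+1%:R * (y - x))) ?(@ramp_eq0 _ (y - n%:R)) ?subrr//; first lra.
by apply: mulr_ge0_le0; [exact: le_trans n1|lra].
Qed.

Lemma step_test_cvg x y : step_test x n y @[n --> \oo] --> (\1_(`]x, +oo[%classic : set R) y : R).
Proof.
apply: cvg_near_cst; have [yx|xy] := leP y x.
  near=> n; rewrite indicE memNset; last by rewrite /= in_itv/= andbT; apply/negP; rewrite -leNgt.
  rewrite /step_test ramp_eq0 ?ramp_eq0 ?subrr//.
    by rewrite subr_le0; near: n; exact: nbhs_infty_ger.
  by apply: mulr_ge0_le0 => //; rewrite subr_le0.
near=> n; rewrite indicE mem_set; last by rewrite /= in_itv/= andbT.
rewrite /step_test ramp_eq1 ?ramp_eq0 ?subr0//.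
  by rewrite subr_le0; near: n; exact: nbhs_infty_ger.
rewrite -ler_pdivrMr ?subr_gt0// div1r; apply: (@le_trans _ _ n%:R); last by rewrite ler_nat.
by near: n; exact: nbhs_infty_ger.
Unshelve. all: by end_near. Qed.

(** The convergence criterion for Lipschitz tests, applied to a constant sequence, gives equality of
    the integrals of [step_test], hence of the measures of rays. *)
Lemma cos_determines_law (d : measure_display) (D : measurableType d) (P : probability D R)
    (Y : D -> R) (mu : probability T R) : measurable_fun setT (Y : D -> T) ->
  (forall u th, \int[P]_w cos (u * Y w + th) = \int[mu]_x cos (u * x + th)) ->
  forall B : set T, measurable B -> P (Y @^-1` B) = mu B.
Proof.
move=> mY Ycos; pose Q : probability T R := law_of P mY.
have Qcos u th : \int[Q]_x cos (u * x + th) = \int[mu]_x cos (u * x + th).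
  by rewrite /Q law_of_integral ?Ycos//; exact: measurable_cos_affine.
have mstep x n : measurable_fun setT (step_test x n : T -> T) by exact: lipschitz_measurable (step_test_lip x n).
have key x n : \int[Q]_y step_test x n y = \int[mu]_y step_test x n y.
  have h : (fun _ : nat => \int[Q]_y (1 * step_test x n y)) @ \oo --> \int[mu]_y (1 * step_test x n y).
    apply: (@cvg_lipschitz_test R (step_test x n) _ _ (step_test_lip x n) (@step_test_supp x n) (step_test_le1 x n) _ T
      (fun _ => Q) mu (fun=> 1) idfun 1); [exact: measurable_cst|exact: measurable_id|by move=> w; rewrite normr1|].
    move=> u th; rewrite (_ : (fun _ => _) = fun _ : nat => \int[mu]_w (1 * cos (u * idfun w + th))); first exact: cvg_cst.
    apply/funext => _; under eq_Rintegral do rewrite mul1r.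
    by rewrite Qcos; apply: eq_Rintegral => w _; rewrite mul1r.
  have h2 : \int[Q]_y (1 * step_test x n y) = \int[mu]_y (1 * step_test x n y).
    exact: (cvg_unique _ (@cvg_cst _ _ _ _ _) h).
  transitivity (\int[Q]_y (1 * step_test x n y)); first by apply: eq_Rintegral => y _; rewrite mul1r.
  by rewrite h2; apply: eq_Rintegral => y _; rewrite mul1r.
move=> B mB; rewrite -[LHS]/(Q B); apply: measure_eq_on_rays mB => [|x].
  exact: le_lt_trans (probability_le1 Q measurableT) (ltry _).
have mray : measurable (`]x, +oo[%classic : set T) by exact: measurable_itv.
have ray (Q' : probability T R) : \int[Q']_y step_test x n y @[n --> \oo] --> fine (Q' `]x, +oo[%classic).
  have := @Rintegral_bdd_dct _ T R Q' (step_test x) (\1_(`]x, +oo[%classic : set R)) 1 (mstep x) (@step_test_cvg x) (step_test_le1 x).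
  by rewrite /Rintegral integral_indic// setIT.
have e : fine (Q `]x, +oo[%classic) = fine (mu `]x, +oo[%classic).
  have h1 : \int[mu]_y step_test x n y @[n --> \oo] --> fine (Q `]x, +oo[%classic).
    by under eq_fun do rewrite -key; exact: ray.
  exact: (cvg_unique _ h1 (ray mu)).
rewrite -[LHS](@fineK _ (Q `]x, +oo[%classic)) ?fin_num_measure//.
by rewrite e fineK// fin_num_measure.
Qed.

Lemma normal_law_prob (v : R) : 0 <= v -> exists mu : probability T R,
  [/\ forall B, measurable B -> normal_law 0 v B = mu B,
      forall u th, \int[mu]_x cos (u * x + th) = cos th * expR (- (u ^+ 2 * v) / 2),
      \int[mu]_x x = 0 & \int[mu]_x (x ^+ 2) = v].
Proof.
move=> v0; have [{v0}->|vn0] := eqVneq v 0.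
  have dE (f : R -> R) : measurable_fun setT (f : T -> T) -> \int[(\d_(0 : T) : probability T R)]_x f x = f 0.
    by move=> mf; rewrite /Rintegral integral_dirac//; [rewrite diracT mul1e|exact/measurable_EFinP].
  exists (\d_(0 : T)); split => [B _|u th||]; first by rewrite /normal_law eqxx.
  - by rewrite dE; [rewrite !mulr0 add0r oppr0 mul0r expR0 mulr1|exact: measurable_cos_affine].
  - by rewrite dE.
  - by rewrite dE ?expr0n//; exact: measurable_funX.
have v1 : 0 < v by rewrite lt_def vn0.
have s0 : Num.sqrt v != 0 by rewrite gt_eqF// sqrtr_gt0.
pose mu : probability T R := normal_prob 0 (Num.sqrt v).
have moment k : \int[mu]_x (x ^+ k) = gauss_moment v k.
  have mX : measurable_fun setT (fun x : T => (x ^+ k) : T) by exact: measurable_funX.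
  have iX : mu.-integrable setT (EFin \o (fun x : T => x ^+ k)).
    apply: integrable_normal_prob => //; have := normal_pdf_moment_integrable 0 s0 k.
    by apply: eq_integrable => //= x _; rewrite subr0.
  rewrite (integral_normal_prob mX iX) -(sqr_sqrtr v0) -(normal_pdf_moment 0 s0 k) (sqr_sqrtr v0).
  by apply: eq_Rintegral => x _; rewrite subr0.
exists mu; split.
- by move=> B _; rewrite /normal_law (negbTE vn0).
- by move=> u th; rewrite normal_prob_cos_affine// (sqr_sqrtr v0).
- exact: (moment 1).
- by rewrite moment /= mulr1 mul1r.
Qed.

End cos_transform.

(** * From cosine transforms to Gaussian laws *)

Section gaussian_law.
Variable R : realType.
Local Notation L2 := (L2 R).
Variable C : L2 -> L2.
Hypothesis Csym : forall g h, L2inner (C g) h = L2inner (C h) g.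
Hypothesis CD : forall f g h, L2inner (C (f + g)) h = L2inner (C f) h + L2inner (C g) h.
Hypothesis CZ : forall a g h, L2inner (C (a *: g)) h = a * L2inner (C g) h.
Hypothesis Cpos : forall h, 0 <= L2inner (C h) h.
Variable nu : probability (L2borel R) R.
Hypothesis nu_cos : forall (h : L2) th,
  \int[nu]_f cos (L2inner (f : L2) h + th) = cos th * expR (- L2inner (C h) h / 2).

Let m_inner (h : L2) : measurable_fun setT (fun f : L2borel R => L2inner (f : L2) h).
Proof. by apply: L2borel_measurable; exact: L2inner_continuous. Qed.

Let nu_cosZ (h : L2) u th :
  \int[nu]_f cos (u * L2inner (f : L2) h + th) = cos th * expR (- (u ^+ 2 * L2inner (C h) h) / 2).
Proof.
rewrite (_ : u ^+ 2 * _ = L2inner (C (u *: h)) (u *: h)); last by rewrite CZ Csym CZ mulrA.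
by rewrite -nu_cos; apply: eq_Rintegral => f _; rewrite L2innerZr.
Qed.

(** Only an inequality at this stage: it gives integrability, and equality follows once the law of
    <f, h> is identified. *)
Lemma gaussian_second_moment_le (h : L2) :
  (\int[nu]_f (L2inner (f : L2) h ^+ 2)%:E <= (L2inner (C h) h)%:E)%E.
Proof.
apply: second_moment_of_cos; first exact: m_inner.
move=> u; have := nu_cosZ h u 0; rewrite cos0 mul1r => <-.
by apply: eq_Rintegral => f _; rewrite addr0.
Qed.

Let sqr_integrable (h : L2) : nu.-integrable setT (EFin \o (fun f : L2borel R => L2inner (f : L2) h ^+ 2)).
Proof.
apply/integrableP; split; first by apply/measurable_EFinP; apply: measurable_funX; exact: m_inner.
rewrite (@eq_integral _ _ _ _ _ (fun f : L2borel R => (L2inner (f : L2) h ^+ 2)%:E)).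
  exact: le_lt_trans (gaussian_second_moment_le h) (ltry _).
by move=> f _ /=; rewrite ger0_norm ?sqr_ge0.
Qed.

Lemma mean_zero_gaussian_of_cos : mean_zero_gaussian C nu.
Proof.
have law (h : L2) (mu : probability (measurableTypeR R) R) :
    (forall u th, \int[mu]_x cos (u * x + th) = cos th * expR (- (u ^+ 2 * L2inner (C h) h) / 2)) ->
    forall B : set (measurableTypeR R), measurable B -> nu ((fun f : L2borel R => L2inner (f : L2) h) @^-1` B) = mu B.
  move=> mucos; apply: (@cos_determines_law R _ (L2borel R) nu); first exact: m_inner.
  by move=> u th; rewrite nu_cosZ mucos.
have moment (h : L2) (k : nat) (mu : probability (measurableTypeR R) R) :
    (forall u th, \int[mu]_x cos (u * x + th) = cos th * expR (- (u ^+ 2 * L2inner (C h) h) / 2)) ->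
    \int[nu]_f (L2inner (f : L2) h ^+ k) = \int[mu]_x (x ^+ k).
  move=> mucos; have mid : measurable_fun setT (idfun : measurableTypeR R -> measurableTypeR R) by exact: measurable_id.
  have mX : measurable_fun setT ((fun x => x ^+ k) : measurableTypeR R -> measurableTypeR R) by exact: measurable_funX.
  exact: (@equal_law_integral R _ _ (L2borel R) (measurableTypeR R) nu mu (fun f : L2borel R => L2inner (f : L2) h) idfun
    (m_inner h) mid (law h mu mucos) (fun x => x ^+ k) mX).
have prod_integrable (g h : L2) : nu.-integrable setT (EFin \o (fun f : L2borel R => L2inner (f : L2) g * L2inner (f : L2) h)).
  apply: (@integrable_le _ (L2borel R) R nu _ (fun f : L2borel R => L2inner (f : L2) g ^+ 2 + L2inner (f : L2) h ^+ 2)).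
  - by apply: measurable_funM; exact: m_inner.
  - exact: (@integrableD _ _ _ nu setT measurableT _ _ (sqr_integrable g) (sqr_integrable h)).
  - move=> f; move: (L2inner (f : L2) g) (L2inner (f : L2) h) => a b; rewrite ler_norml; apply/andP; split; nra.
split => [h|h|g h].
- have [mu [muE mucos _ _]] := normal_law_prob (Cpos h).
  exists 0, (L2inner (C h) h); split => // B mB; rewrite muE//; exact: (law h mu mucos).
- have [mu [_ mucos mu1 _]] := normal_law_prob (Cpos h).
  have i1 : nu.-integrable setT (EFin \o (fun f : L2borel R => L2inner (f : L2) h)).
    apply: (@integrable_le _ (L2borel R) R nu _ (fun f : L2borel R => 1 + L2inner (f : L2) h ^+ 2)).
    - exact: m_inner.
    - have ic : nu.-integrable setT (EFin \o (fun _ : L2borel R => 1 : R)).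
        by apply: (@integrable_bdd _ _ _ nu (fun=> 1) 1) => // f; rewrite normr1.
      exact: (@integrableD _ _ _ nu setT measurableT _ _ ic (sqr_integrable h)).
    - move=> f; move: (L2inner (f : L2) h) => a; rewrite ler_norml; apply/andP; split; nra.
  rewrite -[LHS]fineK ?integrable_fin_num//; congr EFin.
  by have := moment h 1 mu mucos; rewrite mu1.
(* Polarization: the mixed moment is read off the second moments of g, h and g + h. *)
- have second (k : L2) : \int[nu]_f (L2inner (f : L2) k ^+ 2) = L2inner (C k) k.
    by have [mu [_ mucos _ mu2]] := normal_law_prob (Cpos k); rewrite (moment k 2 mu mucos).
  rewrite -[LHS]fineK ?integrable_fin_num//; last exact: prod_integrable.
  congr EFin; rewrite -[LHS]/(\int[nu]_f (L2inner (f : L2) g * L2inner (f : L2) h)).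
  have := second (g + h); rewrite CD !L2innerDr -!second.
  have -> : \int[nu]_f (L2inner (f : L2) (g + h) ^+ 2) = \int[nu]_f (L2inner (f : L2) g ^+ 2) +
      2 * \int[nu]_f (L2inner (f : L2) g * L2inner (f : L2) h) + \int[nu]_f (L2inner (f : L2) h ^+ 2).
    have i2 := integrableZl measurableT 2 (prod_integrable g h).
    have i3 := @integrableD _ _ _ nu setT measurableT _ _ (sqr_integrable g) i2.
    rewrite -(RintegralZl 2 measurableT (prod_integrable g h)).
    rewrite -(RintegralD measurableT (sqr_integrable g) i2) -(RintegralD measurableT i3 (sqr_integrable h)).
    by apply: eq_Rintegral => f _; rewrite L2innerDr; ring.
  rewrite (Csym h g).
  move: (\int[nu]_f (L2inner (f : L2) g ^+ 2)) (\int[nu]_f (L2inner (f : L2) h ^+ 2))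
    (\int[nu]_f (L2inner (f : L2) g * L2inner (f : L2) h)) (L2inner (C g) h) => p q r s; lra.
Qed.

End gaussian_law.

(** * Norm and trace bounds for the covariance operator *)

Section covariance_trace.
Variable R : realType.
Local Notation L2 := (L2 R).
Variables (A : int -> L2 -> L2) (C : L2 -> L2) (a : int -> R) (M : R).
Hypothesis Aa : forall t h, L2norm (A t h) <= a t * L2norm h.
Hypothesis trA : forall t (e : nat -> L2) N, orthosystem (@L2inner R) e ->
  \sum_(n < N) `|L2inner (A t (e n)) (e n)| <= a t.
Hypothesis aM : forall s : seq int, uniq s -> \sum_(t <- s) a t <= M.
Hypothesis AC : forall h, L2norm (\sum_(t <- sym_range N) A t h - C h) @[N --> \oo] --> (0 : R).

Lemma nuclear_sum_norm_le h : L2norm (C h) <= M * L2norm h.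
Proof.
have c := L2_continuous_cvg (@L2norm_continuous R) (AC h).
apply: (cvgr_to_le c); apply: nearW => N.
apply: (le_trans (L2norm_sum _ _)).
apply: (@le_trans _ _ (\sum_(t <- sym_range N) a t * L2norm h)); first exact: ler_sum.
by rewrite -mulr_suml; apply: ler_wpM2r; [exact: L2norm_ge0|exact/aM/uniq_sym_range].
Qed.

(** b n is the sum over t of |<A_t e_n, e_n>|, and exchanging sums bounds its series by that of the
    [a t]. Absolute values are kept because b must dominate every symmetric partial sum, hence the
    second moments for each T, and not only their limit <C e_n, e_n>. *)
Lemma diagonal_bounds (e : nat -> L2) : orthosystem (@L2inner R) e -> exists b : nat -> R,
  [/\ forall n N, \sum_(t <- sym_range N) `|L2inner (A t (e n)) (e n)| <= b n,
      forall n, L2inner (C (e n)) (e n) <= b n & forall N, \sum_(n < N) b n <= M].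
Proof.
move=> oe; pose D n t := `|L2inner (A t (e n)) (e n)|; pose s n N := \sum_(t <- sym_range N) D n t.
have snd n : {homo s n : p q / (p <= q)%N >-> p <= q}.
  move=> p q pq; apply: ler_sum_subset; rewrite ?uniq_sym_range// => t; first exact: normr_ge0.
  by rewrite !mem_sym_range => /leq_trans; apply.
have Da n t : D n t <= a t.
  have := trA t n.+1 oe; apply: le_trans.
  by rewrite big_ord_recr /= lerDr sumr_ge0.
have sc n : cvgn (s n).
  apply: nondecreasing_is_cvgn => //; exists M => _ [N _ <-].
  apply: le_trans (aM (uniq_sym_range N)); apply: ler_sum => t _; exact: Da.
have sb n N : s n N <= limn (s n) by exact: nondecreasing_cvgn_le.
exists (fun n => limn (s n)); split => // [n|N].
  have c := L2_continuous_cvg (@L2inner_continuous R (e n)) (AC (e n)).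
  apply: (cvgr_to_le c); apply: nearW => N; apply: le_trans (sb n N).
  by rewrite L2inner_suml; apply: ler_sum => t _; exact: ler_norm.
have c : \sum_(n <- index_enum 'I_N) s n m @[m --> \oo] --> \sum_(n <- index_enum 'I_N) limn (s n).
  by apply: (@cvg_sum_seq R _ _ (fun n : 'I_N => s n)) => n; exact: sc.
apply: (cvgr_to_le c); apply: nearW => m; rewrite exchange_big /=.
apply: le_trans (aM (uniq_sym_range m)); apply: ler_sum => t _; exact: trA.
Qed.

End covariance_trace.

Theorem corollary2p4 (R : realType) (d : measure_display)
    (Omega : measurableType d) (P : probability Omega R)
    (X : int -> Omega -> L2 R)
    (X_random : forall t : int, random_element (X t))
    (X_stationary : strictly_stationary P X)
    (X_moments : forall k : nat, (2 <= k)%N ->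
      (\int[P]_w ((L2norm (X 0 w)) ^+ k)%:E < +oo)%E)
    (X_cumulants : forall k : nat, (2 <= k)%N ->
      (\esum_(t in [set: k.-1.-tuple int])
         kernel_norm (cumulant_kernel P X (times_with_last0 t)) < +oo)%E)
    (X_autocov : (\esum_(t in [set: int])
         nuclear_norm (autocov_op P X t) < +oo)%E) :
  exists C : L2 R -> L2 R, nuclear_sum (autocov_op P X) C /\
    exists nu : probability (L2borel R) R,
      mean_zero_gaussian C nu /\
      converges_in_law P (normalized_sum P X) nu.
Proof.
have [C [a [M [AC Aa trA aM AR]]]] := nuclear_sum_exists X_autocov.
exists C; split => //.
have [e oe te] := exists_total_orthosystem R.
have Csym := cov_sym X_random X_stationary X_moments AR.
have CD := covD X_random X_stationary X_moments AR.
have CZ := covZ X_random X_stationary X_moments AR.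
have Cpos := cov_ge0 X_random X_stationary X_moments X_cumulants AR.
have [b [Ab Cb bM]] := diagonal_bounds trA aM AR oe.
have CM N : \sum_(n < N) L2inner (C (e n)) (e n) <= M.
  by apply: le_trans (bM N); apply: ler_sum => n _; exact: Cb.
have [nu nu_cos] := exists_gaussian_law Csym CD CZ Cpos oe te (nuclear_sum_norm_le Aa aM AR) CM.
exists nu; split; first exact: mean_zero_gaussian_of_cos.
have mS_inner T h : measurable_fun setT (fun w => L2inner (normalized_sum P X T w) h).
  by apply: random_inner_measurable; exact: normalized_sum_random.
have mS T : measurable_fun setT (normalized_sum P X T : Omega -> L2borel R).
  by apply: (measurable_L2borel oe te) => k; exact: mS_inner.
(* The laws of the normalized sums, so that they and the limit are measures on the same space,
   subject to the same bounds [b n]. *)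
pose Q_ T : probability (L2borel R) R := law_of P (mS T).
have Q_E T (f : L2borel R -> R) : measurable_fun setT f -> \int[Q_ T]_y f y = \int[P]_w f (normalized_sum P X T w).
  exact: law_of_integral.
have m_inner h : measurable_fun setT (fun f : L2borel R => L2inner (f : L2 R) h).
  by apply: L2borel_measurable; exact: L2inner_continuous.
have hcos (h : L2 R) th : \int[Q_ n]_f cos (L2inner (f : L2 R) h + th) @[n --> \oo] -->
    \int[nu]_f cos (L2inner (f : L2 R) h + th).
  rewrite nu_cos; under eq_fun => n.
    rewrite Q_E; last first.
      have := measurable_cos_affine 1 th; under eq_fun do rewrite mul1r.
      by move=> mc; exact: (measurableT_comp mc (m_inner h)).
    over.
  exact: (inner_cos_cvg X_random X_stationary X_moments X_cumulants AR).
have Q_b T n : (\int[Q_ T]_f (L2inner (f : L2 R) (e n) ^+ 2)%:E <= (b n)%:E)%E.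
  have m2 : measurable_fun setT (fun f : L2borel R => L2inner (f : L2 R) (e n) ^+ 2).
    by apply: measurable_funX.
  have -> : (\int[Q_ T]_f (L2inner (f : L2 R) (e n) ^+ 2)%:E =
      \int[P]_w (L2inner (normalized_sum P X T w) (e n) ^+ 2)%:E)%E.
    apply: (@ge0_integral_pushforward _ _ Omega (L2borel R) R _ (mS T) P setT
      (fun f => (L2inner (f : L2 R) (e n) ^+ 2)%:E) measurableT); first exact/measurable_EFinP.
    by move=> f _; rewrite lee_fin sqr_ge0.
  have [i2 _] := inner_moments_cvg X_random X_stationary X_moments X_cumulants AR T (e n) 2.
  rewrite -[leLHS]fineK ?integrable_fin_num// lee_fin.
  exact: (@inner_second_moment_le _ _ _ _ _ X_random X_stationary X_moments T (e n) (b n) (Ab n)).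
have Qb n : (\int[nu]_f (L2inner (f : L2 R) (e n) ^+ 2)%:E <= (b n)%:E)%E.
  by apply: le_trans (gaussian_second_moment_le Csym CZ nu_cos (e n)) _; rewrite lee_fin.
move=> F cF [K FK].
have mF : measurable_fun setT (F : L2borel R -> R) by exact: L2borel_measurable.
have Fcvg := continuous_cvg_integral hcos oe te Q_b Qb bM cF FK.
have iF : nu.-integrable setT (EFin \o (F : L2borel R -> R)) by exact: (integrable_bdd nu mF FK).
rewrite -[X in _ --> X]fineK ?integrable_fin_num//.
have EF T : 'E_P[fun w => F (normalized_sum P X T w)]%E = (\int[Q_ T]_f F f)%:E.
  rewrite (Q_E _ _ mF) unlock /Rintegral fineK//; apply: integrable_fin_num => //.
  apply: (@integrable_bdd _ Omega R P (fun w => F (normalized_sum P X T w)) K) => //.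
  exact: (measurableT_comp mF (mS T)).
under eq_fun do rewrite EF.
by apply: cvg_EFin; [exact: nearW|exact: Fcvg].
Qed.
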